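(* Let $n>2$, $m\in\mathbb{Z}\setminus\{0\}$ and $k\in\mathbb{N}$. Then, with a constant $C$ independent of $m$ and $k$, $$\|P_{m,k}\|_{(L^p(h^n),L^2(h^n))}\le\begin{cases} C\,(2k+n)^{n(\frac1p-\frac12)-\frac12}\,|m|^{n(\frac1p-\frac12)} & \text{if } 1\le p<p_n,\\[2pt] C\,(2k+n)^{\frac14-\frac1{2p}}\,|m|^{n(\frac1p-\frac12)} & \text{if } p_n\le p\le 2,\end{cases}$$ where $p_n=2\frac{2n+1}{2n+3}$. Moreover, these estimates are sharp.
   Context: The reduced Heisenberg group is $h^n=\mathbb{C}^n\times\mathbb{T}$ with product $(\mathbf z,e^{it})(\mathbf w,e^{it'})=(\mathbf z+\mathbf w,\,e^{i(t+t'+\operatorname{Im}(\mathbf z\cdot\bar{\mathbf w}))})$, with Haar measure (a constant multiple of Lebesgue measure $d\mathbf z\,dt$). Writing $z_j=x_j+iy_j$, let $X_j=\partial_{x_j}-y_j\partial_t$, $Y_j=\partial_{y_j}+x_j\partial_t$ and $L=-\sum_{j=1}^n(X_j^2+Y_j^2)$ (the sub-Laplacian). The operators $L$ and $i^{-1}\partial_t$ strongly commute and have discrete joint spectrum $\{(2|m|(2k+n),m):m\in\mathbb{Z}\setminus\{0\},k\in\mathbb{N}\}$, $\mathbb{N}=\{0,1,2,\dots\}$. $P_{m,k}$ is the orthogonal projector of $L^2(h^n)$ onto the joint eigenspace with eigenvalues $2|m|(2k+n)$ for $L$ and $m$ for $i^{-1}\partial_t$. $\|T\|_{(L^p,L^2)}$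 denotes the operator norm from $L^p(h^n)$ to $L^2(h^n)$. ''Sharp'' means that the bounds cannot be improved except for the value of the constant $C$. *)

(* Defs.v *)
From HB Require Import structures.
From mathcomp Require Import all_boot all_order all_algebra.
From mathcomp Require Import all_classical all_reals all_analysis.
Set Implicit Arguments. Unset Strict Implicit. Unset Printing Implicit Defensive.
Import Order.TTheory GRing.Theory Num.Theory.
Import numFieldNormedType.Exports.
Local Open Scope classical_set_scope.
Local Open Scope ring_scope.

(* Coordinates.  A point of C^n x R is a row vector p : 'rV[R]_(n+n).+1 with *)
(*   x_j = p 0 (cx j),  y_j = p 0 (cy j)  (j < n),  t = p 0 ct.              *)
(* Functions on the reduced Heisenberg group h^n = C^n x T are the functions *)
(* on C^n x R that are 2pi-periodic in t (t <-> e^{it}).                    *)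
(* Complex-valued functions are pairs (Re f, Im f) of real functions.       *)

Section Heisenberg.
Variable R : realType.
Variable n : nat.

Definition pt := 'rV[R]_(n + n).+1.

Definition cx (j : 'I_n) : 'I_(n + n).+1 := inord j.
Definition cy (j : 'I_n) : 'I_(n + n).+1 := inord (n + j).
Definition ct : 'I_(n + n).+1 := inord (n + n).

Definition eb (i : 'I_(n + n).+1) : pt := delta_mx 0 i.

Definition Xop (j : 'I_n) (f : pt -> R) : pt -> R :=
  fun p => 'D_(eb (cx j)) f p - p 0 (cy j) * 'D_(eb ct) f p.
Definition Yop (j : 'I_n) (f : pt -> R) : pt -> R :=
  fun p => 'D_(eb (cy j)) f p + p 0 (cx j) * 'D_(eb ct) f p.

Definition subLap (f : pt -> R) : pt -> R :=
  fun p => - \sum_(j < n) (Xop j (Xop j f) p + Yop j (Yop j f) p).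

Definition Dt (f : pt -> R) : pt -> R := 'D_(eb ct) f.

Fixpoint iterD (vs : seq pt) (f : pt -> R) : pt -> R :=
  match vs with [::] => f | v :: vs' => 'D_v (iterD vs' f) end.
Definition smooth (f : pt -> R) : Prop :=
  forall vs : seq pt, continuous (iterD vs f) /\
    forall (v : pt) (q : pt), derivable (iterD vs f) q v.

Definition tperiodic (f : pt -> R) : Prop :=
  forall q : pt, f (q + (2 * pi) *: eb ct) = f q.

Definition borel_fun (f : pt -> R) : Prop :=
  forall O : set R, open O -> <<s [set U : set pt | open U] >> (f @^-1` O).

(* Haar integral on h^n (Lebesgue measure dz dt, t over [0, 2pi[), *)
(* written as an iterated Lebesgue integral over the coordinates. *)
Definition setc (q : pt) (i : 'I_(n + n).+1) (s : R) : pt :=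
  q + (s - q 0 i) *: eb i.
Definition cdom (i : 'I_(n + n).+1) : set R :=
  if i == ct then [set x : R | 0 <= x < 2 * pi] else setT.
Fixpoint iint (k : nat) (g : pt -> \bar R) (q : pt) : \bar R :=
  match k with
  | 0 => g q
  | k'.+1 => (\int[lebesgue_measure]_(s in cdom (inord k'))
                 iint k' g (setc q (inord k') s))%E
  end.
Definition hint (g : pt -> \bar R) : \bar R := iint (n + n).+1 g 0.

Definition cfun := ((pt -> R) * (pt -> R))%type.
Definition cabs (f : cfun) (q : pt) : R := Num.sqrt (f.1 q ^+ 2 + f.2 q ^+ 2).
Definition csub (f g : cfun) : cfun := (f.1 \- g.1, f.2 \- g.2).

Definition normp (p : R) (f : cfun) : \bar R :=
  ((hint (fun q => (cabs f q `^ p)%:E)) `^ p^-1)%E.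

Definition is_hfun (f : cfun) : Prop :=
  [/\ tperiodic f.1, tperiodic f.2, borel_fun f.1 & borel_fun f.2].
Definition inLp (p : R) (f : cfun) : Prop := is_hfun f /\ (normp p f < +oo)%E.

(* L^2 inner product <f, g> = int f * conj g, real and imaginary parts *)
Definition inner_re (f g : cfun) : \bar R :=
  hint (fun q => (f.1 q * g.1 q + f.2 q * g.2 q)%:E).
Definition inner_im (f g : cfun) : \bar R :=
  hint (fun q => (f.2 q * g.1 q - f.1 q * g.2 q)%:E).

(* joint eigenspace of L (eigenvalue 2|m|(2k+n)) and i^{-1} d/dt (eigenvalue m) *)
Definition eigsp (m : int) (k : nat) : set cfun :=
  [set f | inLp 2 f /\ smooth f.1 /\ smooth f.2 /\
      subLap f.1 = (fun q => (2 * `|m|%:~R * (2 * k%:R + n%:R)) * f.1 q) /\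
      subLap f.2 = (fun q => (2 * `|m|%:~R * (2 * k%:R + n%:R)) * f.2 q) /\
      (* i^{-1} d/dt (f.1 + i f.2) = m (f.1 + i f.2) *)
      Dt f.1 = (fun q => - (m%:~R * f.2 q)) /\ Dt f.2 = (fun q => m%:~R * f.1 q)].

Definition is_orth_proj (E : set cfun) (f g : cfun) : Prop :=
  E g /\ forall h, E h ->
    inner_re (csub f g) h = 0%E /\ inner_im (csub f g) h = 0%E.

Definition Pmk (m : int) (k : nat) (f g : cfun) : Prop := is_orth_proj (eigsp m k) f g.

(* operator norm of P_{m,k} from L^p to L^2 (on L^p \cap L^2, where P_{m,k} is defined) *)
Definition opnorm_p2 (m : int) (k : nat) (p : R) : \bar R :=
  ereal_sup [set r : \bar R | exists (f g : cfun),
    [/\ inLp p f, inLp 2 f, normp p f != 0%E, Pmk m k f g &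
         r = ((fine (normp 2 g)) / (fine (normp p f)))%:E]].

End Heisenberg.

Definition p_crit (R : realType) (n : nat) : R :=
  2 * (2 * n%:R + 1) / (2 * n%:R + 3).

Definition bound33 (R : realType) (n : nat) (m : int) (k : nat) (p : R) : R :=
  if p < p_crit R n then
    (2 * k%:R + n%:R) `^ (n%:R * (p^-1 - 2^-1) - 2^-1) * (`|m|%:~R) `^ (n%:R * (p^-1 - 2^-1))
  else
    (2 * k%:R + n%:R) `^ (4^-1 - (2 * p)^-1) * (`|m|%:~R) `^ (n%:R * (p^-1 - 2^-1)).

(* Main.v *)
(* Upper bound. The real and imaginary parts of a joint eigenfunction are real
   functions f with L f = lambda f and D_t^2 f = - m^2 f.  Integrating f by parts
   against P(|z|^2) e^(-s|z|^2) cos(m t) gives a first order ODE in s for the Gaussian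
   moments of f; its solution produces the reproducing kernel K_k of the eigenspace,
   the left translates of m^n phi_k(m|z|^2) cos(m t) with phi_k the Laguerre function
   of order n-1.  The value of K_k on the diagonal gives the L^2 -> L^oo bound (p = 1).
   For the critical exponent one splits K_k = sum_j T_j + remainder by averaging over the
   neighbouring eigenspaces l = k, k+1, ..., k + O(N) with N = 2^j, using polynomials
   in the shift l -> l+1 that vanish to high order at 1 and -1: T_j is O(2^-j) on L^2
   by Bessel's inequality, and its kernel is O(2^((n-1/2)j)) by the identity
   (S-1)^(2a) phi_l ~ x^a phi_(l+a) and the decay of phi_l + phi_(l+1).  Balancing the two
   bounds on level sets of f gives the L^2 -> L^q bound with q the dual critical exponent
   in strong form, because the off-diagonal level sets gain a geometric factor.
   All other p follow by log-convexity between 2, q and oo, and duality.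

   Lower bounds. For p < p_crit, test P_(m,k) on the Gaussian e^(-(2k+n)|m||z|^2/2) e^(imt),
   whose projection is an explicit multiple of phi_k.  For p >= p_crit, test it on the
   eigenfunction z_1^k e^(-|m||z|^2/2) e^(imt). *)
Require Import Defs.
From HB Require Import structures.
From mathcomp Require Import all_boot all_order all_algebra.
From mathcomp Require Import all_classical all_reals all_analysis.
From mathcomp Require Import measurable_realfun.
From mathcomp Require Import ring lra zify.
Set Implicit Arguments. Unset Strict Implicit. Unset Printing Implicit Defensive.
Import Order.TTheory GRing.Theory Num.Theory.
Import numFieldNormedType.Exports.
Local Open Scope classical_set_scope.
Local Open Scope ring_scope.

(** * Borel structure and Haar measure *)

(** The critical exponent is the difficulty: the size of the kernel of one projector gives $p=1$ but
    not $p_n$. As a sequence in $l$ at fixed $x=m|z|^2$, $\phi_l(x)$ varies slowly for $x$ small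
    against $l$ and nearly alternates in sign near the turning point $x\approx 4l$; seen by the
    shift, the harmful frequencies are $1$ and $-1$. Hence the averages are taken in the square of
    the shift, and over indices $l\ge k$ only, so that small $k$ causes no boundary effect. With
    $a=n-1$ the multiplier vanishes to order $2a$: lowering the order of $\phi_l$ from $a$ to $0$
    and raising it back uses $2a$ differences and yields the factor $x^a$ that tames $\phi_l$ near
    its peak. Different eigenspaces meet only through the orthogonality of their kernels.
    Eigenfunctions are merely smooth and in $L^2$, so every integration by parts puts the cut-off on
    the explicit test function, and $f(0)$ is recovered from Gaussians with $s\to\infty$. Functions
    are kept real; the phase in $\cos(mt+\alpha)$ stands for multiplication by $e^{i\alpha}$. *)

Section Borel.
Variables (R : realType) (n : nat).
Notation pt := (pt R n).
(** A copy of [pt] carrying the sigma-algebra that [borel_fun] refers to, so that functions on [pt]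
    can be fed to measure theory. *)
Definition bpt := g_sigma_algebraType [set U : set pt | open U].

Definition ratbox (c : {ffun 'I_(n + n).+1 -> rat * rat}) : set pt :=
  [set q : pt | forall i, ratr (c i).1 < q 0 i < ratr (c i).2].

(** Boxes with rational end points are countably many; through them, measurability of a map into
    [bpt] reduces to that of its coordinates. *)
Lemma open_ratbox (U : set pt) : open U ->
  U = \bigcup_(c in [set c | ratbox c `<=` U]) ratbox c.
Proof.
move=> oU; apply/seteqP; split => [q Uq|q [c /= cU]]; last exact: cU.
have [e /= e0 eU] : exists2 e : R, 0 < e & ball q e `<=` U.
  by have /nbhs_ballP[e e0 eU] := open_nbhs_nbhs (conj oU Uq); exists e.
have h1 i : exists r : rat, ratr r \in `](q 0 i - e), (q 0 i)[.
  by have [|r Hr] := @rat_in_itvoo R (q 0 i - e) (q 0 i); [rewrite ltrBlDr ltrDl|exists r].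
have h2 i : exists r : rat, ratr r \in `](q 0 i), (q 0 i + e)[.
  by have [|r Hr] := @rat_in_itvoo R (q 0 i) (q 0 i + e); [rewrite ltrDl|exists r].
have [f1 f1P] := choice h1.
have [f2 f2P] := choice h2.
exists [ffun i => (f1 i, f2 i)]; last first.
  move=> i; rewrite ffunE /=; have := f1P i; have := f2P i; rewrite !in_itv /=.
  by move=> /andP[-> _] /andP[_ ->].
move=> r /= rP; apply: eU; split => // i j; rewrite ord1.
have := f1P j; have := f2P j; rewrite !in_itv /=.
have := rP j; rewrite ffunE /= => /andP[a1 a2] /andP[_ b2] /andP[b1 _].
rewrite /ball /= ltr_distlC; apply/andP; split; lra.
Qed.

Lemma measurable_bpt d (S : measurableType d) (h : S -> bpt) :
  (forall i, measurable_fun setT (fun s => (h s : pt) 0 i)) ->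
  measurable_fun setT h.
Proof.
move=> mh; apply: (@measurability _ _ S bpt setT h [set U : set pt | open U]) => //.
move=> _ [U /= oU <-]; rewrite setTI (open_ratbox oU) preimage_bigcup.
rewrite bigcup_mkcond; apply: countable_bigcupT_measurable => // c.
case: ifPn => // _.
have -> : h @^-1` ratbox c = \big[setI/setT]_(i < (n + n).+1)
    (fun s => (h s : pt) 0 i) @^-1` `]ratr (c i).1, ratr (c i).2[%classic.
  apply/seteqP; split => [s /= hs|s].
    rewrite -bigcap_seq => i _ /=; rewrite in_itv /=; exact: hs.
  rewrite -bigcap_seq => hs i /=; have := hs i (mem_index_enum i).
  by rewrite /= in_itv.
apply: big_ind => //; first exact: measurableI.
by move=> i _; rewrite -[_ @^-1` _]setTI; exact: mh.
Qed.

Lemma measurable_borel_fun (f : pt -> R) : borel_fun f ->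
  measurable_fun setT (f : bpt -> R).
Proof.
move=> bf; apply: (@measurability _ _ bpt (measurableTypeR R) setT f _ (RGenOInfty.measurableE R)).
by move=> _ [_ [x ->] <-]; rewrite setTI; apply: bf; exact: interval_open.
Qed.

End Borel.

Lemma ge0_integral_mrestr d (T : measurableType d) (R : realType)
    (mu : {measure set T -> \bar R}) (D : set T) (mD : measurable D)
    (f : T -> \bar R) :
  measurable_fun setT f -> (forall x, (0 <= f x)%E) ->
  (\int[mrestr mu mD]_x f x = \int[mu]_(x in D) f x)%E.
Proof.
move=> mf f0.
have mN0 : mrestr mu mD (~` D) = 0%E by rewrite /mrestr setICl measure0.
have := @ge0_negligible_integral _ _ _ (mrestr mu mD) setT (~` D) f
  (measurableC mD) measurableT mf (fun x _ => f0 x) mN0.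
rewrite setTD setCK => ->; apply: eq_measure_integral => A mA AD.
by rewrite /= /mrestr setIidl.
Qed.

Section Haar.
Variables (R : realType) (n : nat).
Notation pt := (pt R n).
Notation bpt := (bpt R n).
Notation leb := (@lebesgue_measure R).
Notation ct := (@ct n).

Lemma measurable_coord i : measurable_fun setT ((fun q : pt => q 0 i) : bpt -> R).
Proof.
apply: measurable_borel_fun => U oU; apply: sub_sigma_algebra.
by apply: open_comp => // x _; exact: coord_continuous.
Qed.

Lemma setcE (q : pt) i s j : setc q i s 0 j = if j == i then s else q 0 j.
Proof.
rewrite /setc /eb !mxE eqxx /=; case: eqVneq => [->|_]; last by rewrite mulr0 addr0.
by rewrite mulr1 addrC subrK.
Qed.

Lemma measurable_setc i :
  measurable_fun setT (fun z : bpt * R => setc (z.1 : pt) i z.2 : bpt).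
Proof.
apply: measurable_bpt => j; case: (eqVneq j i) => [->|/negbTE ji].
  apply: (eq_measurable_fun snd) => [z _|]; last exact: measurable_snd.
  by rewrite /= setcE eqxx.
apply: (eq_measurable_fun (fun z : bpt * R => (z.1 : pt) 0 j)) => [z _|].
  by rewrite /= setcE ji.
by apply: (measurableT_comp (measurable_coord j)); exact: measurable_fst.
Qed.

Lemma measurable_setc1 (q : pt) i :
  measurable_fun setT (fun s : R => setc q i s : bpt).
Proof.
apply: measurable_bpt => j; case: (eqVneq j i) => [->|/negbTE ji].
  by apply: (eq_measurable_fun id) => // s _; rewrite /= setcE eqxx.
by apply: (eq_measurable_fun (cst (q 0 j))) => // s _; rewrite /= setcE ji.
Qed.

Lemma measurable_cdom i : measurable (@cdom R n i).
Proof.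
rewrite /cdom; case: eqP => // _.
rewrite (_ : mkset _ = `[0, 2 * pi[%classic); first exact: measurable_itv.
by apply/seteqP; split => x; rewrite /= in_itv /=.
Qed.

Definition I1 (i : 'I_(n + n).+1) (g : pt -> \bar R) (q : pt) : \bar R :=
  (\int[leb]_(s in cdom i) g (setc q i s))%E.

Lemma measurable_I1 i (g : bpt -> \bar R) : measurable_fun setT g ->
  measurable_fun setT (I1 i g : bpt -> \bar R).
Proof.
move=> mg.
have H (h : bpt -> \bar R) : measurable_fun setT h -> (forall q, (0 <= h q)%E) ->
    measurable_fun setT (I1 i h : bpt -> \bar R).
  move=> mh h0.
  pose F (z : bpt * R) := ((fun s => h (setc (z.1 : pt) i s)) \_ (cdom i)) z.2.
  rewrite (_ : I1 i h = fubini_F lebesgue_measure F); last first.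
    by apply/funext => q; rewrite /I1 integral_mkcond.
  apply: measurable_fun_fubini_tonelli_F.
    have -> : F = (fun z => h (setc (z.1 : pt) i z.2)) \_ (setT `*` cdom i).
      by apply/funext => z; rewrite /F /patch; congr (if _ then _ else _);
        apply/idP/idP; rewrite !inE /= => // -[].
    apply/measurable_restrict => //.
      by apply: measurableX => //; exact: measurable_cdom.
    apply: measurable_funTS; exact: (measurableT_comp mh (measurable_setc i)).
  by move=> z; rewrite /F /patch; case: ifP.
rewrite [X in measurable_fun _ X](_ : _ = (fun q => I1 i (g^\+)%E q - I1 i (g^\-)%E q)%E).
  apply: emeasurable_funB; apply: H => //.
  - exact: measurable_funepos.
  - exact: measurable_funeneg.
apply/funext => q; rewrite /I1 [LHS]integralE.
by congr (_ - _)%E; apply: eq_integral => s _; rewrite ?funeposE ?funenegE.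
Qed.

Lemma iint_measurable k (g : bpt -> \bar R) : measurable_fun setT g ->
  measurable_fun setT (iint k g : bpt -> \bar R).
Proof. by move=> mg; elim: k => [//|k IH]; exact: (@measurable_I1 (inord k)). Qed.

Lemma iint_ge0 k (g : pt -> \bar R) : (forall q, 0 <= g q)%E ->
  forall q, (0 <= iint k g q)%E.
Proof. by move=> g0; elim: k => [//|k IH] q /=; exact: integral_ge0. Qed.

(** At stage [k] of the construction in [haar_aux] only the coordinates of index at least [k] are
    free, the others being frozen at 0. These sets then have finite measure, and they exhaust the
    space. *)
Definition slab (k N : nat) : set pt :=
  [set q | forall j : 'I_(n + n).+1, (k <= j)%N -> `|q 0 j| <= N%:R].

Lemma measurable_slab k N : measurable (slab k N : set bpt).
Proof.
have -> : slab k N = \big[setI/setT]_(j < (n + n).+1 | (k <= j)%N)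
    (fun q : bpt => (q : pt) 0 j) @^-1` `[- N%:R, N%:R]%classic.
  rewrite -bigcap_seq_cond; apply/seteqP; split => q /=.
    by move=> h j /= /andP[_ kj]; rewrite /= in_itv /= -ler_norml; exact: h.
  move=> h j kj; have := h j; rewrite /= mem_index_enum kj => /(_ isT).
  by rewrite in_itv /= ler_norml.
apply: big_ind => //; first exact: measurableI.
by move=> i _; rewrite -[_ @^-1` _]setTI; exact: measurable_coord.
Qed.

Lemma slab_cover k : \bigcup_N slab k N = setT.
Proof.
apply/seteqP; split => // q _.
have [N HN] : exists N : nat, `|q| <= N%:R.
  by exists (Num.bound `|q|); apply/ltW/archi_boundP.
exists N => // j _; apply: le_trans HN.
rewrite /Num.norm /= mx_normrE.
by apply/bigmax_geP; right => /=; exists (0, j).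
Qed.

(** [hint] integrates one coordinate after another and is not given as an integral against a
    measure. The measure is built from the outermost variable inwards: it starts as Lebesgue measure
    on one period of the t-axis, and each step pushes its product with Lebesgue measure forward
    along [setc], which frees one more coordinate. At [k = 0] nothing is left to integrate. *)
Lemma haar_aux (k : nat) : (k <= n + n)%N ->
  exists nu : {sigma_finite_measure set bpt -> \bar R},
   (forall g : bpt -> \bar R, measurable_fun setT g -> (forall q, 0 <= g q)%E ->
     \int[nu]_q iint k g q = hint g)%E /\ (forall N, nu (slab k N) < +oo)%E.
Proof.
suff H d : (d <= n + n)%N -> exists nu : {sigma_finite_measure set bpt -> \bar R},
   (forall g : bpt -> \bar R, measurable_fun setT g -> (forall q, 0 <= g q)%E ->
     \int[nu]_q iint (n + n - d) g q = hint g)%E /\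
      (forall N, nu (slab (n + n - d) N) < +oo)%E.
  by move=> kn; have := H (n + n - k)%N (leq_subr _ _); rewrite subKn.
have mkS (m : {measure set bpt -> \bar R}) k' : (forall N, m (slab k' N) < +oo)%E ->
    exists nu : {sigma_finite_measure set bpt -> \bar R}, (nu : set bpt -> \bar R) = m.
  move=> fin.
  have sf : sigma_finite setT m.
    exists (slab k'); first by rewrite slab_cover.
    by move=> N; split => //; exact: measurable_slab.
  pose H1 := isSFinite.Build _ _ _ _ (sfinite_measure_sigma_finite sf).
  pose H2 := isSigmaFinite.Build _ _ _ _ sf.
  pose nu := HB.pack_for {sigma_finite_measure set bpt -> \bar R}
    (Measure.sort m) H1 H2.
  by exists nu.
elim: d {k} => [_|d IH dn].
  rewrite subn0.
  pose m : {measure set bpt -> \bar R} :=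
    measure_function_pushforward__canonical__measure_function_Measure
      (mrestr leb (measurable_cdom ct)) (measurable_setc1 0 ct).
  have mE (g : bpt -> \bar R) : measurable_fun setT g -> (forall q, 0 <= g q)%E ->
      (\int[m]_q g q = \int[leb]_(s in cdom ct) g (setc (0%R : pt) ct s))%E.
    move=> mg g0; rewrite ge0_integral_pushforward //; last exact: measurable_setc1.
    rewrite preimage_setT ge0_integral_mrestr //.
      exact: (measurableT_comp mg (measurable_setc1 0 ct)).
    by move=> s; exact: g0.
  have [|nu nuE] := mkS m (n + n)%N.
    move=> N; apply: (@le_lt_trans _ _ (m setT)); first by
      apply: le_measure; rewrite ?inE //; exact: measurable_slab.
    rewrite /m /= /pushforward preimage_setT /mrestr setTI /cdom eqxx.
    rewrite (_ : mkset _ = `[0, 2 * pi[%classic); last first.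
      by apply/seteqP; split => x; rewrite /= in_itv /=.
    by rewrite lebesgue_measure_itv /=; case: ifP => _; rewrite -?EFinD ltry.
  exists nu; rewrite nuE; split => [g mg g0|N]; last first.
    apply: (@le_lt_trans _ _ (m setT)); first by
      apply: le_measure; rewrite ?inE //; exact: measurable_slab.
    rewrite /m /= /pushforward preimage_setT /mrestr setTI /cdom eqxx.
    rewrite (_ : mkset _ = `[0, 2 * pi[%classic); last first.
      by apply/seteqP; split => x; rewrite /= in_itv /=.
    by rewrite lebesgue_measure_itv /=; case: ifP => _; rewrite -?EFinD ltry.
  rewrite mE //; first exact: iint_measurable. exact: iint_ge0.
have [nu' [nuE nuF]] := IH (ltnW dn).
set k := (n + n - d.+1)%N.
have kE : (n + n - d = k.+1)%N by rewrite /k -subSn.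
have kn : (k < n + n)%N by rewrite -kE leq_subr.
have knn : (k < (n + n).+1)%N by exact: leqW.
pose i : 'I_(n + n).+1 := inord k.
have iE : (i : nat) = k by rewrite inordK.
have di : cdom i = [set: R].
  rewrite /cdom; case: eqP => // /(congr1 val) /=; rewrite iE /ct inordK // => kk.
  by rewrite kk ltnn in kn.
pose m : {measure set bpt -> \bar R} :=
    measure_function_pushforward__canonical__measure_function_Measure
      (nu' \x leb)%E (measurable_setc i).
have mE (g : bpt -> \bar R) : measurable_fun setT g -> (forall q, 0 <= g q)%E ->
      (\int[m]_q g q = \int[nu']_q I1 i g q)%E.
  move=> mg g0; rewrite ge0_integral_pushforward //; last exact: measurable_setc.
  rewrite preimage_setT fubini_tonelli1; last by move=> z; exact: g0.
    by rewrite /fubini_F /I1 di.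
  exact: (measurableT_comp mg (measurable_setc i)).
(* Finiteness is inherited: the new slab is the old one times an interval of length [2N] in the
   freed coordinate. *)
have fin N : (m (slab k N) < +oo)%E.
  rewrite -[m _]mul1e -integral_cst; last exact: measurable_slab.
  rewrite integral_mkcond mE; last 2 first.
  - by apply/measurable_restrict => //; exact: measurable_slab.
  - by move=> q; rewrite /patch; case: ifP.
  apply: (@le_lt_trans _ _ (\int[nu']_q ((cst (2 * N%:R)%:E) \_ (slab k.+1 N)) q)%E); last first.
    rewrite -integral_mkcond integral_cst; last exact: measurable_slab.
    apply: lte_mul_pinfty; rewrite ?lee_fin ?mulr_ge0 //.
    by rewrite -kE; exact: nuF.
  apply: ge0_le_integral => //.
  - by move=> q _; apply: integral_ge0 => s _; rewrite /patch; case: ifP.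
  - apply: measurable_I1; apply/measurable_restrict => //; exact: measurable_slab.
  - by apply/measurable_restrict => //; exact: measurable_slab.
  move=> q _; rewrite /I1 di {2}/patch; case: ifPn => [_|/negP nq].
    pose J : set R := `[- N%:R, N%:R]%classic.
    have mJ : measurable J by exact: measurable_itv.
    have JE : (leb J <= (2 * N%:R)%:E)%E.
      rewrite /J lebesgue_measure_itv /=; case: ifP => _; last by rewrite lee_fin mulr_ge0.
      by rewrite -EFinD lee_fin opprK mulr_natl mulr2n.
    have A : (\int[leb]_s ((cst 1) \_ (slab k N)) (setc q i s) <=
        \int[leb]_s ((cst 1) \_ J) s)%E.
      apply: ge0_le_integral => //.
      - by move=> s _; rewrite /patch; case: ifP.
      - apply: (measurableT_comp _ (measurable_setc1 q i)).
        by apply/measurable_restrict => //; exact: measurable_slab.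
      - by apply/measurable_restrict.
      move=> s _; rewrite /patch; case: ifPn => [|_]; last by case: ifP.
      rewrite inE => /(_ i); rewrite iE leqnn setcE eqxx => /(_ isT) hs.
      by rewrite ifT // inE /J /= in_itv /= -ler_norml.
    apply: (le_trans A).
    have E : (\int[leb]_(s in J) cst 1 s = \int[leb]_s ((cst 1) \_ J) s)%E.
      exact: integral_mkcond.
    by rewrite -E integral_cst // mul1e.
  rewrite (_ : (fun s => _) = cst 0%E) ?integral0 //.
  apply/funext => s; rewrite /patch; case: ifPn => //; rewrite inE => hs.
  exfalso; apply: nq; rewrite inE => j kj; have := hs j (ltnW kj).
  by rewrite setcE; case: eqP => // ji; rewrite ji iE ltnn in kj.
have [nu nuE'] := mkS m k fin.
exists nu; rewrite nuE'; split => // g mg g0.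
rewrite mE; [|exact: iint_measurable|exact: iint_ge0].
by rewrite -nuE // kE.
Qed.

Definition haar : {sigma_finite_measure set bpt -> \bar R} :=
  projT1 (cid (haar_aux (leq0n _))).

Lemma haarE (g : bpt -> \bar R) : measurable_fun setT g ->
  (forall q, 0 <= g q)%E -> (\int[haar]_q g q = hint g)%E.
Proof. by rewrite /haar; case: cid => nu [H _] /=; exact: H. Qed.

End Haar.

(** * Translations and periods of integrals on the line *)

Section OneDim.
Variable R : realType.
Notation leb := (@lebesgue_measure R).

Lemma measurable_shift (c : R) : measurable_fun setT (fun s : R => s + c).
Proof. exact: measurable_funD. Qed.

Lemma lebesgue_shift (c : R) (A : set R) : measurable A ->
  pushforward leb ((fun s => s + c) : R -> measurableTypeR R) A = leb A.
Proof.
move=> mA.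
pose m := @measure_function_pushforward__canonical__measure_function_Measure
  _ _ _ (measurableTypeR R) R leb _ (measurable_shift c).
apply/esym/(@lebesgue_measure_unique _ m) => //= _ [[a b]] _ <-.
rewrite /pushforward.
rewrite (_ : (fun s => s + c) @^-1` _ = `]a - c, b - c]%classic); last first.
  by apply/seteqP; split => x /=; rewrite !in_itv /= ltrBlDr lerBrDr.
rewrite !lebesgue_measure_itv/= !lte_fin ltrD2r; case: ifP => // _.
by rewrite -!EFinD; congr EFin; ring.
Qed.

Lemma ge0_integral_shiftD (c : R) (D : set R) (f : R -> \bar R) :
  measurable D -> measurable_fun setT f -> (forall s, (0 <= f s)%E) ->
  (\int[leb]_(s in (fun s => s + c)%R @^-1` D) f (s + c)%R = \int[leb]_(s in D) f s)%E.
Proof.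
move=> mD mf f0.
rewrite -(@ge0_integral_pushforward _ _ (measurableTypeR R) (measurableTypeR R) R
  (fun s => s + c) (measurable_shift c) leb D f) //.
- apply: eq_measure_integral; first exact: measurable_shift.
  by move=> ? A mA _; exact: (@lebesgue_shift c A mA).
- exact: measurable_funTS.
Qed.

Lemma ge0_integral_shift (c : R) (f : R -> \bar R) :
  measurable_fun setT f -> (forall s, (0 <= f s)%E) ->
  (\int[leb]_s f (s + c)%R = \int[leb]_s f s)%E.
Proof. by move=> mf f0; rewrite -(ge0_integral_shiftD c measurableT mf f0). Qed.

Lemma periodz (P : R) (f : R -> \bar R) : (forall s, f (s + P) = f s) ->
  forall (k : int) s, f (s + k%:~R * P) = f s.
Proof.
move=> fP; have H (k : nat) s : f (s + k%:R * P) = f s.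
  elim: k s => [|k IH] s; first by rewrite mul0r addr0.
  by rewrite -[k.+1]addn1 natrD mulrDl mul1r addrA fP IH.
case=> k s; first by rewrite -pmulrn H.
by rewrite NegzE mulrNz mulNr -[in RHS](subrK (k.+1%:R * P) s) -pmulrn H.
Qed.

(** Modulo [P] the shift lies in [[0, P[]; the piece of the period pushed over the right end
    re-enters on the left by periodicity. *)
Lemma ge0_integral_period (P c : R) (f : R -> \bar R) : 0 < P ->
  measurable_fun setT f -> (forall s, (0 <= f s)%E) ->
  (forall s, f (s + P) = f s) ->
  (\int[leb]_(s in `[0%R, P[) f (s + c)%R = \int[leb]_(s in `[0%R, P[) f s)%E.
Proof.
move=> P0 mf f0 fP.
pose k := Num.floor (c / P); pose d := c - k%:~R * P.
have d0 : 0 <= d by rewrite subr_ge0 -ler_pdivlMr // Num.Theory.floor_le.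
have dP : d < P.
  have : c / P < (k + 1)%:~R by exact: Num.Theory.floorD1_gt.
  by rewrite ltr_pdivrMr // intrD mulrDl mul1r ltrBlDl.
have -> : (\int[leb]_(s in `[0%R, P[) f (s + c)%R =
          \int[leb]_(s in `[0%R, P[) f (s + d)%R)%E.
  by apply: eq_integral => s _; rewrite -(periodz fP k (s + d)) /d addrA subrK.
have mfd : measurable_fun setT (fun s : R => f (s + d)).
  exact: (measurableT_comp mf (measurable_shift d)).
have sub a : measurable_fun (`[0, a[%classic `|` `[a, P[%classic) f by exact: measurable_funTS.
have disj (a b c' : R) : [disjoint `[a, b[%classic & `[b, c'[%classic].
  apply/disj_setPS => x [/=]; rewrite !in_itv /= => /andP[_ xb] /andP[bx _].
  by move: (lt_le_trans xb bx); rewrite ltxx.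
have split (a b c' : R) : a <= b -> b <= c' ->
    `[a, c'[%classic = `[a, b[%classic `|` `[b, c'[%classic.
  move=> ab bc; apply/seteqP; split => x /=; rewrite !in_itv /=.
    move=> /andP[ax xc]; case: (ltP x b) => xb; first by left; rewrite ax.
    by right.
  case=> /andP[h1 h2]; apply/andP; split => //.
    exact: lt_le_trans bc.
  exact: le_trans ab h1.
rewrite [in LHS](split 0 (P - d) P); [|lra|lra].
rewrite ge0_integral_setU //; last exact: measurable_funTS.
rewrite [in RHS](split 0 d P); [|lra|lra].
rewrite ge0_integral_setU //.
rewrite addeC; congr (_ + _)%E.
  have -> : `[P - d, P[%classic = (fun s => s + (d - P)) @^-1` `[0, d[%classic.
    by apply/seteqP; split => x /=; rewrite !in_itv /= => /andP[h1 h2];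
      apply/andP; split; lra.
  rewrite -[RHS](ge0_integral_shiftD (d - P)) //.
  by apply: eq_integral => s _; rewrite -[RHS]fP; congr f; ring.
rewrite -[RHS](ge0_integral_shiftD d) //.
congr (integral _ _ _).
by apply/seteqP; split => x /=; rewrite !in_itv /= => /andP[h1 h2];
      apply/andP; split; lra.
exact: sub.
Qed.
End OneDim.

Section HintSigned.
Variables (R : realType) (n : nat).
Notation bpt := (bpt R n).
Notation leb := (@lebesgue_measure R).
Notation haar := (haar R n).
Local Open Scope ereal_scope.

(** An iterated integral of a signed function is not additive for free. If both parts have finite
    iterated integrals, the inner integrals are finite almost everywhere at each stage, so the
    difference can be taken layer by layer. *)
Lemma iint_signed (g : bpt -> \bar R) k q : measurable_fun setT g ->
  iint k g^\+ q < +oo -> iint k g^\- q < +oo ->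
  iint k g q = iint k g^\+ q - iint k g^\- q.
Proof.
move=> mg; elim: k q => [|k IH] q /=; first by move=> _ _; rewrite {1}(funeposneg g).
pose i : 'I_(n + n).+1 := inord k.
have mD := @measurable_cdom R n i.
pose a s := iint k g^\+ (setc q i s); pose b s := iint k g^\- (setc q i s).
have ms (h : bpt -> \bar R) : measurable_fun setT h ->
    measurable_fun setT (fun s : R => iint k h (setc q i s)).
  by move=> mh; apply: (measurableT_comp (iint_measurable k mh)); exact: measurable_setc1.
have ma : measurable_fun setT a by apply: ms; exact: measurable_funepos.
have mb : measurable_fun setT b by apply: ms; exact: measurable_funeneg.
have a0 s : 0 <= a s by apply: iint_ge0 => ?; exact: funepos_ge0.
have b0 s : 0 <= b s by apply: iint_ge0 => ?; exact: funeneg_ge0.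
rewrite -/i => ia ib.
have Ia : leb.-integrable (cdom i) a.
  apply/integrableP; split; first exact: measurable_funTS.
  by under eq_integral do rewrite gee0_abs //.
have Ib : leb.-integrable (cdom i) b.
  apply/integrableP; split; first exact: measurable_funTS.
  by under eq_integral do rewrite gee0_abs //.
have mD' : measurable (cdom i : set (measurableTypeR R)) by exact: mD.
rewrite -(integralB mD' Ia Ib); apply: ae_eq_integral => //.
- by apply: measurable_funTS; exact: ms.
- by apply: measurable_funTS; apply: emeasurable_funB.
have := integrable_ae mD' Ia; have := integrable_ae mD' Ib.
apply: filterS2 => s hb ha Ds; apply: IH; rewrite -ge0_fin_numE //.
- exact: ha.
- exact: a0.
- exact: hb.
- exact: b0.
Qed.

Lemma hint_integrable (g : bpt -> R) : haar.-integrable setT (EFin \o g) ->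
  hint (EFin \o g) = \int[haar]_q (g q)%:E.
Proof.
move=> ig; have mg := measurable_int _ ig.
have p0 : hint (EFin \o g)^\+ = \int[haar]_q (EFin \o g)^\+ q.
  by rewrite haarE //; exact: measurable_funepos.
have m0 : hint (EFin \o g)^\- = \int[haar]_q (EFin \o g)^\- q.
  by rewrite haarE //; exact: measurable_funeneg.
rewrite [RHS]integralE -p0 -m0; apply: iint_signed => //.
- rewrite -/(hint _) p0; exact: integral_funepos_lt_pinfty.
- rewrite -/(hint _) m0; exact: integral_funeneg_lt_pinfty.
Qed.
End HintSigned.

(** * Invariance of the Haar integral under the group translations *)

Section Invariance.
Variables (R : realType) (n : nat).
Notation pt := (pt R n).
Notation bpt := (bpt R n).
Notation leb := (@lebesgue_measure R).
Notation haar := (haar R n).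
Notation ct := (@ct n).

Lemma setc_comm (q : pt) i j s u : i != j ->
  setc (setc q i s) j u = setc (setc q j u) i s.
Proof.
move=> ij; apply/rowP => l; rewrite !setcE.
by case: (eqVneq l j) => // ->; rewrite eq_sym (negbTE ij).
Qed.

Lemma setc_add (q : pt) i j s (c : R) : i != j ->
  setc (q + c *: eb R i) j s = setc q j s + c *: eb R i.
Proof.
move=> ij; apply/rowP => l; rewrite setcE [RHS]mxE setcE !mxE eqxx /=.
by case: (eqVneq l j) => // ->; rewrite eq_sym (negbTE ij) mulr0 addr0.
Qed.

Lemma setc_addi (q : pt) i s (c : R) :
  setc q i s + c *: eb R i = setc q i (s + c).
Proof.
apply/rowP => l; rewrite [LHS]mxE !setcE !mxE eqxx /=.
by case: (eqVneq l i) => // _; rewrite ?mulr1 ?mulr0 ?addr0.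
Qed.

Definition eperiodic (g : pt -> \bar R) := forall q : pt, g (q + (2 * pi) *: eb R ct) = g q.

Lemma I1_shift i (g : bpt -> \bar R) (c : R) q : measurable_fun setT g ->
  (forall q, (0 <= g q)%E) -> eperiodic g ->
  I1 i (fun q => g (q + c *: eb R i)) q = I1 i g q.
Proof.
move=> mg g0 gP; rewrite /I1.
have mgs : measurable_fun setT (fun s : R => g (setc q i s)).
  by apply: (measurableT_comp mg); exact: measurable_setc1.
under eq_integral do rewrite setc_addi.
rewrite /cdom; case: (eqVneq i ct) => [ic|_]; last first.
  by rewrite (ge0_integral_shift c mgs) // => s; exact: g0.
rewrite (_ : mkset _ = `[0, 2 * pi[%classic); last first.
  by apply/seteqP; split => x; rewrite /= in_itv /=.
rewrite (@ge0_integral_period _ _ c _ _ mgs) //; first by rewrite mulr_gt0 // pi_gt0.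
by move=> s; rewrite -setc_addi ic gP.
Qed.

Lemma I1_comm i j (g : bpt -> \bar R) q : i != j -> measurable_fun setT g ->
  (forall q, (0 <= g q)%E) -> I1 i (I1 j g) q = I1 j (I1 i g) q.
Proof.
move=> ij mg g0; rewrite /I1.
pose F (z : R * R) := ((fun z : R * R => g (setc (setc q i z.1) j z.2)) \_ (cdom i `*` cdom j)) z.
have mF : measurable_fun setT F.
  apply/measurable_restrict => //; first by apply: measurableX; exact: measurable_cdom.
  apply: measurable_funTS.
  have mS : measurable_fun setT (fun z : R * R => setc (setc q i z.1) j z.2 : bpt).
    apply: measurable_bpt => l; case: (eqVneq l j) => [->|/negbTE lj].
      by apply: (eq_measurable_fun snd) => // z _; rewrite /= setcE eqxx.
    case: (eqVneq l i) => [li|/negbTE li].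
      by apply: (eq_measurable_fun fst) => // z _; rewrite /= setcE lj setcE li eqxx.
    by apply: (eq_measurable_fun (cst (q 0 l))) => // z _; rewrite /= !setcE lj li.
  exact: (measurableT_comp mg mS).
have F0 z : (0 <= F z)%E by rewrite /F /patch; case: ifP.
transitivity (\int[leb]_s \int[leb]_u F (s, u))%E.
  rewrite integral_mkcond; apply: eq_integral => s _; rewrite /patch.
  case: ifPn => Ds; last first.
    rewrite integral0_eq // => u _; rewrite /F /patch ifF //.
    by apply/negbTE; apply: contra Ds; rewrite !inE => -[].
  rewrite integral_mkcond; apply: eq_integral => u _; rewrite /F /patch.
  congr (if _ then _ else _); apply/idP/idP; rewrite !inE /=.
    by move=> ?; split => //; exact: set_mem.
  by case.
transitivity (\int[leb]_u \int[leb]_s F (s, u))%E; first exact: (@fubini_tonelli _ _ (measurableTypeR R) (measurableTypeR R) R leb leb F mF F0).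
rewrite [RHS]integral_mkcond; apply: eq_integral => u _; rewrite [RHS]/patch.
case: ifPn => Du; last first.
  rewrite integral0_eq // => s _; rewrite /F /patch ifF //.
  by apply/negbTE; apply: contra Du; rewrite !inE => -[].
rewrite [RHS]integral_mkcond; apply: eq_integral => s _; rewrite /F /patch.
rewrite setc_comm //.
congr (if _ then _ else _); apply/idP/idP; rewrite !inE /=.
  by case.
by move=> ?; split => //; exact: set_mem.
Qed.

Lemma eq_I1 i (g h : pt -> \bar R) : g =1 h -> I1 i g =1 I1 i h.
Proof. by move=> gh q; apply: eq_integral => s _; rewrite gh. Qed.

Lemma eq_iint k (g h : pt -> \bar R) : g =1 h -> iint k g =1 iint k h.
Proof. by move=> gh; elim: k => [//|k IH]; exact: eq_I1. Qed.

Lemma I1_iint_ct k (g : bpt -> \bar R) q : (k <= n + n)%N -> measurable_fun setT g ->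
  (forall q, (0 <= g q)%E) -> I1 ct (iint k g) q = iint k (I1 ct g) q.
Proof.
elim: k q => [//|k IH] q kn mg g0.
rewrite -[RHS]/(I1 (inord k) (iint k (I1 ct g)) q) -[iint k.+1 g]/(I1 (inord k) (iint k g)).
rewrite I1_comm.
- by apply: eq_I1 => r; apply: IH => //; exact: ltnW.
- apply/eqP => /(congr1 val); rewrite /= !inordK // ?ltnS 1?ltnW // => e.
  by rewrite e ltnn in kn.
- exact: iint_measurable.
- exact: iint_ge0.
Qed.

(** The t-integral is outermost in [hint]. A group translation moves t by an amount depending on z,
    which is harmless once z is frozen; hence t is brought innermost by Tonelli. *)
Lemma hint_ct (g : bpt -> \bar R) : measurable_fun setT g ->
  (forall q, (0 <= g q)%E) -> hint g = iint (n + n) (I1 ct g) 0.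
Proof. by move=> mg g0; rewrite -I1_iint_ct. Qed.

Lemma iint_shift_lt k (i : 'I_(n + n).+1) (g : pt -> \bar R) (c : R) q : (k <= i)%N ->
  iint k (fun q => g (q + c *: eb R i)) q = iint k g (q + c *: eb R i).
Proof.
elim: k q => [//|k IH] q ki /=; apply: eq_integral => s _.
rewrite IH; last exact: ltnW.
rewrite -setc_add //; apply/eqP => /(congr1 val) /=; rewrite inordK.
  by move=> e; rewrite e ltnn in ki.
by apply: leq_trans ki _; apply: ltnW; exact: ltn_ord.
Qed.

Lemma iint_eperiodic k (g : pt -> \bar R) : (k <= n + n)%N -> eperiodic g -> eperiodic (iint k g).
Proof.
move=> kn gP q; rewrite -iint_shift_lt.
  by apply: eq_iint => r; exact: gP.
by rewrite /ct inordK.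
Qed.

Lemma iint_shift_gt k (i : 'I_(n + n).+1) (g : bpt -> \bar R) (c : R) q : (i < k)%N ->
  measurable_fun setT g -> (forall q, (0 <= g q)%E) -> eperiodic g ->
  iint k (fun q => g (q + c *: eb R i)) q = iint k g q.
Proof.
move=> ik mg g0 gP; elim: k q ik => [//|k IH] q; rewrite ltnS leq_eqVlt => /orP[/eqP e|ik].
  rewrite -e -[LHS]/(I1 (inord i) (iint i (fun q => g (q + c *: eb R i))) q).
  rewrite -[RHS]/(I1 (inord i) (iint i g) q) inord_val.
  rewrite -(I1_shift i c q (iint_measurable i mg)).
  - by apply: eq_I1 => r; exact: iint_shift_lt.
  - exact: iint_ge0.
  - by apply: iint_eperiodic => //; rewrite -ltnS.
by apply: eq_I1 => r; exact: IH.
Qed.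

Definition sg (w q : pt) : R :=
  \sum_(j < n) (w 0 (cx j) * q 0 (cy j) - w 0 (cy j) * q 0 (cx j)).

(** Since [sg w q] is $\mathrm{Im}(q\cdot\bar w)$, this is the product $q\,w$ of $h^n$. With the
    signs chosen in $X_j$ and $Y_j$, these are the translations that commute with both fields
    ([Xop_ltr], [Yop_ltr]). *)
Definition ltr (w q : pt) : pt := q + w + sg w q *: eb R ct.

Lemma measurable_addv (v : pt) (f : bpt -> R) : measurable_fun setT f ->
  measurable_fun setT (fun q : bpt => (q : pt) + f q *: v : bpt).
Proof.
move=> mf; apply: measurable_bpt => j.
apply: (eq_measurable_fun (fun q : bpt => (q : pt) 0 j + f q * v 0 j)).
  by move=> q _ /=; rewrite !mxE.
apply: measurable_funD; first exact: measurable_coord.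
by apply: measurable_funM => //; exact: measurable_cst.
Qed.

Lemma measurable_sg w : measurable_fun setT (sg w : bpt -> R).
Proof.
apply: measurable_sum => j; apply: measurable_funB; apply: measurable_funM;
  by [exact: measurable_cst|exact: measurable_coord].
Qed.

Lemma measurable_ltr w : measurable_fun setT (ltr w : bpt -> bpt).
Proof.
apply: measurable_bpt => l.
apply: (eq_measurable_fun (fun q : bpt => (q : pt) 0 l + w 0 l + sg w q * eb R ct 0 l)).
  by move=> q _ /=; rewrite !mxE.
apply: measurable_funD; first by apply: measurable_funD => //; exact: measurable_coord.
by apply: measurable_funM => //; exact: measurable_sg.
Qed.

Lemma measurable_addr w : measurable_fun setT (fun q : bpt => (q : pt) + w : bpt).
Proof.
apply: measurable_bpt => l.
apply: (eq_measurable_fun (fun q : bpt => (q : pt) 0 l + w 0 l)).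
  by move=> q _ /=; rewrite !mxE.
by apply: measurable_funD => //; exact: measurable_coord.
Qed.

Lemma hint_translate (g : bpt -> \bar R) (w : pt) : measurable_fun setT g ->
  (forall q, (0 <= g q)%E) -> eperiodic g -> hint (fun q => g (q + w)) = hint g.
Proof.
move=> mg g0 gP.
suff H (s : seq 'I_(n + n).+1) : hint (fun q => g (q + \sum_(i <- s) w 0 i *: eb R i)) = hint g.
  rewrite -(H (index_enum _)); congr hint; apply/funext => q; congr (g (q + _)).
  exact: row_sum_delta.
elim: s => [|i s IH]; first by congr hint; apply/funext => q; rewrite big_nil addr0.
rewrite -{}IH; set v := (\sum_(i <- s) _)%R.
pose h q := g (q + v).
have mh : measurable_fun setT (h : bpt -> \bar R).
  exact: (measurableT_comp mg (measurable_addr v)).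
rewrite -[RHS](@iint_shift_gt _ i h (w 0 i)) //.
- by apply: eq_iint => q; rewrite /h big_cons addrA.
- by move=> q; exact: g0.
- by move=> q; rewrite /h addrAC gP.
Qed.

Lemma hint_ltr (g : bpt -> \bar R) (w : pt) : measurable_fun setT g ->
  (forall q, (0 <= g q)%E) -> eperiodic g -> hint (g \o ltr w) = hint g.
Proof.
move=> mg g0 gP; rewrite -(hint_translate w mg g0 gP).
pose h q := g (q + w).
have mh : measurable_fun setT (h : bpt -> \bar R).
  exact: (measurableT_comp mg (measurable_addr w)).
have -> : g \o ltr w = fun q => h (q + sg w q *: eb R ct).
  by apply/funext => q; rewrite /h /ltr /= addrAC.
have mS : measurable_fun setT (fun q : bpt => (q : pt) + sg w q *: eb R ct : bpt).
  exact: measurable_addv (measurable_sg w).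
have h0 q : (0 <= h q)%E by exact: g0.
rewrite -/h (hint_ct mh h0) (hint_ct (measurableT_comp mh mS) (fun q => h0 _)).
apply: eq_iint => q.
rewrite -(I1_shift ct (sg w q) q mh h0); last by move=> r; rewrite /h addrAC gP.
apply: eq_integral => s _; congr (h (_ + _ *: _)).
apply: eq_bigr => j _; rewrite !setcE.
have cxt : cx j == ct = false.
  apply/eqP => /(congr1 val); rewrite /cx /ct /= !inordK //; last first.
    by rewrite ltnS (leq_trans (ltnW (ltn_ord j))) // leq_addr.
  by move=> e; have := ltn_ord j; rewrite e ltnNge leq_addr.
have cyt : cy j == ct = false.
  apply/eqP => /(congr1 val); rewrite /cy /ct /= !inordK // ?ltnS ?leq_add2l //; last exact: ltnW.
  by move=> /addnI e; have := ltn_ord j; rewrite e ltnn.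
by rewrite cxt cyt.
Qed.

Lemma ge0_haar_ltr (g : bpt -> \bar R) (w : pt) : measurable_fun setT g ->
  (forall q, (0 <= g q)%E) -> eperiodic g ->
  (\int[haar]_q g (ltr w q) = \int[haar]_q g q)%E.
Proof.
move=> mg g0 gP; rewrite !haarE //; first exact: hint_ltr.
exact: (measurableT_comp mg (measurable_ltr w)).
Qed.
End Invariance.

(** * Smooth functions and left translations *)

Section Lines.
Variables (R : realType) (V : normedModType R).
Implicit Types (f : V -> R) (q v : V).

Lemma is_derive_line f q v (h : R) d :
  is_derive (h *: v + q) v f d <-> is_derive h (1 : R) (fun s : R => f (s *: v + q)) d.
Proof.
have E : (fun k : R => k^-1 *: (((fun s : R => f (s *: v + q)) \o shift h) (k *: (1 : R)) - f (h *: v + q)))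
       = (fun k : R => k^-1 *: ((f \o shift (h *: v + q)) (k *: v) - f (h *: v + q))).
  apply/funext => k /=; congr (_ *: (f _ - _)).
  by rewrite -[k%:A]/(k * 1) mulr1 scalerDl addrA.
by split => -[ex val]; split; move: ex val; rewrite /derivable /derive E.
Qed.

Lemma is_derive_at f q v d :
  is_derive q v f d <-> is_derive (0 : R) (1 : R) (fun s : R => f (s *: v + q)) d.
Proof. by rewrite -is_derive_line scale0r add0r. Qed.

Lemma is_derive_compR (F : R -> R) f q v (a b : R) :
  is_derive (f q) 1 F a -> is_derive q v f b -> is_derive q v (F \o f) (a * b).
Proof.
move=> dF /is_derive_at df; apply/is_derive_at.
have := @is_derive1_comp _ F (fun s : R => f (s *: v + q)) 0 a b.
by rewrite /= scale0r add0r; apply.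
Qed.

Lemma MVT_sym (g dg : R -> R) (a b : R) : (forall x : R, is_derive x (1 : R) g (dg x)) ->
  exists2 c, `|c - a| <= `|b - a| & g b - g a = dg c * (b - a).
Proof.
move=> H; have cg : continuous g.
  by move=> x; apply/differentiable_continuous/derivable1_diffP; exact: (@ex_derive _ _ _ _ _ _ _ (H x)).
case: (leP a b) => ab.
  have [c] := @MVT_segment R g dg a b ab (fun x _ => H x) (continuous_subspaceT cg).
  rewrite in_itv /= => /andP[ac cb] ->; exists c => //.
  by rewrite !ger0_norm ?subr_ge0 ?lerB.
have [c] := @MVT_segment R g dg b a (ltW ab) (fun x _ => H x) (continuous_subspaceT cg).
rewrite in_itv /= => /andP[bc ca] E; exists c.
  by rewrite !ler0_norm ?subr_le0 ?lerN2 ?lerB // ltW.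
by rewrite -[LHS]opprB E -mulrN opprB.
Qed.

(** Smoothness is stated through directional derivatives alone, which need not be additive in the
    direction. The increment along [c *: w] is, by the mean value theorem, a value of ['D_w f] at a
    nearby point, and the continuity of ['D_w f] gives the limit. *)
Lemma is_derive_dir f q u w (c : R) :
  (forall r, derivable f r w) -> continuous ('D_w f) -> derivable f q u ->
  is_derive q (u + c *: w) f ('D_u f q + c * 'D_w f q).
Proof.
move=> dw cw du.
suff H : (fun h : R => h^-1 *: ((f \o shift q) (h *: (u + c *: w)) - f q)) @ 0^' -->
    'D_u f q + c * 'D_w f q.
  split; first by apply/cvg_ex; eexists; exact: H.
  by apply/cvg_lim => //; exact: H.
have Hu : (fun h : R => h^-1 *: ((f \o shift q) (h *: u) - f q)) @ 0^' --> 'D_u f q by [].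
pose G (h : R) := h^-1 *: (f (h *: (u + c *: w) + q) - f (h *: u + q)).
suff HG : G @ 0^' --> c * 'D_w f q.
  apply: (cvg_trans _ (cvgD Hu HG)); apply: near_eq_cvg.
  near=> h; rewrite -[LHS]/(h^-1 *: ((f \o shift q) (h *: u) - f q) + G h) /G -scalerDr /=.
  congr (_ *: _).
  by rewrite addrC addrA subrK.
apply/cvgrPdist_le => e e0.
have e1 : 0 < e / (`|c| + 1) by rewrite divr_gt0 // ltr_wpDl.
have /cvgrPdist_lt /(_ _ e1) := cw q; rewrite near_simpl => /nbhs_ballP[d /= d0 Hd].
near=> h.
have h0 : h != 0 by near: h; exact: nbhs_dnbhs_neq.
have [xi xic E] := @MVT_sym (fun s : R => f (s *: w + (h *: u + q)))
  (fun s => 'D_w f (s *: w + (h *: u + q))) 0 (h * c)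
  (fun s => (is_derive_line _ _ _ _ _).1 (derivableP (dw _))).
have GE : G h = c * 'D_w f (xi *: w + (h *: u + q)).
  rewrite /G; have -> : h *: (u + c *: w) + q = (h * c) *: w + (h *: u + q).
    by rewrite scalerDr scalerA addrA; congr (_ + q); rewrite addrC.
  move: E; rewrite scale0r add0r => ->.
  by rewrite subr0 -[LHS]/(h^-1 * _) mulrCA [h^-1 * _]mulrA mulVf // mul1r mulrC.
rewrite GE -mulrBr normrM.
have [->|c0] := eqVneq c 0; first by rewrite normr0 mul0r ltW.
have lt1 : 0 < `|c| by rewrite normr_gt0.
apply: (@le_trans _ _ (`|c| * (e / (`|c| + 1)))); last first.
  rewrite mulrA ler_pdivrMr ?ltr_wpDl // mulrC ler_wpM2l ?lerDl //; exact: ltW.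
rewrite ler_pM2l //; apply/ltW/Hd.
rewrite -ball_normE /= opprD addrA opprD addrA.
rewrite subr0 in xic.
have -> : q - xi *: w - h *: u - q = - (xi *: w + h *: u).
  by rewrite addrC addrA addrA addNr sub0r opprD.
rewrite normrN; apply: le_lt_trans (ler_normD _ _) _; rewrite !normrZ.
have K0 : 0 < `|c| * `|w| + `|u| + 1 by rewrite ltr_pwDr // addr_ge0 // mulr_ge0.
apply: (@le_lt_trans _ _ (`|h| * (`|c| * `|w| + `|u| + 1))).
  rewrite -addrA mulrDr lerD //.
    by rewrite mulrA; apply: ler_wpM2r => //; rewrite subr0 normrM in xic.
  by apply: ler_wpM2l => //; rewrite lerDl.
rewrite -ltr_pdivlMr //; near: h; apply: dnbhs0_lt; exact: divr_gt0.
Unshelve. all: by end_near. Qed.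
End Lines.

Section Smooth.
Variables (R : realType) (n : nat).
Notation pt := (pt R n).
Notation ct := (@ct n).
Implicit Types (f g : pt -> R).

(** [smooth] quantifies over lists of directions; this recursion on the order carries the same
    information ([smoothP]) in a form where products and compositions go by induction. *)
Fixpoint smoothN (k : nat) f : Prop :=
  match k with
  | 0 => continuous f
  | k'.+1 => continuous f /\ forall v, (forall q, derivable f q v) /\ smoothN k' ('D_v f)
  end.

Lemma iterD_rcons vs v f : Defs.iterD (rcons vs v) f = Defs.iterD vs ('D_v f).
Proof. by elim: vs => [//|u vs IH] /=; rewrite IH. Qed.

Lemma smooth_cont f : smooth f -> continuous f.
Proof. by move=> /(_ [::])[]. Qed.
Lemma smooth_der f q v : smooth f -> derivable f q v.
Proof. by move=> /(_ [::])[_]; apply. Qed.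
Lemma smoothD f v : smooth f -> smooth ('D_v f).
Proof. by move=> sf vs; have := sf (rcons vs v); rewrite iterD_rcons. Qed.

Lemma smoothP f : smooth f <-> forall k, smoothN k f.
Proof.
split=> [sf k|sf].
  elim: k f sf => [|k IH] f sf /=; first exact: smooth_cont.
  split; first exact: smooth_cont.
  by move=> v; split; [move=> q; exact: smooth_der|apply: IH; exact: smoothD].
suff H vs : forall f, (forall k, smoothN k f) -> continuous (Defs.iterD vs f) /\
    forall v q, derivable (Defs.iterD vs f) q v by move=> vs; exact: H.
elim/last_ind: vs => [|vs v IH] {sf}f sf.
  by split; [exact: (sf 0%N)|move=> v q; have [_ /(_ v)[]] := sf 1%N].
rewrite iterD_rcons; apply: IH => k; have [_ /(_ v)[]] := sf k.+1; by [].
Qed.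

Lemma smoothN_cont k f : smoothN k f -> continuous f.
Proof. by case: k => [//|k []]. Qed.

Lemma smoothNS k f : smoothN k.+1 f -> smoothN k f.
Proof.
elim: k f => [|k IH] f; first by case.
by move=> [cf df]; split=> // v; have [dv sv] := df v; split=> //; exact: IH.
Qed.

Lemma smoothN_D k f g : smoothN k f -> smoothN k g -> smoothN k (f \+ g).
Proof.
elim: k f g => [|k IH] f g.
  by move=> /= cf cg q; exact: (cvgD (cf q) (cg q)).
move=> [cf df] [cg dg]; split.
  by move=> q; exact: (cvgD (cf q) (cg q)).
move=> v; have [d1 s1] := df v; have [d2 s2] := dg v; split.
  by move=> q; apply: derivableD.
have -> : 'D_v (f \+ g) = 'D_v f \+ 'D_v g by apply/funext => q; exact: deriveD.
exact: IH.
Qed.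

Lemma smoothN_M k f g : smoothN k f -> smoothN k g -> smoothN k (f \* g).
Proof.
elim: k f g => [|k IH] f g.
  by move=> /= cf cg q; exact: (cvgM (cf q) (cg q)).
move=> sf sg; have sf' := smoothNS sf; have sg' := smoothNS sg.
case: sf => cf df; case: sg => cg dg; split.
  by move=> q; exact: (cvgM (cf q) (cg q)).
move=> v; have [d1 s1] := df v; have [d2 s2] := dg v; split.
  by move=> q; apply: derivableM.
have -> : 'D_v (f \* g) = (f \* 'D_v g) \+ (g \* 'D_v f).
  by apply/funext => q; exact: deriveM.
by apply: smoothN_D; apply: IH.
Qed.

Lemma smoothN_cst k (c : R) : smoothN k (fun=> c).
Proof.
elim: k c => [|k IH] c; first by move=> /=; exact: cst_continuous.
split; first exact: cst_continuous.
move=> v; split; first by move=> q; exact: derivable_cst.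
have -> : 'D_v (fun=> c : R) = (fun=> 0 : R) by apply/funext => q; exact: derive_cst.
exact: IH.
Qed.

Lemma is_derive_coord (q v : pt) i : is_derive q v (fun r : pt => r 0 i) (v 0 i).
Proof.
apply/is_derive_at.
have -> : (fun s : R => (s *: v + q) 0 i) = (fun s => s * v 0 i + q 0 i).
  by apply/funext => s; rewrite !mxE.
apply: is_derive_eq. by rewrite scaler0 add0r addr0 -[LHS]/(v 0 i * 1) mulr1.
Qed.

Lemma smoothN_coord k i : smoothN k (fun q : pt => q 0 i).
Proof.
have cc : continuous (fun q : pt => q 0 i) by move=> q; exact: coord_continuous.
case: k => [//|k]; split => // v; split.
  by move=> q; have [] := is_derive_coord q v i.
have -> : 'D_v (fun q : pt => q 0 i) = (fun=> v 0 i).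
  by apply/funext => q; exact: (@derive_val _ _ _ _ _ _ _ (is_derive_coord q v i)).
exact: smoothN_cst.
Qed.

(** [F i] plays the role of the i-th derivative of [F 0]; providing the whole sequence lets the
    induction move along the index. *)
Lemma smoothN_chain k f (F : nat -> R -> R) : smoothN k f ->
  (forall i (x : R), is_derive x (1 : R) (F i) (F i.+1 x)) ->
  forall i, smoothN k (F i \o f).
Proof.
move=> sf dF i; have cF j : continuous (F j).
  move=> x; apply/differentiable_continuous/derivable1_diffP.
  exact: (@ex_derive _ _ _ _ _ _ _ (dF j x)).
elim: k i f sf => [|k IH] i f sf.
  by move=> q; apply: continuous_comp; [exact: sf|exact: cF].
have sf' := smoothNS sf; case: sf => cf df; split.
  by move=> q; apply: continuous_comp; [exact: cf|exact: cF].
move=> v; have [dv sv] := df v.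
have H q : is_derive q v (F i \o f) (F i.+1 (f q) * 'D_v f q).
  by have dq := derivableP (dv q); exact: (is_derive_compR (dF _ _) dq).
split; first by move=> q; have [] := H q.
have -> : 'D_v (F i \o f) = (F i.+1 \o f) \* 'D_v f.
  by apply/funext => q; exact: (@derive_val _ _ _ _ _ _ _ (H q)).
by apply: smoothN_M => //; exact: IH.
Qed.

Lemma smoothM f g : smooth f -> smooth g -> smooth (f \* g).
Proof. by move=> /smoothP sf /smoothP sg; apply/smoothP => k; exact: smoothN_M. Qed.
Lemma smooth_add f g : smooth f -> smooth g -> smooth (f \+ g).
Proof. by move=> /smoothP sf /smoothP sg; apply/smoothP => k; exact: smoothN_D. Qed.
Lemma smooth_cst (c : R) : smooth ((fun=> c) : pt -> R).
Proof. by apply/smoothP => k; exact: smoothN_cst. Qed.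
Lemma smooth_coord i : smooth (fun q : pt => q 0 i).
Proof. by apply/smoothP => k; exact: smoothN_coord. Qed.
Lemma smooth_chain f (F : nat -> R -> R) : smooth f ->
  (forall i (x : R), is_derive x (1 : R) (F i) (F i.+1 x)) ->
  forall i, smooth (F i \o f).
Proof.
by move=> /smoothP sf dF i; apply/smoothP => k; exact: (smoothN_chain (sf k)).
Qed.
Lemma smoothZ (c : R) f : smooth f -> smooth (fun q => c * f q).
Proof. by move=> sf; exact: (smoothM (smooth_cst c) sf). Qed.
Lemma smooth_sum (I : Type) (s : seq I) (h : I -> pt -> R) : (forall i, smooth (h i)) ->
  smooth (fun q => \sum_(i <- s) h i q).
Proof.
move=> sh; elim: s => [|i s IH].
  have -> : (fun q => \sum_(i <- [::]) h i q) = (fun=> 0).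
    by apply/funext => q; rewrite big_nil.
  exact: smooth_cst.
have -> : (fun q => \sum_(j <- i :: s) h j q) = h i \+ (fun q => \sum_(i <- s) h i q).
  by apply/funext => q; rewrite big_cons.
exact: (smooth_add (sh i) IH).
Qed.

Lemma smooth_dir f u w c q : smooth f ->
  'D_(u + c *: w) f q = 'D_u f q + c * 'D_w f q.
Proof.
move=> sf; have := @is_derive_dir R pt f q u w c (fun r => @smooth_der f r w sf)
  (smooth_cont (@smoothD f w sf)) (@smooth_der f q u sf).
by case.
Qed.

Lemma smooth_Xop j f : smooth f -> smooth (Xop j f).
Proof.
move=> sf; have -> : Xop j f = 'D_(eb R (cx j)) f \+
    (fun q => -1 * (q 0 (cy j) * 'D_(eb R ct) f q)).
  by apply/funext => q; rewrite /Xop /= mulN1r.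
apply: smooth_add; first exact: smoothD.
by apply/smoothZ/smoothM; [exact: smooth_coord|exact: smoothD].
Qed.

Lemma smooth_Yop j f : smooth f -> smooth (Yop j f).
Proof.
move=> sf; have -> : Yop j f = 'D_(eb R (cy j)) f \+
    (fun q => q 0 (cx j) * 'D_(eb R ct) f q) by [].
apply: smooth_add; first exact: smoothD.
by apply/smoothM; [exact: smooth_coord|exact: smoothD].
Qed.
End Smooth.

Lemma comp_app (A B C : Type) (g : B -> C) (h : A -> B) x : (g \o h) x = g (h x).
Proof. by []. Qed.

Section Translation.
Variables (R : realType) (n : nat).
Notation pt := (pt R n).
Notation ct := (@ct n).
Implicit Types (f g : pt -> R) (w : pt).

Lemma cx_val (j : 'I_n) : cx j = j :> nat.
Proof. by rewrite /cx inordK // ltnS (leq_trans (ltnW (ltn_ord j))) // leq_addr. Qed.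
Lemma cy_val (j : 'I_n) : cy j = (n + j)%N :> nat.
Proof. by rewrite /cy inordK // ltnS leq_add2l ltnW. Qed.
Lemma ct_val : ct = (n + n)%N :> nat.
Proof. by rewrite /ct inordK. Qed.
Lemma cx_ct j : (cx j == ct) = false.
Proof.
by apply/negbTE; rewrite -val_eqE /= cx_val ct_val neq_ltn (leq_trans (ltn_ord j)) ?leq_addr.
Qed.
Lemma cy_ct j : (cy j == ct) = false.
Proof. by apply/negbTE; rewrite -val_eqE /= cy_val ct_val eqn_add2l neq_ltn ltn_ord. Qed.
Lemma cx_cy (i j : 'I_n) : (cx i == cy j) = false.
Proof.
by apply/negbTE; rewrite -val_eqE /= cx_val cy_val neq_ltn (leq_trans (ltn_ord i)) ?leq_addr.
Qed.
Lemma cx_cx (i j : 'I_n) : (cx i == cx j) = (i == j).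
Proof. by rewrite -val_eqE /= !cx_val. Qed.
Lemma cy_cy (i j : 'I_n) : (cy i == cy j) = (i == j).
Proof. by rewrite -val_eqE /= !cy_val eqn_add2l. Qed.
Lemma cy_cx (i j : 'I_n) : (cy i == cx j) = false.
Proof. by rewrite eq_sym cx_cy. Qed.
Lemma ct_cx j : (ct == cx j) = false.
Proof. by rewrite eq_sym cx_ct. Qed.
Lemma ct_cy j : (ct == cy j) = false.
Proof. by rewrite eq_sym cy_ct. Qed.
Definition cE := (cx_ct, cy_ct, cx_cy, cx_cx, cy_cy, cy_cx, ct_cx, ct_cy).

Lemma sgD w (q r : pt) : sg w (q + r) = sg w q + sg w r.
Proof. by rewrite -big_split /=; apply: eq_bigr => j _; rewrite !mxE; ring. Qed.
Lemma sgZ w (c : R) (q : pt) : sg w (c *: q) = c * sg w q.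
Proof. by rewrite mulr_sumr; apply: eq_bigr => j _; rewrite !mxE; ring. Qed.
Lemma sgC w (q : pt) : sg w q = - sg q w.
Proof. by rewrite -sumrN; apply: eq_bigr => j _; ring. Qed.
Lemma sgww w : sg w w = 0.
Proof. by rewrite /sg big1 // => j _; rewrite mulrC subrr. Qed.
Lemma sgN w (q : pt) : sg (- w) q = - sg w q.
Proof. by rewrite -sumrN; apply: eq_bigr => j _; rewrite !mxE; ring. Qed.
Lemma sg_ct w : sg w (eb R ct) = 0.
Proof. by rewrite /sg big1 // => j _; rewrite !mxE !cE !andbF !mulr0 subr0. Qed.
Lemma sg_cx w j : sg w (eb R (cx j)) = - w 0 (cy j).
Proof.
rewrite /sg (bigD1 j) //= big1 => [|i /negbTE ij]; rewrite !mxE !cE.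
  by rewrite !eqxx mulr0 mulr1 sub0r addr0.
by rewrite ij !andbF !mulr0 subr0.
Qed.
Lemma sg_cy w j : sg w (eb R (cy j)) = w 0 (cx j).
Proof.
rewrite /sg (bigD1 j) //= big1 => [|i /negbTE ij]; rewrite !mxE !cE.
  by rewrite !eqxx mulr0 mulr1 subr0 addr0.
by rewrite ij !andbF !mulr0 subr0.
Qed.

Lemma ltrK w : cancel (ltr w) (ltr (- w)).
Proof.
move=> q; rewrite /ltr sgN !sgD sgZ sg_ct sgww mulr0 !addr0 scaleNr.
by rewrite addrAC addrK addrK.
Qed.

Lemma ltr0 (w : pt) : ltr w 0 = w.
Proof. by rewrite /ltr add0r -(scale0r (0 : pt)) sgZ mul0r scale0r addr0. Qed.

(** The differential of [ltr w]; it is the same at every point because [ltr w] is affine. *)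
Definition dltr w (v : pt) : pt := v + sg w v *: eb R ct.

Lemma ltr_line w (h : R) (v q : pt) : ltr w (h *: v + q) = h *: dltr w v + ltr w q.
Proof.
rewrite /ltr /dltr sgD sgZ scalerDr scalerA scalerDl.
by rewrite -!addrA; congr (_ + _); rewrite [RHS]addrCA; congr (_ + _); rewrite addrCA; congr (_ + _); rewrite addrC.
Qed.

Lemma quot_ltr f w (v q : pt) :
  (fun h : R => h^-1 *: (((f \o ltr w) \o shift q) (h *: v) - (f \o ltr w) q)) =
  (fun h : R => h^-1 *: ((f \o shift (ltr w q)) (h *: dltr w v) - f (ltr w q))).
Proof. by apply/funext => h /=; rewrite ltr_line. Qed.

Lemma derive_ltr f w (v : pt) : 'D_v (f \o ltr w) = 'D_(dltr w v) f \o ltr w.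
Proof. by apply/funext => q; rewrite /derive quot_ltr. Qed.

Lemma derive_ltrE f w (v q : pt) :
  derive (f \o ltr w) q v = derive f (ltr w q) (dltr w v).
Proof. by rewrite /derive quot_ltr. Qed.

Lemma derivable_ltr f w (v q : pt) :
  derivable f (ltr w q) (dltr w v) -> derivable (f \o ltr w) q v.
Proof. by rewrite /derivable quot_ltr. Qed.

Lemma continuous_ltr w : continuous (ltr w : pt -> pt).
Proof.
move=> q; have cs : continuous (sg w).
  move=> r; rewrite /sg; apply: (@smooth_cont R n (sg w)).
  apply: smooth_sum => j.
  have -> : (fun q : pt => w 0 (cx j) * q 0 (cy j) - w 0 (cy j) * q 0 (cx j)) =
     (fun q : pt => w 0 (cx j) * q 0 (cy j)) \+ (fun q : pt => - w 0 (cy j) * q 0 (cx j)).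
    by apply/funext => r' /=; rewrite mulNr.
  by apply: smooth_add; apply: smoothZ; exact: smooth_coord.
have c1 : continuous (fun r : pt => r + w).
  by move=> r; exact: (cvgD (@cvg_id _ _) (cvg_cst w)).
have c2 : continuous (fun r : pt => sg w r *: eb R ct).
  by move=> r; exact: (cvgZr_tmp (cs r)).
exact: (cvgD (c1 q) (c2 q)).
Qed.

Lemma smooth_ltr f w : smooth f -> smooth (f \o ltr w).
Proof.
move=> /smoothP sf; apply/smoothP => k; have := sf k; elim: k f {sf} => [|k IH] f.
  by move=> cf q; apply: continuous_comp; [exact: continuous_ltr|exact: cf].
move=> [cf df]; split.
  by move=> q; apply: continuous_comp; [exact: continuous_ltr|exact: cf].
move=> v; have [dv sv] := df (dltr w v); split.
  by move=> q; exact: derivable_ltr.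
by rewrite derive_ltr; exact: IH.
Qed.

Lemma ltr_cx w q j : ltr w q 0 (cx j) = q 0 (cx j) + w 0 (cx j).
Proof. by rewrite !mxE !cE andbF mulr0 addr0. Qed.
Lemma ltr_cy w q j : ltr w q 0 (cy j) = q 0 (cy j) + w 0 (cy j).
Proof. by rewrite !mxE !cE andbF mulr0 addr0. Qed.
Lemma ltr_ct w q : ltr w q 0 ct = q 0 ct + w 0 ct + sg w q.
Proof. by rewrite !mxE !eqxx mulr1. Qed.

Lemma Dt_ltr f w : Dt (f \o ltr w) = Dt f \o ltr w.
Proof. by rewrite /Dt derive_ltr /dltr sg_ct scale0r addr0. Qed.

Lemma Xop_ltr j f w : smooth f -> Xop j (f \o ltr w) = Xop j f \o ltr w.
Proof.
move=> sf; apply/funext => q; rewrite /Xop !derive_ltrE /dltr sg_ct scale0r addr0 /=.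
rewrite (smooth_dir (eb R (cx j)) (eb R ct) (sg w (eb R (cx j))) (ltr w q) sf) sg_cx ltr_cy.
have E (a b u v : R) : a + - v * b - u * b = a - (u + v) * b by ring.
exact: E.
Qed.

Lemma Yop_ltr j f w : smooth f -> Yop j (f \o ltr w) = Yop j f \o ltr w.
Proof.
move=> sf; apply/funext => q; rewrite /Yop !derive_ltrE /dltr sg_ct scale0r addr0 /=.
rewrite (smooth_dir (eb R (cy j)) (eb R ct) (sg w (eb R (cy j))) (ltr w q) sf) sg_cy ltr_cx.
have E (a b u v : R) : a + v * b + u * b = a + (u + v) * b by ring.
exact: E.
Qed.

Lemma subLap_ltr f w : smooth f -> subLap (f \o ltr w) = subLap f \o ltr w.
Proof.
move=> sf; have EX j : Xop j (Xop j (f \o ltr w)) = Xop j (Xop j f) \o ltr w.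
  by rewrite (Xop_ltr j w sf) (Xop_ltr j w (smooth_Xop j sf)).
have EY j : Yop j (Yop j (f \o ltr w)) = Yop j (Yop j f) \o ltr w.
  by rewrite (Yop_ltr j w sf) (Yop_ltr j w (smooth_Yop j sf)).
apply/funext => q; rewrite -[RHS]/(subLap f (ltr w q)) /subLap.
have E j : Xop j (Xop j (f \o ltr w)) q + Yop j (Yop j (f \o ltr w)) q =
    Xop j (Xop j f) (ltr w q) + Yop j (Yop j f) (ltr w q).
  by rewrite EX EY !comp_app; reflexivity.
exact: (congr1 -%R (eq_bigr _ (fun j _ => E j))).
Qed.
End Translation.

(** * An integrable weight in $|z|^2$ *)

Section OneDimIntegrals.
Variable R : realType.
Notation leb := (@lebesgue_measure R).

Lemma continuous_cauchy (b : R) : 0 <= b -> continuous (fun s : R => (1 + b * s ^+ 2)^-1).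
Proof.
move=> b0 s.
have c2 : (fun s : R => 1 + b * s ^+ 2) x @[x --> s] --> 1 + b * s ^+ 2.
  by apply: cvgD; [exact: cvg_cst|apply: cvgM; [exact: cvg_cst|exact: exprn_continuous]].
by apply: (cvgV _ c2); rewrite gt_eqF // ltr_wpDr // mulr_ge0 // sqr_ge0.
Qed.

Lemma measurable_cauchy (b : R) : 0 <= b ->
  measurable_fun setT (fun s : R => (1 + b * s ^+ 2)^-1).
Proof. by move=> b0; apply: continuous_measurable_fun; exact: continuous_cauchy. Qed.

Lemma integral_cauchy_lt : exists2 c : R, 0 < c &
  forall b : R, 0 < b -> exists2 d : R, 0 <= d <= c / Num.sqrt b &
   (\int[leb]_s ((1 + b * s ^+ 2)^-1)%:E = d%:E)%E.
Proof.
pose G (s : R) : R := (1 + s ^+ 2)^-1.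
have G0 s : 0 <= G s by rewrite invr_ge0 addr_ge0 // sqr_ge0.
have GE : G = (fun s : R => (1 + 1 * s ^+ 2)^-1) by apply/funext => s; rewrite mul1r.
have mG : measurable_fun setT G by rewrite GE; exact: measurable_cauchy.
have cG : continuous G by rewrite GE; exact: continuous_cauchy.
have mGE : measurable_fun setT (EFin \o G) by apply/measurable_EFinP.
have GE0 s : (0 <= (EFin \o G) s)%E by rewrite lee_fin.
have half : (\int[leb]_(s in `[0%R, +oo[) (G s)%:E = (pi / 2)%:E)%E.
  by rewrite -integral0y_oneDsqr.
have full : (\int[leb]_s (G s)%:E <= (pi)%:E)%E.
  have -> : [set: R] = `]-oo, 0] `|` `]0, +oo[.
    apply/seteqP; split => // x _ /=; rewrite !in_itv /= andbT.
    by case: (leP x 0) => h; [left|right].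
  have disj : [disjoint `]-oo, 0 : R] & `]0 : R, +oo[].
    apply/disj_setPS => x [/=]; rewrite !in_itv /= andbT => h1 h2.
    by move: (le_lt_trans h1 h2); rewrite ltxx.
  rewrite ge0_integral_setU //; try exact: measurable_funTS;
    try (by move=> x _; rewrite lee_fin).
  rewrite integral_itv_obnd_cbnd; last exact: measurable_funTS.
  have E := ge0_integration_by_substitution0 mGE GE0.
  rewrite half -half (_ : (\int[leb]_(s in `]-oo, 0%R]) (G s)%:E = \int[leb]_(s in `[0%R, +oo[) (G s)%:E)%E).
    by rewrite half -EFinD lee_fin -splitr.
  by rewrite [RHS]E; apply: eq_integral => s _; rewrite /G /= sqrrN.
exists pi; first exact: pi_gt0.
move=> b b0; have sb : 0 < Num.sqrt b by rewrite sqrtr_gt0.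
have sub := @increasing_ge0_integration_by_substitutionT R (fun s => s * Num.sqrt b) G.
have dF s : is_derive s (1 : R) (fun s : R => s * Num.sqrt b) (Num.sqrt b).
  by apply: is_derive_eq; rewrite scaler0 add0r -[LHS]/(Num.sqrt b * 1) mulr1.
have dFE : (fun s : R => s * Num.sqrt b)^`()%classic = cst (Num.sqrt b).
  by apply/funext => s; rewrite derive1E; exact: (@derive_val _ _ _ _ _ _ _ (dF s)).
have : (\int[leb]_s (G s)%:E = \int[leb]_s (Num.sqrt b * (1 + b * s ^+ 2)^-1)%:E)%E.
  rewrite sub //.
  - apply: eq_integral => s _; congr EFin.
    rewrite -[LHS]/(G (s * Num.sqrt b) * (fun s : R => s * Num.sqrt b)^`()%classic s) dFE /G /= exprMn.
    by rewrite sqr_sqrtr ?(ltW b0) // mulrC [_ * b]mulrC.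
  - by move=> x y xy; rewrite ltr_pM2r.
  - by rewrite dFE => s; exact: cst_continuous.
  - by rewrite dFE; exact: is_cvg_cst.
  - by rewrite dFE; exact: is_cvg_cst.
  - by apply: gt0_cvgMlNy.
  - by apply: gt0_cvgMly.
under [X in _ = X -> _]eq_integral do rewrite EFinM.
rewrite ge0_integralZl_EFin ?(ltW sb) //; last 2 first.
- by move=> x _; rewrite lee_fin invr_ge0 addr_ge0 // mulr_ge0 ?sqr_ge0 // ltW.
- by apply/measurable_EFinP; apply: measurable_cauchy; exact: ltW.
move=> E.
set X := (\int[leb]_s ((1 + b * s ^+ 2)^-1)%:E)%E in E *.
have X0 : (0 <= X)%E.
  by apply: integral_ge0 => s _; rewrite lee_fin invr_ge0 addr_ge0 // mulr_ge0 ?sqr_ge0 // ltW.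
move: E; case: X X0 => [x|//|//] x0 E.
  exists x => //; rewrite lee_fin in x0; rewrite x0 /= ler_pdivlMr // mulrC.
  by rewrite -lee_fin EFinM -E.
by move: full; rewrite E gt0_muley // lte_fin.
Qed.
End OneDimIntegrals.

Section Product.
Variables (R : realType) (n : nat).
Notation pt := (pt R n).
Notation bpt := (bpt R n).
Notation leb := (@lebesgue_measure R).
Notation haar := (haar R n).
Notation ct := (@ct n).

Lemma hint_prod (h : 'I_(n + n).+1 -> R -> R) (c : 'I_(n + n).+1 -> R) :
  (forall i, measurable_fun setT (h i)) -> (forall i s, 0 <= h i s) ->
  (forall i, \int[leb]_(s in cdom i) (h i s)%:E = (c i)%:E)%E ->
  hint (fun q : pt => (\prod_i h i (q 0 i))%:E) = (\prod_i c i)%:E.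
Proof.
move=> mh h0 hc.
suff H k (q : pt) : (k <= (n + n).+1)%N -> iint k (fun q : pt => (\prod_i h i (q 0 i))%:E) q =
    (\prod_(i : 'I_(n + n).+1) (if (i < k)%N then c i else h i (q 0 i)))%:E.
  rewrite /hint H //; congr EFin; apply: eq_bigr => i _; by rewrite ltn_ord.
elim: k q => [|k IH] q kn; first by [].
rewrite -[LHS]/(I1 (inord k) (iint k _) q) /I1.
set i0 : 'I_(n + n).+1 := inord k.
have i0k : i0 = k :> nat by rewrite inordK.
pose P := \prod_(i | i != i0) (if (i < k)%N then c i else h i (q 0 i)).
have P0 : 0 <= P.
  apply: prodr_ge0 => i _; case: ifP => // _.
  by rewrite -lee_fin -hc; apply: integral_ge0 => s _; rewrite lee_fin.
transitivity (\int[leb]_(s in cdom i0) (P%:E * (h i0 s)%:E))%E.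
  apply: eq_integral => s _; rewrite IH; last exact: ltnW.
  rewrite (bigD1 i0) //= i0k ltnn setcE eqxx mulrC -EFinM; congr (EFin (_ * _)).
  by apply: eq_bigr => i /negbTE ii0; rewrite setcE ii0.
rewrite ge0_integralZl_EFin //; try exact: measurable_cdom;
  try (by move=> s _; rewrite lee_fin); try (by apply: measurable_funTS; apply/measurable_EFinP).
  rewrite hc -EFinM; congr EFin; rewrite (bigD1 i0) //= i0k ltnSn mulrC; congr (_ * _).
  apply: eq_bigr => i ii0.
  have ne : (i : nat) != k by move: ii0; rewrite -val_eqE /= i0k.
  by rewrite ltnS [in RHS]leq_eqVlt (negbTE ne).
have mE : measurable_fun setT (EFin \o h i0) by apply/measurable_EFinP.
exact: (measurable_funS measurableT (@subsetT _ _) mE).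
Qed.

Definition rho2 (q : pt) : R := \sum_(j < n) (q 0 (cx j) ^+ 2 + q 0 (cy j) ^+ 2).

Lemma rho_ge0 q : 0 <= rho2 q.
Proof. by apply: sumr_ge0 => j _; rewrite addr_ge0 ?sqr_ge0. Qed.

Lemma smooth_rho : smooth rho2.
Proof.
apply: smooth_sum => j.
have -> : (fun q : pt => q 0 (cx j) ^+ 2 + q 0 (cy j) ^+ 2) =
  (((fun q : pt => q 0 (cx j)) \* (fun q : pt => q 0 (cx j))) \+
   ((fun q : pt => q 0 (cy j)) \* (fun q : pt => q 0 (cy j)))) by [].
by apply: smooth_add; apply: smoothM; exact: smooth_coord.
Qed.

Lemma continuous_measurable_bpt (f : pt -> R) : continuous f -> measurable_fun setT (f : bpt -> R).
Proof.
move=> cf; apply: measurable_borel_fun => U oU; apply: sub_sigma_algebra.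
by apply: open_comp => // x _; exact: cf.
Qed.

Lemma continuous_borel (f : pt -> R) : continuous f -> borel_fun f.
Proof.
move=> cf U oU; apply: sub_sigma_algebra.
by apply: open_comp => // x _; exact: cf.
Qed.

Lemma continuous_weight (b : R) (k : nat) : 0 <= b ->
  continuous (fun q : pt => ((1 + b * rho2 q) ^+ k)^-1).
Proof.
move=> b0 q.
have c1 : (fun q : pt => 1 + b * rho2 q) x @[x --> q] --> 1 + b * rho2 q.
  have C : continuous (fun q : pt => 1 + b * rho2 q).
    apply: (@smooth_cont R n (fun q : pt => 1 + b * rho2 q)).
    apply: (@smooth_add R n (fun=> 1) (fun q => b * rho2 q)); first exact: smooth_cst.
    by apply: smoothZ; exact: smooth_rho.
  exact: C.
have c2 : (fun q : pt => (1 + b * rho2 q) ^+ k) x @[x --> q] --> (1 + b * rho2 q) ^+ k.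
  exact: (continuous_comp c1 (@exprn_continuous _ k _)).
apply: (cvgV _ c2).
by rewrite gt_eqF // exprn_gt0 // ltr_wpDr // mulr_ge0 ?rho_ge0.
Qed.

(** Each of the 2n factors is at most $1+b|z|^2$. Consequently $(1+b|z|^2)^{-2n}$ lies below a
    product of one-variable Cauchy weights, whose integral factorises. *)
Lemma prod_le_rho (b : R) (q : pt) : 0 <= b ->
  \prod_(i : 'I_(n + n).+1 | i != ct) (1 + b * q 0 i ^+ 2) <= (1 + b * rho2 q) ^+ (n + n).
Proof.
move=> b0; have -> : (1 + b * rho2 q) ^+ (n + n) =
   \prod_(i : 'I_(n + n).+1 | i != ct) (1 + b * rho2 q).
  rewrite prodr_const; congr (_ ^+ _).
  by rewrite (eq_card (B := predC1 ct)) ?cardC1 ?card_ord // => i; rewrite !inE.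
apply: ler_prod => i it; apply/andP; split; first by rewrite addr_ge0 // mulr_ge0 // sqr_ge0.
rewrite lerD2l ler_wpM2l //.
have [ilt|ile] := ltnP i n.
  have -> : i = cx (Ordinal ilt) by apply: val_inj; rewrite /= cx_val.
  rewrite /rho2 (bigD1 (Ordinal ilt)) //= -addrA lerDl addr_ge0 ?sqr_ge0 // sumr_ge0 // => j _.
  by rewrite addr_ge0 ?sqr_ge0.
have lt : (i - n < n)%N.
  have := ltn_ord i; rewrite ltnS leq_eqVlt => /orP[/eqP e|].
    by case/negP: it; rewrite -val_eqE /= ct_val e.
  by rewrite ltn_subLR.
have -> : i = cy (Ordinal lt) by apply: val_inj; rewrite /= cy_val /= subnKC.
rewrite /rho2 (bigD1 (Ordinal lt)) //= addrAC lerDr addr_ge0 ?sqr_ge0 // sumr_ge0 // => j _.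
by rewrite addr_ge0 ?sqr_ge0.
Qed.

Lemma integral_rho_weight : exists2 C : R, 0 < C & forall b : R, 0 < b ->
  (\int[haar]_q (((1 + b * rho2 q) ^+ (n + n))^-1)%:E <= (C / b ^+ n)%:E)%E.
Proof.
have [c c0 hc] := integral_cauchy_lt R.
exists (2 * pi * c ^+ (n + n)); first by rewrite !mulr_gt0 ?pi_gt0 ?exprn_gt0.
move=> b b0; have [d /andP[d0 dc] hd] := hc b b0.
pose h (i : 'I_(n + n).+1) (s : R) := if i == ct then 1 else (1 + b * s ^+ 2)^-1.
pose cc (i : 'I_(n + n).+1) := if i == ct then 2 * pi else d.
have h0 i s : 0 <= h i s.
  rewrite /h; case: (i == ct) => //; rewrite invr_ge0 addr_ge0 // mulr_ge0 ?sqr_ge0 //; exact: ltW.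
have mh i : measurable_fun setT (h i).
  by rewrite /h; case: (i == ct) => //; apply: measurable_cauchy; exact: ltW.
have hE i : (\int[leb]_(s in cdom i) (h i s)%:E = (cc i)%:E)%E.
  rewrite /h /cc /cdom; case: ifP => _ //.
  rewrite (_ : mkset _ = `[0, 2 * pi[%classic); last first.
    by apply/seteqP; split => x; rewrite /= in_itv /=.
  pose J : set (measurableTypeR R) := `[0, 2 * pi[%classic.
  have mJ : measurable J by exact: (measurable_itv `[0, 2 * pi[).
  transitivity (1%:E * leb J)%E; first exact: (integral_cst leb mJ 1%E).
  rewrite mul1e /J lebesgue_measure_itv /=.
  by rewrite lte_fin mulr_gt0 ?pi_gt0 // -EFinD subr0.
have mW : measurable_fun setT (fun q : bpt => (\prod_i h i ((q : pt) 0 i))%:E).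
  apply/measurable_EFinP; apply: measurable_prod => i _.
  by apply: (measurableT_comp (mh i)); exact: measurable_coord.
have := hint_prod mh h0 hE; rewrite -haarE //; last first.
  by move=> q; rewrite lee_fin prodr_ge0.
move=> E; apply: (@le_trans _ _ (\prod_i cc i)%:E).
  rewrite -E; apply: ge0_le_integral => //.
  - by move=> q _; rewrite lee_fin invr_ge0 exprn_ge0 // addr_ge0 // mulr_ge0 ?rho_ge0 // ltW.
  - apply/measurable_EFinP; apply: continuous_measurable_bpt.
    by apply: continuous_weight; exact: ltW.
  move=> q _; rewrite lee_fin (bigD1 ct) //= /h eqxx mul1r.
  under eq_bigr => i /negbTE it do rewrite it.
  rewrite prodfV lef_pV2 ?posrE ?exprn_gt0 //.
  - by apply: prod_le_rho; exact: ltW.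
  - by rewrite ltr_wpDr // mulr_ge0 ?rho_ge0 // ltW.
  - by apply: prodr_gt0 => i _; rewrite ltr_wpDr // mulr_ge0 ?sqr_ge0 // ltW.
rewrite lee_fin (bigD1 ct) //= /cc eqxx.
under eq_bigr => i /negbTE it do rewrite it.
rewrite prodr_const.
have -> : #|(fun i : 'I_(n + n).+1 => i != ct)| = (n + n)%N.
  by rewrite (eq_card (B := predC1 ct)) ?cardC1 ?card_ord // => i; rewrite !inE.
rewrite -!mulrA ler_pM2l // ler_pM2l ?pi_gt0 //.
apply: (le_trans (lerXn2r (n + n) _ _ dc)); rewrite ?nnegrE //.
  by rewrite divr_ge0 ?sqrtr_ge0 // ltW.
by rewrite expr_div_n ler_wpM2l ?exprn_ge0 ?(ltW c0) // addnn -mul2n exprM sqr_sqrtr // ltW.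
Qed.

End Product.

(** * Integration by parts for the sub-Laplacian *)

Section IntegralTools.
Context d (T : measurableType d) (R : realType) (mu : {measure set T -> \bar R}).
Implicit Types f g h : T -> R.

Definition L1 f : Prop := mu.-integrable setT (EFin \o f).

Lemma L1P f : L1 f <-> measurable_fun setT f /\ (\int[mu]_x `|f x|%:E < +oo)%E.
Proof.
split=> [/integrableP[mf fin]|[mf fin]]; first by split => //; apply/measurable_EFinP.
by apply/integrableP; split => //; apply/measurable_EFinP.
Qed.

Lemma L1_meas f : L1 f -> measurable_fun setT f.
Proof. by case/L1P. Qed.

Lemma L1_le f g : measurable_fun setT f -> L1 g -> (forall x, `|f x| <= g x) -> L1 f.
Proof.
move=> mf ig fg; apply: (@le_integrable _ _ _ mu setT measurableT _ (EFin \o g)) => //.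
  by apply/measurable_EFinP.
by move=> x _ /=; rewrite lee_fin (le_trans (fg x)) // ler_norm.
Qed.

Lemma L1D f g : L1 f -> L1 g -> L1 (fun x => f x + g x).
Proof. by move=> If Ig; exact: (@integrableD _ _ _ mu setT measurableT _ _ If Ig). Qed.

Lemma L1Z (c : R) f : L1 f -> L1 (fun x => c * f x).
Proof. by move=> If; exact: (@integrableZl _ _ _ mu setT measurableT c _ If). Qed.

Lemma L1N f : L1 f -> L1 (fun x => - f x).
Proof.
by move=> If; have := L1Z (-1) If; rewrite (_ : (fun x => _) = (fun x => - f x)) //; apply/funext => x; rewrite mulN1r.
Qed.

Lemma L1B f g : L1 f -> L1 g -> L1 (fun x => f x - g x).
Proof. by move=> If Ig; exact: (L1D If (L1N Ig)). Qed.

Lemma L1_norm f : L1 f -> L1 (fun x => `|f x|).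
Proof.
move=> If; have mf := L1_meas If; apply/L1P; split; first exact: measurableT_comp.
case/L1P: If => _; congr (_ < _)%E; apply: eq_integral => x _; by rewrite normr_id.
Qed.

Lemma L1_0 : L1 (fun=> 0).
Proof. exact: integrable0. Qed.

Lemma L1_sum (I : Type) (s : seq I) (P : pred I) (h : I -> T -> R) :
  (forall i, P i -> L1 (h i)) -> L1 (fun x => \sum_(i <- s | P i) h i x).
Proof.
move=> ih; elim: s => [|i s IH].
  by rewrite (_ : (fun x => _) = (fun=> 0)) ?L1_0 //; first exact: L1_0; apply/funext => x; rewrite big_nil.
case Pi: (P i).
  rewrite (_ : (fun x => _) = (fun x => h i x + \sum_(j <- s | P j) h j x)).
    by apply: L1D => //; exact: ih.
  by apply/funext => x; rewrite big_cons Pi.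
rewrite (_ : (fun x => _) = (fun x => \sum_(j <- s | P j) h j x)) //.
by apply/funext => x; rewrite big_cons Pi.
Qed.

Lemma intD f g : L1 f -> L1 g -> \int[mu]_x (f x + g x) = \int[mu]_x f x + \int[mu]_x g x.
Proof. by move=> If Ig; rewrite RintegralD. Qed.

Lemma intB f g : L1 f -> L1 g -> \int[mu]_x (f x - g x) = \int[mu]_x f x - \int[mu]_x g x.
Proof. by move=> If Ig; rewrite RintegralB. Qed.

Lemma intZ (c : R) f : L1 f -> \int[mu]_x (c * f x) = c * \int[mu]_x f x.
Proof. by move=> If; rewrite RintegralZl. Qed.

Lemma int_sum (I : Type) (s : seq I) (P : pred I) (h : I -> T -> R) :
  (forall i, P i -> L1 (h i)) ->
  \int[mu]_x (\sum_(i <- s | P i) h i x) = \sum_(i <- s | P i) \int[mu]_x h i x.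
Proof.
move=> ih; elim: s => [|i s IH].
  rewrite big_nil (_ : (fun x => _) = (fun=> 0)); last by apply/funext => x; rewrite big_nil.
  by rewrite /Rintegral integral0.
rewrite big_cons; case Pi: (P i).
  rewrite -IH -intD; [|exact: ih|exact: L1_sum].
  by congr Rintegral; apply/funext => x; rewrite big_cons Pi.
by rewrite -IH; congr Rintegral; apply/funext => x; rewrite big_cons Pi.
Qed.

Lemma int_le f g : L1 f -> L1 g -> (forall x, f x <= g x) ->
  \int[mu]_x f x <= \int[mu]_x g x.
Proof. by move=> If Ig fg; apply: le_Rintegral => // x _; exact: fg. Qed.

Lemma int_ge0 f : (forall x, 0 <= f x) -> 0 <= \int[mu]_x f x.
Proof. by move=> f0; apply: Rintegral_ge0. Qed.

Lemma int_abs f : L1 f -> `|\int[mu]_x f x| <= \int[mu]_x `|f x|.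
Proof. by move=> If; exact: le_normr_Rintegral. Qed.

Lemma intE f : L1 f -> (\int[mu]_x (f x)%:E)%E = (\int[mu]_x f x)%:E.
Proof. by move=> If; rewrite /Rintegral fineK //; exact: integrable_fin_num. Qed.

Lemma L1_ge0 f (c : R) : measurable_fun setT f -> (forall x, 0 <= f x) ->
  (\int[mu]_x (f x)%:E <= c%:E)%E -> L1 f /\ \int[mu]_x f x <= c.
Proof.
move=> mf f0 fc; have If : L1 f.
  apply/L1P; split => //; apply: (le_lt_trans _ (ltry c)); apply: le_trans fc.
  by apply: ge0_le_integral => //; [apply/measurable_EFinP; exact: measurableT_comp|
    apply/measurable_EFinP|move=> x _; rewrite ger0_norm].
by split => //; rewrite -lee_fin -intE.
Qed.

Lemma measM f g : measurable_fun setT f -> measurable_fun setT g ->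
  measurable_fun setT (fun x => f x * g x).
Proof. by move=> mf mg; exact: measurable_funM. Qed.

Lemma L1_mul f g : measurable_fun setT f -> measurable_fun setT g ->
  L1 (fun x => f x ^+ 2) -> L1 (fun x => g x ^+ 2) -> L1 (fun x => f x * g x).
Proof.
move=> mf mg If Ig; apply: (L1_le _ (L1D If Ig)); first exact: measM.
move=> x; rewrite normrM -(real_normK (num_real (f x))) -(real_normK (num_real (g x))).
have := sqr_ge0 (`|f x| - `|g x|); have := normr_ge0 (f x); have := normr_ge0 (g x).
by set a := `|f x|; set b := `|g x|; nra.
Qed.

Lemma cauchy_schwarz f g : measurable_fun setT f -> measurable_fun setT g ->
  L1 (fun x => f x ^+ 2) -> L1 (fun x => g x ^+ 2) ->
  (\int[mu]_x (f x * g x)) ^+ 2 <= \int[mu]_x (f x ^+ 2) * \int[mu]_x (g x ^+ 2).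
Proof.
move=> mf mg If Ig; have Ifg := L1_mul mf mg If Ig.
set A := \int[mu]_x (f x ^+ 2); set B := \int[mu]_x (g x ^+ 2); set C := \int[mu]_x (f x * g x).
have A0 : 0 <= A by apply: int_ge0 => x; exact: sqr_ge0.
have B0 : 0 <= B by apply: int_ge0 => x; exact: sqr_ge0.
have H (s t : R) : 0 <= s ^+ 2 * A + (2 * s * t) * C + t ^+ 2 * B.
  rewrite -(intZ _ If) -(intZ _ Ig) -(intZ _ Ifg) -intD; [|exact: L1Z|exact: L1Z].
  rewrite -intD; [|by apply: L1D; exact: L1Z|exact: L1Z].
  apply: int_ge0 => x; have := sqr_ge0 (s * f x + t * g x).
  by congr (_ <= _); ring.
have [A00|An0] := eqVneq A 0.
  rewrite A00 mul0r; have [->|C0] := eqVneq C 0; first by rewrite expr0n.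
  (* With $\int f^2=0$ the quadratic form is affine in its first argument; were $\int fg\neq0$, this
     argument would give it the value $-1$. *)
  have := H (- (B + 1) / (2 * C)) 1; rewrite A00 mulr0 add0r expr1n mul1r.
  have -> : 2 * (- (B + 1) / (2 * C)) * 1 * C = - (B + 1) by field.
  by rewrite opprD addrAC addNr add0r oppr_ge0 ler10.
have Ap : 0 < A by rewrite lt_neqAle eq_sym An0.
have := H (- C) A; have -> : (- C) ^+ 2 * A + 2 * - C * A * C + A ^+ 2 * B = A * (A * B - C ^+ 2) by ring.
by rewrite pmulr_rge0 // subr_ge0.
Qed.

Lemma dct (F : nat -> T -> R) f g : (forall i, measurable_fun setT (F i)) ->
  measurable_fun setT f -> (forall x, F i x @[i --> \oo] --> f x) ->
  L1 g -> (forall i x, `|F i x| <= g x) ->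
  \int[mu]_x F i x @[i --> \oo] --> \int[mu]_x f x.
Proof.
move=> mF mf Ff Ig Fg.
have [] := @dominated_convergence _ T R mu setT measurableT (fun i => EFin \o F i) (EFin \o f) (EFin \o g).
- by move=> i; apply/measurable_EFinP.
- by apply/measurable_EFinP.
- by apply/aeW => x _ /=; apply/fine_cvgP; split; [exact: nearW|exact: Ff].
- exact: Ig.
- by apply/aeW => x i _ /=; rewrite lee_fin.
move=> If _ H; have If' : L1 f := If.
have : (\int[mu]_x (EFin \o F i) x)%E @[i --> \oo] --> (\int[mu]_x f x)%:E by rewrite -intE.
by move/fine_cvg.
Qed.

End IntegralTools.

Section HaarTools.
Variables (R : realType) (n : nat).
Notation pt := (pt R n).
Notation bpt := (bpt R n).
Notation haar := (haar R n).
Notation rho := (@rho2 R n).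
Notation L1 := (@L1 _ bpt R haar).

Definition wgt (q : pt) : R := ((1 + rho q) ^+ (n + n))^-1.
(** The weight is integrable, bounded, and comparable with its translates ([wgt_addv]): these three
    properties supply every domination below. *)
Definition decay (g : pt -> R) := exists C : R, forall q : pt, `|g q| <= C * wgt q.

Lemma rho1_gt0 (q : pt) : 0 < 1 + rho q.
Proof. by rewrite ltr_wpDr // rho_ge0. Qed.

Lemma wgt_gt0 (q : pt) : 0 < wgt q.
Proof. by rewrite invr_gt0 exprn_gt0 // rho1_gt0. Qed.

Lemma wgt_le1 (q : pt) : wgt q <= 1.
Proof. by rewrite invf_le1 ?exprn_gt0 ?rho1_gt0 // exprn_ege1 // lerDl rho_ge0. Qed.

Lemma continuous_wgt : continuous wgt.
Proof.
have := @continuous_weight R n 1 (n + n) ler01.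
rewrite (_ : (fun q => _) = wgt) //; apply/funext => q; by rewrite mul1r.
Qed.

Lemma L1_wgt : L1 wgt.
Proof.
have [C C0 /(_ 1 ltr01)] := integral_rho_weight R n.
rewrite (_ : (fun q => _) = (fun q => (wgt q)%:E)); last by apply/funext => q; rewrite mul1r.
move=> H; have mw : measurable_fun setT (wgt : bpt -> R).
  by apply: continuous_measurable_bpt; exact: continuous_wgt.
by have [] := L1_ge0 mw (fun q => ltW (wgt_gt0 q)) H.
Qed.

Lemma L1_decay (g : pt -> R) : measurable_fun setT (g : bpt -> R) -> decay g -> L1 g.
Proof. by move=> mg [C HC]; apply: (L1_le mg (L1Z C L1_wgt)). Qed.

Lemma decay_ge0 (g : pt -> R) : decay g -> exists2 C : R, 0 <= C & forall q : pt, `|g q| <= C * wgt q.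
Proof.
move=> [C HC]; exists C => //.
by rewrite -(pmulr_lge0 _ (wgt_gt0 0)) (le_trans _ (HC 0)).
Qed.

Lemma decay_bd (g : pt -> R) : decay g -> exists C : R, forall q : pt, `|g q| <= C.
Proof.
move=> /decay_ge0[C C0 HC]; exists C => q; apply: le_trans (HC q) _.
by rewrite ler_piMr // wgt_le1.
Qed.

Lemma decayM (f g : pt -> R) : decay f -> (exists C : R, forall q : pt, `|g q| <= C) ->
  decay (fun q => f q * g q).
Proof.
move=> /decay_ge0[C C0 HC] [D HD]; exists (C * D) => q; rewrite normrM mulrAC.
by apply: ler_pM.
Qed.

Lemma decayD (f g : pt -> R) : decay f -> decay g -> decay (fun q => f q + g q).
Proof.
move=> [C HC] [D HD]; exists (C + D) => q; rewrite mulrDl.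
by apply: le_trans (ler_normD _ _) _; exact: lerD.
Qed.

Lemma decay_sqr (g : pt -> R) : decay g -> decay (fun q => g q ^+ 2).
Proof. by move=> dg; have := decayM dg (decay_bd dg). Qed.

Lemma L1_decay2 (g : pt -> R) : measurable_fun setT (g : bpt -> R) -> decay g -> L1 (fun q => g q ^+ 2).
Proof.
move=> mg dg; apply: L1_decay; last exact: decay_sqr.
by apply: (measM mg mg).
Qed.

Lemma rho_addv (q v : pt) : rho (q + v) <= 2 * rho q + 2 * rho v.
Proof.
rewrite /rho2 !mulr_sumr -big_split /=; apply: ler_sum => j _; rewrite !mxE.
set a := q 0 _; set b := v 0 _; set c := q 0 _; set d := v 0 _.
by have := sqr_ge0 (a - b); have := sqr_ge0 (c - d); nra.
Qed.

Lemma rhoZ (c : R) (v : pt) : rho (c *: v) = c ^+ 2 * rho v.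
Proof. by rewrite /rho2 mulr_sumr; apply: eq_bigr => j _; rewrite !mxE !exprMn mulrDr. Qed.

Lemma wgt_addv (q v : pt) (s : R) : `|s| <= 1 ->
  wgt (s *: v + q) <= (2 + 2 * rho v) ^+ (n + n) * wgt q.
Proof.
move=> s1; have v0 : 0 < 2 + 2 * rho v by rewrite ltr_wpDr // mulr_ge0 // rho_ge0.
rewrite /wgt -ler_pdivrMl ?exprn_gt0 // -invfM -exprMn lef_pV2 ?posrE ?exprn_gt0 ?mulr_gt0 ?rho1_gt0 //.
apply: lerXn2r; rewrite ?nnegrE ?(ltW (rho1_gt0 _)) ?mulr_ge0 ?(ltW v0) ?(ltW (rho1_gt0 _)) //.
have := rho_addv (s *: v + q) (- s *: v); rewrite scaleNr addrAC addrN add0r -scaleNr rhoZ sqrrN => H.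
have s2 : s ^+ 2 <= 1 by rewrite -[s ^+ 2]ger0_norm ?sqr_ge0 // normrX exprn_ile1.
have r0 := rho_ge0 v; have r1 := rho_ge0 (s *: v + q).
have : s ^+ 2 * rho v <= rho v by rewrite ler_piMl.
move=> H2; have : 0 <= rho v * rho (s *: v + q) by exact: mulr_ge0.
move: H H2; set a := rho (s *: v + q); set b := s ^+ 2 * rho v; nra.
Qed.

Lemma tperiodic_eperiodic (h : R -> \bar R) (g : pt -> R) : tperiodic g -> eperiodic (fun q => h (g q)).
Proof. by move=> pg q; rewrite pg. Qed.

Section Preserve.
Variable phi : bpt -> bpt.
Hypothesis mphi : measurable_fun setT phi.
Hypothesis phiI : forall g : bpt -> \bar R, measurable_fun setT g -> (forall q, 0 <= g q)%E ->
  eperiodic g -> (\int[haar]_q g (phi q) = \int[haar]_q g q)%E.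

Lemma L1_preserve (g : pt -> R) : tperiodic g -> L1 g -> L1 (g \o phi).
Proof.
move=> pg /L1P[mg fin]; apply/L1P; split; first exact: (measurableT_comp mg).
rewrite -[X in (X < _)%E]/(\int[haar]_q (fun q => `|g q|%:E) (phi q))%E phiI //.
- by apply/measurable_EFinP; exact: measurableT_comp.
- exact: (tperiodic_eperiodic (fun x => `|x|%:E)).
Qed.

Lemma int_preserve (g : pt -> R) : tperiodic g -> L1 g ->
  \int[haar]_q (g (phi q)) = \int[haar]_q g q.
Proof.
move=> pg Ig; have Ig' := L1_preserve pg Ig.
have mg : measurable_fun setT (EFin \o g : bpt -> \bar R) by apply/measurable_EFinP; exact: (L1_meas Ig).
congr fine; rewrite integralE [RHS]integralE.
have E1 := phiI (measurable_funepos mg) (fun q => funepos_ge0 _ q).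
have E2 := phiI (measurable_funeneg mg) (fun q => funeneg_ge0 _ q).
rewrite -E1; last by move=> q; rewrite !funeposE /= pg.
rewrite -E2; last by move=> q; rewrite !funenegE /= pg.
by congr (_ - _)%E; apply: eq_integral => q _; rewrite ?funeposE ?funenegE.
Qed.

End Preserve.

Lemma L1_ltr w (g : pt -> R) : tperiodic g -> L1 g -> L1 (g \o ltr w).
Proof. by apply: L1_preserve; [exact: measurable_ltr|move=> h; exact: ge0_haar_ltr]. Qed.

Lemma int_ltr w (g : pt -> R) : tperiodic g -> L1 g ->
  \int[haar]_q (g (ltr w q)) = \int[haar]_q g q.
Proof. by apply: int_preserve; [exact: measurable_ltr|move=> h; exact: ge0_haar_ltr]. Qed.

Lemma ge0_haar_addv (w : pt) (g : bpt -> \bar R) : measurable_fun setT g -> (forall q, 0 <= g q)%E ->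
  eperiodic g -> (\int[haar]_q g ((q : pt) + w)%R = \int[haar]_q g q)%E.
Proof.
move=> mg g0 gP; rewrite !haarE //; first exact: hint_translate.
exact: (measurableT_comp mg (measurable_addr w)).
Qed.

Lemma L1_addv w (g : pt -> R) : tperiodic g -> L1 g -> L1 (fun q => g (q + w)).
Proof.
by apply: (@L1_preserve (fun q => (q : pt) + w)); [exact: measurable_addr|move=> h; exact: ge0_haar_addv].
Qed.

Lemma int_addv w (g : pt -> R) : tperiodic g -> L1 g ->
  \int[haar]_q (g ((q : pt) + w)) = \int[haar]_q g q.
Proof.
by apply: (@int_preserve (fun q => (q : pt) + w)); [exact: measurable_addr|move=> h; exact: ge0_haar_addv].
Qed.

(** Difference quotients integrate to 0 by translation invariance. By the mean value theorem each is
    a value of the derivative at a point within [v] of [q], so the weight dominates them all and the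
    limit passes under the integral. *)
Lemma int_D0 (F dF : pt -> R) (v : pt) : continuous F -> continuous dF -> tperiodic F ->
  (forall q : pt, is_derive q v F (dF q)) -> decay F -> decay dF ->
  \int[haar]_q dF q = 0.
Proof.
move=> cF cdF pF dFE decF decdF.
pose h (i : nat) : R := i.+1%:R^-1.
have h0 i : h i != 0 by rewrite invr_eq0 pnatr_eq0.
pose G i (q : pt) := (h i)^-1 * (F (q + h i *: v) - F q).
have mF := continuous_measurable_bpt cF; have mdF := continuous_measurable_bpt cdF.
have IF := L1_decay mF decF.
have int0 i : \int[haar]_q G i q = 0.
  rewrite intZ; last by apply: L1B => //; exact: L1_addv.
  by rewrite intB ?int_addv ?subrr ?mulr0 //; exact: L1_addv.
have [C C0 HC] := decay_ge0 decdF.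
have mG i : measurable_fun setT (G i : bpt -> R).
  apply: measM; first exact: measurable_cst.
  by apply: measurable_funB => //; exact: (measurableT_comp mF (measurable_addr _)).
have GE i q : exists2 c, `|c| <= `|h i| & G i q = dF (c *: v + q).
  have [c cc E] := @MVT_sym R (fun s : R => F (s *: v + q)) (fun s => dF (s *: v + q)) 0 (h i)
    (fun s => (is_derive_line _ _ _ _ _).1 (dFE _)).
  rewrite !subr0 in cc E; exists c => //.
  by move: E; rewrite scale0r add0r /G [q + _]addrC => ->; rewrite mulrC mulfK.
have Gb i q : `|G i q| <= (C * (2 + 2 * rho v) ^+ (n + n)) * wgt q.
  have [c cc ->] := GE i q; apply: le_trans (HC _) _; rewrite -mulrA ler_wpM2l //.
  apply: wgt_addv; apply: le_trans cc _; rewrite ger0_norm ?invr_ge0 // invf_le1 ?ltr0n //.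
  by rewrite ler1n.
have lim q : G i q @[i --> \oo] --> dF q.
  have H : (fun s : R => s^-1 *: ((F \o shift q) (s *: v) - F q)) @ 0^' --> dF q.
    by have [dv <-] := dFE q.
  have := (cvgr_dnbhsP _ _ _).1 H h (conj h0 (@cvg_harmonic R)).
  rewrite (_ : (fun i => _) = (fun i => G i q)) //; apply/funext => i.
  by rewrite /G /= [q + _]addrC.
have := dct mG mdF lim (L1Z _ L1_wgt) Gb.
rewrite (_ : (fun i => _) = (fun=> 0)); last by apply/funext => i; exact: int0.
by move=> H; apply: esym; apply: (cvg_unique _ _ H) => //; exact: cvg_cst.
Qed.

End HaarTools.

Section Symmetry.
Variables (R : realType) (n : nat).
Notation pt := (pt R n).
Notation bpt := (bpt R n).
Notation haar := (haar R n).
Notation ct := (@ct n).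
Notation rho := (@rho2 R n).
Notation L1 := (@L1 _ bpt R haar).

Definition cs (g : pt -> R) : Prop :=
  [/\ continuous g, tperiodic g & exists r : R, forall q : pt, r < rho q -> g q = 0].

Lemma tperiodicz (g : pt -> R) : tperiodic g ->
  forall (z : int) (q : pt), g (q + (z%:~R * (2 * pi)) *: eb R ct) = g q.
Proof.
move=> pg z q; have H (s : R) : g (q + (s + 2 * pi) *: eb R ct) = g (q + s *: eb R ct).
  by rewrite scalerDl addrA pg.
have := @periodz R (2 * pi) (fun s => (g (q + s *: eb R ct))%:E) _ z 0.
rewrite add0r scale0r addr0 => E; apply: EFin_inj; apply: E => s; by rewrite H.
Qed.

Lemma sqr_le_norm (x r : R) : x ^+ 2 <= r -> `|x| <= r + 1.
Proof.
rewrite -real_normK ?num_real // => h; have := normr_ge0 x.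
by have := sqr_ge0 (`|x| - 1); move: h; set y := `|x|; nra.
Qed.

Lemma coord_le_rho (q : pt) (j : 'I_n) : q 0 (cx j) ^+ 2 <= rho q /\ q 0 (cy j) ^+ 2 <= rho q.
Proof.
rewrite /rho2 (bigD1 j) //=.
have s0 : 0 <= \sum_(i < n | i != j) (q 0 (cx i) ^+ 2 + q 0 (cy i) ^+ 2).
  by apply: sumr_ge0 => i _; rewrite addr_ge0 ?sqr_ge0.
have := sqr_ge0 (q 0 (cx j)); have := sqr_ge0 (q 0 (cy j)).
by split; lra.
Qed.

Lemma index_cases (i : 'I_(n + n).+1) : i = ct \/ exists j : 'I_n, i = cx j \/ i = cy j.
Proof.
have [ilt|ile] := ltnP i n.
  by right; exists (Ordinal ilt); left; apply: val_inj; rewrite /= cx_val.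
have [il|e] := ltnP i (n + n).
  have lt : (i - n < n)%N by rewrite ltn_subLR.
  by right; exists (Ordinal lt); right; apply: val_inj; rewrite /= cy_val /= subnKC.
left; apply: val_inj; rewrite /= ct_val; apply/eqP; rewrite eqn_leq e andbT -ltnS.
exact: ltn_ord.
Qed.

Lemma cs_bound (g : pt -> R) (r : R) : continuous g -> tperiodic g ->
  exists2 C : R, 0 <= C & forall q : pt, rho q <= r -> `|g q| <= C.
Proof.
move=> cg pg; pose B : R := `|r| + 1 + 2 * pi.
have pi0 : 0 < 2 * pi :> R by rewrite mulr_gt0 ?pi_gt0.
have B0 : 0 <= B by rewrite addr_ge0 ?addr_ge0 // ltW.
pose K := [set q : 'rV[R]_(n + n).+1 | forall i, `[- B, B]%classic (q ord0 i)].
have cK : compact K by apply: (@rV_compact R _ (fun=> `[- B, B]%classic)) => i; exact: segment_compact.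
have K0 : K !=set0 by exists 0 => i; rewrite mxE /= in_itv /= oppr_le0 B0.
have cgK : {within K, continuous (fun q : 'rV[R]_(n + n).+1 => `|g q|)}.
  apply: continuous_subspaceT => q; apply: continuous_comp; first exact: cg.
  exact: norm_continuous.
have [c _ Hc] := EVT_max_rV K0 cK cgK.
exists `|g c| => // q qr.
(* Support is bounded in z only; subtracting whole periods brings t into one period, hence the point
   into a compact box. *)
pose z := Num.floor (q 0 ct / (2 * pi)).
rewrite -(tperiodicz pg (- z)).
apply: Hc; rewrite inE => i /=; rewrite in_itv /= -ler_norml mxE.
have rr : rho q <= `|r| by apply: le_trans qr (ler_norm _).
case: (index_cases i) => [->|[j []->]].
- rewrite !mxE !eqxx /= mulr1 intrN mulNr.
  have := Num.Theory.floor_itv (q 0 ct / (2 * pi)); rewrite -/z => /andP[].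
  rewrite ler_pdivlMr // ltr_pdivrMr // intrD mulrDl mul1r => h1 h2.
  have rn := normr_ge0 r.
  by rewrite ger0_norm ?subr_ge0 // /B; lra.
- rewrite !mxE !eqxx cE /= mulr0 addr0; apply: (@le_trans _ _ (`|r| + 1)); last by rewrite /B lerDl ltW.
  by apply: sqr_le_norm; apply: le_trans rr; have [] := coord_le_rho q j.
- rewrite !mxE !eqxx cE /= mulr0 addr0; apply: (@le_trans _ _ (`|r| + 1)); last by rewrite /B lerDl ltW.
  by apply: sqr_le_norm; apply: le_trans rr; have [] := coord_le_rho q j.
Qed.

Lemma cs_decay (g : pt -> R) : cs g -> decay g.
Proof.
move=> [cg pg [r Hr]]; have [C C0 HC] := cs_bound r cg pg.
exists (C * (1 + `|r|) ^+ (n + n)) => q.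
have [rq|qr] := ltP r (rho q).
  rewrite Hr // normr0 mulr_ge0 ?(ltW (wgt_gt0 _)) // mulr_ge0 // exprn_ge0 // addr_ge0 //.
apply: le_trans (HC _ qr) _; rewrite -mulrA ler_peMr // /wgt -expr_div_n exprn_ege1 //.
rewrite ler_pdivlMr ?rho1_gt0 // mul1r lerD2l; apply: le_trans qr (ler_norm _).
Qed.

Lemma cs_meas (g : pt -> R) : cs g -> measurable_fun setT (g : bpt -> R).
Proof. by case=> cg _ _; exact: continuous_measurable_bpt. Qed.

Lemma cs_L1 (g : pt -> R) : cs g -> L1 g.
Proof. by move=> sg; apply: L1_decay; [exact: cs_meas|exact: cs_decay]. Qed.

Lemma tperiodicM (f g : pt -> R) : tperiodic f -> tperiodic g -> tperiodic (f \* g).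
Proof. by move=> pf pg q /=; rewrite pf pg. Qed.

Lemma tperiodicD (f g : pt -> R) : tperiodic f -> tperiodic g -> tperiodic (f \+ g).
Proof. by move=> pf pg q /=; rewrite pf pg. Qed.

Lemma csM (f g : pt -> R) : cs f -> continuous g -> tperiodic g -> cs (f \* g).
Proof.
move=> [cf pf [r Hr]] cg pg; split; last by exists r => q /Hr /= ->; rewrite mul0r.
  by move=> q; exact: (cvgM (cf q) (cg q)).
exact: tperiodicM.
Qed.

Lemma csMl (f g : pt -> R) : continuous f -> tperiodic f -> cs g -> cs (f \* g).
Proof.
move=> cf pf sg; have := csM sg cf pf; rewrite (_ : g \* f = f \* g) //.
by apply/funext => q /=; rewrite mulrC.
Qed.

Lemma csD (f g : pt -> R) : cs f -> cs g -> cs (f \+ g).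
Proof.
move=> [cf pf [r Hr]] [cg pg [s Hs]]; split.
- by move=> q; exact: (cvgD (cf q) (cg q)).
- exact: tperiodicD.
exists (Num.max r s) => q; rewrite gt_max => /andP[/Hr h1 /Hs h2] /=.
by rewrite h1 h2 addr0.
Qed.

Lemma tperiodic_D (g : pt -> R) (v : pt) : tperiodic g -> tperiodic ('D_v g).
Proof.
move=> pg q; rewrite /derive.
rewrite (_ : (fun h : R => h^-1 *: ((g \o shift (q + (2 * pi) *: eb R ct)) (h *: v) - g (q + (2 * pi) *: eb R ct)))
  = (fun h : R => h^-1 *: ((g \o shift q) (h *: v) - g q))) //.
by apply/funext => h /=; rewrite addrA !pg.
Qed.

Lemma tperiodic_cx (j : 'I_n) : tperiodic (fun q : pt => q 0 (cx j)).
Proof. by move=> q; rewrite !mxE !eqxx cE /= mulr0 addr0. Qed.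
Lemma tperiodic_cy (j : 'I_n) : tperiodic (fun q : pt => q 0 (cy j)).
Proof. by move=> q; rewrite !mxE !eqxx cE /= mulr0 addr0. Qed.

Lemma tperiodic_rho : tperiodic rho.
Proof. by move=> q; apply: eq_bigr => j _; rewrite (tperiodic_cx j) (tperiodic_cy j). Qed.

Lemma cs_D (g : pt -> R) (v : pt) : smoothN 1 g -> cs g -> cs ('D_v g).
Proof.
move=> [_ dg] [cg pg [r Hr]]; split; first by have [_ c0] := dg v.
  exact: tperiodic_D.
exists r => q rq.
transitivity ('D_v (cst (0 : R)) q); last exact: derive_cst.
apply: near_eq_derive; near=> s; rewrite Hr //; near: s.
have C : continuous (rho : pt -> R) by apply: (@smooth_cont R n); exact: smooth_rho.
exact: (cvgr_gt _ (C q)).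
Unshelve. all: by end_near. Qed.

Lemma smoothN_add k (f g : pt -> R) : smoothN k f -> smoothN k g -> smoothN k (f \+ g).
Proof. exact: smoothN_D. Qed.

Lemma smoothN_Dv k (f : pt -> R) (v : pt) : smoothN k.+1 f -> smoothN k ('D_v f).
Proof. by move=> [_ /(_ v) []]. Qed.

Lemma XopE j (f : pt -> R) : Xop j f =
  'D_(eb R (cx j)) f \+ (((fun=> -1) : pt -> R) \* ((fun q : pt => q 0 (cy j)) \* 'D_(eb R ct) f)).
Proof. by apply/funext => q; rewrite /Xop /= mulN1r. Qed.

Lemma YopE j (f : pt -> R) : Yop j f =
  'D_(eb R (cy j)) f \+ ((fun q : pt => q 0 (cx j)) \* 'D_(eb R ct) f).
Proof. by []. Qed.

Lemma smoothN_Xop k j (f : pt -> R) : smoothN k.+1 f -> smoothN k (Xop j f).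
Proof.
move=> sf; rewrite XopE; apply: smoothN_D; first exact: smoothN_Dv.
apply: smoothN_M; first exact: smoothN_cst.
by apply: smoothN_M; [exact: smoothN_coord|exact: smoothN_Dv].
Qed.

Lemma smoothN_Yop k j (f : pt -> R) : smoothN k.+1 f -> smoothN k (Yop j f).
Proof.
move=> sf; rewrite YopE; apply: smoothN_D; first exact: smoothN_Dv.
by apply: smoothN_M; [exact: smoothN_coord|exact: smoothN_Dv].
Qed.

Lemma tperiodic_cst (c : R) : tperiodic ((fun=> c) : pt -> R).
Proof. by []. Qed.

Lemma tperiodic_Xop j (f : pt -> R) : tperiodic f -> tperiodic (Xop j f).
Proof.
move=> pf; rewrite XopE; apply: tperiodicD; first exact: tperiodic_D.
apply: tperiodicM; first exact: tperiodic_cst.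
by apply: tperiodicM; [exact: tperiodic_cy|exact: tperiodic_D].
Qed.

Lemma tperiodic_Yop j (f : pt -> R) : tperiodic f -> tperiodic (Yop j f).
Proof.
move=> pf; rewrite YopE; apply: tperiodicD; first exact: tperiodic_D.
by apply: tperiodicM; [exact: tperiodic_cx|exact: tperiodic_D].
Qed.

Lemma coord_cont i : continuous (fun q : pt => q 0 i).
Proof. exact: smooth_cont (smooth_coord i). Qed.

Lemma int_cD0 (i : 'I_(n + n).+1) (v : pt) (G : pt -> R) : v 0 i = 0 ->
  tperiodic (fun q : pt => q 0 i) ->  smoothN 1 G -> cs G ->
  L1 (fun q : pt => q 0 i * 'D_v G q) /\ \int[haar]_q ((q : pt) 0 i * 'D_v G q) = 0.
Proof.
move=> vi pi_ sG csG; have csd := csMl (@coord_cont i) pi_ (cs_D v sG csG).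
have csi := csMl (@coord_cont i) pi_ csG.
split; first exact: (cs_L1 csd).
have [c1 p1 _] := csi; have [c2 _ _] := csd.
apply: (int_D0 c1 c2 p1 _ (cs_decay csi) (cs_decay csd)) => q.
have dG : derivable G q v by case: sG => _ /(_ v) [].
have H := is_deriveM (is_derive_coord q v i) (derivableP dG).
apply: (is_derive_eq H); rewrite vi scaler0 addr0; reflexivity.
Qed.

Lemma int_D0_cs (v : pt) (G : pt -> R) : smoothN 1 G -> cs G ->
  L1 ('D_v G) /\ \int[haar]_q ('D_v G q) = 0.
Proof.
move=> sG csG; have csd := cs_D v sG csG; split; first exact: (cs_L1 csd).
have [c1 p1 _] := csG; have [c2 _ _] := csd.
apply: (int_D0 c1 c2 p1 _ (cs_decay csG) (cs_decay csd)) => q.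
by apply: derivableP; case: sG => _ /(_ v) [].
Qed.

Lemma int_Xop0 j (G : pt -> R) : smoothN 1 G -> cs G ->
  L1 (Xop j G) /\ \int[haar]_q (Xop j G q) = 0.
Proof.
move=> sG csG; have [I1 E1] := int_D0_cs (eb R (cx j)) sG csG.
have [I2 E2] : L1 (fun q : pt => q 0 (cy j) * 'D_(eb R ct) G q) /\
    \int[haar]_q ((q : pt) 0 (cy j) * 'D_(eb R ct) G q) = 0.
  by apply: int_cD0 => //; [rewrite !mxE !cE andbF|exact: tperiodic_cy].
by split; [exact: L1B|rewrite intB // E1 E2 subrr].
Qed.

Lemma int_Yop0 j (G : pt -> R) : smoothN 1 G -> cs G ->
  L1 (Yop j G) /\ \int[haar]_q (Yop j G q) = 0.
Proof.
move=> sG csG; have [I1 E1] := int_D0_cs (eb R (cy j)) sG csG.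
have [I2 E2] : L1 (fun q : pt => q 0 (cx j) * 'D_(eb R ct) G q) /\
    \int[haar]_q ((q : pt) 0 (cx j) * 'D_(eb R ct) G q) = 0.
  by apply: int_cD0 => //; [rewrite !mxE !cE andbF|exact: tperiodic_cx].
by split; [exact: L1D|rewrite intD // E1 E2 addr0].
Qed.

Lemma derM (f g : pt -> R) (q v : pt) : smoothN 1 f -> smoothN 1 g ->
  'D_v (f \* g) q = 'D_v f q * g q + f q * 'D_v g q.
Proof.
move=> [_ /(_ v) [df _]] [_ /(_ v) [dg _]].
have H := is_deriveM (derivableP (df q)) (derivableP (dg q)).
transitivity (f q *: 'D_v g q + g q *: 'D_v f q); first exact: (@derive_val _ _ _ _ _ _ _ H).
by rewrite addrC; congr (_ + _); rewrite -[LHS]/(g q * _) mulrC.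
Qed.

Lemma derD (f g : pt -> R) (q v : pt) : smoothN 1 f -> smoothN 1 g ->
  'D_v (f \+ g) q = 'D_v f q + 'D_v g q.
Proof.
move=> [_ /(_ v) [df _]] [_ /(_ v) [dg _]].
exact: (@derive_val _ _ _ _ _ _ _ (is_deriveD (derivableP (df q)) (derivableP (dg q)))).
Qed.

Lemma XopM j (f g : pt -> R) (q : pt) : smoothN 1 f -> smoothN 1 g ->
  Xop j (f \* g) q = Xop j f q * g q + f q * Xop j g q.
Proof.
move=> sf sg; rewrite /Xop !derM //.
have E (a b c d u v y : R) : a * v + u * b - y * (c * v + u * d) = (a - y * c) * v + u * (b - y * d) by ring.
exact: E.
Qed.

Lemma YopM j (f g : pt -> R) (q : pt) : smoothN 1 f -> smoothN 1 g ->
  Yop j (f \* g) q = Yop j f q * g q + f q * Yop j g q.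
Proof.
move=> sf sg; rewrite /Yop !derM //.
have E (a b c d u v y : R) : a * v + u * b + y * (c * v + u * d) = (a + y * c) * v + u * (b + y * d) by ring.
exact: E.
Qed.

Lemma XopD j (f g : pt -> R) (q : pt) : smoothN 1 f -> smoothN 1 g ->
  Xop j (f \+ g) q = Xop j f q + Xop j g q.
Proof.
move=> sf sg; rewrite /Xop !derD //.
have E (a b c d y : R) : a + b - y * (c + d) = a - y * c + (b - y * d) by ring.
exact: E.
Qed.

Lemma YopD j (f g : pt -> R) (q : pt) : smoothN 1 f -> smoothN 1 g ->
  Yop j (f \+ g) q = Yop j f q + Yop j g q.
Proof.
move=> sf sg; rewrite /Yop !derD //.
have E (a b c d y : R) : a + b + y * (c + d) = a + y * c + (b + y * d) by ring.
exact: E.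
Qed.

Section Green.
Variable Z : (pt -> R) -> pt -> R.
Hypothesis ZS : forall k f, smoothN k.+1 f -> smoothN k (Z f).
Hypothesis Zp : forall f, tperiodic f -> tperiodic (Z f).
Hypothesis Zcs : forall f, smoothN 1 f -> cs f -> cs (Z f).
Hypothesis ZM : forall (f g : pt -> R) (q : pt), smoothN 1 f -> smoothN 1 g ->
  Z (f \* g) q = Z f q * g q + f q * Z g q.
Hypothesis Z0 : forall G, smoothN 1 G -> cs G -> \int[haar]_q (Z G q) = 0.

(** [Z] stands for $X_j$ or $Y_j$. The boundary term is $\int Z(fg)$, and the compact support of [g]
    alone kills it, so [f] may be an eigenfunction without decay. *)
Lemma green1 (f g : pt -> R) : smoothN 1 f -> tperiodic f -> smoothN 1 g -> cs g ->
  \int[haar]_q (Z f q * g q) = - \int[haar]_q (f q * Z g q).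
Proof.
move=> sf pf sg csg; have cf := smoothN_cont sf.
have cs1 : cs (Z f \* g) by apply: csMl => //; [exact: (smoothN_cont (ZS sf))|exact: Zp].
have cs2 : cs (f \* Z g) by apply: csMl => //; exact: Zcs.
apply/eqP; rewrite -addr_eq0 -(intD (cs_L1 cs1) (cs_L1 cs2)).
rewrite -[X in _ == X](@Z0 (f \* g)); [|exact: smoothN_M|exact: csMl].
by apply/eqP; congr Rintegral; apply/funext => q; rewrite ZM.
Qed.

Lemma green2 (f g : pt -> R) : smoothN 2 f -> tperiodic f -> smoothN 2 g -> cs g ->
  \int[haar]_q (Z (Z f) q * g q) = \int[haar]_q (f q * Z (Z g) q).
Proof.
move=> sf pf sg csg; have sg1 := smoothNS sg; have sf1 := smoothNS sf.
rewrite (green1 (ZS sf) (Zp pf) sg1 csg) (green1 sf1 pf (ZS sg) (Zcs sg1 csg)).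
by rewrite opprK.
Qed.
End Green.

Lemma cs_Xop j (f : pt -> R) : smoothN 1 f -> cs f -> cs (Xop j f).
Proof.
move=> sf csf; rewrite XopE; apply: csD; first exact: cs_D.
apply: csMl; [exact: cst_continuous|exact: tperiodic_cst|].
by apply: csMl; [exact: coord_cont|exact: tperiodic_cy|exact: cs_D].
Qed.

Lemma cs_Yop j (f : pt -> R) : smoothN 1 f -> cs f -> cs (Yop j f).
Proof.
move=> sf csf; rewrite YopE; apply: csD; first exact: cs_D.
by apply: csMl; [exact: coord_cont|exact: tperiodic_cx|exact: cs_D].
Qed.

Lemma subLap_sym (f g : pt -> R) : smoothN 2 f -> tperiodic f -> smoothN 2 g -> cs g ->
  \int[haar]_q (subLap f q * g q) = \int[haar]_q (f q * subLap g q).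
Proof.
move=> sf pf sg csg.
have EX j : \int[haar]_q (Xop j (Xop j f) q * g q) = \int[haar]_q (f q * Xop j (Xop j g) q).
  apply: (@green2 (Xop j)) => //; [by move=> k h; exact: smoothN_Xop|by move=> h; exact: tperiodic_Xop|
   by move=> h; exact: cs_Xop|by move=> h1 h2 q; exact: XopM|by move=> G sG cG; have [] := int_Xop0 j sG cG].
have EY j : \int[haar]_q (Yop j (Yop j f) q * g q) = \int[haar]_q (f q * Yop j (Yop j g) q).
  apply: (@green2 (Yop j)) => //; [by move=> k h; exact: smoothN_Yop|by move=> h; exact: tperiodic_Yop|
   by move=> h; exact: cs_Yop|by move=> h1 h2 q; exact: YopM|by move=> G sG cG; have [] := int_Yop0 j sG cG].
have sg1 := smoothNS sg; have cf := smoothN_cont sf.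
have IX1 j : L1 (fun q => Xop j (Xop j f) q * g q).
  have p1 := tperiodic_Xop j (tperiodic_Xop j pf).
  have s0 : continuous (Xop j (Xop j f)) := smoothN_Xop j (smoothN_Xop j sf).
  exact: (cs_L1 (csMl s0 p1 csg)).
have IY1 j : L1 (fun q => Yop j (Yop j f) q * g q).
  have p1 := tperiodic_Yop j (tperiodic_Yop j pf).
  have s0 : continuous (Yop j (Yop j f)) := smoothN_Yop j (smoothN_Yop j sf).
  exact: (cs_L1 (csMl s0 p1 csg)).
have IX2 j : L1 (fun q => f q * Xop j (Xop j g) q).
  exact: (cs_L1 (csMl cf pf (cs_Xop j (smoothN_Xop j sg) (cs_Xop j sg1 csg)))).
have IY2 j : L1 (fun q => f q * Yop j (Yop j g) q).
  exact: (cs_L1 (csMl cf pf (cs_Yop j (smoothN_Yop j sg) (cs_Yop j sg1 csg)))).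
transitivity (\int[haar]_q (-1 * \sum_(j < n) (Xop j (Xop j f) q * g q + Yop j (Yop j f) q * g q))).
  congr Rintegral; apply/funext => q; rewrite /subLap mulN1r mulNr mulr_suml.
  by congr (- _); apply: eq_bigr => j _; rewrite mulrDl.
transitivity (\int[haar]_q (-1 * \sum_(j < n) (f q * Xop j (Xop j g) q + f q * Yop j (Yop j g) q))); last first.
  congr Rintegral; apply/funext => q; rewrite /subLap mulN1r mulrN mulr_sumr.
  exact: (congr1 -%R (eq_bigr _ (fun j _ => esym (mulrDr (f q) _ _)))).
rewrite !intZ; try by apply: L1_sum => j _; exact: L1D.
rewrite !int_sum; try by move=> j _; exact: L1D.
by congr (_ * _); apply: eq_bigr => j _; rewrite !intD // EX EY.
Qed.

End Symmetry.

(** * Radial test functions and moments of eigenfunctions *)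

Section Deriv1.
Variable R : realType.
Implicit Types f g : R -> R.

Definition der f (x a : R) := is_derive x (1 : R) f a.

Lemma derP_M f g x a b : der f x a -> der g x b -> der (fun y => f y * g y) x (f x * b + g x * a).
Proof. by move=> df dg; exact: (is_deriveM df dg). Qed.

Lemma derP_D f g x a b : der f x a -> der g x b -> der (fun y => f y + g y) x (a + b).
Proof. by move=> df dg; exact: (is_deriveD df dg). Qed.

Lemma derP_Z (c : R) f x a : der f x a -> der (fun y => c * f y) x (c * a).
Proof.
move=> df; have := derP_M (is_derive_cst c x 1) df.
by rewrite mulr0 addr0.
Qed.

Lemma derP_cst (c : R) x : der (fun=> c) x 0.
Proof. exact: is_derive_cst. Qed.

Lemma derP_id x : der (fun y => y) x 1.
Proof. exact: is_derive_id. Qed.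

Lemma derP_aff (c d : R) x : der (fun y => c * y + d) x c.
Proof. by apply: is_derive_eq (derP_D (derP_Z c (derP_id x)) (derP_cst d x)) _; rewrite mulr1 addr0. Qed.

Lemma derP_comp f g x a b : der f (g x) a -> der g x b -> der (fun y => f (g y)) x (a * b).
Proof. by move=> df dg; exact: (is_derive_compR df dg). Qed.

Lemma derP_cont f : (forall x, exists a, der f x a) -> continuous f.
Proof.
move=> H x; have [a d] := H x; apply/differentiable_continuous/derivable1_diffP.
exact: (@ex_derive _ _ _ _ _ _ _ d).
Qed.

Lemma derP_eq f x a b : der f x a -> a = b -> der f x b.
Proof. by move=> H <-. Qed.

Lemma derP_ext f g x a : f =1 g -> der f x a -> der g x a.
Proof. by move=> /funext ->. Qed.

Lemma derP_quad f x a (C : R) : (forall h, `|f (x + h) - f x - a * h| <= C * h ^+ 2) -> der f x a.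
Proof.
move=> H; suff L : (fun h : R => h^-1 *: ((f \o shift x) (h *: (1 : R)) - f x)) @ 0^' --> a.
  by split; [apply/cvg_ex; exists a|apply/cvg_lim].
apply/cvgrPdist_le => e e0; near=> h.
have h0 : h != 0 by near: h; exact: nbhs_dnbhs_neq.
rewrite /= distrC -[h *: 1]/(h * 1) mulr1 [h + x]addrC -[h^-1 *: _]/(h^-1 * _).
have -> : h^-1 * (f (x + h) - f x) - a = h^-1 * (f (x + h) - f x - a * h).
  by rewrite [in RHS]mulrBr [X in _ = _ - X]mulrCA mulVf // mulr1.
rewrite normrM normfV ler_pdivrMl ?normr_gt0 //; apply: le_trans (H h) _.
rewrite -real_normK ?num_real // expr2 mulrA [_ * `|h|]mulrC ler_wpM2l //.
apply: (@le_trans _ _ ((`|C| + 1) * `|h|)).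
  by rewrite ler_wpM2r // (le_trans (ler_norm C)) // lerDl.
have C1 : 0 < `|C| + 1 by rewrite ltr_wpDl.
rewrite -ler_pdivlMl // mulrC; apply: ltW; near: h; apply: dnbhs0_lt; exact: divr_gt0.
Unshelve. all: by end_near. Qed.

Lemma derP_sqabs (u : R) : der (fun u => u * `|u|) u (2 * `|u|).
Proof.
apply: (@derP_quad _ _ _ 1) => h; rewrite mul1r ler_norml.
by case: (lerP 0 u) => hu; case: (lerP 0 (u + h)) => huh;
  rewrite ?(ger0_norm hu) ?(ltr0_norm hu) ?(ger0_norm huh) ?(ltr0_norm huh); apply/andP; split; nra.
Qed.

(** This is $\max(u,0)^3$, followed by its derivatives $3\max(u,0)^2$ and $6\max(u,0)$. The cube
    makes it of class $C^2$, the regularity a second-order operator asks for. *)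
Definition pos0 (u : R) := (u ^+ 3 + u * (u * `|u|)) / 2.
Definition pos1 (u : R) := 3 * (u ^+ 2 + u * `|u|) / 2.
Definition pos2 (u : R) := 3 * (u + `|u|).

Lemma der_pos0 u : der pos0 u (pos1 u).
Proof.
have d1 := derP_M (derP_id u) (derP_sqabs u).
have d2 := derP_M (derP_id u) (derP_M (derP_id u) (derP_id u)).
have d3 := derP_Z 2^-1 (derP_D d2 d1).
apply: (derP_eq (derP_ext _ d3)) => [x|]; first by rewrite /pos0; ring.
by rewrite /pos1; field.
Qed.

Lemma der_pos1 u : der pos1 u (pos2 u).
Proof.
have d1 := derP_sqabs u.
have d2 := derP_M (derP_id u) (derP_id u).
have d3 := derP_Z (3 / 2) (derP_D d2 d1).
apply: (derP_eq (derP_ext _ d3)) => [x|]; first by rewrite /pos1; ring.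
by rewrite /pos2; field.
Qed.

Lemma cont_pos2 : continuous pos2.
Proof.
move=> u; apply: cvgM; first exact: cvg_cst.
by apply: cvgD; [exact: cvg_id|exact: norm_continuous].
Qed.

Lemma pos_neg u : u <= 0 -> [/\ pos0 u = 0, pos1 u = 0 & pos2 u = 0].
Proof.
by move=> u0; rewrite /pos0 /pos1 /pos2 ler0_norm //; split; field.
Qed.

Lemma pos_bd u : u <= 1 -> [/\ `|pos0 u| <= 1, `|pos1 u| <= 3 & `|pos2 u| <= 6].
Proof.
move=> u1; have [u0|u0] := leP u 0.
  by have [-> -> ->] := pos_neg u0; rewrite normr0.
have E0 : pos0 u = u ^+ 3 by rewrite /pos0 gtr0_norm //; field.
have E1 : pos1 u = 3 * u ^+ 2 by rewrite /pos1 gtr0_norm //; field.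
have E2 : pos2 u = 6 * u by rewrite /pos2 gtr0_norm //; ring.
have h2 : u ^+ 2 <= 1 by rewrite exprn_ile1 // ltW.
have h3 : u ^+ 3 <= 1 by rewrite exprn_ile1 // ltW.
rewrite E0 E1 E2 !ger0_norm ?exprn_ge0 ?mulr_ge0 ?exprn_ge0 ?(ltW u0) //.
by split => //; lra.
Qed.

(** [F] multiplied by $\max(1-x/(N+1),0)^3$, with its first two derivatives by the Leibniz rule from
    [F], [F1], [F2]. *)
Definition cutf (N : nat) (F : R -> R) (F1 F2 : R -> R) : (R -> R) * (R -> R) * (R -> R) :=
  let w := N.+1%:R^-1 in let u x := 1 - w * x in
  (fun x => F x * pos0 (u x),
   fun x => F1 x * pos0 (u x) - w * (F x * pos1 (u x)),
   fun x => F2 x * pos0 (u x) - 2 * w * (F1 x * pos1 (u x)) + w ^+ 2 * (F x * pos2 (u x))).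

Lemma der_cutu N f g (x : R) : (forall u, der f u (g u)) ->
  der (fun x => f (1 - N.+1%:R^-1 * x)) x (- N.+1%:R^-1 * g (1 - N.+1%:R^-1 * x)).
Proof.
move=> H; have d := derP_aff (- N.+1%:R^-1) 1 x.
have E y : - N.+1%:R^-1 * y + 1 = 1 - N.+1%:R^-1 * y by rewrite mulNr addrC.
have d2 := derP_comp (H _) d; rewrite mulrC E in d2.
by apply: (derP_ext _ d2) => y; rewrite E.
Qed.

Lemma der_cut N (F F1 F2 : R -> R) : (forall x, der F x (F1 x)) -> (forall x, der F1 x (F2 x)) ->
  (forall x, der (cutf N F F1 F2).1.1 x ((cutf N F F1 F2).1.2 x)) /\
  (forall x, der (cutf N F F1 F2).1.2 x ((cutf N F F1 F2).2 x)).
Proof.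
move=> d0 d1; split => x /=.
  apply: (derP_eq (derP_M (d0 x) (der_cutu N x der_pos0))); ring.
have e1 := derP_M (d1 x) (der_cutu N x der_pos0).
have e2 := derP_Z (- N.+1%:R^-1) (derP_M (d0 x) (der_cutu N x der_pos1)).
apply: (derP_eq (derP_ext _ (derP_D e1 e2))) => [y|]; ring.
Qed.

Lemma cont_cut N (F F1 F2 : R -> R) : (forall x, der F x (F1 x)) -> (forall x, der F1 x (F2 x)) ->
  continuous F2 -> continuous (cutf N F F1 F2).2.
Proof.
move=> d0 d1 cF2 x /=.
have cF : continuous F by apply: derP_cont => y; exists (F1 y).
have cF1 : continuous F1 by apply: derP_cont => y; exists (F2 y).
have c0 : continuous (fun x : R => pos0 (1 - N.+1%:R^-1 * x)).
  by apply: derP_cont => y; eexists; exact: (der_cutu N y der_pos0).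
have c1 : continuous (fun x : R => pos1 (1 - N.+1%:R^-1 * x)).
  by apply: derP_cont => y; eexists; exact: (der_cutu N y der_pos1).
have c2 : continuous (fun x : R => pos2 (1 - N.+1%:R^-1 * x)).
  move=> y; apply: (@continuous_comp _ _ _ (fun x : R => 1 - N.+1%:R^-1 * x) pos2); last exact: cont_pos2.
  by apply: cvgB; [exact: cvg_cst|apply: cvgM; [exact: cvg_cst|exact: cvg_id]].
exact: (cvgD (cvgB (cvgM (cF2 x) (c0 x)) (cvgM (cvg_cst _) (cvgM (cF1 x) (c1 x))))
  (cvgM (cvg_cst _) (cvgM (cF x) (c2 x)))).
Qed.

Lemma cut_zero N (F F1 F2 : R -> R) x : N.+1%:R < x -> (cutf N F F1 F2).1.1 x = 0.
Proof.
move=> h; have u0 : 1 - N.+1%:R^-1 * x <= 0.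
  by rewrite subr_le0 mulrC ler_pdivlMr // mul1r ltW.
by have [E _ _] := pos_neg u0; rewrite /= E mulr0.
Qed.

Lemma cut_bd N (F F1 F2 : R -> R) x : 0 <= x ->
  [/\ `|(cutf N F F1 F2).1.1 x| <= `|F x|, `|(cutf N F F1 F2).1.2 x| <= 3 * (`|F x| + `|F1 x|)
    & `|(cutf N F F1 F2).2 x| <= 6 * (`|F x| + `|F1 x| + `|F2 x|)].
Proof.
move=> x0; rewrite /=; set w := N.+1%:R^-1.
have w0 : 0 <= w by rewrite invr_ge0.
have w1 : w <= 1 by rewrite invf_le1 ?ltr0n // ler1n.
have [] := @pos_bd (1 - w * x) _; first by rewrite gerBl mulr_ge0.
set a := pos0 _; set b := pos1 _; set c := pos2 _ => ha hb hc.
have K (u v B : R) : `|v| <= B -> `|u * v| <= B * `|u|.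
  by move=> h; rewrite normrM mulrC ler_wpM2r.
have K0 := K (F x) a 1 ha; have K1 := K (F1 x) a 1 ha; have K2 := K (F2 x) a 1 ha.
have L0 := K (F x) b 3 hb; have L1' := K (F1 x) b 3 hb; have M0 := K (F x) c 6 hc.
have W (u B : R) : `|u| <= B -> `|w * u| <= B.
  by move=> h; rewrite normrM ger0_norm // (le_trans _ h) // ler_piMl.
have nF := normr_ge0 (F x); have nF1 := normr_ge0 (F1 x); have nF2 := normr_ge0 (F2 x).
have ww : `|w * (F x * b)| <= 3 * `|F x| by exact: W.
have wv : `|2 * w * (F1 x * b)| <= 6 * `|F1 x|.
  rewrite -mulrA normrM ger0_norm //.
  have := W _ _ L1'; set z := `|w * _|; lra.
have wc : `|w ^+ 2 * (F x * c)| <= 6 * `|F x| by rewrite expr2 -mulrA; do 2 apply: (W _ (6 * `|F x|)).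
split; first by rewrite mul1r in K0.
- by apply: le_trans (ler_normB _ _) _; lra.
- by apply: le_trans (ler_normD _ _) _; have := ler_normB (F2 x * a) (2 * w * (F1 x * b)); lra.
Qed.

Lemma cut_lim (F F1 F2 : R -> R) x :
  [/\ (cutf N F F1 F2).1.1 x @[N --> \oo] --> F x, (cutf N F F1 F2).1.2 x @[N --> \oo] --> F1 x
    & (cutf N F F1 F2).2 x @[N --> \oo] --> F2 x].
Proof.
have hw : (fun N : nat => N.+1%:R^-1 : R) @ \oo --> (0 : R) by exact: cvg_harmonic.
have hu : (fun N : nat => 1 - N.+1%:R^-1 * x) @ \oo --> (1 : R).
  rewrite -[X in _ --> X]subr0 -[X in _ --> _ - X](mul0r x).
  exact: (cvgB (cvg_cst _) (cvgM hw (cvg_cst x))).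
have c0 : continuous pos0 by apply: derP_cont => u; exists (pos1 u); exact: der_pos0.
have c1 : continuous pos1 by apply: derP_cont => u; exists (pos2 u); exact: der_pos1.
have h0 := cvg_comp _ _ hu (c0 1).
have h1 := cvg_comp _ _ hu (c1 1).
have c2 : continuous pos2 by exact: cont_pos2.
have h2 := cvg_comp _ _ hu (c2 1).
have E0 : pos0 1 = 1 by rewrite /pos0 normr1; field.
rewrite E0 in h0.
split.
- rewrite -[X in _ --> X]mulr1; exact: (cvgM (cvg_cst _) h0).
- rewrite (_ : F1 x = F1 x * 1 - 0 * (F x * pos1 1)); last by ring.
  exact: (cvgB (cvgM (cvg_cst _) h0) (cvgM hw (cvgM (cvg_cst _) h1))).
- rewrite (_ : F2 x = F2 x * 1 - 2 * 0 * (F1 x * pos1 1) + 0 ^+ 2 * (F x * pos2 1)); last by ring.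
  exact: (cvgD (cvgB (cvgM (cvg_cst _) h0) (cvgM (cvgM (cvg_cst _) hw) (cvgM (cvg_cst _) h1)))
    (cvgM (cvgM hw hw) (cvgM (cvg_cst _) h2))).
Qed.

End Deriv1.

Section Rad.
Variables (R : realType) (n : nat).
Notation pt := (pt R n).
Notation ct := (@ct n).
Notation rho := (@rho2 R n).

(** A chain of finite length, for the cut-off functions, which have only two continuous
    derivatives. *)
Lemma smoothN_chain_upto k (f : pt -> R) (F : nat -> R -> R) : smoothN k f ->
  (forall i (x : R), (i < k)%N -> der (F i) x (F i.+1 x)) ->
  (forall i, (i <= k)%N -> continuous (F i)) -> smoothN k (F 0%N \o f).
Proof.
elim: k F => [|k IH] F sf dF cF.
  by move=> q; apply: continuous_comp; [exact: sf|exact: cF].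
have sf' := smoothNS sf; case: sf => cf df; split.
  by move=> q; apply: continuous_comp; [exact: cf|exact: cF].
move=> v; have [dv sv] := df v.
have H q : is_derive q v (F 0%N \o f) (F 1%N (f q) * 'D_v f q).
  by have dq := derivableP (dv q); exact: (is_derive_compR (dF _ _ _) dq).
split; first by move=> q; have [] := H q.
have -> : 'D_v (F 0%N \o f) = (F 1%N \o f) \* 'D_v f.
  by apply/funext => q; exact: (@derive_val _ _ _ _ _ _ _ (H q)).
apply: smoothN_M => //; apply: (IH (fun i => F i.+1)) => //.
- by move=> i x ik; exact: dF.
- by move=> i ik; exact: cF.
Qed.

Lemma is_derive_rho (q v : pt) : is_derive q v rho
  (2 * \sum_(j < n) (q 0 (cx j) * v 0 (cx j) + q 0 (cy j) * v 0 (cy j))).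
Proof.
apply/is_derive_at; set A := \sum_(j < n) _.
have E s : rho (s *: v + q) = rho v * s ^+ 2 + 2 * A * s + rho q.
  rewrite /rho2 /A mulr_sumr !mulr_suml -!big_split /=; apply: eq_bigr => j _.
  by rewrite !mxE; ring.
apply: (@derP_quad _ _ _ _ (rho v)) => h; rewrite add0r !E.
rewrite [X in `|X|](_ : _ = rho v * h ^+ 2); last by ring.
by rewrite ger0_norm // mulr_ge0 ?rho_ge0 ?sqr_ge0.
Qed.

Lemma Drho_cx (q : pt) j : 'D_(eb R (cx j)) rho q = 2 * q 0 (cx j).
Proof.
rewrite (@derive_val _ _ _ _ _ _ _ (is_derive_rho q (eb R (cx j)))); congr (_ * _).
rewrite (bigD1 j) //= big1 => [|i /negbTE ij]; rewrite !mxE !cE.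
  by rewrite !eqxx /= mulr1 mulr0 !addr0.
by rewrite ij !andbF !mulr0 addr0.
Qed.
Lemma Drho_cy (q : pt) j : 'D_(eb R (cy j)) rho q = 2 * q 0 (cy j).
Proof.
rewrite (@derive_val _ _ _ _ _ _ _ (is_derive_rho q (eb R (cy j)))); congr (_ * _).
rewrite (bigD1 j) //= big1 => [|i /negbTE ij]; rewrite !mxE !cE.
  by rewrite !eqxx /= mulr1 mulr0 add0r addr0.
by rewrite ij !andbF !mulr0 addr0.
Qed.
Lemma Drho_ct (q : pt) : 'D_(eb R ct) rho q = 0.
Proof.
rewrite (@derive_val _ _ _ _ _ _ _ (is_derive_rho q (eb R ct))) big1 ?mulr0 // => i _.
by rewrite !mxE !cE !andbF !mulr0 addr0.
Qed.

Lemma D_comp (F : R -> R) (f : pt -> R) (q v : pt) a : der F (f q) a -> smoothN 1 f ->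
  'D_v (F \o f) q = a * 'D_v f q.
Proof.
move=> dF [_ /(_ v)[df _]].
exact: (@derive_val _ _ _ _ _ _ _ (is_derive_compR dF (derivableP (df q)))).
Qed.

Lemma D_coord (i : 'I_(n + n).+1) (q v : pt) : 'D_v (fun q : pt => q 0 i) q = v 0 i.
Proof. exact: (@derive_val _ _ _ _ _ _ _ (is_derive_coord q v i)). Qed.

Lemma sN_rho k : smoothN k rho.
Proof. by have /smoothP := @smooth_rho R n; exact. Qed.

Lemma X_rad j (F : R -> R) (q : pt) a : der F (rho q) a -> Xop j (F \o rho) q = 2 * q 0 (cx j) * a.
Proof.
move=> dF; rewrite /Xop !(D_comp _ dF (sN_rho 1)) Drho_cx Drho_ct mulr0 mulr0 subr0; exact: mulrC.
Qed.
Lemma Y_rad j (F : R -> R) (q : pt) a : der F (rho q) a -> Yop j (F \o rho) q = 2 * q 0 (cy j) * a.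
Proof.
move=> dF; rewrite /Yop !(D_comp _ dF (sN_rho 1)) Drho_cy Drho_ct mulr0 mulr0 addr0; exact: mulrC.
Qed.
Definition tcoord (q : pt) : R := q 0 ct.
Lemma sN_t k : smoothN k tcoord.
Proof. exact: smoothN_coord. Qed.
Lemma D_t (q v : pt) : 'D_v tcoord q = v 0 ct.
Proof. exact: D_coord. Qed.
Lemma X_t j (F : R -> R) (q : pt) a : der F (tcoord q) a -> Xop j (F \o tcoord) q = - q 0 (cy j) * a.
Proof.
move=> dF; rewrite /Xop !(D_comp _ dF (sN_t 1)) !D_t !mxE !cE !eqxx /= mulr0 mulr1.
by rewrite sub0r mulNr.
Qed.
Lemma Y_t j (F : R -> R) (q : pt) a : der F (tcoord q) a -> Yop j (F \o tcoord) q = q 0 (cx j) * a.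
Proof.
move=> dF; rewrite /Yop !(D_comp _ dF (sN_t 1)) !D_t !mxE !cE !eqxx /= mulr0 mulr1.
by rewrite add0r.
Qed.
Lemma X_x j (q : pt) : Xop j (fun q : pt => q 0 (cx j)) q = 1.
Proof. by rewrite /Xop !D_coord !mxE !cE !eqxx /= mulr0 subr0. Qed.
Lemma X_y j (q : pt) : Xop j (fun q : pt => q 0 (cy j)) q = 0.
Proof. by rewrite /Xop !D_coord !mxE !cE !eqxx /= mulr0 subr0. Qed.
Lemma Y_x j (q : pt) : Yop j (fun q : pt => q 0 (cx j)) q = 0.
Proof. by rewrite /Yop !D_coord !mxE !cE !eqxx /= mulr0 addr0. Qed.
Lemma Y_y j (q : pt) : Yop j (fun q : pt => q 0 (cy j)) q = 1.
Proof. by rewrite /Yop !D_coord !mxE !cE !eqxx /= mulr0 addr0. Qed.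

Section RadCalc.
Variables (F0 F1 F2 W0 W1 W2 : R -> R).
Hypothesis dF0 : forall x, der F0 x (F1 x).
Hypothesis dF1 : forall x, der F1 x (F2 x).
Hypothesis cF2 : continuous F2.
Hypothesis dW0 : forall x, der W0 x (W1 x).
Hypothesis dW1 : forall x, der W1 x (W2 x).
Hypothesis cW2 : continuous W2.

Lemma chain2 (G0 G1 G2 : R -> R) (f : pt -> R) : smoothN 2 f -> (forall x, der G0 x (G1 x)) ->
  (forall x, der G1 x (G2 x)) -> continuous G2 -> smoothN 2 (G0 \o f) /\ smoothN 1 (G1 \o f).
Proof.
move=> sf d0 d1 c2.
have c0 : continuous G0 by apply: derP_cont => x; exists (G1 x).
have c1 : continuous G1 by apply: derP_cont => x; exists (G2 x).
split.
  apply: (@smoothN_chain_upto 2 f (fun i => nth G2 [:: G0; G1] i)) => //.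
    by move=> [|[|i]].
  by move=> [|[|[|i]]].
apply: (@smoothN_chain_upto 1 f (fun i => nth G2 [:: G1] i)).
- exact: smoothNS.
- by move=> [|i].
by move=> [|[|i]].
Qed.

Definition radt : pt -> R := (F0 \o rho) \* (W0 \o tcoord).

Lemma smoothN_radt : smoothN 2 radt.
Proof.
have [a _] := chain2 (sN_rho 2) dF0 dF1 cF2.
have [b _] := chain2 (sN_t 2) dW0 dW1 cW2.
exact: smoothN_M.
Qed.

Let A1 : smoothN 1 (F0 \o rho). Proof. by have [/smoothNS] := chain2 (sN_rho 2) dF0 dF1 cF2. Qed.
Let A2 : smoothN 1 (F1 \o rho). Proof. by have [_] := chain2 (sN_rho 2) dF0 dF1 cF2. Qed.
Let B1 : smoothN 1 (W0 \o tcoord). Proof. by have [/smoothNS] := chain2 (sN_t 2) dW0 dW1 cW2. Qed.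
Let B2 : smoothN 1 (W1 \o tcoord). Proof. by have [_] := chain2 (sN_t 2) dW0 dW1 cW2. Qed.
Let Cc i : smoothN 1 (fun q : pt => q 0 i). Proof. exact: smoothN_coord. Qed.
Let k2 : smoothN 1 ((fun=> 2) : pt -> R). Proof. exact: smoothN_cst. Qed.
Let k1 : smoothN 1 ((fun=> -1) : pt -> R). Proof. exact: smoothN_cst. Qed.

Lemma X_cst j (c : R) (q : pt) : Xop j (fun=> c) q = 0.
Proof. by rewrite /Xop !derive_cst mulr0 subr0. Qed.
Lemma Y_cst j (c : R) (q : pt) : Yop j (fun=> c) q = 0.
Proof. by rewrite /Yop !derive_cst mulr0 addr0. Qed.

Lemma X_radt j : Xop j radt =
  ((((fun=> 2) : pt -> R) \* ((fun q : pt => q 0 (cx j)) \* ((F1 \o rho) \* (W0 \o tcoord)))) \+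
  (((fun=> -1) : pt -> R) \* ((fun q : pt => q 0 (cy j)) \* ((F0 \o rho) \* (W1 \o tcoord))))).
Proof.
apply/funext => q; rewrite (XopM j q A1 B1) (X_rad j (dF0 _)) (X_t j (dW0 _)) /=; ring.
Qed.
Lemma Y_radt j : Yop j radt =
  ((((fun=> 2) : pt -> R) \* ((fun q : pt => q 0 (cy j)) \* ((F1 \o rho) \* (W0 \o tcoord)))) \+
  ((fun q : pt => q 0 (cx j)) \* ((F0 \o rho) \* (W1 \o tcoord)))).
Proof.
apply/funext => q; rewrite (YopM j q A1 B1) (Y_rad j (dF0 _)) (Y_t j (dW0 _)) /=; ring.
Qed.

Lemma XX_radt j q : Xop j (Xop j radt) q =
  (2 * F1 (rho q) + 4 * q 0 (cx j) ^+ 2 * F2 (rho q)) * W0 (tcoord q)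
  - 4 * q 0 (cx j) * q 0 (cy j) * F1 (rho q) * W1 (tcoord q)
  + q 0 (cy j) ^+ 2 * F0 (rho q) * W2 (tcoord q).
Proof.
have T0 := smoothN_M A2 B1; have T1 := smoothN_M (Cc (cx j)) T0.
have U0 := smoothN_M A1 B2; have U1 := smoothN_M (Cc (cy j)) U0.
rewrite X_radt (XopD j q (smoothN_M k2 T1) (smoothN_M k1 U1)) (XopM j q k2 T1) (XopM j q k1 U1).
rewrite (XopM j q (Cc (cx j)) T0) (XopM j q (Cc (cy j)) U0) (XopM j q A2 B1) (XopM j q A1 B2).
rewrite !X_cst X_x X_y (X_rad j (dF0 _)) (X_rad j (dF1 _)) (X_t j (dW0 _)) (X_t j (dW1 _)) /=.
ring.
Qed.
Lemma YY_radt j q : Yop j (Yop j radt) q =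
  (2 * F1 (rho q) + 4 * q 0 (cy j) ^+ 2 * F2 (rho q)) * W0 (tcoord q)
  + 4 * q 0 (cx j) * q 0 (cy j) * F1 (rho q) * W1 (tcoord q)
  + q 0 (cx j) ^+ 2 * F0 (rho q) * W2 (tcoord q).
Proof.
have T0 := smoothN_M A2 B1; have T1 := smoothN_M (Cc (cy j)) T0.
have U0 := smoothN_M A1 B2; have U1 := smoothN_M (Cc (cx j)) U0.
rewrite Y_radt (YopD j q (smoothN_M k2 T1) U1) (YopM j q k2 T1).
rewrite (YopM j q (Cc (cy j)) T0) (YopM j q (Cc (cx j)) U0) (YopM j q A2 B1) (YopM j q A1 B2).
rewrite !Y_cst Y_x Y_y (Y_rad j (dF0 _)) (Y_rad j (dF1 _)) (Y_t j (dW0 _)) (Y_t j (dW1 _)) /=.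
ring.
Qed.

(** The mixed terms $\pm4x_jy_jF'W'$ of $X_j^2$ and $Y_j^2$ cancel, because the rotation field
    paired with $\partial_t$ kills functions of $|z|^2$. What remains is a second-order operator in
    $|z|^2$ alone. *)
Lemma subLap_radt q : subLap radt q =
  - ((4 * n%:R * F1 (rho q) + 4 * rho q * F2 (rho q)) * W0 (tcoord q) + rho q * F0 (rho q) * W2 (tcoord q)).
Proof.
rewrite /subLap; congr (- _).
rewrite (eq_bigr (fun j => 4 * F1 (rho q) * W0 (tcoord q) + (q 0 (cx j) ^+ 2 + q 0 (cy j) ^+ 2) *
   (4 * F2 (rho q) * W0 (tcoord q) + F0 (rho q) * W2 (tcoord q)))); last first.
  by move=> j _; rewrite XX_radt YY_radt; ring.
rewrite big_split /= sumr_const card_ord -mulr_suml -/(rho q) -mulr_natr; ring.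
Qed.

Lemma Dt_radt : Dt radt = (F0 \o rho) \* (W1 \o tcoord).
Proof.
apply/funext => q; rewrite /Dt (derM q _ A1 B1) (D_comp _ (dF0 _) (sN_rho 1)) Drho_ct.
by rewrite (D_comp _ (dW0 _) (sN_t 1)) D_t !mxE !eqxx /= mulr0 mul0r add0r mulr1.
Qed.
End RadCalc.
End Rad.

Section PolyExp.
Variable R : realType.

Definition pexp (s : R) (P : {poly R}) (x : R) : R := P.[x] * expR (- s * x).

Definition dpoly (s : R) (P : {poly R}) : {poly R} := P^`() - s *: P.

Lemma der_pexp s P x : der (pexp s P) x (pexp s (dpoly s P) x).
Proof.
have d1 := derP_comp (is_derive_expR _) (derP_aff (- s) 0 x).
have d2 : der (fun x => expR (- s * x)) x (expR (- s * x) * - s).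
  by rewrite addr0 in d1; apply: (derP_ext _ d1) => y; rewrite addr0.
apply: (derP_eq (derP_M (is_derive_poly P x) d2)).
by rewrite /pexp /dpoly hornerD hornerN hornerZ; ring.
Qed.

Lemma cont_pexp s P : continuous (pexp s P).
Proof. by apply: derP_cont => x; eexists; exact: der_pexp. Qed.

Lemma exp_bd (s : R) k : 0 < s -> exists2 C : R, 0 < C & forall x, 0 <= x -> expR (- s * x) <= C / (1 + x) ^+ k.
Proof.
move=> s0; case: k => [|k].
  by exists 1 => // x x0; rewrite expr0 divr1 -expR0 ler_expR mulNr oppr_le0 mulr_ge0 // ltW.
(* Chosen so that $e(1+x)\le 1+\frac{s}{k+1}x\le e^{sx/(k+1)}$; raising to the power $k+1$ gives the
   bound. *)
pose e := Num.min 1 (s / k.+1%:R).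
have e0 : 0 < e by rewrite lt_min ltr01 divr_gt0 // ltr0n.
exists (e ^- k.+1); first by rewrite invr_gt0 exprn_gt0.
move=> x x0; rewrite mulNr expRN -invfM lef_pV2 ?posrE ?expR_gt0 ?mulr_gt0 ?exprn_gt0 ?ltr_wpDr //.
rewrite -exprMn (_ : s * x = k.+1%:R * (s / k.+1%:R * x)); last by rewrite mulrA [_ * (s / _)]mulrC divfK // pnatr_eq0.
rewrite expRM_natl; apply: lerXn2r; rewrite ?nnegrE ?expR_ge0 ?mulr_ge0 ?addr_ge0 ?(ltW e0) //.
apply: le_trans (expR_ge1Dx _); rewrite mulrDr mulr1 lerD //; first by rewrite ge_min lexx.
by rewrite ler_wpM2r // ge_min lexx orbT.
Qed.

Lemma poly_bd (P : {poly R}) : exists2 C : R, 0 <= C & exists k : nat, forall x, 0 <= x -> `|P.[x]| <= C * (1 + x) ^+ k.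
Proof.
elim/poly_ind: P => [|P c [C C0 [k HC]]].
  by exists 0 => //; exists 0%N => x _; rewrite horner0 normr0 mul0r.
exists (C + `|c|); first by rewrite addr_ge0.
exists k.+1 => x x0; rewrite hornerMXaddC; apply: le_trans (ler_normD _ _) _.
rewrite mulrDl lerD //; last by rewrite ler_peMr // exprn_ege1 // lerDl.
rewrite normrM (ger0_norm x0) exprSr mulrA; apply: ler_pM => //; first exact: HC.
by rewrite lerDr.
Qed.

Lemma pexp_bd s P k : 0 < s -> exists2 C : R, 0 <= C & forall x, 0 <= x -> `|pexp s P x| <= C / (1 + x) ^+ k.
Proof.
move=> s0; have [A A0 [i HA]] := poly_bd P; have [B B0 HB] := exp_bd (i + k) s0.
exists (A * B); first by rewrite mulr_ge0 // ltW.
move=> x x0; rewrite /pexp normrM [`|expR _|]ger0_norm ?expR_ge0 //.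
apply: le_trans (ler_pM (normr_ge0 _) (expR_ge0 _) (HA x x0) (HB x x0)) _.
have x1 : 0 < 1 + x by rewrite ltr_wpDr.
by rewrite exprD [leLHS](_ : _ = A * B / (1 + x) ^+ k) //; field; rewrite !expf_neq0 ?gt_eqF.
Qed.
End PolyExp.

(** * Real joint eigenfunctions and the integrated eigenvalue equation *)

Section Eigen.
Variables (R : realType) (n : nat).
Notation pt := (pt R n).
Notation bpt := (bpt R n).
Notation haar := (haar R n).
Notation ct := (@ct n).
Notation rho := (@rho2 R n).
Notation tc := (@tcoord R n).
Notation L1 := (@L1 _ bpt R haar).

Lemma decay_pexp (s : R) P : 0 < s -> decay (fun q : pt => pexp s P (rho q)).
Proof.
move=> s0; have [C C0 HC] := pexp_bd P (n + n) s0; exists C => q.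
by apply: HC; exact: rho_ge0.
Qed.

Lemma abs_cos_le1 (x : R) : `|cos x| <= 1.
Proof. by rewrite ler_norml cos_geN1 cos_le1. Qed.

Definition om (m : nat) (al : R) (s : R) : R := cos (m%:R * s + al).

Definition om1 (m : nat) (al : R) (s : R) : R := - m%:R * sin (m%:R * s + al).
Definition om2 (m : nat) (al : R) (s : R) : R := - m%:R ^+ 2 * cos (m%:R * s + al).

Lemma der_om m al x : der (om m al) x (om1 m al x).
Proof.
by apply: (derP_eq (derP_comp (is_derive_cos _) (derP_aff m%:R al x))); rewrite /om1; ring.
Qed.
Lemma der_om1 m al x : der (om1 m al) x (om2 m al x).
Proof.
have d := derP_comp (is_derive_sin _) (derP_aff m%:R al x).
by apply: (derP_eq (derP_Z (- m%:R) d)); rewrite /om2; ring.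
Qed.
Lemma cont_om2 m al : continuous (om2 m al).
Proof.
apply: derP_cont => x; eexists.
exact: (derP_Z (- m%:R ^+ 2) (derP_comp (is_derive_cos _) (derP_aff m%:R al x))).
Qed.

Lemma tperiodic_om m al : tperiodic (om m al \o tc).
Proof.
move=> q /=; rewrite /om /tcoord !mxE !eqxx /= mulr1 mulrDr addrAC.
rewrite (_ : m%:R * (2 * pi) = (pi *+ 2) *+ m); last by rewrite -[(pi *+ 2) *+ m]mulr_natl -[pi *+ 2]mulr_natl.
exact: (periodicn (@cosD2pi R)).
Qed.

(** Real and imaginary parts of a joint eigenfunction are coupled by one t-derivative; two of them
    decouple the parts and leave only $|m|$. *)
Definition Vk (m : nat) (lam : R) (f : pt -> R) : Prop :=
  [/\ smooth f, tperiodic f, L1 (fun q => f q ^+ 2), subLap f = (fun q => lam * f q)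
    & Dt (Dt f) = (fun q => - (m%:R ^+ 2 * f q))].

Section Ibp.
Variables (m : nat) (lam al : R) (f : pt -> R) (F0 F1 F2 : R -> R).
Hypothesis Vf : Vk m lam f.
Hypothesis dF0 : forall x, der F0 x (F1 x).
Hypothesis dF1 : forall x, der F1 x (F2 x).
Hypothesis cF2 : continuous F2.
Hypothesis decF : decay (fun q : pt => (1 + rho q) * (`|F0 (rho q)| + `|F1 (rho q)| + `|F2 (rho q)|)).

Lemma cs_radt_cut N : let G := cutf N F0 F1 F2 in cs (radt G.1.1 (om m al) : pt -> R).
Proof.
move=> G; have [d0 d1] := der_cut N dF0 dF1; have c2 := @cont_cut R N F0 F1 F2 dF0 dF1 cF2.
have sR : smoothN 2 (radt G.1.1 (om m al) : pt -> R).
  exact: (@smoothN_radt R n _ _ _ _ _ _ d0 d1 c2 (der_om m al) (der_om1 m al) (@cont_om2 m al)).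
split; first by apply: (@smoothN_cont R n 2).
- by move=> q; rewrite /radt /= -[om m al (tc (q + _))]/((om m al \o tc) (q + _)) tperiodic_om tperiodic_rho.
- exists N.+1%:R => q h; rewrite -[LHS]/(G.1.1 (rho q) * om m al (tc q)).
  by rewrite /G cut_zero // mul0r.
Qed.

(** [f] is only square integrable. The symmetry of L is applied to the truncated test functions, and
    the truncation is removed by dominated convergence: [cut_bd] bounds everything by [|f|] times a
    function of $L^2$, uniformly in N. *)
Lemma ibp : \int[haar]_q (f q * ((- (4 * rho q * F2 (rho q)) - 4 * n%:R * F1 (rho q)
    + m%:R ^+ 2 * rho q * F0 (rho q)) * om m al (tc q)))
  = lam * \int[haar]_q (f q * (F0 (rho q) * om m al (tc q))).
Proof.
have [sf pf f2 Lf _] := Vf.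
have cF0 : continuous F0 by apply: derP_cont => x; exists (F1 x).
have cF1 : continuous F1 by apply: derP_cont => x; exists (F2 x).
have crho : continuous rho by exact: (smoothN_cont (sN_rho R n 0)).
have ct_ : continuous tc by exact: (smoothN_cont (sN_t R n 0)).
have com : continuous (om m al) by apply: derP_cont => x; eexists; exact: der_om.
have com2 := @cont_om2 m al.
have cc (G : R -> R) : continuous G -> continuous (G \o rho).
  by move=> cG q; apply: continuous_comp; [exact: crho|exact: cG].
have ctt (G : R -> R) : continuous G -> continuous (G \o tc).
  by move=> cG q; apply: continuous_comp; [exact: ct_|exact: cG].
have mf := continuous_measurable_bpt (smooth_cont sf).
have mr := continuous_measurable_bpt crho.
pose D (q : pt) : R := (1 + rho q) * (`|F0 (rho q)| + `|F1 (rho q)| + `|F2 (rho q)|).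
have mabs (G : R -> R) : continuous G -> measurable_fun setT (fun q : bpt => `|G (rho q)|).
  by move=> cG; apply: measurableT_comp => //; exact: (continuous_measurable_bpt (cc _ cG)).
have mD : measurable_fun setT (D : bpt -> R).
  apply: measM; first by apply: measurable_funD => //; exact: measurable_cst.
  by apply: measurable_funD; [apply: measurable_funD|]; exact: mabs.
have D0 q : 0 <= D q by rewrite mulr_ge0 ?(ltW (rho1_gt0 q)) // addr_ge0 // addr_ge0.
have IfD : L1 (fun q => `|f q| * D q).
  apply: L1_mul => //; first exact: measurableT_comp.
    by rewrite (_ : (fun q => _) = (fun q => f q ^+ 2)) //; apply/funext => q; rewrite real_normK ?num_real.
  exact: L1_decay2.
(* The coefficients $4n$ and $4\rho$ of $F'$ and $F''$ times the constants 3 and 6 of [cut_bd], and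
   $m^2$ from the second t-derivative. *)
pose A : R := 12 * n%:R + 24 + m%:R ^+ 2.
have A0 : 0 <= A by rewrite addr_ge0 ?sqr_ge0 // addr_ge0 // mulr_ge0.
pose G N := cutf N F0 F1 F2.
pose S N (q : pt) := - ((4 * n%:R * (G N).1.2 (rho q) + 4 * rho q * (G N).2 (rho q)) * om m al (tc q)
   + rho q * (G N).1.1 (rho q) * om2 m al (tc q)).
have SE N q : subLap (radt (G N).1.1 (om m al) : pt -> R) q = S N q.
  have [d0 d1] := der_cut N dF0 dF1; have c2 := @cont_cut R N F0 F1 F2 dF0 dF1 cF2.
  exact: (subLap_radt d0 d1 c2 (der_om m al) (der_om1 m al) (@cont_om2 m al)).
have SB N q : `|S N q| <= A * D q.
  have r0 := rho_ge0 q; have [b0 b1 b2] := cut_bd N F0 F1 F2 r0.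
  rewrite normrN; apply: le_trans (ler_normD _ _) _.
  rewrite (normrM _ (om m al (tc q))) (normrM _ (om2 m al (tc q))) (normrM (rho q)).
  have c1 := abs_cos_le1 (m%:R * tc q + al); rewrite -/(om m al (tc q)) in c1.
  have c2 : `|om2 m al (tc q)| <= m%:R ^+ 2.
    rewrite /om2 normrM normrN normrX ger0_norm // ler_piMr ?exprn_ge0 //; exact: abs_cos_le1.
  set a0 := `|F0 (rho q)|; set a1 := `|F1 (rho q)|; set a2 := `|F2 (rho q)|.
  have p0 : 0 <= a0 by exact: normr_ge0.
  have p1 : 0 <= a1 by exact: normr_ge0.
  have p2 : 0 <= a2 by exact: normr_ge0.
  have H1 : `|4 * n%:R * (G N).1.2 (rho q) + 4 * rho q * (G N).2 (rho q)| <=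
     12 * n%:R * (a0 + a1) + 24 * rho q * (a0 + a1 + a2).
    apply: le_trans (ler_normD _ _) _.
    rewrite (normrM _ ((G N).1.2 (rho q))) (normrM _ ((G N).2 (rho q))) !normrM (ger0_norm r0) !normr_nat; apply: lerD.
      have -> : 12 * n%:R * (a0 + a1) = 4 * n%:R * (3 * (a0 + a1)) by ring.
      by apply: ler_wpM2l => //; rewrite mulr_ge0.
    have -> : 24 * rho q * (a0 + a1 + a2) = 4 * rho q * (6 * (a0 + a1 + a2)) by ring.
    by apply: ler_wpM2l => //; rewrite mulr_ge0.
  have H2 : `|rho q| * `|(G N).1.1 (rho q)| * `|om2 m al (tc q)| <= rho q * a0 * m%:R ^+ 2.
    by rewrite (ger0_norm r0); apply: ler_pM => //; [rewrite mulr_ge0|apply: ler_wpM2l].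
  apply: (@le_trans _ _ ((12 * n%:R * (a0 + a1) + 24 * rho q * (a0 + a1 + a2)) + rho q * a0 * m%:R ^+ 2)).
    apply: lerD => //; apply: le_trans H1; rewrite -[leRHS]mulr1.
    by apply: ler_pM => //.
  rewrite /A /D -/a0 -/a1 -/a2; set r := rho q in r0 *; set N' := n%:R; set M := m%:R ^+ 2.
  have n0 : 0 <= N' :> R by []. have M0 : 0 <= M by exact: sqr_ge0.
  have e1 : 12 * N' * (a0 + a1) <= 12 * N' * ((1 + r) * (a0 + a1 + a2)).
    by apply: ler_wpM2l; [rewrite mulr_ge0|nra].
  have e3 : r * a0 * M <= M * ((1 + r) * (a0 + a1 + a2)).
    by rewrite mulrC; apply: ler_wpM2l => //; nra.
  have e2 : 24 * r * (a0 + a1 + a2) <= 24 * ((1 + r) * (a0 + a1 + a2)) by nra.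
  by rewrite !mulrDl; clear -e1 e2 e3; lra.
have EN N : \int[haar]_q (f q * S N q) = lam * \int[haar]_q (f q * ((G N).1.1 (rho q) * om m al (tc q))).
  have [d0 d1] := der_cut N dF0 dF1; have c2 := @cont_cut R N F0 F1 F2 dF0 dF1 cF2.
  have sg : smoothN 2 (radt (G N).1.1 (om m al) : pt -> R).
    exact: (@smoothN_radt R n _ _ _ _ _ _ d0 d1 c2 (der_om m al) (der_om1 m al) (@cont_om2 m al)).
  have cg := @cs_radt_cut N; cbv zeta in cg.
  have := subLap_sym ((smoothP _).1 sf 2) pf sg cg.
  rewrite (_ : (fun q => f q * subLap _ q) = (fun q => f q * S N q)); last by apply/funext => q; rewrite SE.
  move=> <-; rewrite Lf -intZ; last first.
    by apply: cs_L1; apply: csMl => //; exact: (smooth_cont sf).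
  by congr Rintegral; apply/funext => q; exact: (esym (mulrA lam (f q) _)).
have mS N : measurable_fun setT (S N : bpt -> R).
  have [d0 d1] := der_cut N dF0 dF1; have c2 := @cont_cut R N F0 F1 F2 dF0 dF1 cF2.
  have c0 : continuous (G N).1.1 by apply: derP_cont => x; exists ((G N).1.2 x).
  have c1 : continuous (G N).1.2 by apply: derP_cont => x; exists ((G N).2 x).
  apply: continuous_measurable_bpt => q.
  exact: (cvgN (cvgD (cvgM (cvgD (cvgM (cvg_cst _) (cc _ c1 q)) (cvgM (cvgM (cvg_cst _) (crho q)) (cc _ c2 q)))
    (ctt _ com q)) (cvgM (cvgM (crho q) (cc _ c0 q)) (ctt _ com2 q)))).
have mSl : measurable_fun setT ((fun q => (- (4 * rho q * F2 (rho q)) - 4 * n%:R * F1 (rho q)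
    + m%:R ^+ 2 * rho q * F0 (rho q)) * om m al (tc q)) : bpt -> R).
  apply: continuous_measurable_bpt => q.
  exact: (cvgM (cvgD (cvgB (cvgN (cvgM (cvgM (cvg_cst _) (crho q)) (cc _ cF2 q))) (cvgM (cvg_cst _) (cc _ cF1 q)))
    (cvgM (cvgM (cvg_cst _) (crho q)) (cc _ cF0 q))) (ctt _ com q)).
have L1' := @dct _ _ _ haar (fun N q => f q * S N q) _ (fun q => A * (`|f q| * D q))
  (fun N => measM mf (mS N)) (measM mf mSl) _ (L1Z A IfD) _.
have L2' := @dct _ _ _ haar (fun N q => f q * ((G N).1.1 (rho q) * om m al (tc q)))
  (fun q => f q * (F0 (rho q) * om m al (tc q))) (fun q => `|f q| * D q) _ _ _ IfD _.
have lim1 : \int[haar]_q (f q * S N q) @[N --> \oo] -->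
   \int[haar]_q (f q * ((- (4 * rho q * F2 (rho q)) - 4 * n%:R * F1 (rho q)
    + m%:R ^+ 2 * rho q * F0 (rho q)) * om m al (tc q))).
  apply: L1' => [q|N q]; last first.
    by rewrite normrM mulrCA ler_wpM2l // SB.
  have [h0 h1 h2] := cut_lim F0 F1 F2 (rho q).
  apply: cvgM; first exact: cvg_cst.
  rewrite (_ : (- (4 * rho q * F2 (rho q)) - 4 * n%:R * F1 (rho q)
    + m%:R ^+ 2 * rho q * F0 (rho q)) * om m al (tc q) =
    - ((4 * n%:R * F1 (rho q) + 4 * rho q * F2 (rho q)) * om m al (tc q)
      + rho q * F0 (rho q) * om2 m al (tc q))); last by rewrite /om2 /om; ring.
  exact: (cvgN (cvgD (cvgM (cvgD (cvgM (cvg_cst _) h1) (cvgM (cvg_cst _) h2)) (cvg_cst _))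
    (cvgM (cvgM (cvg_cst _) h0) (cvg_cst _)))).
have lim2 : \int[haar]_q (f q * ((G N).1.1 (rho q) * om m al (tc q))) @[N --> \oo] -->
   \int[haar]_q (f q * (F0 (rho q) * om m al (tc q))).
  apply: L2' => [N||q|N q].
  - apply: measM => //; have [c _ _] := @cs_radt_cut N; exact: (continuous_measurable_bpt c).
  - apply: measM => //; apply: continuous_measurable_bpt => q.
    exact: (cvgM (cc _ cF0 q) (ctt _ com q)).
  - have [h0 _ _] := cut_lim F0 F1 F2 (rho q).
    exact: (cvgM (cvg_cst _) (cvgM h0 (cvg_cst _))).
  - have r0 := rho_ge0 q; have [b0 _ _] := cut_bd N F0 F1 F2 r0.
    rewrite (normrM (f q)) (normrM _ (om m al (tc q))); apply: ler_wpM2l => //; apply: (@le_trans _ _ `|F0 (rho q)|).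
      rewrite -[leRHS]mulr1; apply: ler_pM => //; exact: abs_cos_le1.
    apply: (@le_trans _ _ (`|F0 (rho q)| + `|F1 (rho q)| + `|F2 (rho q)|)).
      by rewrite -addrA lerDl addr_ge0.
    by rewrite /D ler_peMl ?addr_ge0 // lerDl.
apply: (cvg_unique _ lim1) => //.
rewrite (_ : (fun N => _) = (fun N => lam * \int[haar]_q (f q * ((G N).1.1 (rho q) * om m al (tc q))))).
  by apply: cvgM => //; exact: cvg_cst.
by apply/funext => N; exact: EN.
Qed.
End Ibp.

Lemma ibp_pexp (m : nat) (lam al s : R) (f : pt -> R) (P : {poly R}) : 0 < s -> Vk m lam f ->
  let P1 := dpoly s P in let P2 := dpoly s P1 in
  \int[haar]_q (f q * (pexp s (- (4 *: ('X * P2)) - (4 * n%:R) *: P1 + (m%:R ^+ 2) *: ('X * P)) (rho q) * om m al (tc q)))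
  = lam * \int[haar]_q (f q * (pexp s P (rho q) * om m al (tc q))).
Proof.
move=> s0 Vf P1 P2.
rewrite -(@ibp m lam al f (pexp s P) (pexp s P1) (pexp s P2) Vf (der_pexp s P) (der_pexp s P1) (@cont_pexp _ s P2)).
  congr Rintegral; apply/funext => q; congr (_ * (_ * _)).
  by rewrite /pexp !(hornerD, hornerN, hornerZ, hornerM, hornerX); ring.
have dab (Q : {poly R}) : decay (fun q : pt => `|pexp s Q (rho q)|).
  by have [C HC] := decay_pexp Q s0; exists C => q; rewrite normr_id.
have H (Q : {poly R}) : decay (fun q : pt => (1 + rho q) * `|pexp s Q (rho q)|).
  have := dab ((1 + 'X) * Q); rewrite (_ : (fun q => _) = (fun q => (1 + rho q) * `|pexp s Q (rho q)|)) //.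
  apply/funext => q; rewrite /pexp hornerM hornerD hornerX -[1]/(1%:P) hornerC -mulrA normrM.
  by rewrite ger0_norm // ltW // rho1_gt0.
rewrite (_ : (fun q => _) = (fun q => ((1 + rho q) * `|pexp s P (rho q)| + (1 + rho q) * `|pexp s P1 (rho q)|)
   + (1 + rho q) * `|pexp s P2 (rho q)|)); last by apply/funext => q; rewrite !mulrDr.
by apply: decayD => //; exact: decayD.
Qed.

Lemma Vk_ltr m lam f w : Vk m lam f -> Vk m lam (f \o ltr w).
Proof.
move=> [sf pf f2 Lf Df]; split.
- exact: smooth_ltr.
- move=> q /=; rewrite -[RHS]pf; congr f.
  by rewrite /ltr sgD sgZ sg_ct mulr0 addr0 [q + _ + w]addrAC [LHS]addrAC.
- have p2 : tperiodic (fun q => f q ^+ 2) by move=> q; rewrite pf.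
  exact: (L1_ltr w p2 f2).
- by rewrite subLap_ltr // Lf.
- by rewrite !Dt_ltr Df.
Qed.

(** Along the t-axis [f] solves $u''=-m^2u$. The difference [v] from the claimed solution has zero
    Cauchy data, and its energy $v'^2+m^2v^2$ is constant. *)
Lemma Vk_rot m lam f (q : pt) (s : R) : (0 < m)%N -> Vk m lam f ->
  f (q + s *: eb R ct) = f q * cos (m%:R * s) + Dt f q / m%:R * sin (m%:R * s).
Proof.
move=> m0 [sf pf f2 Lf Df]; have m1 : (m%:R : R) != 0 by rewrite pnatr_eq0 -lt0n.
pose u (s : R) := f (s *: eb R ct + q).
pose u1 (s : R) := Dt f (s *: eb R ct + q).
have du x : der u x (u1 x).
  by apply: ((is_derive_line _ _ _ _ _).1 (derivableP _)); exact: smooth_der.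
have du1 x : der u1 x (- (m%:R ^+ 2 * u x)).
  have := (is_derive_line _ _ _ _ _).1 (derivableP (@smooth_der _ _ (Dt f) (x *: eb R ct + q) (eb R ct) (smoothD _ sf))).
  by rewrite -[X in is_derive _ _ _ X]/(Dt (Dt f) _) Df.
pose c (x : R) := om m 0 x; pose sn (x : R) := sin (m%:R * x + 0).
have dc x := der_om m 0 x : der c x _.
have ds x : der sn x (cos (m%:R * x + 0) * m%:R) := derP_comp (is_derive_sin _) (derP_aff m%:R 0 x).
pose v (x : R) := u x + (- f q * c x + - (Dt f q / m%:R) * sn x).
pose v1 (x : R) := u1 x + (- f q * om1 m 0 x + - (Dt f q / m%:R) * (cos (m%:R * x + 0) * m%:R)).
have dv x : der v x (v1 x) by exact: derP_D (du x) (derP_D (derP_Z _ (dc x)) (derP_Z _ (ds x))).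
have dv1 x : der v1 x (- (m%:R ^+ 2 * v x)).
  have h2 := derP_Z m%:R (der_om m 0 x).
  have h3 : der (fun x => cos (m%:R * x + 0) * m%:R) x (m%:R * om1 m 0 x).
    by apply: (derP_ext _ h2) => y; rewrite mulrC.
  apply: (derP_eq (derP_D (du1 x) (derP_D (derP_Z (- f q) (der_om1 m 0 x)) (derP_Z (- (Dt f q / m%:R)) h3)))).
  by rewrite /v /c /om1 /om2 /sn /om; ring.
pose E (x : R) := v1 x * v1 x + m%:R ^+ 2 * (v x * v x).
have dE x : der E x 0.
  apply: (derP_eq (derP_D (derP_M (dv1 x) (dv1 x)) (derP_Z _ (derP_M (dv x) (dv x))))).
  ring.
have v0 : v 0 = 0.
  by rewrite /v /u /c /sn /om scale0r add0r !mulr0 addr0 cos0 sin0; ring.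
have v10 : v1 0 = 0.
  by rewrite /v1 /u1 /om1 scale0r add0r !mulr0 addr0 cos0 sin0; field.
have [xi _ EE] := @MVT_sym R E (fun=> 0) 0 s dE.
have E0 : E 0 = 0 by rewrite /E v0 v10; ring.
rewrite E0 subr0 mul0r in EE.
have vs : v s = 0.
  move/eqP: EE; rewrite paddr_eq0 -?expr2 ?sqr_ge0 //; last by rewrite mulr_ge0 ?sqr_ge0.
  by move=> /andP[_]; rewrite mulf_eq0 !sqrf_eq0 (negbTE m1) => /eqP.
move: vs; rewrite /v /u /c /om /sn !addr0 [q + _]addrC => /eqP; rewrite addr_eq0 => /eqP ->; ring.
Qed.

End Eigen.

(** * Gaussian moments of eigenfunctions and the value at the origin *)

Section Gauss.
Variable R : realType.
Notation leb := (@lebesgue_measure R).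

Lemma cont_gauss (b : R) : continuous (fun s : R => expR (- b * s ^+ 2)).
Proof.
apply: derP_cont => x; eexists.
exact: (derP_comp (is_derive_expR _) (derP_Z (- b) (derP_M (derP_id x) (derP_id x)))).
Qed.

Lemma integral_gauss_scaled (b : R) : 0 < b ->
  (\int[leb]_s (expR (- b * s ^+ 2))%:E = (Num.sqrt (pi / b))%:E)%E.
Proof.
move=> b0; have sb : 0 < Num.sqrt b by rewrite sqrtr_gt0.
pose G (s : R) : R := gauss_fun s.
have GE s : G s = expR (- s ^+ 2) by [].
have cG : continuous G by exact: continuous_gauss_fun.
have sub := @increasing_ge0_integration_by_substitutionT R (fun s => s * Num.sqrt b) G.
have dF s : is_derive s (1 : R) (fun s : R => s * Num.sqrt b) (Num.sqrt b).
  by apply: is_derive_eq; rewrite scaler0 add0r -[LHS]/(Num.sqrt b * 1) mulr1.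
have dFE : (fun s : R => s * Num.sqrt b)^`()%classic = cst (Num.sqrt b).
  by apply/funext => s; rewrite derive1E; exact: (@derive_val _ _ _ _ _ _ _ (dF s)).
have : (\int[leb]_s (G s)%:E = \int[leb]_s (Num.sqrt b * expR (- b * s ^+ 2))%:E)%E.
  rewrite sub //.
  - apply: eq_integral => s _; congr EFin.
    rewrite -[LHS]/(G (s * Num.sqrt b) * (fun s : R => s * Num.sqrt b)^`()%classic s) dFE GE /= exprMn.
    by rewrite sqr_sqrtr ?(ltW b0) // mulrC mulrC [_ * b]mulrC mulNr mulrC.
  - by move=> x y xy; rewrite ltr_pM2r.
  - by rewrite dFE => s; exact: cst_continuous.
  - by rewrite dFE; exact: is_cvg_cst.
  - by rewrite dFE; exact: is_cvg_cst.
  - by apply: gt0_cvgMlNy.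
  - by apply: gt0_cvgMly.
  - by move=> s; rewrite GE expR_ge0.
rewrite integralT_gauss.
under [X in _ = X -> _]eq_integral do rewrite EFinM.
rewrite ge0_integralZl_EFin ?(ltW sb) //; last first.
- by apply/measurable_EFinP; apply: continuous_measurable_fun; exact: cont_gauss.
move=> E; set X := (\int[leb]_s _)%E in E *.
have X0 : (0 <= X)%E by apply: integral_ge0 => s _; rewrite lee_fin expR_ge0.
move: E; case: X X0 => [x|//|//] x0.
  move=> E; have {}E : Num.sqrt pi = Num.sqrt b * x by apply: EFin_inj; rewrite E.
  congr EFin; rewrite sqrtrM ?pi_ge0 // E mulrC mulrA sqrtrV ?(ltW b0) // mulVf ?mul1r // gt_eqF //.
by rewrite gt0_muley // lte_fin.
Qed.
End Gauss.

Section Reproducing.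
Variables (R : realType) (n : nat).
Notation pt := (pt R n).
Notation bpt := (bpt R n).
Notation haar := (haar R n).
Notation ct := (@ct n).
Notation rho := (@rho2 R n).
Notation tc := (@tcoord R n).
Notation L1 := (@L1 _ bpt R haar).

Lemma gauss_prod (b : R) (q : pt) : expR (- b * rho q) =
  \prod_(i : 'I_(n + n).+1) (if i == ct then 1 else expR (- b * q 0 i ^+ 2)).
Proof.
rewrite (bigD1 ct) //= eqxx mul1r.
rewrite (eq_bigr (fun i => expR (- b * q 0 i ^+ 2))); last by move=> i /negbTE ->.
have E : \sum_(i : 'I_(n + n).+1 | i != ct) (- b * q 0 i ^+ 2) = - b * rho q.
  rewrite -mulr_sumr; congr (_ * _); rewrite /rho2 big_split /=.
  have S0 (F : nat -> R) : \sum_(i : 'I_(n + n).+1 | i != ct) F i = \sum_(i < n + n) F i.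
    rewrite big_mkcond big_ord_recr /= (_ : (ord_max != ct) = false) ?addr0.
      by apply: eq_bigr => i _; rewrite (_ : _ != _) // -val_eqE /= ct_val neq_ltn ltn_ord.
    by apply/negbTE; rewrite negbK -val_eqE /= ct_val.
  transitivity (\sum_(i : 'I_(n + n).+1 | i != ct) (fun k : nat => q 0 (inord k) ^+ 2) i).
    by apply: eq_bigr => i _; rewrite inord_val.
  rewrite (S0 (fun k : nat => q 0 (inord k) ^+ 2)) big_split_ord /=; congr (_ + _); apply: eq_bigr => j _ //.
by rewrite -E expR_sum.
Qed.

Lemma L1_gauss (b : R) : 0 < b -> L1 (fun q => expR (- b * rho q)).
Proof.
move=> b0; have := @decay_pexp R n b 1 b0.
rewrite (_ : (fun q => _) = (fun q : pt => expR (- b * rho q))).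
  apply: L1_decay; apply: continuous_measurable_bpt => q.
  apply: (@continuous_comp _ _ _ rho (fun x => expR (- b * x))); first exact: (smoothN_cont (sN_rho R n 0)).
  by have := @cont_pexp R b 1 (rho q); rewrite (_ : pexp b 1 = (fun x => expR (- b * x))) //; apply/funext => x; rewrite /pexp hornerC mul1r.
by apply/funext => q; rewrite /pexp hornerC mul1r.
Qed.

Lemma int_gauss (b : R) : 0 < b -> \int[haar]_q expR (- b * rho q) = 2 * pi * (pi / b) ^+ n.
Proof.
move=> b0; have I := L1_gauss b0.
have := intE I; rewrite haarE //; last by apply/measurable_EFinP; exact: (L1_meas I).
rewrite (_ : (fun q => _) = (fun q : pt => (\prod_i (fun i s => if i == ct then 1 else expR (- b * s ^+ 2)) i (q 0 i))%:E)); last first.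
  by apply/funext => q; rewrite gauss_prod.
rewrite (@hint_prod R n (fun i s => if i == ct then 1 else expR (- b * s ^+ 2)) (fun i => if i == ct then 2 * pi else Num.sqrt (pi / b))).
- case=> <-; rewrite (bigD1 ct) //= eqxx; congr (_ * _).
  rewrite (eq_bigr (fun=> Num.sqrt (pi / b))); last by move=> i /negbTE ->.
  rewrite prodr_const (_ : #|_| = (n + n)%N); last first.
    by rewrite (eq_card (B := predC1 ct)) ?cardC1 ?card_ord // => i; rewrite !inE.
  by rewrite addnn -mul2n exprM sqr_sqrtr // divr_ge0 ?pi_ge0 // ltW.
- by move=> i; case: (i == ct) => //; apply: continuous_measurable_fun; exact: cont_gauss.
- by move=> i s; case: (i == ct) => //; rewrite expR_ge0.
move=> i; rewrite /cdom; case: ifP => _.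
  rewrite (_ : mkset _ = `[0, 2 * pi[%classic); last first.
    by apply/seteqP; split => x; rewrite /= in_itv /=.
  pose J : set (measurableTypeR R) := `[0, 2 * pi[%classic.
  have mJ : measurable J by exact: (measurable_itv `[0, 2 * pi[).
  transitivity (1%:E * (@lebesgue_measure R) J)%E; first exact: (integral_cst _ mJ 1%E).
  rewrite mul1e /J lebesgue_measure_itv /=.
  by rewrite lte_fin mulr_gt0 ?pi_gt0 // -EFinD subr0.
exact: integral_gauss_scaled.
Qed.

Variable m : nat.
Hypothesis m0 : (0 < m)%N.
Notation M := (m%:R : R).

Let M0 : 0 < M. Proof. by rewrite ltr0n. Qed.

Variables (k : nat) (f : pt -> R).
Let lam : R := 2 * M * (2 * k%:R + n%:R).
Hypothesis Vf : Vk m lam f.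

Lemma Vk_meas : measurable_fun setT (f : bpt -> R).
Proof. by case: Vf => sf _ _ _ _; exact: (continuous_measurable_bpt (smooth_cont sf)). Qed.

Lemma pexp_om_cont s P al : continuous (fun q : pt => pexp s P (rho q) * om m al (tc q)).
Proof.
move=> q; have c1 : continuous rho by exact: (smoothN_cont (sN_rho R n 0)).
have c2 : continuous tc by exact: (smoothN_cont (sN_t R n 0)).
have c3 : continuous (om m al) by apply: derP_cont => x; eexists; exact: der_om.
have e1 : continuous (pexp s P \o rho) by move=> r; apply: continuous_comp; [exact: c1|exact: cont_pexp].
have e2 : continuous (om m al \o tc) by move=> r; apply: continuous_comp; [exact: c2|exact: c3].
exact: (cvgM (e1 q) (e2 q)).
Qed.

Lemma pexp_om_decay s P al : 0 < s -> decay (fun q : pt => pexp s P (rho q) * om m al (tc q)).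
Proof. by move=> s0; apply: decayM; [exact: decay_pexp|exists 1 => q; exact: abs_cos_le1]. Qed.

Lemma L1_fpexp s P al : 0 < s -> L1 (fun q => f q * (pexp s P (rho q) * om m al (tc q))).
Proof.
move=> s0; have mp := continuous_measurable_bpt (@pexp_om_cont s P al).
by apply: (L1_mul Vk_meas mp); [case: Vf|apply: L1_decay2 => //; exact: pexp_om_decay].
Qed.

Definition moment (s : R) (P : {poly R}) : R := \int[haar]_q (f q * (pexp s P (rho q) * om m 0 (tc q))).

Lemma momD s P Q : 0 < s -> moment s (P + Q) = moment s P + moment s Q.
Proof.
move=> s0; rewrite /moment -intD; [|exact: L1_fpexp|exact: L1_fpexp].
by congr Rintegral; apply/funext => q; rewrite /pexp hornerD; ring.
Qed.

Lemma mom_ext s P Q : (forall x, P.[x] = Q.[x]) -> moment s P = moment s Q.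
Proof. by move=> H; rewrite /moment; congr Rintegral; apply/funext => q; rewrite /pexp H. Qed.

Lemma momZ s (c : R) P : 0 < s -> moment s (c *: P) = c * moment s P.
Proof.
move=> s0; rewrite /moment -intZ; last exact: L1_fpexp.
by congr Rintegral; apply/funext => q; rewrite /pexp hornerZ; ring.
Qed.

Lemma mom_sum s (I : Type) (r : seq I) (P : I -> {poly R}) : 0 < s ->
  moment s (\sum_(i <- r) P i) = \sum_(i <- r) moment s (P i).
Proof.
move=> s0; elim: r => [|i r IH]; last by rewrite !big_cons momD // IH.
by rewrite !big_nil -(scale0r (0 : {poly R})) momZ // mul0r.
Qed.

Lemma mom_ibp s P : 0 < s ->
  moment s (- (4 *: ('X * dpoly s (dpoly s P))) - (4 * n%:R) *: dpoly s P + (M ^+ 2) *: ('X * P)) = lam * moment s P.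
Proof. by move=> s0; exact: (ibp_pexp 0 P s0 Vf). Qed.

(** At $s=m/2$ the terms of degree $j+2$ cancel in [mom_ibp], which leaves a two-term recursion. Its
    left factor vanishes exactly at $j+1=k$, where the chain of zero moments stops. *)
Lemma mom_rec (j : nat) : 4 * M * (j.+1%:R - k%:R) * moment (M / 2) 'X^(j.+1) = 4 * j.+1%:R * (j%:R + n%:R) * moment (M / 2) 'X^j.
Proof.
have s0 : 0 < M / 2 by rewrite divr_gt0.
have := mom_ibp 'X^(j.+1) s0.
rewrite (@mom_ext _ _ ((- (4 * j.+1%:R * (j%:R + n%:R))) *: 'X^j + (4 * j.+1%:R * M + 2 * n%:R * M) *: 'X^(j.+1))).
  by rewrite momD // !momZ // /lam; nra.
move=> x; rewrite /dpoly !(derivB, derivZ, derivXn, derivMn) /=.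
rewrite !(hornerD, hornerN, hornerZ, hornerM, hornerX, hornerXn, hornerMn) -!(mulr_natr (x ^+ _)) -!(mulr_natr (x ^+ _ * _)).
by case: j => [|j] /=; rewrite ?exprS ?expr0; field.
Qed.

End Reproducing.

Section OneVar.
Variable R : realType.
Implicit Types f g : R -> R.

Lemma derP_X f x a k : der f x a -> der (fun y => f y ^+ k) x (k%:R * f x ^+ k.-1 * a).
Proof.
move=> df; elim: k => [|k IH].
  by apply: (derP_eq (derP_cst 1 x)); rewrite !mul0r.
apply: (derP_eq (derP_ext _ (derP_M df IH))) => [y|]; first by rewrite exprS.
by case: k {IH} => [|k] /=; rewrite ?expr0 -?(natr1 k.+1) -?(natr1 k) ?exprS; ring.
Qed.

Lemma derP_inv f x a : f x != 0 -> der f x a -> der (fun y => (f y)^-1) x (- (f x) ^- 2 * a).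
Proof.
move=> f0 df; have dx : derivable f x 1 by exact: (@ex_derive _ _ _ _ _ _ _ df).
split; first exact: derivableV.
by rewrite deriveV // (@derive_val _ _ _ _ _ _ _ df).
Qed.

Lemma MVT_on g dg (a b : R) : a <= b -> (forall x, a <= x <= b -> der g x (dg x)) ->
  exists2 c, a <= c <= b & g b - g a = dg c * (b - a).
Proof.
move=> ab H.
have cw : {within `[a, b], continuous g}.
  apply: derivable_within_continuous => x; rewrite in_itv /= => xab.
  exact: (@ex_derive _ _ _ _ _ _ _ (H x xab)).
have [|c cab E] := @MVT_segment R g dg a b ab _ cw; last by exists c.
by move=> x; rewrite in_itv /= => /andP[ax xb]; apply: H; rewrite !ltW.
Qed.

Lemma der_le g dg (a b : R) : a <= b -> (forall x, a <= x <= b -> der g x (dg x)) ->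
  (forall x, a <= x <= b -> 0 <= dg x) -> g a <= g b.
Proof.
move=> ab H H0; have [c cab E] := MVT_on ab H.
by rewrite -subr_ge0 E mulr_ge0 ?H0 // subr_ge0.
Qed.

Lemma der_const g dg (a b : R) : a <= b -> (forall x, a <= x <= b -> der g x (dg x)) ->
  (forall x, a <= x <= b -> dg x = 0) -> g a = g b.
Proof.
move=> ab H H0; have [c cab E] := MVT_on ab H.
by apply/esym/eqP; rewrite -subr_eq0 E H0 // mul0r.
Qed.

Definition etay (k : nat) : {poly R} := \sum_(j < k) ((-1) ^+ j / j`!%:R) *: 'X^j.

Lemma deriv_etay k : (etay k.+1)^`() = - etay k.
Proof.
rewrite /etay raddf_sum big_ord_recl /= expr0 derivZ derivC scaler0 add0r -sumrN.
apply: eq_bigr => j _; rewrite -[bump 0 j]/(j.+1) derivZ derivXn /= -[X in _ *: X]scaler_nat scalerA -scaleNr.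
congr (_ *: _).
rewrite factS natrM exprS; field.
by rewrite nat1r !pnatr_eq0 -lt0n fact_gt0.
Qed.

(** With the sign included, the derivative of the remainder of order $k+1$ is the remainder of order
    $k$, so both inequalities propagate by monotonicity. *)
Lemma exp_taylor k y : 0 <= y -> 0 <= (-1) ^+ k * (expR (- y) - (etay k).[y]) <= y ^+ k / k`!%:R.
Proof.
elim: k y => [|k IH] y y0.
  rewrite /etay big_ord0 horner0 subr0 !expr0 mul1r expR_ge0 divr1 /= -expR0 ler_expR oppr_le0 //.
pose E j y := (-1) ^+ j * (expR (- y) - (etay j).[y]).
have dE x : der (E k.+1) x (E k x).
  have d1 := derP_comp (is_derive_expR _) (derP_Z (-1) (derP_id x)).
  have d2 := derP_Z (-1) (is_derive_poly (etay k.+1) x).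
  apply: (derP_eq (derP_ext _ (derP_Z ((-1) ^+ k.+1) (derP_D d1 d2)))) => [z|].
    by rewrite /E !mulN1r.
  by rewrite deriv_etay hornerN /E exprS !mulN1r; ring.
have E0 : E k.+1 0 = 0.
  rewrite /E /etay big_ord_recl /= hornerD horner_sum big1 => [|j _].
    by rewrite expr0 fact0 divr1 scale1r expr0 hornerC oppr0 expR0 addr0 subrr mulr0.
  by rewrite hornerZ hornerXn -[bump 0 j]/(j.+1) expr0n mulr0.
apply/andP; split.
  rewrite -[leRHS]/(E k.+1 y) -E0; apply: (der_le y0 (fun x _ => dE x)) => x /andP[x0 _].
  by have /andP[] := IH x x0.
pose G (x : R) := x ^+ k.+1 / k.+1`!%:R + -1 * E k.+1 x.
have dG x : der G x (x ^+ k / k`!%:R + -1 * E k x).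
  have d1 := derP_Z (k.+1`!%:R^-1) (derP_X k.+1 (derP_id x)).
  apply: (derP_eq (derP_ext _ (derP_D d1 (derP_Z (-1) (dE x))))) => [z|]; first by rewrite /G mulrC.
  congr (_ + _); rewrite factS natrM /=; field.
  by rewrite nat1r !pnatr_eq0 -lt0n fact_gt0.
have : G 0 <= G y.
  apply: (der_le y0 (fun x _ => dG x)) => x /andP[x0 _].
  by rewrite mulN1r subr_ge0; have /andP[] := IH x x0.
by rewrite /G E0 exprS !mul0r mulr0 addr0 mulN1r subr_ge0.
Qed.

End OneVar.

Section Concentrate.
Variables (R : realType) (n : nat).
Notation pt := (pt R n).
Notation bpt := (bpt R n).
Notation haar := (haar R n).
Notation rho := (@rho2 R n).
Notation L1 := (@L1 _ bpt R haar).

Lemma meas_gauss (s : R) : measurable_fun setT ((fun q => expR (- s * rho q)) : bpt -> R).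
Proof.
have := @pexp_om_cont R n 0 s 1 0; rewrite (_ : (fun q => _) = (fun q : pt => expR (- s * rho q))).
  exact: continuous_measurable_bpt.
by apply/funext => q; rewrite /pexp /om mul0r addr0 cos0 mulr1 hornerC mul1r.
Qed.

Lemma gauss_decay (s : R) : 0 < s -> decay (fun q : pt => expR (- s * rho q)).
Proof.
move=> s0; have := @decay_pexp R n s 1 s0; rewrite (_ : (fun q => _) = (fun q : pt => expR (- s * rho q))) //.
by apply/funext => q; rewrite /pexp hornerC mul1r.
Qed.

(** The Gaussian has integral $2\pi^{n+1}(N+1)^{-n}$, so the factor makes it an approximate identity
    at $z=0$. It does not localise t, which is why [g] must be close to [c] uniformly in t. *)
Lemma concentrate (g : pt -> R) (c : R) : measurable_fun setT (g : bpt -> R) -> L1 (fun q => g q ^+ 2) ->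
  (forall e, 0 < e -> exists2 d, 0 < d & forall q, rho q < d -> `|g q - c| <= e) ->
  N.+1%:R ^+ n * \int[haar]_q (g q * expR (- N.+1%:R * rho q)) @[N --> \oo] --> 2 * pi ^+ n.+1 * c.
Proof.
move=> mg g2 gc.
have s0 N : 0 < N.+1%:R :> R by rewrite ltr0n.
have Lg s : 0 < s -> L1 (fun q => g q * expR (- s * rho q)).
  move=> s1; apply: (L1_mul mg (@meas_gauss s) g2).
  by apply: L1_decay2; [exact: meas_gauss|exact: gauss_decay].
have Ls s : 0 < s -> L1 (fun q => expR (- s * rho q)) by exact: L1_gauss.
have Lh s : 0 < s -> L1 (fun q => (g q - c) * expR (- s * rho q)).
  move=> s1; have := L1B (Lg s s1) (L1Z c (Ls s s1)).
  by rewrite (_ : (fun x => _) = (fun q => (g q - c) * expR (- s * rho q))) //; apply/funext => q; rewrite mulrBl.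
have Z N : N.+1%:R ^+ n * \int[haar]_q expR (- N.+1%:R * rho q) = 2 * pi ^+ n.+1.
  rewrite int_gauss // expr_div_n exprS; field.
  by rewrite expf_neq0 // pnatr_eq0.
have E N : N.+1%:R ^+ n * \int[haar]_q (g q * expR (- N.+1%:R * rho q)) =
    2 * pi ^+ n.+1 * c + N.+1%:R ^+ n * \int[haar]_q ((g q - c) * expR (- N.+1%:R * rho q)).
  rewrite -(Z N) -mulrA [_ * c]mulrC -(intZ _ (Ls _ (s0 N))) -mulrDr -intD; [|by apply: L1Z; exact: Ls|exact: Lh].
  by congr (_ * _); congr Rintegral; apply/funext => q; ring.
pose K := \int[haar]_q (`|g q - c| * expR (- 1 * rho q)).
have LK s : 0 < s -> L1 (fun q => `|g q - c| * expR (- s * rho q)).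
  move=> s1; have := L1_norm (Lh s s1).
  by rewrite (_ : (fun x => _) = (fun q => `|g q - c| * expR (- s * rho q))) //; apply/funext => q; rewrite normrM [`|expR _|]ger0_norm ?expR_ge0.
have K0 : 0 <= K by apply: int_ge0 => q; rewrite mulr_ge0 ?expR_ge0.
apply/cvgrPdist_le => e e0.
pose Z0 : R := 2 * pi ^+ n.+1.
have Z00 : 0 < Z0 by rewrite mulr_gt0 // exprn_gt0 // pi_gt0.
have e1 : 0 < e / 2 / Z0 by rewrite !divr_gt0.
have [d d0 Hd] := gc _ e1.
(* Where $\rho\ge d$, $e^{-(N+1)\rho}\le e^{-dN}e^{-\rho}$, and $e^{-dN}$ beats the growth $(N+1)^n$
   with one power to spare. *)
have [C C0 HC] := exp_bd n.+1 d0.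
have B N : `|N.+1%:R ^+ n * \int[haar]_q ((g q - c) * expR (- N.+1%:R * rho q))| <= e / 2 + C * K / N.+1%:R.
  rewrite normrM ger0_norm ?exprn_ge0 //.
  apply: (@le_trans _ _ (N.+1%:R ^+ n * \int[haar]_q ((e / 2 / Z0) * expR (- N.+1%:R * rho q)
     + expR (- d * N%:R) * (`|g q - c| * expR (- 1 * rho q))))).
    rewrite ler_wpM2l ?exprn_ge0 //; apply: le_trans (int_abs (Lh _ (s0 N))) _.
    apply: int_le; [exact: L1_norm (Lh _ (s0 N))|by apply: L1D; apply: L1Z; [exact: Ls|exact: LK]|].
    move=> q; rewrite normrM [`|expR _|]ger0_norm ?expR_ge0 //.
    have [rd|dr] := ltP (rho q) d.
      apply: (@le_trans _ _ ((e / 2 / Z0) * expR (- N.+1%:R * rho q))).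
        by rewrite ler_wpM2r ?expR_ge0 // Hd.
      by rewrite lerDl mulr_ge0 ?expR_ge0 // mulr_ge0 ?expR_ge0.
    apply: (@le_trans _ _ (expR (- d * N%:R) * (`|g q - c| * expR (- 1 * rho q)))); last first.
      by rewrite lerDr mulr_ge0 ?expR_ge0 // ltW.
    rewrite mulrCA ler_wpM2l // -expRD ler_expR -natr1; have := ler_wpM2r (ler0n R N) dr.
    by set r := rho q; set N' := N%:R; lra.
  rewrite intD; [|by apply: L1Z; exact: Ls|by apply: L1Z; exact: LK].
  rewrite !intZ; [|exact: Ls|exact: LK].
  rewrite mulrDr mulrCA Z -/Z0 -/K divfK ?gt_eqF // lerD2l.
  have h1 := HC N%:R (ler0n R N); rewrite nat1r in h1.
  have h2 : N.+1%:R ^+ n * expR (- d * N%:R) <= C / N.+1%:R.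
    rewrite mulrC -ler_pdivlMr ?exprn_gt0 //; apply: le_trans h1 _.
    by rewrite exprS invfM mulrA.
  by rewrite mulrA [leRHS]mulrAC; apply: ler_wpM2r K0 _ _ h2.
near=> N.
rewrite E -/Z0 opprD addrA subrr add0r normrN; apply: le_trans (B N) _.
rewrite [leRHS](splitr e) lerD2l.
rewrite ler_pdivrMr ?ltr0n // -ler_pdivrMl ?divr_gt0 //.
apply: (@le_trans _ _ N%:R); last by rewrite ler_nat.
near: N; exact: nbhs_infty_ger.
Unshelve. all: by end_near. Qed.

End Concentrate.

Section Reproduce.
Variables (R : realType) (n : nat).
Notation pt := (pt R n).
Notation bpt := (bpt R n).
Notation haar := (haar R n).
Notation ct := (@ct n).
Notation rho := (@rho2 R n).
Notation tc := (@tcoord R n).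
Notation L1 := (@L1 _ bpt R haar).
Variable m : nat.
Hypothesis m0 : (0 < m)%N.
Notation M := (m%:R : R).
Definition eigval (k : nat) : R := 2 * M * (2 * k%:R + n%:R).
Variables (k : nat) (f : pt -> R).
Hypothesis Vf : Vk m (eigval k) f.
Notation mom := (@moment R n m f).

Let M0 : 0 < M. Proof. by rewrite ltr0n. Qed.
Let s0 : 0 < M / 2. Proof. by rewrite divr_gt0. Qed.

(** The case $P=1$ of the integrated equation. As $-\int f\rho\,e^{-s\rho}\cos(mt)$ is the
    s-derivative of the moment of 1, this is a linear differential equation of order one, singular
    at $s=m/2$. *)
Lemma mom_ode s : 0 < s -> (M ^+ 2 - 4 * s ^+ 2) * mom s 'X + 4 * n%:R * s * mom s 1 = eigval k * mom s 1.
Proof.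
move=> s1; rewrite -(mom_ibp Vf 1 s1).
transitivity (mom s ((M ^+ 2 - 4 * s ^+ 2) *: 'X + (4 * n%:R * s) *: 1)).
  by rewrite (momD Vf) // !(momZ Vf).
apply: mom_ext => x; rewrite /dpoly -polyC1 !(derivB, derivZ, derivC).
by rewrite !(hornerD, hornerN, hornerZ, hornerM, hornerX, hornerC); ring.
Qed.

(** At $s=m/2$ the differential equation degenerates to a multiple $-4mk$ of the moment of 1, which
    must vanish for $k>0$; [mom_rec] carries the zero up to degree $k-1$. *)
Lemma mom_small j : (j < k)%N -> mom (M / 2) 'X^j = 0.
Proof.
have Mn : M != 0 by rewrite gt_eqF.
elim: j => [|j IH] jk.
  have := mom_ode s0; rewrite expr0.
  have -> : M ^+ 2 - 4 * (M / 2) ^+ 2 = 0 by field.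
  rewrite mul0r add0r => /eqP; rewrite -subr_eq0 -mulrBl mulf_eq0 => /orP[|/eqP //].
  have -> : 4 * n%:R * (M / 2) - eigval k = - (4 * M * k%:R) by rewrite /eigval; field.
  by rewrite oppr_eq0 !mulf_eq0 (negbTE Mn) !pnatr_eq0 /= => /eqP k0; rewrite k0 in jk.
have := mom_rec m0 Vf j; rewrite IH ?(ltnW jk) // mulr0 => /eqP.
rewrite !mulf_eq0 (negbTE Mn) pnatr_eq0 /= subr_eq0 eqr_nat => /orP[/eqP e|/eqP //].
by rewrite e ltnn in jk.
Qed.

Lemma der_mom s : 0 < s -> der (fun s => mom s 1) s (- mom s 'X).
Proof.
move=> s1.
pose F (u : R) (q : bpt) := f q * (pexp u 1 (rho q) * om m 0 (tc q)).
pose dF (u : R) (q : bpt) := - (f q * (pexp u 'X (rho q) * om m 0 (tc q))).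
have d1 u q : der (F ^~ q) u (dF u q).
  have e1 := derP_comp (is_derive_expR _) (derP_Z (- rho q) (derP_id u)).
  apply: (derP_eq (derP_ext _ (derP_Z (f q * om m 0 (tc q)) e1))) => [x|].
    by rewrite /F /pexp hornerC mul1r mulNr -mulNr [- x * _]mulrC mulNr -mulrN; ring.
  by rewrite /dF /pexp hornerX (_ : - rho q * u = - u * rho q); ring.
(* On []u0, v0[] the s-derivative of the integrand is dominated by [|f|] times the weight taken at
   [s / 2]. *)
pose u0 := s / 2; pose v0 := s + 1.
have Is : (`]u0, v0[%classic : set R) s.
  by rewrite /= in_itv /= /u0 /v0 ltr_pdivrMr // mulr_natr mulr2n ltrDl s1 ltrDl ltr01.
have pos x : (`]u0, v0[%classic : set R) x -> s / 2 < x by rewrite /= in_itv /= => /andP[].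
have sp : 0 < s / 2 by rewrite divr_gt0.
pose G (q : bpt) := `|f q * (pexp (s / 2) 'X (rho q) * om m 0 (tc q))| + `|f q| * `|pexp (s / 2) 'X (rho q)|.
have LG : L1 G.
  apply: L1D; first by apply: L1_norm; exact: (L1_fpexp Vf).
  have mp := continuous_measurable_bpt (@pexp_om_cont R n 0 (s / 2) 'X 0).
  have Lp : L1 (fun q => (pexp (s / 2) 'X (rho q) * om 0 0 (tc q)) ^+ 2).
    by apply: L1_decay2 => //; exact: pexp_om_decay.
  have f2 : L1 (fun q => f q ^+ 2) by case: Vf.
  have := L1_norm (L1_mul (Vk_meas Vf) mp f2 Lp).
  rewrite (_ : (fun x => _) = (fun q => `|f q| * `|pexp (s / 2) 'X (rho q)|)) //.
  by apply/funext => q; rewrite normrM /om mul0r addr0 cos0 mulr1.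
have G0 q : 0 <= G q by rewrite addr_ge0 // mulr_ge0.
have LF x : (`]u0, v0[%classic : set R) x -> L1 (F x).
  by move=> /pos xs; apply: (L1_fpexp Vf); apply: lt_trans xs.
have dd x y : (`]u0, v0[%classic : set R) x -> setT y -> derivable (F ^~ y) x 1.
  by move=> _ _; exact: (@ex_derive _ _ _ _ _ _ _ (d1 x y)).
have E1 x y : partial1of2 F x y = dF x y.
  by rewrite partial1of2E; exact: (@derive_val _ _ _ _ _ _ _ (d1 x y)).
have bd x y : (`]u0, v0[%classic : set R) x -> setT y -> `|partial1of2 F x y| <= G y.
  move=> /pos xs _; rewrite E1 /dF normrN !normrM.
  apply: (@le_trans _ _ (`|f y| * `|pexp (s / 2) 'X (rho y)|)); last by rewrite /G lerDr.
  rewrite ler_wpM2l // -[leRHS]mulr1; apply: ler_pM => //; last exact: abs_cos_le1.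
  rewrite /pexp !normrM; apply: ler_wpM2l => //.
  rewrite !ger0_norm ?expR_ge0 // ler_expR !mulNr lerN2 ler_wpM2r ?rho_ge0 // ltW //.
have D := @derivable_under_integral R _ bpt haar F setT measurableT s u0 v0 Is LF dd G G0 LG bd.
have V := @differentiation_under_integral R _ bpt haar F setT measurableT s u0 v0 Is LF dd G G0 LG bd.
split; first exact: D.
rewrite -derive1E [LHS]V.
transitivity (\int[haar]_q (-1 * (f q * (pexp s 'X (rho q) * om m 0 (tc q))))).
  by congr Rintegral; apply/funext => q; rewrite E1 /dF mulN1r.
by rewrite intZ ?mulN1r //; exact: (L1_fpexp Vf).
Qed.

(** The moment multiplied by the integrating factor of [mom_ode], hence constant on $s>m/2$. *)
Let r (s : R) : R := mom s 1 * ((2 * s + M) ^+ (n + k) * (2 * s - M)^-1 ^+ k).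

Lemma mom_const a b : M / 2 < a -> a <= b -> r a = r b.
Proof.
move=> Ma ab.
have H s : a <= s <= b -> 0 < 2 * s - M /\ 0 < 2 * s + M /\ 0 < s.
  move=> /andP[as_ _]; move: Ma; rewrite ltr_pdivrMr // => Ma.
  by have := M0; split; [lra|split; lra].
pose dr s := mom s 1 * ((2 * s + M) ^+ (n + k) * (k%:R * (2 * s - M)^-1 ^+ k.-1 * (- (2 * s - M) ^- 2 * 2))
  + (2 * s - M)^-1 ^+ k * ((n + k)%:R * (2 * s + M) ^+ (n + k).-1 * 2))
  + ((2 * s + M) ^+ (n + k) * (2 * s - M)^-1 ^+ k) * - mom s 'X.
apply: (@der_const _ r dr) => // s sab; have [h1 [h2 h3]] := H s sab.
  have e1 := derP_aff 2 (- M) s; have e2 := derP_aff 2 M s.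
  have e3 := derP_X k (@derP_inv R (fun y => 2 * y - M) s 2 (lt0r_neq0 h1) e1); have e4 := derP_X (n + k) e2.
  exact: (derP_M (der_mom h3) (derP_M e4 e3)).
have ode := mom_ode h3.
have P1 : k%:R * (2 * s - M)^-1 ^+ k.-1 = k%:R * (2 * s - M)^-1 ^+ k * (2 * s - M).
  by case: (k) => [|k']; [rewrite !mul0r|rewrite /= exprSr -!mulrA mulVf ?mulr1 // gt_eqF].
have P2 : (n + k)%:R * (2 * s + M) ^+ (n + k).-1 = (n + k)%:R * (2 * s + M) ^+ (n + k) / (2 * s + M).
  by case: (n + k)%N => [|k']; [rewrite !mul0r|rewrite /= exprSr -!mulrA mulfV ?mulr1 // gt_eqF].
rewrite /dr P1 P2 natrD.
set U := (2 * s + M) ^+ (n + k); set W := (2 * s - M)^-1 ^+ k; set H0 := mom s 1 in ode *; set H1 := mom s 'X in ode *.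
have E : H1 = (eigval k - 4 * n%:R * s) * H0 / ((M - 2 * s) * (M + 2 * s)).
  have nz : (M - 2 * s) * (M + 2 * s) != 0.
    by apply: mulf_neq0; [rewrite -opprB oppr_eq0 gt_eqF|rewrite addrC gt_eqF].
  apply: (mulfI nz); rewrite [RHS]mulrC divfK //.
  by rewrite [in RHS]mulrBl -ode; ring.
rewrite E /eigval; field.
by apply/and3P; split; [rewrite addrC gt_eqF|rewrite -opprB oppr_eq0 gt_eqF|rewrite gt_eqF].
Qed.

(** The value of [f] at the foot $(z,0)$ of the fibre. Being independent of t, it can be tested by
    Gaussians in z alone. *)
Definition f0 (q : pt) : R := f (q - tc q *: eb R ct).

Lemma f0E q : f0 q = f q * cos (m%:R * tc q) - Dt f q / M * sin (m%:R * tc q).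
Proof.
by rewrite /f0 -scaleNr (Vk_rot _ _ m0 Vf) mulrN cosN sinN mulrN.
Qed.

Let tau : R := pi / 2 / M.

Lemma f_tau q : f (q + tau *: eb R ct) = Dt f q / M.
Proof.
rewrite (Vk_rot _ _ m0 Vf) (_ : m%:R * tau = pi / 2) ?cos_pihalf ?sin_pihalf ?mulr0 ?add0r ?mulr1 //.
by rewrite /tau mulrC divfK // gt_eqF.
Qed.

(** Add to the integral its translate by a quarter period in t: [f] turns into [Dt f / M] and the
    cosine into minus the sine, so the two integrands add up to [f0] times the Gaussian. This is the
    origin of the factor one half. *)
Lemma half_mom s : 0 < s -> L1 (fun q => f0 q ^+ 2) /\ measurable_fun setT (f0 : bpt -> R) /\
  mom s 1 = 2^-1 * \int[haar]_q (f0 q * expR (- s * rho q)).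
Proof.
move=> s1; have [sf pf f2 _ _] := Vf.
have cf := smooth_cont sf.
have cDt : continuous (Dt f) by exact: (smooth_cont (smoothD _ sf)).
have c2 : continuous (fun q : pt => Dt f q / M) by move=> q; exact: (cvgM (cDt q) (cvg_cst _)).
have L2t : L1 (fun q => (Dt f q / M) ^+ 2).
  have p2 : tperiodic (fun q => f q ^+ 2) by move=> q; rewrite pf.
  have := L1_addv (tau *: eb R ct) p2 f2.
  by rewrite (_ : (fun q => _) = (fun q => (Dt f q / M) ^+ 2)) //; apply/funext => q; rewrite f_tau.
have ctc : continuous tc by exact: (smoothN_cont (sN_t R n 0)).
have ccos : continuous ((fun x : R => cos (m%:R * x)) \o tc).
  have c3 : continuous (fun x : R => cos (m%:R * x)).
    by apply: derP_cont => x; eexists; exact: (derP_comp (is_derive_cos _) (derP_Z m%:R (derP_id x))).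
  by move=> q; apply: continuous_comp; [exact: ctc|exact: c3].
have csin : continuous ((fun x : R => sin (m%:R * x)) \o tc).
  have c3 : continuous (fun x : R => sin (m%:R * x)).
    by apply: derP_cont => x; eexists; exact: (derP_comp (is_derive_sin _) (derP_Z m%:R (derP_id x))).
  by move=> q; apply: continuous_comp; [exact: ctc|exact: c3].
have mf0 : measurable_fun setT (f0 : bpt -> R).
  apply: (eq_measurable_fun (fun q : bpt => f q * cos (m%:R * tc q) - Dt f q / M * sin (m%:R * tc q))).
    by move=> q _; rewrite f0E.
  apply: continuous_measurable_bpt => q.
  exact: (cvgB (cvgM (cf q) (ccos q)) (cvgM (c2 q) (csin q))).
have L2f0 : L1 (fun q => f0 q ^+ 2).
  apply: (L1_le (measM mf0 mf0) (L1Z 2 (L1D f2 L2t))) => q.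
  rewrite ger0_norm; last by rewrite -expr2 sqr_ge0.
  rewrite f0E; have := cos2Dsin2 (m%:R * tc q).
  set a := f q; set b := Dt f q / M; set c := cos _; set d := sin _ => e.
  have := sqr_ge0 (a * c + b * d); have := sqr_ge0 (a * d - b * c); have := sqr_ge0 (a * d + b * c).
  have -> : 2 * (a ^+ 2 + b ^+ 2) = 2 * (a ^+ 2 + b ^+ 2) * (c ^+ 2 + d ^+ 2) by rewrite e mulr1.
  have := sqr_ge0 (a * c); have := sqr_ge0 (b * d); have := sqr_ge0 (a * d); have := sqr_ge0 (b * c).
  nra.
split=> //; split=> //.
have I1 : L1 (fun q => f q * (pexp s 1 (rho q) * om m 0 (tc q))) by exact: (L1_fpexp Vf).
have p1 : tperiodic (fun q => f q * (pexp s 1 (rho q) * om m 0 (tc q))).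
  move=> q; rewrite pf (tperiodic_rho q) -[om m 0 (tc (q + _))]/((om m 0 \o tc) (q + _)).
  by rewrite tperiodic_om.
have T := int_addv (tau *: eb R ct) p1 I1; have IT := L1_addv (tau *: eb R ct) p1 I1.
have ET q : f (q + tau *: eb R ct) * (pexp s 1 (rho (q + tau *: eb R ct)) * om m 0 (tc (q + tau *: eb R ct)))
   = - (Dt f q / M * sin (m%:R * tc q)) * expR (- s * rho q).
  rewrite f_tau; have -> : rho (q + tau *: eb R ct) = rho q.
    by apply: eq_bigr => j _; rewrite !mxE !cE !andbF !mulr0 !addr0.
  have -> : om m 0 (tc (q + tau *: eb R ct)) = - sin (m%:R * tc q).
    rewrite /om /tcoord !mxE !eqxx /= mulr1 addr0 mulrDr -cosDpihalf; congr (cos (_ + _)).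
    by rewrite /tau mulrC divfK // gt_eqF.
  by rewrite /pexp hornerC mul1r; ring.
have D : mom s 1 + mom s 1 = \int[haar]_q (f0 q * expR (- s * rho q)).
  rewrite {2}/moment -T -intD //.
  by congr Rintegral; apply/funext => q; rewrite ET f0E /om addr0 /pexp hornerC mul1r; ring.
by rewrite -D; field.
Qed.

Lemma f0_cont e : 0 < e -> exists2 d, 0 < d & forall q, rho q < d -> `|f0 q - f 0| <= e.
Proof.
move=> e0; have [sf _ _ _ _] := Vf.
have cf : continuous f by exact: smooth_cont.
have /cvgrPdist_le /(_ _ e0) := cf 0; rewrite near_simpl => /nbhs_ballP[d /= d0 Hd].
exists (d ^+ 2) => [|q rq]; first exact: exprn_gt0.
rewrite distrC; apply: Hd; split => // i l /=; rewrite ord1 -ball_normE /= mxE sub0r normrN !mxE.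
have K (x : R) : x ^+ 2 <= rho q -> `|x| < d.
  move=> h; rewrite -(@ltr_pXn2r _ 2) ?nnegrE ?(ltW d0) // real_normK ?num_real //.
  exact: le_lt_trans h rq.
case: (index_cases l) => [->|[j []->]].
- by rewrite /tcoord !eqxx /= mulr1 subrr normr0.
- by rewrite !cE !andbF mulr0 subr0 K //; have [] := coord_le_rho q j.
- by rewrite !cE !andbF mulr0 subr0 K //; have [] := coord_le_rho q j.
Qed.

(** The integrating factor grows like $2^ns^n$, the normalisation of [concentrate]; so the constant
    value of [r] is read off at infinity. *)
Lemma r_infty : r N.+1%:R @[N --> \oo] --> pi ^+ n.+1 * f 0 * 2 ^+ n.
Proof.
have [L2 [mf _]] := half_mom ltr01.
have C := concentrate mf L2 f0_cont.
have h : (fun N : nat => N.+1%:R^-1 : R) @ \oo --> (0 : R) by exact: cvg_harmonic.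
have c1 : (fun N : nat => (2 + M * N.+1%:R^-1) ^+ (n + k)) @ \oo --> (2 + M * 0) ^+ (n + k).
  exact: (cvg_comp _ _ (cvgD (cvg_cst _) (cvgM (cvg_cst _) h)) (@exprn_continuous _ (n + k) _)).
have c2 : (fun N : nat => (2 - M * N.+1%:R^-1)^-1 ^+ k) @ \oo --> (2 - M * 0)^-1 ^+ k.
  have nz : 2 - M * 0 != 0 by rewrite mulr0 subr0.
  exact: (cvg_comp _ _ (cvgV nz (cvgB (cvg_cst _) (cvgM (cvg_cst _) h))) (@exprn_continuous _ k _)).
have E : (fun N : nat => r N.+1%:R) = (fun N : nat => (2^-1 * (N.+1%:R ^+ n * \int[haar]_q (f0 q * expR (- N.+1%:R * rho q))))
    * ((2 + M * N.+1%:R^-1) ^+ (n + k) * (2 - M * N.+1%:R^-1)^-1 ^+ k)).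
  apply/funext => N.
  have sN : 0 < N.+1%:R :> R by rewrite ltr0n.
  have [_ [_ E]] := half_mom sN; rewrite /r E.
  have e1 : 2 * N.+1%:R + M = N.+1%:R * (2 + M * N.+1%:R^-1).
    by rewrite mulrDr mulrCA mulfV ?gt_eqF // mulr1 mulrC.
  have e2 : 2 * N.+1%:R - M = N.+1%:R * (2 - M * N.+1%:R^-1).
    by rewrite mulrBr mulrCA mulfV ?gt_eqF // mulr1 mulrC.
  rewrite e1 e2 invfM !exprMn exprD -!mulrA; congr (_ * _).
  set a := (2 + _) ^+ _; set b := (2 - _)^-1 ^+ k; set I := Rintegral _ _ _.
  rewrite [LHS](_ : _ = (N.+1%:R ^+ k * N.+1%:R^-1 ^+ k) * (N.+1%:R ^+ n * (I * (a * b)))); last by ring.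
  by rewrite -exprMn mulfV ?expr1n ?mul1r // gt_eqF.
rewrite E (_ : pi ^+ n.+1 * f 0 * 2 ^+ n = 2^-1 * (2 * pi ^+ n.+1 * f 0) * ((2 + M * 0) ^+ (n + k) * (2 - M * 0)^-1 ^+ k)).
  exact: (cvgM (cvgM (cvg_cst _) C) (cvgM c1 c2)).
apply: esym.
rewrite !mulr0 addr0 subr0 exprD -!mulrA -exprMn mulfV // expr1n mulr1.
by rewrite mulrA mulVf // mul1r.
Qed.

Lemma mom_all s : M / 2 < s -> mom s 1 = pi ^+ n.+1 * f 0 * 2 ^+ n * ((2 * s - M) ^+ k / (2 * s + M) ^+ (n + k)).
Proof.
move=> sM; have s1 : 0 < s by apply: lt_trans sM.
have E : r s = pi ^+ n.+1 * f 0 * 2 ^+ n.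
  have H : (fun N : nat => r N.+1%:R) @ \oo --> r s; last exact: (cvg_unique _ H r_infty).
  apply: cvg_near_cst; near=> N; apply: esym.
  apply: mom_const => //; apply: (@le_trans _ _ N%:R); last by rewrite ler_nat.
  near: N; exact: nbhs_infty_ger.
have h1 : 0 < 2 * s - M by move: sM; rewrite ltr_pdivrMr // => sM; lra.
have h2 : 0 < 2 * s + M by have := M0; lra.
rewrite -E /r exprVn; field.
by rewrite !expf_neq0 ?gt_eqF.
Unshelve. all: by end_near. Qed.

(** Two expansions at $s=m/2+\varepsilon$: by Taylor and [mom_small] the moment of 1 is
    $(-\varepsilon)^k\mu_k/k!+O(\varepsilon^{k+1})$, where $\mu_k$ is the moment of degree $k$; by
    [mom_all] it is an explicit multiple of $\varepsilon^k$. Dividing by $\varepsilon^k$ identifies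
    $\mu_k$. *)
Lemma mom_k : (- 1) ^+ k * M ^+ k / k`!%:R * mom (M / 2) 'X^k = pi ^+ n.+1 * f 0 / M ^+ n.
Proof.
pose e (N : nat) : R := N.+1%:R^-1.
have e0 N : 0 < e N by rewrite invr_gt0 ltr0n.
have h : e @ \oo --> (0 : R) by exact: cvg_harmonic.
pose A := \int[haar]_q `|f q * (pexp (M / 2) 'X^(k.+1) (rho q) * om m 0 (tc q))|.
have LA : L1 (fun q => `|f q * (pexp (M / 2) 'X^(k.+1) (rho q) * om m 0 (tc q))|).
  by apply: L1_norm; exact: (L1_fpexp Vf).
have sp N : 0 < M / 2 + e N by rewrite addr_gt0.
have T N : `|mom (M / 2 + e N) 1 - (- e N) ^+ k / k`!%:R * mom (M / 2) 'X^k| <= e N ^+ k.+1 * A.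
  have -> : (- e N) ^+ k / k`!%:R * mom (M / 2) 'X^k = mom (M / 2) (\sum_(j < k.+1) ((- e N) ^+ j / j`!%:R) *: 'X^j).
    rewrite (mom_sum Vf) // big_ord_recr /= big1 ?add0r ?(momZ Vf) // => j _.
    by rewrite (momZ Vf) // mom_small // mulr0.
  rewrite /moment -intB; [|exact: (L1_fpexp Vf)|exact: (L1_fpexp Vf)].
  apply: le_trans (int_abs _) _; first by apply: L1B; exact: (L1_fpexp Vf).
  rewrite /A -intZ //; apply: int_le; [by apply: L1_norm; apply: L1B; exact: (L1_fpexp Vf)|exact: L1Z|].
  move=> q; have r0 := rho_ge0 q.
  have y0 : 0 <= e N * rho q by rewrite mulr_ge0 // ltW.
  have /andP[t0 t1] := exp_taylor k.+1 y0.
  have E : pexp (M / 2 + e N) 1 (rho q) - pexp (M / 2) (\sum_(j < k.+1) ((- e N) ^+ j / j`!%:R) *: 'X^j) (rho q) =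
     expR (- (M / 2) * rho q) * (expR (- (e N * rho q)) - (etay R k.+1).[e N * rho q]).
    rewrite /pexp hornerC mul1r opprD mulrDl expRD mulNr mulrBr; congr (_ - _); first by rewrite mulNr.
    rewrite mulrC; congr (_ * _); rewrite /etay !horner_sum; apply: eq_bigr => j _.
    by rewrite !hornerZ !hornerXn exprMn [(- e N) ^+ j]exprNn; ring.
  rewrite -mulrBr -mulrBl E.
  have B : `|expR (- (e N * rho q)) - (etay R k.+1).[e N * rho q]| <= (e N * rho q) ^+ k.+1.
    have -> : `|expR (- (e N * rho q)) - (etay R k.+1).[e N * rho q]| = `|(-1) ^+ k.+1 * (expR (- (e N * rho q)) - (etay R k.+1).[e N * rho q])|.
      by rewrite normrM normrX normrN1 expr1n mul1r.
    rewrite ger0_norm //; apply: le_trans t1 _.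
    rewrite ler_pdivrMr ?ltr0n ?fact_gt0 // ler_peMr ?exprn_ge0 //.
    by rewrite ler1n fact_gt0.
  rewrite !(normrM (f q)) !(normrM _ (om m 0 (tc q))) [leRHS]mulrCA; apply: ler_wpM2l => //.
  rewrite mulrA; apply: ler_wpM2r => //.
  have -> : `|pexp (M / 2) 'X^(k.+1) (rho q)| = rho q ^+ k.+1 * expR (- (M / 2) * rho q).
    by rewrite /pexp hornerXn normrM (ger0_norm (expR_ge0 _)) ger0_norm // exprn_ge0.
  rewrite normrM (ger0_norm (expR_ge0 _)) mulrA -exprMn [leLHS]mulrC.
  by apply: ler_wpM2r => //; exact: expR_ge0.
pose x N := mom (M / 2 + e N) 1.
have RE N : (2 * M + 2 * e N) ^+ (n + k) * (2^-1 ^+ k * (x N * (e N)^-1 ^+ k)) = pi ^+ n.+1 * f 0 * 2 ^+ n.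
  have h1 : 2 * (M / 2 + e N) - M = 2 * e N by field.
  have h2 : 2 * (M / 2 + e N) + M = 2 * M + 2 * e N by field.
  rewrite /x mom_all ?ltrDl // h1 h2 (exprVn 2 k) (exprVn (e N) k) exprMn.
  have U0 : (2 * M + 2 * e N) ^+ (n + k) != 0 by rewrite expf_neq0 // gt_eqF // addr_gt0 // mulr_gt0.
  have A0 : 2 ^+ k != 0 :> R by rewrite expf_neq0.
  have B0 : e N ^+ k != 0 by rewrite expf_neq0 // gt_eqF.
  move: U0 A0 B0; set U := _ ^+ (n + k); set a := 2 ^+ k; set b := e N ^+ k; set z := 2 ^+ n => U0 A0 B0.
  by field; rewrite U0 A0 B0.
have lx : (fun N => x N * (e N)^-1 ^+ k) @ \oo --> (-1) ^+ k / k`!%:R * mom (M / 2) 'X^k.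
  apply/cvgrPdist_le => d d0.
  have hA : (fun N => e N * A) @ \oo --> (0 : R) by rewrite -(mul0r A); exact: (cvgM h (cvg_cst _)).
  have /cvgrPdist_le /(_ _ d0) HA := hA; near=> N.
  have eN : `|0 - e N * A| <= d by near: N; exact: HA.
  rewrite sub0r normrN in eN; apply: le_trans (_ : _ <= e N * A) _; last exact: le_trans (ler_norm _) eN.
  have := T N; rewrite distrC -/(x N) => TN.
  have ek : 0 < e N ^+ k by rewrite exprn_gt0.
  have -> : (-1) ^+ k / k`!%:R * mom (M / 2) 'X^k - x N * (e N)^-1 ^+ k =
    ((- e N) ^+ k / k`!%:R * mom (M / 2) 'X^k - x N) * (e N)^-1 ^+ k.
    rewrite mulrBl; congr (_ - _); rewrite (exprNn (e N) k) (exprVn (e N) k).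
    have bn : e N ^+ k != 0 by rewrite gt_eqF.
    have fn : k`!%:R != 0 :> R by rewrite pnatr_eq0 -lt0n fact_gt0.
    move: bn fn; set b := e N ^+ k; set z := k`!%:R; set u := (-1) ^+ k => bn fn.
    by field; rewrite bn fn.
  rewrite normrM (exprVn (e N) k) normfV (ger0_norm (ltW ek)) ler_pdivrMr //.
  by apply: le_trans TN _; rewrite exprS mulrAC.
have l2 : (fun N => (2 * M + 2 * e N) ^+ (n + k)) @ \oo --> (2 * M + 2 * 0) ^+ (n + k).
  exact: (cvg_comp _ _ (cvgD (cvg_cst _) (cvgM (cvg_cst _) h)) (@exprn_continuous _ (n + k) _)).
have L : (fun N => (2 * M + 2 * e N) ^+ (n + k) * (2^-1 ^+ k * (x N * (e N)^-1 ^+ k))) @ \oo -->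
    (2 * M + 2 * 0) ^+ (n + k) * (2^-1 ^+ k * ((-1) ^+ k / k`!%:R * mom (M / 2) 'X^k)).
  exact: (cvgM l2 (cvgM (cvg_cst _) lx)).
have L' : (fun N => (2 * M + 2 * e N) ^+ (n + k) * (2^-1 ^+ k * (x N * (e N)^-1 ^+ k))) @ \oo --> pi ^+ n.+1 * f 0 * 2 ^+ n.
  by rewrite (_ : (fun N => _) = (fun=> pi ^+ n.+1 * f 0 * 2 ^+ n)); [exact: cvg_cst|apply/funext].
have := cvg_unique _ L L'; rewrite mulr0 addr0 exprMn !exprD (exprVn 2 k) => /(_ _) E.
have -> : pi ^+ n.+1 * f 0 / M ^+ n = (pi ^+ n.+1 * f 0 * 2 ^+ n) / (2 ^+ n * M ^+ n).
  by field; rewrite !expf_neq0 ?gt_eqF.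
rewrite -E //.
have n1 : 2 ^+ n != 0 :> R by rewrite expf_neq0.
have n2 : 2 ^+ k != 0 :> R by rewrite expf_neq0.
have n3 : M ^+ n != 0 by rewrite expf_neq0 // gt_eqF.
have n4 : k`!%:R != 0 :> R by rewrite pnatr_eq0 -lt0n fact_gt0.
move: n1 n2 n3 n4; set z1 := 2 ^+ n; set z2 := 2 ^+ k; set z3 := M ^+ n; set z4 := k`!%:R.
set z5 := M ^+ k; set u := (-1) ^+ k => n1 n2 n3 n4.
by field; rewrite n1 n2 n3 n4.
Unshelve. all: by end_near. Qed.

End Reproduce.

(** * Laguerre functions and spectral kernels *)

Section Laguerre.
Variable R : realType.

(** The Laguerre polynomial $L_k^{(a)}$. The usual $\binom{k+a}{k-i}$ is written $\binom{k+a}{i+a}$,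
    which vanishes by itself for $i>k$, so [coef_lag] holds for every index. *)
Definition lag (a k : nat) : {poly R} :=
  \poly_(i < k.+1) ((-1) ^+ i * 'C(k + a, i + a)%:R / i`!%:R).

Lemma fact_neq0 k : k`!%:R != 0 :> R.
Proof. by rewrite pnatr_eq0 -lt0n fact_gt0. Qed.

Lemma coef_lag a k i : (lag a k)`_i = (-1) ^+ i * 'C(k + a, i + a)%:R / i`!%:R.
Proof.
rewrite coef_poly; case: ltnP => // ki.
by rewrite bin_small ?mulr0 ?mul0r // ltn_add2r.
Qed.

Lemma lag0 a : lag a 0 = 1.
Proof.
apply/polyP => i; rewrite coef_lag coef1; case: i => [|i].
  by rewrite expr0 mul1r add0n binn fact0 divr1.
by rewrite bin_small ?mulr0 ?mul0r // ltn_add2r.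
Qed.

Lemma lag_pascal a k : lag a.+1 k.+1 - lag a.+1 k = lag a k.+1.
Proof.
apply/polyP => i; rewrite coefB !coef_lag -mulrBl -mulrBr; congr (_ * _ / _).
have -> : (k.+1 + a.+1 = (k + a.+1).+1)%N by rewrite addSn.
have -> : (i + a.+1 = (i + a).+1)%N by rewrite addnS.
by rewrite binS natrD addrAC subrr add0r addnS addSn.
Qed.

Lemma deriv_lag a k : (lag a k.+1)^`() = - lag a.+1 k.
Proof.
apply/polyP => i; rewrite coef_deriv coefN !coef_lag.
have -> : (k.+1 + a = k + a.+1)%N by rewrite addSnnS.
have -> : (i.+1 + a = i + a.+1)%N by rewrite addSnnS.
rewrite exprS factS natrM -(mulr_natr (_ / _)).
have i0 : i.+1%:R != 0 :> R by rewrite pnatr_eq0.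
have F (z u e c : R) : z != 0 -> u != 0 -> -1 * e * c / (z * u) * z = - (e * c / u).
  by move=> z0 u0; field; rewrite ?z0 ?u0.
by rewrite F ?fact_neq0.
Qed.

Lemma coef_lag_rec a k j : (lag a k)`_j.+1 * j.+1%:R * (j + a.+1)%:R + (lag a k)`_j * (k%:R - j%:R) = 0.
Proof.
rewrite !coef_lag factS natrM exprS.
have -> : (j.+1 + a = (j + a).+1)%N by [].
have -> : (j + a.+1 = (j + a).+1)%N by rewrite addnS.
have := mul_bin_left (k + a) (j + a); set A := 'C(_, (j + a).+1); set B := 'C(_, j + a).
move=> /(congr1 (fun x : nat => x%:R : R)); rewrite !natrM => E.
have E2 : ((k + a) - (j + a))%:R * B%:R = (k%:R - j%:R) * B%:R :> R.
  have [jk|kj] := leqP j k; first by rewrite natrB ?leq_add2r // !natrD; congr (_ * _); ring.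
  by rewrite /B bin_small ?mulr0 // ltn_add2r.
rewrite E2 in E.
have z0 : j.+1%:R != 0 :> R by rewrite pnatr_eq0.
have F (z u e w y b x : R) : z != 0 -> u != 0 -> w * y = x * b ->
    -1 * e * y / (z * u) * z * w + e * b / u * x = 0.
  move=> z1 u1 H; transitivity (e / u * (x * b - w * y)); last by rewrite H subrr mulr0.
  by field; rewrite ?z1 ?u1.
by apply: F => //; exact: fact_neq0.
Qed.

Lemma lag_ode a k : 'X * (lag a k)^`()^`() + (a.+1%:R - 'X) * (lag a k)^`() + k%:R * lag a k = 0.
Proof.
apply/polyP => i; rewrite !coefD mulrBl coefB coef0 !coefXM !mulr_natl !coefMn !coef_deriv.
have := coef_lag_rec a k i; case: i => [|i] /=.
  set A := (lag a k)`_1; set B := (lag a k)`_0 => E; rewrite -[RHS]E; ring.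
set A := (lag a k)`_i.+2; set B := (lag a k)`_i.+1 => E; rewrite -[RHS]E natrD; ring.
Qed.

Definition lagv (a k : nat) (x : R) : R := (lag a k).[x].
Definition phi (a k : nat) (x : R) : R := pexp 2^-1 (lag a k) x.

Lemma phiE a k x : phi a k x = lagv a k x * expR (- 2^-1 * x).
Proof. by []. Qed.

Lemma lag_rec5 j k : k.+1%:R *: lag j k.+1 - (k.+1 + j)%:R *: lag j k = - ('X * lag j.+1 k).
Proof.
apply/polyP => i; rewrite coefN coefB !coefZ coefXM !coef_lag.
have := mul_bin_down (k.+1 + j) (i + j); move=> /(congr1 (fun x : nat => x%:R : R)); rewrite !natrM.
have -> : ((k.+1 + j).-1 = k + j)%N by [].
move=> E.
have E2 : ((k.+1 + j) - (i + j))%:R * 'C(k.+1 + j, i + j)%:R = (k.+1%:R - i%:R) * 'C(k.+1 + j, i + j)%:R :> R.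
  have [jk|kj] := leqP i k.+1; first by rewrite natrB ?leq_add2r // !natrD; congr (_ * _); ring.
  by rewrite bin_small ?mulr0 // ltn_add2r.
rewrite E2 in E.
rewrite mulrA [X in _ - X]mulrA [X in _ - X / _]mulrCA E.
case: i E E2 => [|i] E E2 /=.
  by rewrite fact0 expr0 !divr1; ring.
have -> : (k + j.+1 = k.+1 + j)%N by rewrite addSnnS.
have -> : (i + j.+1 = i.+1 + j)%N by rewrite addSnnS.
rewrite factS natrM exprS.
have z0 : i.+1%:R != 0 :> R by rewrite pnatr_eq0.
have F (z u e c y : R) : z != 0 -> u != 0 ->
    y * (-1 * e * c) / (z * u) - -1 * e * ((y - z) * c) / (z * u) = - (e * c / u).
  by move=> z1 u1; field; rewrite ?z1 ?u1.
by rewrite F ?fact_neq0.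
Qed.

Lemma lead_lag a k : (lag a k)`_k = (-1) ^+ k / k`!%:R.
Proof. by rewrite coef_lag binn mulr1. Qed.

Lemma lag_at0 a k : (lag a k).[0] = 'C(k + a, a)%:R.
Proof. by rewrite horner_coef0 coef_lag expr0 mul1r fact0 divr1 add0n. Qed.

Lemma size_lag a k : (size (lag a k) <= k.+1)%N.
Proof. exact: size_poly. Qed.

End Laguerre.

Section Kernel.
Variables (R : realType) (n : nat).
Notation pt := (pt R n).
Notation bpt := (bpt R n).
Notation haar := (haar R n).
Notation ct := (@ct n).
Notation rho := (@rho2 R n).
Notation tc := (@tcoord R n).
Notation L1 := (@L1 _ bpt R haar).
Variable m : nat.
Hypothesis m0 : (0 < m)%N.
Hypothesis n0 : (0 < n)%N.
Notation M := (m%:R : R).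
Notation evk := (@eigval R n m).
Let M0 : 0 < M. Proof. by rewrite ltr0n. Qed.
Let s0 : 0 < M / 2. Proof. by rewrite divr_gt0. Qed.

Definition lagM (l : nat) : {poly R} := lag R n.-1 l \Po (M *: 'X).
Definition ef (l : nat) (al : R) (q : pt) : R := pexp (M / 2) (lagM l) (rho q) * om m al (tc q).

Lemma lap_horner (c1 c2 x : R) (P0 P1 P2 : {poly R}) :
  (- (4 *: ('X * P2)) - c1 *: P1 + c2 *: ('X * P0)).[x] = - (4 * (x * P2.[x])) - c1 * P1.[x] + c2 * (x * P0.[x]).
Proof. by rewrite !(hornerD, hornerN, hornerZ, hornerM, hornerX). Qed.

Lemma lagM_horner l x : (lagM l).[x] = (lag R n.-1 l).[M * x].
Proof. by rewrite /lagM horner_comp hornerZ hornerX. Qed.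

Lemma pexp_phi l x : pexp (M / 2) (lagM l) x = phi n.-1 l (M * x).
Proof.
rewrite /pexp /phi /pexp lagM_horner; congr (_ * expR _).
by field.
Qed.

Lemma lagM_ode l x :
  (- (4 *: ('X * dpoly (M / 2) (dpoly (M / 2) (lagM l)))) - (4 * n%:R) *: dpoly (M / 2) (lagM l)
   + (M ^+ 2) *: ('X * lagM l)).[x] = evk l * (lagM l).[x].
Proof.
have d1 : (lagM l)^`() = M *: ((lag R n.-1 l)^`() \Po (M *: 'X)).
  by rewrite /lagM deriv_comp derivZ derivX -scalerAr mulr1.
have d2 : (lagM l)^`()^`() = M ^+ 2 *: ((lag R n.-1 l)^`()^`() \Po (M *: 'X)).
  by rewrite d1 derivZ deriv_comp derivZ derivX -scalerAr mulr1 scalerA expr2.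
have e1 : (lagM l)^`().[x] = M * (lag R n.-1 l)^`().[M * x] by rewrite d1 hornerZ horner_comp hornerZ hornerX.
have e2 : (lagM l)^`()^`().[x] = M ^+ 2 * (lag R n.-1 l)^`()^`().[M * x] by rewrite d2 hornerZ horner_comp hornerZ hornerX.
have dp1 : (dpoly (M / 2) (lagM l)).[x] = (lagM l)^`().[x] - M / 2 * (lagM l).[x].
  by rewrite /dpoly hornerD hornerN hornerZ.
have dp2 : (dpoly (M / 2) (dpoly (M / 2) (lagM l))).[x] =
    (lagM l)^`()^`().[x] - M / 2 * (lagM l)^`().[x] - M / 2 * ((lagM l)^`().[x] - M / 2 * (lagM l).[x]).
  by rewrite {1}/dpoly hornerD hornerN hornerZ dp1 /dpoly derivB derivZ hornerD hornerN hornerZ.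
have := congr1 (fun P : {poly R} => P.[M * x]) (lag_ode R n.-1 l).
rewrite !(hornerD, hornerN, hornerM, hornerX, horner0) (prednK n0) -!polyC_natr !hornerC.
rewrite !(hornerZ, hornerM, hornerX) dp2 dp1 e2 e1 lagM_horner.
set u := (lag R n.-1 l)^`()^`().[_]; set v := (lag R n.-1 l)^`().[_]; set w := (lag R n.-1 l).[_] => E.
rewrite /eigval.
have -> : - (4 * (x * (M ^+ 2 * u - M / 2 * (M * v) - M / 2 * (M * v - M / 2 * w)))) - 4 * n%:R * (M * v - M / 2 * w)
  + M ^+ 2 * (x * w) = - (4 * M) * (M * x * u + (n%:R - M * x) * v) + 2 * n%:R * M * w by field.
have -> : M * x * u + (n%:R - M * x) * v = - (l%:R * w).
  by apply/eqP; rewrite -addr_eq0 E.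
by ring.
Qed.

Lemma smooth_pexp s P : smooth (fun q : pt => pexp s P (rho q)).
Proof.
have H := @smooth_chain R n rho (fun i => pexp s (iter i (dpoly s) P)) (@smooth_rho R n).
by apply: (H _ 0%N) => i x; exact: der_pexp.
Qed.

Lemma smooth_om al : smooth (om m al \o tc).
Proof.
have H := @smooth_chain R n tc (fun i x => M ^+ i * cos (M * x + (al + i%:R * (pi / 2)))) (@smooth_coord R n ct).
have := H _ 0%N; rewrite (_ : (fun x => _) = om m al); last first.
  by apply/funext => x; rewrite expr0 mul1r mul0r addr0.
apply => i x.
have d := derP_Z (M ^+ i) (derP_comp (is_derive_cos _) (derP_aff M (al + i%:R * (pi / 2)) x)).
have E : M * x + (al + i.+1%:R * (pi / 2)) = M * x + (al + i%:R * (pi / 2)) + pi / 2 by rewrite -natr1; ring.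
by apply: (derP_eq d); rewrite E cosDpihalf exprSr; ring.
Qed.

Lemma smooth_ef l al : smooth (ef l al).
Proof. exact: (smoothM (smooth_pexp _ _) (smooth_om al)). Qed.

Lemma subLap_ef l al : subLap (ef l al) = (fun q => evk l * ef l al q).
Proof.
apply/funext => q.
have -> : ef l al = radt (pexp (M / 2) (lagM l)) (om m al) by [].
rewrite (@subLap_radt R n _ _ _ _ _ _ (der_pexp _ _) (der_pexp _ _) (@cont_pexp _ _ _) (der_om m al) (der_om1 m al) (@cont_om2 _ m al)).
have E := lagM_ode l (rho q).
transitivity (evk l * (lagM l).[rho q] * (expR (- (M / 2) * rho q) * om m al (tc q))); last by rewrite /radt /= /pexp; ring.
move: E; set P2 := dpoly _ (dpoly _ _); set P1 := dpoly _ (lagM l); set P0 := lagM l => E.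
rewrite -E /om2 -/(om m al (tc q)) /pexp.
rewrite lap_horner.
by ring.
Qed.

Lemma Dt_ef l al : Dt (Dt (ef l al)) = (fun q => - (M ^+ 2 * ef l al q)).
Proof.
have E : ef l al = radt (pexp (M / 2) (lagM l)) (om m al) by [].
have D1 : Dt (ef l al) = radt (pexp (M / 2) (lagM l)) (om1 m al).
  rewrite E (@Dt_radt R n _ _ _ _ _ _ (der_pexp _ _) (der_pexp _ _) (@cont_pexp _ _ _) (der_om m al) (der_om1 m al) (@cont_om2 _ m al)) //.
have dom2 x : der (om2 m al) x (- M ^+ 2 * om1 m al x) by exact: (derP_Z _ (der_om m al x)).
have com : continuous (fun x => - M ^+ 2 * om1 m al x).
  by apply: derP_cont => x; eexists; exact: (derP_Z _ (der_om1 m al x)).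
rewrite D1 (@Dt_radt R n _ _ _ _ _ _ (der_pexp _ _) (der_pexp _ _) (@cont_pexp _ _ _) (der_om1 m al) dom2 com).
by apply/funext => q; rewrite /ef /= /om2 /om; ring.
Qed.

Lemma tperiodic_ef l al : tperiodic (ef l al).
Proof.
move=> q; rewrite /ef tperiodic_rho -[om m al (tc (q + _))]/((om m al \o tc) (q + _)).
by rewrite tperiodic_om.
Qed.

Lemma meas_ef l al : measurable_fun setT (ef l al : bpt -> R).
Proof. exact: (continuous_measurable_bpt (@pexp_om_cont R n m (M / 2) (lagM l) al)). Qed.

Lemma L2_ef l al : L1 (fun q => ef l al q ^+ 2).
Proof. by apply: L1_decay2; [exact: meas_ef|exact: pexp_om_decay]. Qed.

Lemma Vk_ef l al : Vk m (evk l) (ef l al).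
Proof. by split; [exact: smooth_ef|exact: tperiodic_ef|exact: L2_ef|exact: subLap_ef|exact: Dt_ef]. Qed.

Lemma evk_inj k l : evk k = evk l -> k = l.
Proof.
rewrite /eigval => h; have nz : 2 * M != 0 by rewrite mulf_neq0 // gt_eqF.
have h1 := addIr _ (mulfI nz h); have nz2 : 2 != 0 :> R by [].
by apply/eqP; rewrite -(eqr_nat R) (mulfI nz2 h1).
Qed.

(** The integrated equation is tested on the radial eigenfunction of index [l]: both sides are
    multiples of the same integral, with different eigenvalues. *)
Lemma ef_orth k l al f : Vk m (evk k) f -> k != l -> \int[haar]_q (f q * ef l al q) = 0.
Proof.
move=> Vf kl; have := ibp_pexp al (lagM l) s0 Vf; cbv zeta.
rewrite (_ : (fun q => f q * (pexp _ (_ + _) _ * _)) = (fun q => evk l * (f q * ef l al q))); last first.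
  by apply/funext => q; rewrite /ef {1}/pexp lagM_ode /pexp; ring.
rewrite intZ; last exact: (L1_fpexp Vf).
move=> /eqP; rewrite -subr_eq0 -mulrBl mulf_eq0 subr_eq0 => /orP[/eqP e|/eqP //].
by rewrite (evk_inj e) eqxx in kl.
Qed.

Definition cK : R := M ^+ n / pi ^+ n.+1.
Definition kn (l : nat) (q : pt) : R := cK * ef l 0 q.

Lemma cK_gt0 : 0 < cK.
Proof. by rewrite divr_gt0 // exprn_gt0 // pi_gt0. Qed.

(** All moments below degree [k] vanish, so only the leading coefficient of the Laguerre polynomial
    contributes, and [mom_k] evaluates it. *)
Lemma ef_repr k f : Vk m (evk k) f -> \int[haar]_q (f q * ef k 0 q) = f 0 / cK.
Proof.
move=> Vf; rewrite -[LHS]/(moment m f (M / 2) (lagM k)).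
have E : lagM k = \sum_(i < k.+1) ((lag R n.-1 k)`_i * M ^+ i) *: 'X^i.
  rewrite /lagM comp_polyE.
  rewrite (big_ord_widen k.+1 (fun i => (lag R n.-1 k)`_i *: (M *: 'X) ^+ i)) ?size_lag //.
  rewrite big_mkcond; apply: eq_bigr => i _; rewrite exprZn scalerA; case: ltnP => // h.
  by rewrite (nth_default 0 h) mul0r scale0r.
rewrite E (mom_sum Vf) // big_ord_recr /= big1 ?add0r => [|i _]; last first.
  by rewrite (momZ Vf) // (mom_small m0 Vf) // mulr0.
have := mom_k m0 Vf; rewrite /cK => H.
transitivity ((-1) ^+ k * M ^+ k / k`!%:R * moment m f (M / 2) 'X^k).
  by rewrite (momZ Vf) // lead_lag; ring.
by rewrite H invf_div mulrA [_ * f 0]mulrC.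
Qed.

Lemma Vk_Z (c : R) lam (f : pt -> R) : Vk m lam f -> Vk m lam (fun q => c * f q).
Proof.
move=> [sf pf f2 Lf Df].
have sN := smoothP f; have sf' := (sN).1 sf.
have EX j (g : pt -> R) : smooth g -> Xop j (fun q => c * g q) = (fun q => c * Xop j g q).
  move=> /smoothP sg; apply/funext => q.
  have := XopM j q (@smoothN_cst R n 1 c) (sg 1%N).
  by rewrite X_cst mul0r add0r.
have EY j (g : pt -> R) : smooth g -> Yop j (fun q => c * g q) = (fun q => c * Yop j g q).
  move=> /smoothP sg; apply/funext => q.
  have := YopM j q (@smoothN_cst R n 1 c) (sg 1%N).
  by rewrite Y_cst mul0r add0r.
have ED (g : pt -> R) : smooth g -> Dt (fun q => c * g q) = (fun q => c * Dt g q).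
  move=> /smoothP sg; apply/funext => q.
  have := derM q (eb R ct) (@smoothN_cst R n 1 c) (sg 1%N).
  by rewrite derive_cst mul0r add0r.
split.
- exact: smoothZ.
- by move=> q; rewrite pf.
- have := L1Z (c ^+ 2) f2; rewrite (_ : (fun x => _) = (fun q => (c * f q) ^+ 2)) //.
  by apply/funext => q; rewrite exprMn.
- apply/funext => q; rewrite mulrCA -[lam * f q]/((fun q => lam * f q) q) -Lf /subLap mulrN mulr_sumr; congr (- _).
  apply: eq_bigr => j _; rewrite (EX _ _ sf) (EY _ _ sf) (EX _ _ (smooth_Xop j sf)) (EY _ _ (smooth_Yop j sf)).
  exact: (esym (mulrDr c _ _)).
- rewrite (ED _ sf) (ED _ (smoothD _ sf)) -/(Dt f) Df; apply/funext => q; ring.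
Qed.

Lemma Vk_kn l : Vk m (evk l) (kn l).
Proof. by apply: Vk_Z; exact: Vk_ef. Qed.

Lemma kn_repr k l f : Vk m (evk k) f -> \int[haar]_q (f q * kn l q) = if k == l then f 0 else 0.
Proof.
move=> Vf; rewrite (_ : (fun q => f q * kn l q) = (fun q => cK * (f q * ef l 0 q))); last first.
  by apply/funext => q; rewrite /kn; ring.
rewrite intZ; last exact: (L1_fpexp Vf).
case: eqVneq => [<-|kl]; first by rewrite ef_repr // mulrC divfK // gt_eqF // cK_gt0.
by rewrite (ef_orth 0 Vf kl) mulr0.
Qed.

Definition KK (l : nat) (w q : bpt) : R := kn l (ltr (- (w : pt)) (q : pt)).

Lemma Vk_KK l w : Vk m (evk l) (KK l w).
Proof. exact: (Vk_ltr (- (w : pt)) (Vk_kn l)). Qed.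

Lemma Vk_L2 lam f : Vk m lam f -> L1 (fun q => f q ^+ 2).
Proof. by case. Qed.

Lemma Vk_measurable lam f : Vk m lam f -> measurable_fun setT (f : bpt -> R).
Proof. by case=> sf _ _ _ _; exact: (continuous_measurable_bpt (smooth_cont sf)). Qed.

(** Translation by [w] preserves both the Haar integral and the eigenspace, so reproduction at the
    origin becomes reproduction at [w]. *)
Lemma KK_repr k l f (w : pt) : Vk m (evk k) f -> \int[haar]_q (f q * KK l w q) = if k == l then f w else 0.
Proof.
move=> Vf; have Vw := Vk_ltr w Vf.
have pK : tperiodic (fun q => f q * KK l w q).
  by move=> q; case: Vf => _ -> _ _ _; case: (Vk_KK l w) => _ -> _ _ _.
have IK : L1 (fun q => f q * KK l w q).
  by apply: L1_mul; [exact: (Vk_measurable Vf)|exact: (Vk_measurable (Vk_KK l w))|exact: (Vk_L2 Vf)|exact: (Vk_L2 (Vk_KK l w))].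
rewrite -(int_ltr w pK IK).
rewrite (_ : (fun q => _) = (fun q => (f \o ltr w) q * kn l q)); last first.
  by apply/funext => q; rewrite /KK ltrK.
by rewrite (kn_repr l Vw) /= ltr0.
Qed.

Lemma KK_sym l (w q : bpt) : KK l w q = KK l q w.
Proof.
rewrite /KK /kn /ef; have -> : rho (ltr (- (w : pt)) (q : pt)) = rho (ltr (- (q : pt)) (w : pt)).
  by apply: eq_bigr => j _; rewrite !ltr_cx !ltr_cy !mxE; ring.
congr (_ * (_ * _)); rewrite /om !addr0 /tcoord !ltr_ct !mxE sgN sgC -cosN; congr cos.
by rewrite sgN; ring.
Qed.

Lemma KK_orth l l' (w z : bpt) : \int[haar]_y (KK l w y * KK l' z y) = if l == l' then KK l w z else 0.
Proof. by rewrite (KK_repr l' z (Vk_KK l w)). Qed.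

Lemma rho0 : rho 0 = 0.
Proof. by rewrite /rho2 big1 // => j _; rewrite !mxE expr0n addr0. Qed.

Lemma KK_diag l (w : bpt) : KK l w w = cK * 'C(l + n.-1, n.-1)%:R.
Proof.
rewrite /KK /kn /ef /pexp lagM_horner.
have -> : ltr (- (w : pt)) (w : pt) = 0 by rewrite /ltr sgN sgww oppr0 scale0r addr0 subrr.
rewrite rho0 mulr0 lag_at0 mulr0 expR0 mulr1 /om /tcoord mxE mulr0 add0r cos0 mulr1 //.
Qed.

Lemma meas_KK l : measurable_fun setT (fun z : bpt * bpt => KK l z.1 z.2).
Proof.
have mk := Vk_measurable (Vk_kn l).
suff mz : measurable_fun setT (fun z : bpt * bpt => ltr (- (z.1 : pt)) (z.2 : pt) : bpt).
  exact: (measurableT_comp mk mz).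
apply: measurable_bpt => i.
have mc j : measurable_fun setT (fun z : bpt * bpt => (z.1 : pt) 0 j).
  exact: (measurableT_comp (@measurable_coord R n j) measurable_fst).
have mc2 j : measurable_fun setT (fun z : bpt * bpt => (z.2 : pt) 0 j).
  exact: (measurableT_comp (@measurable_coord R n j) measurable_snd).
apply: (eq_measurable_fun (fun z : bpt * bpt => ((z.2 : pt) 0 i - (z.1 : pt) 0 i)
  + (\sum_(j < n) (- (z.1 : pt) 0 (cx j) * (z.2 : pt) 0 (cy j) - - (z.1 : pt) 0 (cy j) * (z.2 : pt) 0 (cx j))) * eb R ct 0 i)).
  by move=> z _; rewrite /ltr /sg !mxE; congr (_ + _ * _); apply: eq_bigr => j _; rewrite !mxE.
apply: measurable_funD; first exact: measurable_funB.
apply: measurable_funM; last exact: measurable_cst.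
apply: measurable_sum => j; apply: measurable_funB; apply: measurable_funM => //; exact: measurableT_comp.
Qed.

Lemma KK_phi l (w q : bpt) : KK l w q = cK * (phi n.-1 l (M * rho (ltr (- (w : pt)) (q : pt))) * om m 0 (tc (ltr (- (w : pt)) (q : pt)))).
Proof. by rewrite /KK /kn /ef pexp_phi. Qed.

End Kernel.

(** * Reproducing kernels and abstract interpolation *)

Lemma eqR d (T : measurableType d) (R : realType) (mu : {measure set T -> \bar R}) (g f : T -> R) :
  f =1 g -> \int[mu]_x f x = \int[mu]_x g x.
Proof. by move=> /funext ->. Qed.

Section RKHS.
Context d (T : measurableType d) (R : realType) (mu : {sigma_finite_measure set T -> \bar R}).
Notation L1 := (@L1 _ T R mu).
Variable K : nat -> T -> T -> R.
Hypothesis mK : forall l, measurable_fun setT (fun z : T * T => K l z.1 z.2).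
Hypothesis K_sym : forall l x y, K l x y = K l y x.
Hypothesis K_L2 : forall l x, L1 (fun y => K l x y ^+ 2).
Hypothesis K_orth : forall l l' x z, \int[mu]_y (K l x y * K l' z y) = if l == l' then K l x z else 0.
Hypothesis K_bd : forall l, exists D, forall x, K l x x <= D.

Lemma mK1 l x : measurable_fun setT (K l x).
Proof. exact: (measurableT_comp (mK l) (@pair1_measurable _ _ T T x)). Qed.

Lemma K_norm l x : \int[mu]_y (K l x y ^+ 2) = K l x x.
Proof. by have := K_orth l l x x; rewrite eqxx => <-. Qed.

Lemma K_diag_ge0 l x : 0 <= K l x x.
Proof. by rewrite -K_norm; apply: int_ge0 => y; exact: sqr_ge0. Qed.

(* the bound of the weight |F| on K(x,.)^2 is carried by the diagonal *)
Lemma K_bound l : exists2 D, 0 <= D & forall x y, `|K l x y| <= D.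
Proof.
have [D hD] := K_bd l; exists `|D| => // x y.
have := cauchy_schwarz (mK1 l x) (mK1 l y) (K_L2 l x) (K_L2 l y).
rewrite K_orth eqxx !K_norm => h.
have h2 : K l x y ^+ 2 <= `|D| ^+ 2.
  by rewrite (le_trans h) // expr2 ler_pM ?K_diag_ge0 // (le_trans (hD _)) // ler_norm.
by rewrite -(ler_pXn2r (n := 2)) ?nnegrE // real_normK // num_real.
Qed.

(** Bounded integrable functions cover the level-set functions used later and make all the double
    integrals against the kernels absolutely convergent. *)
Definition nice (F : T -> R) := [/\ measurable_fun setT F, L1 F & exists c, forall x, `|F x| <= c].

Lemma nice_L2 F : nice F -> L1 (fun x => F x ^+ 2).
Proof.
move=> [mF iF [c hc]]; apply: (L1_le _ (L1Z c (L1_norm iF))).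
  by rewrite (_ : (fun x => _) = (fun x => F x * F x)); [exact: measM|apply/funext => x; rewrite expr2].
by move=> x; rewrite expr2 normrM ler_wpM2r.
Qed.

Lemma niceD F G : nice F -> nice G -> nice (fun x => F x + G x).
Proof.
move=> [mF iF [c hc]] [mG iG [e he]]; split; [exact: measurable_funD|exact: L1D|exists (c + e) => x].
by rewrite (le_trans (ler_normD _ _)) // lerD.
Qed.

Lemma niceZ (c : R) F : nice F -> nice (fun x => c * F x).
Proof.
move=> [mF iF [e he]]; split; [exact: measM|exact: L1Z|exists (`|c| * e) => x].
by rewrite normrM ler_wpM2l.
Qed.

Lemma L1_KF l x F : nice F -> L1 (fun y => K l x y * F y).
Proof. by move=> nF; case: (nF) => mF _ _; apply: L1_mul => //; [exact: mK1|exact: nice_L2]. Qed.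

Definition PP (l : nat) (F : T -> R) (x : T) : R := \int[mu]_y (K l x y * F y).

(* Fubini for K(x,y) F(y) H(x) *)
Section Swap.
Variables (l : nat) (F H : T -> R).
Hypotheses (nF : nice F) (mH : measurable_fun setT H) (H2 : L1 (fun x => H x ^+ 2)).
Let g (z : T * T) : \bar R := (K l z.1 z.2 * F z.2 * H z.1)%:E.

Let mg : measurable_fun setT g.
Proof.
case: nF => mF _ _; apply/measurable_EFinP; apply: measM; [apply: measM => //|].
  exact: (measurableT_comp mF measurable_snd).
exact: (measurableT_comp mH measurable_fst).
Qed.

Let ig : (mu \x mu)%E.-integrable setT g.
Proof.
apply/(integrable21ltyP _ _ mg).
have [D D0 hD] := K_bound l; case: (nF) => mF iF _.
pose c := (\int[mu]_x (H x ^+ 2)) + D.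
have Hx2 x : `|H x| ^+ 2 = H x ^+ 2 by rewrite real_normK // num_real.
have mHn : measurable_fun setT (fun x => `|H x|) by exact: measurableT_comp.
have bound y : (\int[mu]_x `|g (x, y)|)%E = (`|F y| * \int[mu]_x (`|K l y x| * `|H x|))%:E
   /\ (`|F y| * \int[mu]_x (`|K l y x| * `|H x|)) <= `|F y| * c.
  have Kn2 x : `|K l y x| ^+ 2 = K l y x ^+ 2 by rewrite real_normK // num_real.
  have I1 : L1 (fun x => `|K l y x| * `|H x|).
    apply: L1_mul => //; first by apply: measurableT_comp => //; exact: mK1.
      by under eq_fun do rewrite Kn2; exact: K_L2.
    by under eq_fun do rewrite Hx2.
  split.
    rewrite -intZ // -intE; last exact: L1Z.
    by apply: eq_integral => x _; rewrite /g /= !normrM K_sym mulrAC mulrC.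
  apply: ler_wpM2l => //.
  have IK := K_L2 l y.
  apply: (@le_trans _ _ (\int[mu]_x (H x ^+ 2 + K l y x ^+ 2))).
    apply: int_le => //; first exact: L1D.
    move=> x; rewrite -Hx2 -Kn2; have := sqr_ge0 (`|H x| - `|K l y x|).
    by have := normr_ge0 (H x); have := normr_ge0 (K l y x); nra.
  by rewrite intD // lerD2l K_norm (le_trans (ler_norm _)).
apply: (@le_lt_trans _ _ (\int[mu]_y (`|F y| * c)%:E)%E).
  apply: ge0_le_integral => //.
  - by move=> y _; apply: integral_ge0.
  - exact: (@measurable_fun_fubini_tonelli_G _ _ T T R mu (fun z => `|g z|%E) (measurableT_comp (@abse_measurable R setT) mg) (fun=> abse_ge0 _)).
  - by apply/measurable_EFinP; apply: measurable_funM => //; exact: measurableT_comp.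
  by move=> y _; case: (bound y) => -> h; rewrite lee_fin.
have Ic : L1 (fun y => `|F y| * c).
  by rewrite (_ : (fun y => _) = (fun y => c * `|F y|)); [exact: L1Z (L1_norm iF)|apply/funext => y; rewrite mulrC].
by rewrite (intE Ic) ltry.
Qed.

Lemma swap : \int[mu]_x (PP l F x * H x) = \int[mu]_y (F y * \int[mu]_x (K l y x * H x)).
Proof.
have := @Fubini _ _ T T R mu mu g ig => E.
rewrite /Rintegral; congr fine.
transitivity (\int[mu]_x \int[mu]_y g (x, y))%E.
  apply: eq_integral => x _; rewrite /PP mulrC.
  rewrite -intZ; last exact: L1_KF.
  rewrite -intE; last by apply: L1Z; exact: L1_KF.
  by apply: eq_integral => y _; rewrite /g mulrC.
rewrite E; apply: eq_integral => y _.
have IKH : L1 (fun x => K l y x * H x) by apply: L1_mul => //; exact: mK1.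
rewrite -/(Rintegral _ _ _) -intZ // -intE; last exact: L1Z.
by apply: eq_integral => x _; rewrite /g /= K_sym -mulrA mulrCA.
Qed.

End Swap.

Lemma meas_PP l F : measurable_fun setT F -> measurable_fun setT (PP l F).
Proof.
move=> mF; pose h (z : T * T) : \bar R := (K l z.1 z.2 * F z.2)%:E.
have mh : measurable_fun setT h.
  by apply/measurable_EFinP; apply: measM => //; exact: (measurableT_comp mF measurable_snd).
pose hp := (fun z => (h^\+ z)%E); pose hn := (fun z => (h^\- z)%E).
have m1 := @measurable_fun_fubini_tonelli_F _ _ T T R mu hp (measurable_funepos mh) (fun z => funepos_ge0 h z).
have m2 := @measurable_fun_fubini_tonelli_F _ _ T T R mu hn (measurable_funeneg mh) (fun z => funeneg_ge0 h z).
apply: eq_measurable_fun (measurableT_comp (@fine_measurable R setT measurableT) (emeasurable_funB m1 m2)).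
move=> x _; rewrite /PP /Rintegral /= integralE; congr (fine (_ - _)); apply: eq_integral => y _.
  by rewrite /hp !funeposE.
by rewrite /hn !funenegE.
Qed.

(** Cauchy-Schwarz with weight $|F|$ gives $|P_lF(x)|^2\le\|F\|_1\int K_l(x,y)^2|F(y)|\,dy$; then
    Tonelli and the bounded diagonal of $K_l$. *)
Lemma L2_PP l F : nice F -> L1 (fun x => PP l F x ^+ 2).
Proof.
move=> nF; have [D D0 hD] := K_bound l; case: (nF) => mF iF _.
have mFn : measurable_fun setT (fun y => `|F y|) by exact: measurableT_comp.
set I := \int[mu]_y `|F y|; have I0 : 0 <= I by apply: int_ge0.
pose h (z : T * T) : \bar R := (K l z.1 z.2 ^+ 2 * `|F z.2|)%:E.
have mh : measurable_fun setT h.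
  apply/measurable_EFinP; apply: measM; last exact: (measurableT_comp mFn measurable_snd).
  by apply: measurable_funX; exact: mK.
have h0 z : (0 <= h z)%E by rewrite lee_fin mulr_ge0 // sqr_ge0.
have I1 x : L1 (fun y => K l x y ^+ 2 * `|F y|).
  apply: (L1_le _ (L1Z (D ^+ 2) (L1_norm iF))).
    by apply: measM => //; apply: measurable_funX; exact: mK1.
  move=> y; rewrite normrM normr_id ler_wpM2r // normrX ler_pXn2r ?nnegrE //.
have mPP := meas_PP l mF.
have pt x : PP l F x ^+ 2 <= I * \int[mu]_y (K l x y ^+ 2 * `|F y|).
  have sF y : Num.sqrt `|F y| ^+ 2 = `|F y| by rewrite sqr_sqrtr.
  have msq : measurable_fun setT (fun y => Num.sqrt `|F y|).
    exact: (measurableT_comp (continuous_measurable_fun (@sqrt_continuous R)) mFn).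
  have mKn : measurable_fun setT (fun y => `|K l x y|) by apply: measurableT_comp => //; exact: mK1.
  have Ku y : (`|K l x y| * Num.sqrt `|F y|) ^+ 2 = K l x y ^+ 2 * `|F y|.
    by rewrite exprMn sF real_normK // num_real.
  have := @cauchy_schwarz _ T R mu (fun y => `|K l x y| * Num.sqrt `|F y|) (fun y => Num.sqrt `|F y|) (measM mKn msq) msq.
  under eq_fun do rewrite Ku.
  under [in X in _ -> X -> _]eq_fun do rewrite sF.
  move=> /(_ (I1 x) (L1_norm iF)).
  rewrite (@eqR _ T R mu (fun y => `|K l x y * F y|)); last first.
    by move=> y; rewrite -mulrA -expr2 sF normrM.
  rewrite (@eqR _ T R mu (fun y => `|F y|) (fun y => (Num.sqrt `|F y|) ^+ 2)) //.
  rewrite mulrC; apply: le_trans.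
  rewrite -(real_normK (num_real (PP l F x))) ler_pXn2r ?nnegrE //; last by apply: int_ge0.
  by apply: int_abs; exact: L1_KF.
apply: (@L1_ge0 _ T R mu _ (I * (D * I)) _ _ _).1.
- exact: measurable_funX.
- by move=> x; exact: sqr_ge0.
apply: (@le_trans _ _ (\int[mu]_x (I%:E * \int[mu]_y h (x, y)))%E).
  apply: ge0_le_integral => //.
  - by move=> x _; rewrite lee_fin sqr_ge0.
  - by apply/measurable_EFinP; exact: measurable_funX.
  - by apply: measurable_funeM; exact: (@measurable_fun_fubini_tonelli_F _ _ T T R mu h mh h0).
  by move=> x _; rewrite /h (intE (I1 x)) lee_fin.
rewrite ge0_integralZl_EFin //; last 2 first.
- by move=> x _; apply: integral_ge0.
- exact: (@measurable_fun_fubini_tonelli_F _ _ T T R mu h mh h0).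
rewrite EFinM lee_wpmul2l ?lee_fin //.
rewrite (@fubini_tonelli _ _ T T R mu mu h mh h0).
apply: (@le_trans _ _ (\int[mu]_y (D * `|F y|)%:E)%E).
  apply: ge0_le_integral => //.
  - by move=> y _; apply: integral_ge0.
  - exact: (@measurable_fun_fubini_tonelli_G _ _ T T R mu h mh h0).
  - by apply/measurable_EFinP; apply: measM.
  move=> y _; rewrite /h /=.
  have IK := L1Z `|F y| (K_L2 l y).
  rewrite (_ : (fun x => _) = (fun x => (`|F y| * K l y x ^+ 2)%:E)); last first.
    by apply/funext => x; rewrite K_sym mulrC.
  rewrite intE // intZ; last exact: K_L2.
  by rewrite lee_fin mulrC ler_wpM2r // K_norm (le_trans (ler_norm _)).
by rewrite intE; [rewrite lee_fin intZ //; exact: L1_norm|apply: L1Z; exact: L1_norm].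
Qed.

Definition BB (l : nat) (F G : T -> R) : R := \int[mu]_x (PP l F x * G x).

Lemma BB_sym l F G : nice F -> nice G -> BB l F G = BB l G F.
Proof.
move=> nF nG; case: (nG) => mG _ _; rewrite /BB (swap l nF mG (nice_L2 nG)).
by apply: eqR => x; rewrite mulrC.
Qed.

Lemma PP_orth l l' F x : nice F -> \int[mu]_y (K l x y * PP l' F y) = if l == l' then PP l F x else 0.
Proof.
move=> nF; rewrite (eqR _ (g := fun y => PP l' F y * K l x y)); last by move=> y; rewrite mulrC.
rewrite (swap l' nF (mK1 l x) (K_L2 l x)).
rewrite (eqR _ (g := fun y => if l == l' then K l x y * F y else 0)); last first.
  move=> y; rewrite (eqR _ (g := fun z => K l x z * K l' y z)) ?K_orth; last by move=> z; rewrite mulrC.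
  by case: ifP; rewrite ?mulr0 // mulrC.
by case: eqVneq => [->//|_]; rewrite /Rintegral integral0.
Qed.

Lemma BB_PP l l' F G : nice F -> nice G ->
  \int[mu]_x (PP l F x * PP l' G x) = if l == l' then BB l F G else 0.
Proof.
move=> nF nG; case: (nG) (nF) => mG _ _ [mF _ _].
rewrite (swap l nF (meas_PP l' mG) (L2_PP l' nG)).
rewrite (eqR _ (g := fun y => if l == l' then PP l G y * F y else 0)); last first.
  by move=> y; rewrite PP_orth //; case: ifP; rewrite ?mulr0 // mulrC.
by case: eqVneq => [->|_]; [exact: BB_sym|rewrite /Rintegral integral0].
Qed.

Lemma BB_ge0 l F : nice F -> 0 <= BB l F F.
Proof.
move=> nF; have := BB_PP l l nF nF; rewrite eqxx => <-.
by apply: int_ge0 => x; rewrite -expr2 sqr_ge0.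
Qed.

Lemma BB_CS l F G : nice F -> nice G -> BB l F G ^+ 2 <= BB l F F * BB l G G.
Proof.
move=> nF nG; case: (nG) (nF) => mG _ _ [mF _ _].
have E F' G' (n1 : nice F') (n2 : nice G') : BB l F' G' = \int[mu]_x (PP l F' x * PP l G' x).
  by rewrite BB_PP // eqxx.
rewrite (E F G nF nG) (E F F nF nF) (E G G nG nG); have := cauchy_schwarz (meas_PP l mF) (meas_PP l mG) (L2_PP l nF) (L2_PP l nG).
by under [X in _ <= X * _ -> _]eq_Rintegral do rewrite expr2; under [X in _ <= _ * X -> _]eq_Rintegral do rewrite expr2.
Qed.

(** For the sum [G] of the projections, orthogonality makes $\|G\|^2$ and $\langle G,F\rangle$ both
    equal to the left side; Cauchy-Schwarz concludes. *)
Lemma bessel k N F : nice F -> \sum_(i < N) BB (k + i) F F <= \int[mu]_x (F x ^+ 2).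
Proof.
move=> nF; case: (nF) => mF _ _; pose G x := \sum_(i < N) PP (k + i) F x.
have mG : measurable_fun setT G.
  by apply: measurable_sum => i; exact: meas_PP.
have I i j : L1 (fun x => PP (k + i) F x * PP (k + j) F x).
  by apply: L1_mul; [exact: meas_PP|exact: meas_PP|exact: L2_PP|exact: L2_PP].
have IGe x : G x ^+ 2 = \sum_(i < N) \sum_(j < N) PP (k + i) F x * PP (k + j) F x.
  by rewrite expr2 /G mulr_suml; apply: eq_bigr => i _; rewrite mulr_sumr.
have IG : L1 (fun x => G x ^+ 2).
  by under eq_fun do rewrite IGe; apply: L1_sum => i _; apply: L1_sum => j _.
have GG : \int[mu]_x (G x ^+ 2) = \sum_(i < N) BB (k + i) F F.
  rewrite (eqR _ (g := fun x => \sum_(i < N) \sum_(j < N) PP (k + i) F x * PP (k + j) F x)); last by move=> x; rewrite IGe.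
  rewrite int_sum; last by move=> i _; apply: L1_sum => j _.
  apply: eq_bigr => i _; rewrite int_sum //.
  rewrite (bigD1 i) //= BB_PP // eqxx big1 ?addr0 // => j ji.
  by rewrite BB_PP // eqn_add2l ifN // eq_sym.
have GF : \int[mu]_x (G x * F x) = \sum_(i < N) BB (k + i) F F.
  rewrite (eqR _ (g := fun x => \sum_(i < N) PP (k + i) F x * F x)); last by move=> x; rewrite mulr_suml.
  by rewrite int_sum // => i _; apply: L1_mul => //; [exact: meas_PP|exact: L2_PP|exact: nice_L2].
have := cauchy_schwarz mG mF IG (nice_L2 nF); rewrite GG GF.
set S := \sum_(i < N) _; have S0 : 0 <= S by apply: sumr_ge0 => i _; exact: BB_ge0.
have [->|Sn] := eqVneq S 0; first by move=> _; apply: int_ge0 => x; exact: sqr_ge0.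
by rewrite expr2 ler_pM2l // lt_neqAle eq_sym Sn.
Qed.

Lemma BB_kernel (I : Type) (s : seq I) (c : I -> R) (h : I -> nat) (E : R) F G : nice F -> nice G ->
  (forall x y, `|\sum_(i <- s) c i * K (h i) x y| <= E) ->
  `|\sum_(i <- s) c i * BB (h i) F G| <= E * (\int[mu]_x `|F x|) * (\int[mu]_x `|G x|).
Proof.
move=> nF nG hE; case: (nF) (nG) => mF iF _ [mG iG _].
have IPG i : L1 (fun x => PP (h i) F x * G x).
  by apply: L1_mul => //; [exact: meas_PP|exact: L2_PP|exact: nice_L2].
have -> : \sum_(i <- s) c i * BB (h i) F G = \int[mu]_x (\sum_(i <- s) c i * (PP (h i) F x * G x)).
  by rewrite int_sum; [apply: eq_bigr => i _; rewrite intZ|move=> i _; exact: L1Z].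
have IS : L1 (fun x => \sum_(i <- s) c i * (PP (h i) F x * G x)) by apply: L1_sum => i _; exact: L1Z.
apply: (le_trans (int_abs IS)); rewrite -intZ; last exact: L1_norm.
apply: int_le; [exact: L1_norm|exact: L1Z (L1_norm iG)|] => x.
have -> : \sum_(i <- s) c i * (PP (h i) F x * G x) = (\int[mu]_y (\sum_(i <- s) c i * (K (h i) x y * F y))) * G x.
  rewrite int_sum; last by move=> i _; apply: L1Z; exact: L1_KF.
  by rewrite mulr_suml; apply: eq_bigr => i _; rewrite intZ ?mulrA //; exact: L1_KF.
rewrite normrM ler_wpM2r //.
have IK : L1 (fun y => \sum_(i <- s) c i * (K (h i) x y * F y)) by apply: L1_sum => i _; apply: L1Z; exact: L1_KF.
apply: (le_trans (int_abs IK)); rewrite -intZ; last exact: L1_norm.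
apply: int_le; [exact: L1_norm|exact: L1Z (L1_norm iF)|] => y.
rewrite (_ : \sum_(i <- s) _ = (\sum_(i <- s) c i * K (h i) x y) * F y); last first.
  by rewrite mulr_suml; apply: eq_bigr => i _; rewrite mulrA.
by rewrite normrM ler_wpM2r.
Qed.

(** As [f] reproduces itself, pairing with it sees only $P_kF$. This turns upper bounds for the form
    [BB k] into bounds for eigenfunctions. *)
Lemma BB_repr k F (f : T -> R) : nice F -> measurable_fun setT f -> L1 (fun x => f x ^+ 2) ->
  (forall x, \int[mu]_y (f y * K k x y) = f x) ->
  (\int[mu]_x (F x * f x)) ^+ 2 <= BB k F F * \int[mu]_x (f x ^+ 2).
Proof.
move=> nF mf f2 rf; case: (nF) => mF _ _.
have -> : \int[mu]_x (F x * f x) = \int[mu]_x (PP k F x * f x).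
  rewrite (swap k nF mf f2); apply: eqR => x; congr (_ * _).
  by rewrite -[LHS]rf; apply: eqR => y; rewrite mulrC.
apply: (le_trans (cauchy_schwarz (meas_PP k mF) mf (L2_PP k nF) f2)).
rewrite (_ : \int[mu]_x (PP k F x ^+ 2) = BB k F F) //.
by have := BB_PP k k nF nF; rewrite eqxx => <-; apply: eqR => x; rewrite expr2.
Qed.
Lemma nice_sum N (h : 'I_N -> R) (e : 'I_N -> T -> R) : (forall i, nice (e i)) ->
  nice (fun x => \sum_(i < N) h i * e i x).
Proof.
elim: N h e => [|N IH] h e ne.
  split; [| |].
  - by under eq_fun do rewrite big_ord0; exact: measurable_cst.
  - by apply: L1_sum => i _; apply: L1Z; case: (ne i).
  by exists 0 => x; rewrite big_ord0 normr0.
under eq_fun do rewrite big_ord_recl.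
by apply: niceD; [exact: niceZ|exact: IH].
Qed.

Lemma BB_suml N l (h : 'I_N -> R) (e : 'I_N -> T -> R) G : (forall i, nice (e i)) -> nice G ->
  BB l (fun x => \sum_(i < N) h i * e i x) G = \sum_(i < N) h i * BB l (e i) G.
Proof.
move=> ne nG; case: (nG) => mG _ _; rewrite /BB.
have I i : L1 (fun x => PP l (e i) x * G x).
  by case: (ne i) => mi _ _; apply: L1_mul => //; [exact: meas_PP|exact: L2_PP|exact: nice_L2].
rewrite (eqR _ (g := fun x => \sum_(i < N) h i * (PP l (e i) x * G x))); last first.
  move=> x; rewrite /PP (eqR _ (g := fun y => \sum_(i < N) h i * (K l x y * e i y))); last first.
    by move=> y; rewrite mulr_sumr; apply: eq_bigr => i _; rewrite mulrCA.
  rewrite int_sum; last by move=> i _; apply: L1Z; exact: L1_KF.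
  rewrite mulr_suml; apply: eq_bigr => i _; rewrite intZ ?mulrA //; exact: L1_KF.
by rewrite int_sum; [apply: eq_bigr => i _; rewrite intZ|move=> i _; exact: L1Z].
Qed.

End RKHS.

(** * Geometric sums and balancing *)

Section RealLemmas.
Variable R : realType.
Implicit Types (eta X : R) (A B c : nat -> R).

Lemma geo_inc eta B J : 0 < eta < 1 -> (forall j, 0 <= B j) -> (forall j, B j <= eta * B j.+1) ->
  \sum_(j < J.+1) B j <= B J / (1 - eta).
Proof.
move=> /andP[e0 e1] B0 hB; have d0 : 0 < 1 - eta by rewrite subr_gt0.
elim: J => [|J IH].
  by rewrite big_ord_recl big_ord0 addr0 ler_pdivlMr // ler_piMr // lerBlDr lerDl ltW.
rewrite big_ord_recr /=; move: IH; rewrite !ler_pdivlMr // [(_ + _) * _]mulrDl; have := hB J; lra.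
Qed.

Lemma geo_dec eta A J : 0 < eta < 1 -> (forall j, 0 <= A j) -> (forall j, A j.+1 <= eta * A j) ->
  \sum_(j < J) A j <= A 0%N / (1 - eta).
Proof.
move=> /andP[e0 e1]; have d0 : 0 < 1 - eta by rewrite subr_gt0.
elim: J A => [|J IH] A A0 hA; first by rewrite big_ord0 divr_ge0 // ltW.
rewrite big_ord_recl /=; have := IH (fun j => A j.+1) (fun j => A0 _) (fun j => hA _).
rewrite ler_pdivlMr // => h; rewrite ler_pdivlMr //; have := hA 0%N.
by rewrite mulrDl; move: h; lra.
Qed.

Lemma geo_inc_le eta X B J : 0 < eta < 1 -> 0 <= X -> (forall j, 0 <= B j) -> (forall j, B j <= eta * B j.+1) ->
  \sum_(j < J | B j <= X) B j <= X / (1 - eta).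
Proof.
move=> e01 X0 B0 hB; have d0 : 0 < 1 - eta by case/andP: e01 => _; rewrite subr_gt0.
elim: J => [|J IH]; first by rewrite big_ord0 divr_ge0 // ltW.
have [h|h] := leP (B J) X; last first.
  by rewrite big_mkcond big_ord_recr /= -big_mkcond /= [B J <= X]leNgt h addr0.
apply: (@le_trans _ _ (B J / (1 - eta))); last by rewrite ler_wpM2r // invr_ge0 ltW.
apply: (le_trans _ (geo_inc J e01 B0 hB)); rewrite big_mkcond; apply: ler_sum => j _.
by case: ifP.
Qed.

Lemma geo_dec_le eta X A J : 0 < eta < 1 -> 0 <= X -> (forall j, 0 <= A j) -> (forall j, A j.+1 <= eta * A j) ->
  \sum_(j < J | A j <= X) A j <= X / (1 - eta).
Proof.
move=> e01 X0; have d0 : 0 < 1 - eta by case/andP: e01 => _; rewrite subr_gt0.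
elim: J A => [|J IH] A A0 hA; first by rewrite big_ord0 divr_ge0 // ltW.
have [h|h] := leP (A 0%N) X; last first.
  rewrite big_mkcond big_ord_recl /= -big_mkcond /= [A 0%N <= X]leNgt h add0r.
  exact: (IH (fun j => A j.+1)).
apply: (@le_trans _ _ (A 0%N / (1 - eta))); last by rewrite ler_wpM2r // invr_ge0 ltW.
apply: (le_trans _ (geo_dec J.+1 e01 A0 hA)); rewrite big_mkcond; apply: ler_sum => j _.
by case: ifP.
Qed.

(** Indices with [A j <= X] are summed through [A], the others have [B j <= X] and are summed
    through [B]; each is a geometric sum with largest term at most [X]. *)
Lemma geo_min eta X A B c J : 0 < eta < 1 -> 0 <= X ->
  (forall j, 0 <= A j) -> (forall j, A j.+1 <= eta * A j) ->
  (forall j, 0 <= B j) -> (forall j, B j <= eta * B j.+1) ->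
  (forall j, A j <= X \/ B j <= X) ->
  (forall j, (j < J)%N -> c j <= A j) -> (forall j, (j < J)%N -> c j <= B j) ->
  \sum_(j < J) c j <= 2 / (1 - eta) * X.
Proof.
move=> e01 X0 A0 hA B0 hB hAB cA cB.
rewrite (bigID (fun j : 'I_J => A j <= X)) /=.
have h1 := geo_dec_le J e01 X0 A0 hA; have h2 := geo_inc_le J e01 X0 B0 hB.
have -> : 2 / (1 - eta) * X = X / (1 - eta) + X / (1 - eta) by ring.
apply: lerD; first by apply: (le_trans _ h1); apply: ler_sum => j _; exact: cA.
apply: (le_trans _ h2); rewrite big_mkcond [leRHS]big_mkcond; apply: ler_sum => j _.
by case: ifPn => [h|_]; case: ifPn => // k; [exact: cB|have [] := hAB j; rewrite ?(negbTE h) ?(negbTE k)].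
Qed.

(* min(al 2^(-th j), be 2^(ga j)) is balanced at 2^j = ta *)
Lemma geo_min_pow (th ga : R) : 0 < th -> 0 < ga -> exists2 C : R, 0 < C &
  forall (al be ta : R) (c : nat -> R) J, 0 <= al -> 0 <= be -> 0 < ta ->
  (forall j, (j < J)%N -> c j <= al * (2 ^+ j) `^ (- th)) -> (forall j, (j < J)%N -> c j <= be * (2 ^+ j) `^ ga) ->
  \sum_(j < J) c j <= C * (al * ta `^ (- th) + be * ta `^ ga).
Proof.
move=> th0 ga0.
have two (x : R) : 0 < x -> 2 `^ (- x) < 1.
  by move=> x0; rewrite powRN invf_lt1 ?powR_gt0 // /powR (gt_eqF (ltr0n R 2)) expR_gt1 mulr_gt0 // ln_gt0 // ltr1n.
pose eta : R := Num.max (2 `^ (- th)) (2 `^ (- ga)).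
have eg0 : 0 < eta by rewrite lt_max powR_gt0.
have e01 : 0 < eta < 1 by rewrite eg0 /= /eta gt_max !two.
have d0 : 0 < 1 - eta by case/andP: e01 => _; rewrite subr_gt0.
exists (2 / (1 - eta)); first by rewrite divr_gt0.
move=> al be ta c J al0 be0 ta0 cA cB.
have pS (x : R) j : (2 ^+ j.+1 : R) `^ x = 2 `^ x * (2 ^+ j) `^ x by rewrite exprS powRM // exprn_ge0.
apply: (geo_min (A := fun j => al * (2 ^+ j) `^ (- th)) (B := fun j => be * (2 ^+ j) `^ ga) e01).
- by rewrite addr_ge0 // mulr_ge0 // powR_ge0.
- by move=> j; rewrite mulr_ge0 // powR_ge0.
- move=> j; rewrite pS mulrCA ler_wpM2r ?mulr_ge0 ?powR_ge0 //.
  by rewrite /eta le_max lexx.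
- by move=> j; rewrite mulr_ge0 // powR_ge0.
- move=> j; rewrite pS mulrCA ler_wpM2l // mulrA ler_peMl ?powR_ge0 //.
  have : 2 `^ (- ga) * 2 `^ ga = 1 :> R by rewrite powRN mulVf // gt_eqF // powR_gt0.
  by move=> {1}<-; rewrite ler_wpM2r ?powR_ge0 // /eta le_max lexx orbT.
- move=> j; have [h|h] := leP (2 ^+ j) ta; [right|left].
    rewrite -[leLHS]add0r lerD ?mulr_ge0 ?powR_ge0 // ler_wpM2l // ge0_ler_powR ?nnegrE ?exprn_ge0 //; exact: ltW.
  rewrite -[leLHS]addr0 lerD ?mulr_ge0 ?powR_ge0 // ler_wpM2l // !powRN lef_pV2 ?posrE ?powR_gt0 ?exprn_gt0 //.
  by rewrite ge0_ler_powR ?nnegrE ?exprn_ge0 //; exact: ltW.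
- exact: cA.
exact: cB.
Qed.

(** With truncated subtraction the exponent is the distance $|a-b|$. *)
Lemma sum_dist_le (eta : R) N (a : 'I_N) : 0 < eta < 1 ->
  \sum_(b < N) eta ^+ (a - b + (b - a)) <= 2 / (1 - eta).
Proof.
move=> e01; have /andP[e0 e1] := e01; rewrite -[leRHS]mulr1.
have k0 k : 0 <= eta ^+ k by rewrite exprn_ge0 // ltW.
have k1 k : eta ^+ k <= 1 by rewrite exprn_ile1 // ltW.
have kp k : 0 < eta ^+ k by rewrite exprn_gt0.
apply: (geo_min (A := fun j => eta ^+ j / eta ^+ a) (B := fun j => eta ^+ a / eta ^+ j)
  (c := fun b => eta ^+ (a - b + (b - a))) e01) => //.
- by move=> j; rewrite divr_ge0.
- by move=> j; rewrite exprS mulrA.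
- by move=> j; rewrite divr_ge0.
- move=> j; rewrite exprS le_eqVlt; apply/orP; left; apply/eqP.
  by field; rewrite !gt_eqF.
- move=> j; rewrite !ler_pdivrMr // !mul1r; have [h|h] := leqP a j; [left|right].
    by rewrite -(subnK h) exprD ler_piMl.
  by rewrite -(subnK (ltnW h)) exprD ler_piMl.
- move=> j _; rewrite ler_pdivlMr // -exprD; have [h|h] := leqP a j.
    by rewrite (_ : (a - j + (j - a) + a = j)%N) // (eqP h) add0n subnK.
  by rewrite (eqP (ltnW h)) addn0 -(subnK (ltnW h)) addnK addnA exprD ler_piMl.
- move=> j _; rewrite ler_pdivlMr // -exprD; have [h|h] := leqP a j.
    by rewrite (eqP h) add0n -{2}(subnK h) addnA exprD ler_piMl.
  by rewrite (eqP (ltnW h)) addn0 subnK // ltnW.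
Qed.

(** The embedding of $\ell^p$ in $\ell^2$: write $y_a^2=y_a^p\,(y_a^p)^{2/p-1}$ and bound the second
    factor by the same power of the whole sum. *)
Lemma sum_pow_le (p : R) N (y : 'I_N -> R) : 0 < p <= 2 -> (forall a, 0 <= y a) ->
  \sum_a y a ^+ 2 <= (\sum_a y a `^ p) `^ (2 / p).
Proof.
move=> /andP[p0 p2] y0; set S := \sum_a y a `^ p.
have S0 : 0 <= S by apply: sumr_ge0 => a _; exact: powR_ge0.
have [Sz|Sn] := eqVneq S 0.
  rewrite big1 ?powR_ge0 // => a _.
  have /eqP := Sz; rewrite psumr_eq0; last by move=> *; exact: powR_ge0.
  by move=> /allP /(_ a (mem_index_enum _)) /=; rewrite powR_eq0 => /andP[/eqP -> _]; rewrite expr0n.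
have e : S `^ (2 / p) = \sum_a y a `^ p * S `^ (2 / p - 1).
  rewrite -mulr_suml -/S -{2}[S]powRr1 // -powRD ?Sn ?implybT //; congr (_ `^ _).
  by rewrite addrC subrK.
rewrite e; apply: ler_sum => a _.
have -> : y a ^+ 2 = y a `^ p * (y a `^ p) `^ (2 / p - 1).
  rewrite -powRrM -powR_mulrn //.
  have -> : p * (2 / p - 1) = 2 - p by field; rewrite gt_eqF.
  have [->|yn] := eqVneq (y a) 0; first by rewrite [0 `^ 2]powR0 // [0 `^ p]powR0 ?gt_eqF // mul0r.
  by rewrite -powRD ?yn ?implybT // addrC subrK.
apply: ler_wpM2l; first exact: powR_ge0.
rewrite ge0_ler_powR ?nnegrE ?powR_ge0 //.
  by rewrite subr_ge0 ler_pdivlMr // mul1r.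
rewrite /S (bigD1 a) //= lerDl; apply: sumr_ge0 => *; exact: powR_ge0.
Qed.

End RealLemmas.

(** The conclusion of [geo_min_pow] as a property of the constant, which the next section takes as a
    variable; this makes visible that it is the same for all m and k. *)
Definition geo_spec (R : realType) (th ga C : R) := 0 < C /\
  forall (al be ta : R) (c : nat -> R) J, 0 <= al -> 0 <= be -> 0 < ta ->
  (forall j, (j < J)%N -> c j <= al * (2 ^+ j) `^ (- th)) -> (forall j, (j < J)%N -> c j <= be * (2 ^+ j) `^ ga) ->
  \sum_(j < J) c j <= C * (al * ta `^ (- th) + be * ta `^ ga).

Lemma powR_expR (R : realType) (a x : R) : expR a `^ x = expR (x * a).
Proof. by rewrite /powR gt_eqF ?expR_gt0 // expRK. Qed.

Lemma ler_powR_base (R : realType) (x y r : R) : 0 <= r -> 0 <= x -> x <= y -> x `^ r <= y `^ r.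
Proof. by move=> r0 x0 xy; rewrite ge0_ler_powR ?nnegrE // (le_trans x0). Qed.

(** * From kernel bounds to the strong bound at the critical exponent *)

Section Interp.
Context d (T : measurableType d) (R : realType) (mu : {sigma_finite_measure set T -> \bar R}).
Notation L1 := (@L1 _ T R mu).
Notation nice := (@nice _ T R mu).
Variable K : nat -> T -> T -> R.
Hypothesis mK : forall l, measurable_fun setT (fun z : T * T => K l z.1 z.2).
Hypothesis K_sym : forall l x y, K l x y = K l y x.
Hypothesis K_L2 : forall l x, L1 (fun y => K l x y ^+ 2).
Hypothesis K_orth : forall l l' x z, \int[mu]_y (K l x y * K l' z y) = if l == l' then K l x z else 0.
Hypothesis K_bd : forall l, exists D, forall x, K l x x <= D.
Notation BB := (@BB _ T R mu K).
Let BB_sym := BB_sym mK K_sym K_L2 K_orth K_bd.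
Let BB_ge0 := BB_ge0 mK K_sym K_L2 K_orth K_bd.
Let BB_CS := BB_CS mK K_sym K_L2 K_orth K_bd.
Let bessel := bessel mK K_sym K_L2 K_orth K_bd.
Let BB_kernel := BB_kernel mK K_sym K_L2 K_orth K_bd.
Let BB_repr := BB_repr mK K_sym K_L2 K_orth K_bd.
Let BB_suml := BB_suml mK K_sym K_L2 K_orth K_bd.

Variable n : nat.
Hypothesis n1 : (1 < n)%N.
Notation nr := (n%:R : R).
(** [cc] is the growth exponent of the kernels of the pieces. [ev] is $1/(1+cc)$, from balancing
    that growth against the decay $2^{-j}$; it equals $1-2/q$ with [qq] the exponent dual to $p_n$.
    [ip] is $1/p_n=1-1/q$, and [e0] is the exponent gained when the two sets have different
    sizes. *)
Definition cc : R := nr - 2^-1.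
Definition ev : R := 2 / (2 * nr + 1).
Definition ip : R := (2 * nr + 3) / (2 * (2 * nr + 1)).
Definition e0 : R := (2 * nr - 1) / (4 * nr * (2 * nr + 1)).
Definition qq : R := 2 * (2 * nr + 1) / (2 * nr - 1).
Let nr1 : 1 < nr. Proof. by rewrite ltr1n. Qed.
Let nz0 : nr != 0. Proof. by rewrite gt_eqF // (lt_trans ltr01). Qed.
Let nz1 : 2 * nr + 1 != 0. Proof. by rewrite gt_eqF //; lra. Qed.

Lemma bal1 (D u w : R) : 0 < u -> 0 < w ->
  D * u * ((u * w) `^ (- ev)) `^ (- 1) + w * u ^+ 2 * ((u * w) `^ (- ev)) `^ cc = (D + 1) * (u * (u * w) `^ ev).
Proof.
move=> u0 w0; have x0 : 0 < u * w by rewrite mulr_gt0.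
rewrite -!powRrM mulrNN mulr1.
have -> : w * u ^+ 2 * (u * w) `^ (- ev * cc) = u * ((u * w) `^ 1 * (u * w) `^ (- ev * cc)).
  by rewrite powRr1 ?ltW //; ring.
have x00 : u * w != 0 by rewrite gt_eqF.
rewrite -powRD; last by apply/implyP => _.
have -> : 1 + - ev * cc = ev by rewrite /ev /cc; field; rewrite gt_eqF //; lra.
ring.
Qed.

(** Here the decay rate is 1/2 and the growth rate [cc]; they add up to n, hence the n-th root in
    [ta]. After balancing, the asymmetry between [u] and [u'] survives as the power [e0]. *)
Lemma bal2 (C u u' w : R) : 0 < u -> 0 < u' -> 0 < w ->
  let S := Num.sqrt (u * (u * w) `^ ev * u') in let ta := (S / (w * (u * u'))) `^ (nr^-1) in
  C * S * ta `^ (- 2^-1) + w * (u * u') * ta `^ cc = (C + 1) * (w `^ ev * ((u * u') `^ ip * (u / u') `^ e0)).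
Proof.
move=> + + + S ta; rewrite /ta /S.
move=> /lnK <- /lnK <- /lnK <-; set a := ln u; set a' := ln u'; set b := ln w.
have sE (x : R) : Num.sqrt (expR x) = expR (x / 2) by rewrite -powR12_sqrt ?expR_ge0 // powR_expR mulrC.
rewrite -!expRN -!expRD !powR_expR -!expRD sE -!expRN -!expRD !powR_expR -!expRD -mulrA -!expRD.
set X1 := expR _; set X2 := expR _; set X3 := expR _.
have -> : X1 = X3 by congr expR; rewrite /ev /ip /e0; field; rewrite nz1 nz0.
have -> : X2 = X3 by congr expR; rewrite /ev /ip /e0 /cc; field; rewrite nz1 nz0.
ring.
Qed.

Variables (D k J : nat) (kappa : R) (p : nat -> nat -> R).
Let NN j := (D * 2 ^ j)%N.
Hypothesis D0 : (0 < D)%N.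
Hypothesis kap0 : 0 < kappa.
Hypothesis p_bd : forall j i, (j <= J)%N -> `|p j i| <= D%:R / 2 ^+ j.
Hypothesis p_supp : forall j i, (NN j < i)%N -> p j i = 0.
Hypothesis p_sum : forall i, \sum_(j < J.+1) p j i = (i == 0%N)%:R.
Hypothesis p_ker : forall j l x y, (j <= J)%N -> (k <= l <= k + NN J)%N ->
  `|\sum_(i < (NN j).+1) p j i * K (l + i) x y| <= kappa * (2 ^+ j) `^ cc.
Variables (C1 C2 : R).
Hypothesis G1 : geo_spec 1 cc C1.
Hypothesis G2 : geo_spec 2^-1 cc C2.

Lemma NN_widen j (F : nat -> R) : (j <= J)%N ->
  \sum_(i < (NN J).+1) p j i * F i = \sum_(i < (NN j).+1) p j i * F i.
Proof.
move=> jJ; have h : ((NN j).+1 <= (NN J).+1)%N by rewrite ltnS leq_mul2l leq_exp2l // jJ orbT.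
rewrite (big_ord_widen _ (fun i => p j i * F i) h) [RHS]big_mkcond; apply: eq_bigr => i _.
by case: ifPn => //; rewrite -leqNgt => hi; rewrite p_supp ?mul0r.
Qed.

Lemma BB_split l F G : BB l F G = \sum_(j < J.+1) \sum_(i < (NN j).+1) p j i * BB (l + i) F G.
Proof.
rewrite (eq_bigr (fun j : 'I_J.+1 => \sum_(i < (NN J).+1) p j i * BB (l + i) F G)); last first.
  by move=> j _; rewrite (NN_widen (fun i => BB (l + i) F G)) // -ltnS.
rewrite exchange_big (bigD1 ord0 isT) /= -mulr_suml p_sum eqxx mul1r addn0 big1; [by rewrite addr0|move=> i i0].
by rewrite -mulr_suml p_sum (negbTE (i0 : (i : nat) != 0%N)) mul0r.
Qed.

Definition unit_fun (e : T -> R) := nice e /\ forall x, `|e x| <= 1.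
Definition mass (e : T -> R) := \int[mu]_x `|e x|.

Lemma unit_L2 e : unit_fun e -> \int[mu]_x (e x ^+ 2) <= mass e.
Proof.
move=> [ne e1]; case: (ne) => me ie _.
apply: int_le; [exact: nice_L2|exact: L1_norm|] => x.
by rewrite -real_normK ?num_real // expr2 ler_piMl.
Qed.

(** Each piece is estimated twice, by Bessel with coefficients $O(2^{-j})$ and by the supremum of
    its kernel; for a [unit_fun] both reduce to its mass, and the sum over j is balanced. It is
    proved at every [l] of the window because [pair_bound] sums it over the neighbours of [k]. *)
Lemma restricted l e : (k <= l <= k + NN J)%N -> unit_fun e -> 0 < mass e ->
  BB l e e <= C1 * (D%:R + 1) * (mass e * (mass e * kappa) `^ ev).
Proof.
move=> lk ue u0; case: (ue) => ne e1; set u := mass e in u0 *.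
pose c j := `|\sum_(i < (NN j).+1) p j i * BB (l + i) e e|.
have cA j : (j < J.+1)%N -> c j <= D%:R * u * (2 ^+ j) `^ (- 1).
  move=> jJ; rewrite powR_inv1 ?exprn_ge0 // /c.
  apply: (@le_trans _ _ (\sum_(i < (NN j).+1) D%:R / 2 ^+ j * BB (l + i) e e)).
    apply: (le_trans (ler_norm_sum _ _ _)); apply: ler_sum => i _.
    by rewrite normrM (ger0_norm (BB_ge0 _ ne)) ler_wpM2r ?BB_ge0 // p_bd.
  rewrite -mulr_sumr [D%:R * u / _]mulrAC ler_wpM2l ?divr_ge0 ?exprn_ge0 //.
  exact: (le_trans (bessel _ _ ne) (unit_L2 ue)).
have cB j : (j < J.+1)%N -> c j <= kappa * u ^+ 2 * (2 ^+ j) `^ cc.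
  move=> jJ; have := BB_kernel ne ne (fun x y => p_ker x y (jJ : (j <= J)%N) lk).
  by rewrite -/(mass e) -/u => /le_trans; apply; rewrite expr2; rewrite le_eqVlt; apply/orP; left; apply/eqP; ring.
have [C10 HG] := G1.
have := HG (D%:R * u) (kappa * u ^+ 2) ((u * kappa) `^ (- ev)) c J.+1.
have uk : 0 < u * kappa by rewrite mulr_gt0.
move=> /(_ _ _ _ cA cB) h.
rewrite -mulrA -bal1 //.
rewrite BB_split; apply: (le_trans _ (h _ _ _)); last 3 first.
- by rewrite mulr_ge0 // ltW.
- by rewrite mulr_ge0 ?sqr_ge0 // ltW.
- by rewrite powR_gt0.
by apply: ler_sum => j _; exact: ler_norm.
Qed.

Let Cr := C1 * (D%:R + 1).
Let Ca := D%:R * (2 * D%:R * Cr + 1).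

(* optimizing la X + Y / la over la *)
Lemma pair_bound e e' : unit_fun e -> unit_fun e' -> 0 < mass e -> mass e <= mass e' ->
  `|BB k e e'| <= C2 * (Ca + 1) * (kappa `^ ev * ((mass e * mass e') `^ ip * (mass e / mass e') `^ e0)).
Proof.
move=> ue ue' u0 uu; case: (ue) (ue') => ne e1 [ne' e1'].
set u := mass e in u0 uu *; set u' := mass e' in uu *; have u0' : 0 < u' by exact: lt_le_trans uu.
have [C10 _] := G1; have [C20 HG] := G2.
pose Z := u * (u * kappa) `^ ev; have uk : 0 < u * kappa by rewrite mulr_gt0.
have Z0 : 0 < Z by rewrite mulr_gt0 // powR_gt0.
have Cr0 : 0 < Cr by rewrite mulr_gt0 // ltr_wpDl.
have Dr0 : (0 : R) < D%:R by rewrite ltr0n.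
pose c j := `|\sum_(i < (NN j).+1) p j i * BB (k + i) e e'|.
have cA j : (j < J.+1)%N -> c j <= Ca * Num.sqrt (Z * u') * (2 ^+ j) `^ (- 2^-1).
  move=> jJ; set t : R := 2 ^+ j; have t0 : 0 < t by rewrite exprn_gt0.
  (* This value equates the two terms. The smaller function is controlled index by index through
     [restricted], giving [t * Z], and the larger one by Bessel, giving [u']; the rate $2^{-j/2}$ is
     the price of improving on Bessel for the smaller one. *)
  pose la := Num.sqrt u' / (Num.sqrt t * Num.sqrt Z).
  have sq (x : R) : 0 < x -> 0 < Num.sqrt x by rewrite sqrtr_gt0.
  have la0 : 0 < la by rewrite divr_gt0 ?mulr_gt0 ?sq.
  have am i : `|BB (k + i) e e'| <= la * BB (k + i) e e + la^-1 * BB (k + i) e' e'.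
    have X0 := BB_ge0 (k + i) ne; have Y0 := BB_ge0 (k + i) ne'; have := BB_CS (k + i) ne ne'.
    set X := BB _ e e in X0 *; set Y := BB _ e' e' in Y0 *; set W := BB _ e e' => h.
    rewrite -ler_sqr ?nnegrE ?addr_ge0 ?mulr_ge0 ?invr_ge0 ?(ltW la0) // real_normK ?num_real //.
    apply: (le_trans h); rewrite sqrrD.
    have -> : la * X * (la^-1 * Y) = X * Y by field; rewrite gt_eqF.
    rewrite -subr_ge0; have := mulr_ge0 X0 Y0; have := sqr_ge0 (la * X); have := sqr_ge0 (la^-1 * Y).
    by rewrite mulr2n; lra.
  have s1 : \sum_(i < (NN j).+1) BB (k + i) e e <= 2 * D%:R * Cr * (t * Z).
    apply: (@le_trans _ _ (\sum_(i < (NN j).+1) Cr * Z)).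
      apply: ler_sum => i _; apply: restricted => //; rewrite leq_addr /= leq_add2l.
      by rewrite (leq_trans (ltn_ord i : (i <= NN j)%N)) // leq_mul2l leq_exp2l // [(j <= J)%N]jJ orbT.
    rewrite sumr_const card_ord -[leLHS]mulr_natr.
    have -> : 2 * D%:R * Cr * (t * Z) = Cr * Z * (2 * (D%:R * t)) by ring.
    rewrite ler_wpM2l //; first by rewrite mulr_ge0 // ltW.
    rewrite /t -natrX -natrM -natrM ler_nat /NN mul2n -addnn -addn1 leq_add2l.
    by rewrite muln_gt0 D0 expn_gt0.
  have s2 : \sum_(i < (NN j).+1) BB (k + i) e' e' <= u' := le_trans (bessel _ _ ne') (unit_L2 ue').
  have h : c j <= D%:R / t * (la * (2 * D%:R * Cr * (t * Z)) + la^-1 * u').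
    apply: (@le_trans _ _ (D%:R / t * \sum_(i < (NN j).+1) (la * BB (k + i) e e + la^-1 * BB (k + i) e' e'))).
      rewrite mulr_sumr /c; apply: (le_trans (ler_norm_sum _ _ _)); apply: ler_sum => i _.
      by rewrite normrM ler_pM // p_bd.
    rewrite ler_wpM2l ?divr_ge0 ?(ltW t0) ?(ltW Dr0) // big_split /= -!mulr_sumr lerD // ler_wpM2l //.
      by rewrite ltW.
    by rewrite invr_ge0 ltW.
  apply: (le_trans h); rewrite powRN powR12_sqrt ?(ltW t0) // sqrtrM ?(ltW Z0) //.
  rewrite le_eqVlt; apply/orP; left; apply/eqP.
  have F (a b z D' C' : R) : 0 < a -> 0 < b -> 0 < z ->
    D' / a ^+ 2 * (b / (a * z) * (2 * D' * C' * (a ^+ 2 * z ^+ 2)) + (b / (a * z))^-1 * b ^+ 2) =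
    D' * (2 * D' * C' + 1) * (z * b) * a^-1.
    by move=> ? ? ?; field; rewrite !gt_eqF.
  have := F (Num.sqrt t) (Num.sqrt u') (Num.sqrt Z) D%:R Cr (sq _ t0) (sq _ u0') (sq _ Z0).
  by rewrite !sqr_sqrtr ?ltW.
have cB j : (j < J.+1)%N -> c j <= kappa * (u * u') * (2 ^+ j) `^ cc.
  move=> jJ; have kk : (k <= k <= k + NN J)%N by rewrite leqnn leq_addr.
  have := BB_kernel ne ne' (fun x y => p_ker x y (jJ : (j <= J)%N) kk).
  by rewrite -/(mass e) -/(mass e') -/u -/u' => /le_trans; apply; rewrite le_eqVlt; apply/orP; left; apply/eqP; ring.
pose ta := (Num.sqrt (Z * u') / (kappa * (u * u'))) `^ (nr^-1).
have Ca0 : 0 < Ca by rewrite mulr_gt0 // addr_gt0 // !mulr_gt0.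
have := HG (Ca * Num.sqrt (Z * u')) (kappa * (u * u')) ta c J.+1 _ _ _ cA cB.
rewrite -(mulrA C2) -(bal2 Ca u0 u0' kap0).
move=> h; rewrite BB_split; apply: (le_trans (ler_norm_sum _ _ _)); apply: (le_trans _ (h _ _ _)) => //.
- by rewrite mulr_ge0 ?sqrtr_ge0 // ltW.
- by rewrite !mulr_ge0 // ltW.
- by rewrite powR_gt0 // divr_gt0 ?mulr_gt0 // sqrtr_gt0 mulr_gt0.
Qed.

Lemma BB_mass0 e e' : unit_fun e -> unit_fun e' -> mass e = 0 -> BB k e e' = 0.
Proof.
move=> ue ue' e0; case: (ue) (ue') => ne _ [ne' _].
have h0 : BB k e e <= 0.
  have := bessel k 1 ne; rewrite big_ord_recl big_ord0 addr0 addn0 => /le_trans; apply.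
  by rewrite -e0; exact: unit_L2.
have h1 : BB k e e = 0 by apply/eqP; rewrite eq_le h0 BB_ge0.
have := BB_CS k ne ne'; rewrite h1 mul0r => h2.
by apply/eqP; rewrite -sqrf_eq0 eq_le h2 sqr_ge0.
Qed.

Definition eta0 : R := 2 `^ (- (qq * e0)).
Definition lev (N a : nat) : R := 2 ^+ a / 2 ^+ N.

Lemma ip_gt0 : 0 < ip.
Proof. by rewrite divr_gt0 //; have := nr1; nra. Qed.
Lemma e0_gt0 : 0 < e0.
Proof. by rewrite divr_gt0 //; have := nr1; nra. Qed.
Let nz2 : 2 * nr - 1 != 0. Proof. by rewrite gt_eqF //; have := nr1; nra. Qed.
Lemma qq_gt2 : 2 < qq.
Proof. by rewrite /qq ltr_pdivlMr; have := nr1; nra. Qed.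
Lemma qip : qq * ip = qq - 1.
Proof. by rewrite /qq /ip; field; rewrite nz1 nz2. Qed.
Lemma e0_le_ip : e0 <= ip.
Proof.
rewrite /e0 /ip ler_pdivrMr; last by have := nr1; nra.
have -> : (2 * nr + 3) / (2 * (2 * nr + 1)) * (4 * nr * (2 * nr + 1)) = (2 * nr + 3) * (2 * nr) by field.
by have := nr1; nra.
Qed.

Lemma eta0_lt1 : 0 < eta0 < 1.
Proof.
rewrite powR_gt0 //= /eta0 powRN invf_lt1 ?powR_gt0 // /powR (gt_eqF (ltr0n R 2)) expR_gt1.
by rewrite mulr_gt0 ?ln_gt0 ?ltr1n // mulr_gt0 ?e0_gt0 // (lt_trans _ qq_gt2).
Qed.

Lemma lev_gt0 N a : 0 < lev N a.
Proof. by rewrite divr_gt0 ?exprn_gt0. Qed.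

Lemma levE N a : lev N a = expR ((a%:R - N%:R) * ln 2).
Proof. by rewrite mulrBl expRD expRN !expRM_natl lnK ?posrE. Qed.

(** With [La] and [Lb] the logarithms of the two weighted masses, one must show that
    $L_a+L_b+e_0(\ln u-\ln u')$ is at most $2\max(L_a,L_b)$ minus a fixed multiple of $|a-b|$. *)
Lemma level_pair N a b (u u' : R) : 0 < u -> u <= u' ->
  lev N a `^ (qq - 1) * lev N b `^ (qq - 1) * ((u * u') `^ ip * (u / u') `^ e0) <=
  eta0 ^+ (a - b + (b - a)) * ((lev N a `^ (qq - 1) * u `^ ip) ^+ 2 + (lev N b `^ (qq - 1) * u' `^ ip) ^+ 2).
Proof.
move=> u0 uu; have u0' : 0 < u' by exact: lt_le_trans uu.
have L0 : 0 < ln 2 :> R by rewrite ln_gt0 // ltr1n.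
have : ln u <= ln u' by rewrite ler_ln.
rewrite !levE; set x := ln u; set z := ln u'; set L := ln 2 in L0 *; move=> xz.
have -> : u = expR x by rewrite lnK.
have -> : u' = expR z by rewrite lnK.
have -> : eta0 = expR (- (qq * e0) * L) by rewrite /eta0 /powR (gt_eqF (ltr0n R 2)).
rewrite -!expRN -!expRD !powR_expR -!expRD -!expRM_natl.
set La := (qq - 1) * ((a%:R - N%:R) * L) + ip * x; set Lb := (qq - 1) * ((b%:R - N%:R) * L) + ip * z.
have Q2 := qq_gt2; have I0 := ip_gt0; have E0 := e0_gt0; have EI := e0_le_ip; have QI := qip.
have -> : (qq - 1) * ((a%:R - N%:R) * L) + (qq - 1) * ((b%:R - N%:R) * L) + (ip * (x + z) + e0 * (x - z)) =
  La + Lb + e0 * (x - z) by rewrite /La /Lb; ring.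
set G := expR (_ * (- (qq * e0) * L)).
have A0 : 0 <= G * expR (2%:R * La) by rewrite mulr_ge0 ?expR_ge0.
have B0 : 0 <= G * expR (2%:R * Lb) by rewrite mulr_ge0 ?expR_ge0.
rewrite [G * _]mulrDr.
suff [h|h] : expR (La + Lb + e0 * (x - z)) <= G * expR (2%:R * La) \/ expR (La + Lb + e0 * (x - z)) <= G * expR (2%:R * Lb).
- by rewrite (le_trans h) // lerDl.
- by rewrite (le_trans h) // lerDr.
rewrite /G -!expRD !ler_expR.
(* If the smaller mass sits on the lower level, [Lb] exceeds [La] by at least $(q-1)(b-a)\ln2$,
   which suffices since $qe_0\le q\cdot ip=q-1$. *)
have [ab|ba] := leqP a b; [right|].
  have -> : ((a - b + (b - a))%N%:R : R) = b%:R - a%:R by rewrite (eqP ab) add0n natrB.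
  have d0 : 0 <= b%:R - a%:R :> R by rewrite subr_ge0 ler_nat.
  have s0 : 0 <= z - x by rewrite subr_ge0.
  have -> : La + Lb + e0 * (x - z) = 2%:R * Lb - (qq - 1) * L * (b%:R - a%:R) - ip * (z - x) - e0 * (z - x).
    by rewrite /La /Lb; ring.
  have h1 : qq * e0 * (L * (b%:R - a%:R)) <= (qq - 1) * (L * (b%:R - a%:R)).
    by rewrite ler_wpM2r ?mulr_ge0 ?(ltW L0) // -QI ler_wpM2l //; lra.
  have h2 : 0 <= ip * (z - x) by rewrite mulr_ge0 // ltW.
  have h3 : 0 <= e0 * (z - x) by rewrite mulr_ge0 // ltW.
  by lra.
have -> : ((a - b + (b - a))%N%:R : R) = a%:R - b%:R by rewrite (eqP (ltnW ba)) addn0 natrB // ltnW.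
pose r := e0 / ip; have r0 : 0 <= r by rewrite divr_ge0 // ltW.
have r1 : r <= 1 by rewrite ler_pdivrMr // mul1r.
(* In the other order the mass ratio must pay: this identity splits off the wanted geometric factor
   exactly and leaves a fraction [r] in [0, 1] of [La - Lb], absorbed by the larger of the two. *)
have E : e0 * (x - z) = (a%:R - b%:R) * (- (qq * e0) * L) + r * (La - Lb).
  have -> : La - Lb = ip * (qq * ((a%:R - b%:R) * L) + (x - z)) by rewrite /La /Lb -QI; ring.
  by rewrite /r; field; rewrite gt_eqF.
rewrite E; have [h|h] := leP Lb La; [left|right].
  have : r * (La - Lb) <= 1 * (La - Lb) by rewrite ler_wpM2r // subr_ge0.
  by lra.
have : r * (Lb - La) >= 0 by rewrite mulr_ge0 // subr_ge0 ltW.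
have : r * (Lb - La) <= 1 * (Lb - La) by rewrite ler_wpM2r // subr_ge0 ltW.
by lra.
Qed.

Let C3 := C2 * (Ca + 1).
Lemma C3_gt0 : 0 < C3.
Proof.
have [C10 _] := G1; have [C20 _] := G2.
have Cr0 : 0 < Cr by rewrite mulr_gt0 // ltr_wpDl.
have Dr0 : (0 : R) < D%:R by rewrite ltr0n.
by rewrite mulr_gt0 // addr_gt0 // mulr_gt0 // addr_gt0 // !mulr_gt0.
Qed.

Definition lw (N a : nat) (e : T -> R) : R := lev N a `^ (qq - 1) * mass e `^ ip.

Lemma pair_lev N a b e e' : unit_fun e -> unit_fun e' ->
  lev N a `^ (qq - 1) * lev N b `^ (qq - 1) * `|BB k e e'| <=
  C3 * kappa `^ ev * (eta0 ^+ (a - b + (b - a)) * (lw N a e ^+ 2 + lw N b e' ^+ 2)).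
Proof.
wlog: e e' a b / mass e <= mass e' => [H ue ue'|uu ue ue'].
  have [h|/ltW h] := leP (mass e) (mass e'); first exact: H.
  have [ne _] := ue; have [ne' _] := ue'.
  rewrite (BB_sym k ne ne') (mulrC (lev N a `^ _)) (addrC (lw N a e ^+ 2)) (addnC (a - b)%N).
  exact: (H e' e b a h ue' ue).
have R0 : 0 <= C3 * kappa `^ ev * (eta0 ^+ (a - b + (b - a)) * (lw N a e ^+ 2 + lw N b e' ^+ 2)).
  have /andP[/ltW ? _] := eta0_lt1.
  have C30 := ltW C3_gt0.
  by apply: mulr_ge0; [rewrite mulr_ge0 ?powR_ge0|rewrite mulr_ge0 ?exprn_ge0 // addr_ge0 // sqr_ge0].
have : 0 <= mass e by apply: int_ge0.
rewrite le_eqVlt => /orP[/eqP e0|u0]; first by rewrite (BB_mass0 ue ue') // normr0 mulr0.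
have h := pair_bound ue ue' u0 uu; rewrite -/C3 in h.
have h2 := level_pair N a b u0 uu.
set H := lev N a `^ _ * _ in h2 *; have H0 : 0 <= H by rewrite mulr_ge0 ?powR_ge0.
apply: (le_trans (ler_wpM2l H0 h)).
rewrite (_ : H * _ = C3 * kappa `^ ev * (H * ((mass e * mass e') `^ ip * (mass e / mass e') `^ e0))); last by ring.
by rewrite ler_wpM2l // mulr_ge0 ?powR_ge0 // (ltW C3_gt0).
Qed.

Variables (f : T -> R) (Bf : R).
Hypothesis mf : measurable_fun setT f.
Hypothesis f2 : L1 (fun x => f x ^+ 2).
Hypothesis f_bd : forall x, `|f x| <= Bf.
Hypothesis f_repr : forall x, \int[mu]_y (f y * K k x y) = f x.
Let Q := \int[mu]_x (f x ^+ 2).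

Definition lset N a : set T := [set x | lev N a < `|f x| /\ `|f x| <= 2 * lev N a].
(** [f] restricted to a dyadic level and rescaled so that its modulus lies in ]1/2, 1] there. *)
Definition lfun N a (x : T) : R := (2 * lev N a)^-1 * (f x * \1_(lset N a) x).

Lemma meas_lset N a : measurable (lset N a).
Proof.
have mn : measurable_fun setT (fun x => `|f x|) by exact: measurableT_comp.
have h1 := measurable_fun_ltr (measurable_cst (lev N a)) mn.
have h2 := measurable_fun_ler mn (measurable_cst (2 * lev N a)).
have := measurable_and h1 h2; rewrite -[lset N a]setTI.
move=> /(_ measurableT [set true] I); congr (measurable (_ `&` _)).
by apply/seteqP; split => x /=; [move=> /andP[]|case=> -> ->].
Qed.

Lemma lfun_abs N a x : `|lfun N a x| = (2 * lev N a)^-1 * (`|f x| * \1_(lset N a) x).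
Proof.
rewrite /lfun !normrM ger0_norm; last by rewrite invr_ge0 mulr_ge0 // ltW // lev_gt0.
by rewrite [`|\1_ _ _|]ger0_norm // indicE ler0n.
Qed.

Lemma lfun_unit N a : unit_fun (lfun N a).
Proof.
have t0 := lev_gt0 N a; have t20 : 0 < 2 * lev N a by rewrite mulr_gt0.
have b1 x : `|lfun N a x| <= 1.
  rewrite lfun_abs mulrC ler_pdivrMr // mul1r indicE; case: (boolP (x \in lset N a)); last by rewrite mulr0 ltW.
  by rewrite inE mulr1 => -[].
have ml : measurable_fun setT (lfun N a).
  by apply: measM => //; apply: measM => //; exact: (measurable_indic (meas_lset N a)).
split=> //; split=> //; last by exists 1.
apply: (L1_le ml (L1Z ((lev N a)^-1 ^+ 2) f2)) => x.
rewrite lfun_abs indicE; case: (boolP (x \in lset N a)); last by rewrite !mulr0 mulr_ge0 ?sqr_ge0.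
rewrite inE => -[h1 h2]; rewrite mulr1 -[f x ^+ 2]real_normK ?num_real // -exprMn expr2.
have e1 : 1 <= (lev N a)^-1 * `|f x| by rewrite mulrC ler_pdivlMr // mul1r ltW.
apply: (@le_trans _ _ ((lev N a)^-1 * `|f x|)).
  by rewrite ler_wpM2r // lef_pV2 ?posrE // ler_peMl ?(ltW t0) // ler1n.
by rewrite ler_peMl // (le_trans ler01).
Qed.

(** A dyadic version of $\int|f|^q$ over the values between $2^{-N}$ and $2^N$. The truncation makes
    it a finite number, so that [Ssum_le] may divide by a power of it. *)
Definition Ssum N := \sum_(a < 2 * N) lev N a `^ qq * mass (lfun N a).
Definition Cf : R := C3 * kappa `^ ev * (4 / (1 - eta0)).

(** Test [f] on $F=\sum_a 2^{(a-N)(q-1)}$ [lfun N a], whose pairing with [f] is at least [Ssum]. By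
    [BB_repr] it remains to bound [BB k F F]; the off-diagonal gain of [pair_lev] reduces it, Schur
    fashion, to $\sum y_a^2\le(\sum y_a^{1/ip})^{2ip}$, and $y_a^{1/ip}$ is the a-th term of [Ssum]
    because $(q-1)/ip=q$. *)
Lemma Ssum_bound N : Ssum N ^+ 2 <= Cf * Ssum N `^ (2 * ip) * Q.
Proof.
have ne a : nice (lfun N a) by case: (lfun_unit N a).
pose h (a : 'I_(2 * N)) := lev N a `^ (qq - 1).
pose F x := \sum_(a < 2 * N) h a * lfun N a x.
have nF : nice F by exact: nice_sum.
have S0 : 0 <= Ssum N.
  by apply: sumr_ge0 => a _; rewrite mulr_ge0 ?powR_ge0 //; apply: int_ge0.
have SF : Ssum N <= \int[mu]_x (F x * f x).
  have If a : L1 (fun x => lfun N a x * f x).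
    by case: (ne a) => ma _ _; apply: L1_mul => //; exact: nice_L2.
  rewrite (eqR _ (g := fun x => \sum_(a < 2 * N) h a * (lfun N a x * f x))); last first.
    by move=> x; rewrite mulr_suml; apply: eq_bigr => a _; rewrite mulrA.
  rewrite int_sum; last by move=> a _; exact: L1Z.
  apply: ler_sum => a _; rewrite intZ //.
  have -> : lev N a `^ qq = h a * lev N a.
    have t0 := lev_gt0 N a.
    by rewrite /h -{3}[lev N a]powRr1 ?(ltW t0) // -powRD ?subrK //; apply/implyP => _; rewrite gt_eqF.
  rewrite -mulrA ler_wpM2l ?powR_ge0 // /mass -intZ; last by case: (ne a) => _ i _; exact: L1_norm.
  apply: int_le => //; first by apply: L1Z; apply: L1_norm; case: (ne a).
  move=> x; rewrite lfun_abs /lfun indicE; case: (boolP (x \in lset N a)); last by rewrite !mulr0 mul0r.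
  have t0 := lev_gt0 N a.
  rewrite inE /= => -[h1 h2]; rewrite /= !mulr1 [leLHS]mulrCA -[leRHS]mulrA; apply: ler_wpM2l; first by rewrite invr_ge0 mulr_ge0 // ltW.
  by rewrite -expr2 -[f x ^+ 2]real_normK ?num_real // expr2 ler_wpM2r // ltW.
have BF : BB k F F <= Cf * Ssum N `^ (2 * ip).
  rewrite BB_suml //.
  have -> : \sum_(a < 2 * N) h a * BB k (lfun N a) F =
      \sum_(a < 2 * N) \sum_(b < 2 * N) h a * h b * BB k (lfun N a) (lfun N b).
    apply: eq_bigr => a _; rewrite BB_sym // BB_suml // mulr_sumr; apply: eq_bigr => b _.
    by rewrite BB_sym // mulrA.
  pose y (a : 'I_(2 * N)) := lw N a (lfun N a).
  have C0 : 0 <= C3 * kappa `^ ev by rewrite mulr_ge0 ?powR_ge0 // (ltW C3_gt0).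
  have y0 a : 0 <= y a by rewrite mulr_ge0 ?powR_ge0.
  have /andP[eg0 eg1] := eta0_lt1; have d0 : 0 < 1 - eta0 by rewrite subr_gt0.
  have s1 : \sum_(a < 2 * N) \sum_(b < 2 * N) h a * h b * BB k (lfun N a) (lfun N b) <=
     C3 * kappa `^ ev * (4 / (1 - eta0) * \sum_(a < 2 * N) y a ^+ 2).
    pose w (a b : 'I_(2 * N)) := eta0 ^+ (a - b + (b - a)).
    have wC a b : w a b = w b a by rewrite /w addnC.
    have w1 : \sum_a \sum_b w a b * y a ^+ 2 <= 2 / (1 - eta0) * \sum_a y a ^+ 2.
      rewrite mulr_sumr; apply: ler_sum => a _; rewrite -mulr_suml ler_wpM2r ?sqr_ge0 //.
      exact: (sum_dist_le a eta0_lt1).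
    apply: (@le_trans _ _ (C3 * kappa `^ ev * (\sum_a \sum_b w a b * y a ^+ 2 + \sum_b \sum_a w b a * y b ^+ 2))).
      rewrite [X in _ + X]exchange_big /= -big_split mulr_sumr; apply: ler_sum => a _.
      rewrite -big_split mulr_sumr; apply: ler_sum => b _ /=.
      rewrite (wC b a) -mulrDr; apply: (le_trans _ (pair_lev N a b (lfun_unit N a) (lfun_unit N b))).
      by rewrite ler_wpM2l ?mulr_ge0 ?powR_ge0 // ler_norm.
    rewrite ler_wpM2l //; have := lerD w1 w1; lra.
  apply: (le_trans s1); rewrite /Cf -[leRHS]mulrA; apply: ler_wpM2l => //.
  apply: ler_wpM2l; first by rewrite divr_ge0 // ltW.
  have I0 := ip_gt0; have I2 : 2^-1 <= ip.
    by rewrite /ip ler_pdivlMr; have := nr1; nra.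
  have pp : 0 < ip^-1 <= 2 by rewrite invr_gt0 I0 /= -[leRHS]invrK lef_pV2 // ?posrE ?invr_gt0.
  have := sum_pow_le pp y0; rewrite invrK => /le_trans; apply.
  rewrite le_eqVlt; apply/orP; left; apply/eqP; congr (_ `^ _).
  apply: eq_bigr => a _; rewrite /y /lw powRM ?powR_ge0 // -!powRrM mulfV ?gt_eqF // powRr1; last by apply: int_ge0.
  by rewrite -qip mulfK // gt_eqF.
have Q0 : 0 <= Q by apply: int_ge0 => x; exact: sqr_ge0.
apply: (@le_trans _ _ ((\int[mu]_x (F x * f x)) ^+ 2)); first by rewrite ler_sqr ?nnegrE // (le_trans S0).
by apply: (le_trans (BB_repr nF mf f2 f_repr)); rewrite ler_wpM2r.
Qed.

Lemma Ssum_le N : Ssum N <= (Cf * Q) `^ (qq / 2).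
Proof.
have Q2 := qq_gt2; have Q0 : 0 <= Q by apply: int_ge0 => x; exact: sqr_ge0.
have S0 : 0 <= Ssum N.
  by apply: sumr_ge0 => a _; rewrite mulr_ge0 ?powR_ge0 //; apply: int_ge0.
move: S0; rewrite le_eqVlt => /orP[/eqP <-|S0]; first exact: powR_ge0.
have h : Ssum N `^ (2 / qq) <= Cf * Q.
  have -> : 2 / qq = 2 - 2 * ip.
    have -> : ip = (qq - 1) / qq by rewrite -qip mulrAC mulfV ?mul1r // gt_eqF //; lra.
    by field; rewrite gt_eqF //; lra.
  rewrite powRD; last by apply/implyP => _; rewrite gt_eqF.
  rewrite powRN ler_pdivrMr ?powR_gt0 // powR_mulrn ?(ltW S0) //.
  by apply: (le_trans (Ssum_bound N)); rewrite mulrAC.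
have -> : Ssum N = (Ssum N `^ (2 / qq)) `^ (qq / 2).
  rewrite -powRrM (_ : 2 / qq * (qq / 2) = 1) ?powRr1 ?ltW //.
  by field; rewrite gt_eqF //; lra.
apply: ge0_ler_powR; rewrite ?nnegrE ?powR_ge0 //; first by lra.
by apply: le_trans h; exact: powR_ge0.
Qed.

Lemma level_exists N b x : lev N 0 < x -> x <= lev N b -> exists2 a, (a < b)%N & lev N a < x /\ x <= 2 * lev N a.
Proof.
move=> h0; elim: b => [|b IH] hb; first by have := lt_le_trans h0 hb; rewrite ltxx.
have [h|h] := leP x (lev N b); first by have [a ab ha] := IH h; exists a => //; exact: ltnW.
by exists b => //; split => //; rewrite /lev mulrA -exprS.
Qed.

Lemma level_sum_ge N x : Bf <= 2 ^+ N ->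
  `|f x| `^ qq <= \sum_(a < 2 * N) 2 * 2 `^ qq * (lev N a `^ qq * `|lfun N a x|) + (2 ^- N) `^ (qq - 2) * f x ^+ 2.
Proof.
move=> hN; have Q2 := qq_gt2.
have s0 : 0 <= \sum_(a < 2 * N) 2 * 2 `^ qq * (lev N a `^ qq * `|lfun N a x|).
  by apply: sumr_ge0 => a _; rewrite !mulr_ge0 ?powR_ge0.
have [h|h] := leP (`|f x|) (lev N 0).
  rewrite -[leLHS]add0r lerD //.
  have -> : qq = (qq - 2) + 2 by rewrite subrK.
  rewrite powRD; last by apply/implyP => /eqP e; move: Q2; rewrite subrK in e; lra.
  rewrite powR_mulrn // real_normK ?num_real // ler_wpM2r ?sqr_ge0 // addrK.
  apply: ge0_ler_powR; rewrite ?nnegrE //; first by lra.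
  by move: h; rewrite /lev expr0 mul1r.
have [a aN [h1 h2]] : exists2 a, (a < 2 * N)%N & lev N a < `|f x| /\ `|f x| <= 2 * lev N a.
  apply: level_exists => //; rewrite /lev mul2n -addnn exprD mulfK ?gt_eqF ?exprn_gt0 //.
  exact: le_trans hN.
rewrite -[leLHS]addr0 lerD //; last by rewrite mulr_ge0 ?powR_ge0 // sqr_ge0.
rewrite (bigD1 (Ordinal aN)) //= -[leLHS]addr0 lerD //; last first.
  by apply: sumr_ge0 => b _; rewrite !mulr_ge0 ?powR_ge0.
have t0 := lev_gt0 N a.
apply: (@le_trans _ _ ((2 * lev N a) `^ qq)).
  by apply: ler_powR_base => //; lra.
rewrite powRM ?(ltW t0) //.
have -> : 2 * 2 `^ qq * (lev N a `^ qq * `|lfun N a x|) = 2 `^ qq * lev N a `^ qq * (2 * `|lfun N a x|) by ring.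
rewrite ler_peMr ?mulr_ge0 ?powR_ge0 // lfun_abs indicE mem_set //= mulr1.
have -> : 2 * ((2 * lev N a)^-1 * `|f x|) = `|f x| / lev N a by field; rewrite gt_eqF.
by rewrite ler_pdivlMr // mul1r ltW.
Qed.

Lemma L1_fq : L1 (fun x => `|f x| `^ qq).
Proof.
have Q2 := qq_gt2.
have mn : measurable_fun setT (fun x => `|f x|) by exact: measurableT_comp.
have m : measurable_fun setT (fun x => `|f x| `^ qq) by exact: (measurableT_comp (measurable_powR _) mn).
apply: (L1_le m (L1Z (Bf `^ (qq - 2)) f2)) => x.
rewrite ger0_norm ?powR_ge0 //.
have -> : qq = (qq - 2) + 2 by rewrite subrK.
rewrite powRD; last by apply/implyP => /eqP e; move: Q2; rewrite subrK in e; lra.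
rewrite powR_mulrn // real_normK ?num_real // ler_wpM2r ?sqr_ge0 // addrK.
apply: ge0_ler_powR; rewrite ?nnegrE //; first by lra.
exact: le_trans (f_bd x).
Qed.

(** Values below $2^{-N}$ contribute at most $2^{-N(q-2)}\int f^2$, which disappears as N grows;
    values above $2^N$ do not occur once [Bf] is smaller. *)
Lemma strong_bound : \int[mu]_x (`|f x| `^ qq) <= 2 * 2 `^ qq * (Cf * Q) `^ (qq / 2).
Proof.
have Q2 := qq_gt2; have Q0 : 0 <= Q by apply: int_ge0 => x; exact: sqr_ge0.
have H N : Bf <= 2 ^+ N -> \int[mu]_x (`|f x| `^ qq) <= 2 * 2 `^ qq * (Cf * Q) `^ (qq / 2) + (2 ^- N) `^ (qq - 2) * Q.
  move=> hN.
  have I1 a : L1 (fun x => 2 * 2 `^ qq * (lev N a `^ qq * `|lfun N a x|)).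
    by apply: L1Z; apply: L1Z; apply: L1_norm; case: (lfun_unit N a) => -[].
  have IS : L1 (fun x => \sum_(a < 2 * N) 2 * 2 `^ qq * (lev N a `^ qq * `|lfun N a x|)) by apply: L1_sum => a _.
  apply: (@le_trans _ _ (\int[mu]_x (\sum_(a < 2 * N) 2 * 2 `^ qq * (lev N a `^ qq * `|lfun N a x|) + (2 ^- N) `^ (qq - 2) * f x ^+ 2))).
    apply: int_le; [exact: L1_fq|by apply: L1D => //; exact: L1Z|].
    by move=> x; exact: level_sum_ge.
  rewrite intD //; last exact: L1Z.
  rewrite intZ // lerD2r int_sum //.
  have -> : \sum_(a < 2 * N) \int[mu]_x (2 * 2 `^ qq * (lev N a `^ qq * `|lfun N a x|)) = 2 * 2 `^ qq * Ssum N.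
    rewrite mulr_sumr; apply: eq_bigr => a _; have Ia : L1 (fun x => `|lfun N a x|) by apply: L1_norm; case: (lfun_unit N a) => -[].
    by rewrite intZ ?intZ //; exact: L1Z.
  by rewrite ler_wpM2l ?mulr_ge0 ?powR_ge0 // Ssum_le.
apply/ler_addgt0Pr => e eg0.
pose z : R := (e / (Q + 1)) `^ ((qq - 2)^-1).
have e1 : 0 < e / (Q + 1) by rewrite divr_gt0 // ltr_wpDl.
have z0 : 0 < z by rewrite powR_gt0.
have [N hN] : exists N : nat, Num.max `|Bf| z^-1 < 2 ^+ N.
  exists (Num.truncn (Num.max `|Bf| z^-1)).+1; apply: (lt_le_trans (truncnS_gt _)).
  by rewrite -natrX ler_nat ltnW // ltn_expl.
apply: (le_trans (H N _)).
  by rewrite (le_trans (ler_norm _)) // (le_trans _ (ltW hN)) // le_max lexx.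
rewrite lerD2l.
have h2 : 2 ^- N <= z.
  by rewrite -[z]invrK lef_pV2 ?posrE ?invr_gt0 ?exprn_gt0 // (le_trans _ (ltW hN)) // le_max lexx orbT.
apply: (@le_trans _ _ (z `^ (qq - 2) * Q)).
  apply: ler_wpM2r => //; apply: ler_powR_base => //; lra.
rewrite /z -powRrM mulVf ?powRr1 ?(ltW e1) //; last by rewrite gt_eqF // subr_gt0.
by rewrite mulrAC ler_pdivrMr ?ltr_wpDl // ler_wpM2l ?(ltW eg0) // lerDl.
Qed.

End Interp.

(** * Laguerre bounds for the multiplier pieces *)

Section Act.
Variable R : realType.
Implicit Types (P Q : {poly R}) (u : nat -> R).

(* the polynomial P evaluated at the shift operator *)
Definition act P u (k : nat) : R := \sum_(i < size P) P`_i * u (k + i)%N.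

Lemma act_widen N P u k : (size P <= N)%N -> act P u k = \sum_(i < N) P`_i * u (k + i)%N.
Proof.
move=> h; rewrite /act (big_ord_widen _ (fun i => P`_i * u (k + i)%N) h) [LHS]big_mkcond; apply: eq_bigr => i _.
by case: ifPn => //; rewrite -leqNgt => hi; rewrite nth_default ?mul0r.
Qed.

Lemma actD P Q u k : act (P + Q) u k = act P u k + act Q u k.
Proof.
have h := size_polyD P Q.
rewrite (act_widen u k h) (@act_widen (maxn (size P) (size Q)) P) ?leq_maxl //.
rewrite (@act_widen (maxn (size P) (size Q)) Q) ?leq_maxr // -big_split /=.
by apply: eq_bigr => i _; rewrite coefD mulrDl.
Qed.

Lemma actZ c P u k : act (c *: P) u k = c * act P u k.
Proof.
rewrite (act_widen u k (size_scale_leq c P)) mulr_sumr.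
by apply: eq_bigr => i _; rewrite coefZ mulrA.
Qed.

Lemma actN P u k : act (- P) u k = - act P u k.
Proof. by rewrite -scaleN1r actZ mulN1r. Qed.

Lemma actB P Q u k : act (P - Q) u k = act P u k - act Q u k.
Proof. by rewrite actD actN. Qed.

Lemma act0 u k : act 0 u k = 0.
Proof. by rewrite /act size_poly0 big_ord0. Qed.

Lemma actC c u k : act c%:P u k = c * u k.
Proof.
by rewrite (@act_widen 1) ?size_polyC_leq1 // big_ord_recl big_ord0 addr0 coefC addn0.
Qed.

Lemma act1 u k : act 1 u k = u k.
Proof. by rewrite -polyC1 actC mul1r. Qed.

Lemma actMX P u k : act (P * 'X) u k = act P u k.+1.
Proof.
have h : (size (P * 'X)%R <= (size P).+1)%N by rewrite (leq_trans (size_polyMleq _ _)) // size_polyX addn2.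
rewrite (act_widen u k h) big_ord_recl coefMX mul0r add0r.
by apply: eq_bigr => i _; rewrite coefMX /= addSnnS.
Qed.

Lemma act_mul P Q u k : act (P * Q) u k = act P (act Q u) k.
Proof.
elim/poly_ind: P k => [|P c IH] k; first by rewrite mul0r !act0.
rewrite mulrDl mulrAC !actD !actMX IH actC; congr (_ + _).
by rewrite mul_polyC actZ.
Qed.

Lemma act_sum (I : Type) (s : seq I) (F : I -> {poly R}) u k :
  act (\sum_(i <- s) F i) u k = \sum_(i <- s) act (F i) u k.
Proof.
by elim: s => [|i s IH]; rewrite ?big_nil ?act0 // !big_cons actD IH.
Qed.

Lemma actXn j u k : act 'X^j u k = u (k + j)%N.
Proof.
elim: j k => [|j IH] k; first by rewrite expr0 act1 addn0.
by rewrite exprSr actMX IH addSnnS.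
Qed.

Lemma act_shift P u v k j : (forall i, u i = v (i + j)%N) -> act P u k = act P v (k + j)%N.
Proof. by move=> h; apply: eq_bigr => i _; rewrite h addnAC. Qed.

Lemma act_scale P c u k : act P (fun i => c * u i) k = c * act P u k.
Proof. by rewrite /act mulr_sumr; apply: eq_bigr => i _; rewrite mulrCA. Qed.

Lemma act_delta P i : act P (fun j => (j == i)%:R) 0 = P`_i.
Proof.
rewrite (@act_widen (maxn (size P) i.+1)) ?leq_maxl //.
have hi : (i < maxn (size P) i.+1)%N by rewrite leq_maxr.
rewrite (bigD1 (Ordinal hi)) //= eqxx mulr1 big1 ?addr0 // => j ji.
by rewrite add0n (negbTE (ji : (j : nat) != i)) mulr0.
Qed.

(** The supremum norm of [P] acting through the shift, restricted to a window of length [W]; the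
    restriction matters because $\phi_l$ is controlled only for indices comparable with [k]. *)
Definition opb P (c : R) (W : nat) := forall u k B,
  (forall i, (i <= W)%N -> `|u (k + i)%N| <= B) -> `|act P u k| <= c * B.

Lemma opbM P Q c c' W W' : opb P c W -> opb Q c' W' -> opb (P * Q) (c * c') (W + W').
Proof.
move=> hP hQ u k B hu; rewrite act_mul -mulrA; apply: hP => i iW; apply: hQ => j jW.
by rewrite -addnA; apply: hu; exact: leq_add.
Qed.

Lemma opb_wk P c c' W W' : opb P c W -> c <= c' -> (W <= W')%N -> opb P c' W'.
Proof.
move=> h cc WW u k B hu; have B0 : 0 <= B by rewrite (le_trans _ (hu 0%N _)).
apply: (@le_trans _ _ (c * B)); last by rewrite ler_wpM2r.
by apply: h => i iW; apply: hu; exact: leq_trans WW.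
Qed.

Lemma opbD P Q c c' W : opb P c W -> opb Q c' W -> opb (P + Q) (c + c') W.
Proof.
by move=> hP hQ u k B hu; rewrite actD mulrDl (le_trans (ler_normD _ _)) // lerD ?hP ?hQ.
Qed.

Lemma opbN P c W : opb P c W -> opb (- P) c W.
Proof. by move=> h u k B hu; rewrite actN normrN; exact: h. Qed.

Lemma opb1 W : opb 1 1 W.
Proof. by move=> u k B hu; rewrite act1 mul1r -[k]addn0; exact: hu. Qed.

Lemma opbXn j W : (j <= W)%N -> opb 'X^j 1 W.
Proof. by move=> h u k B hu; rewrite actXn mul1r; exact: hu. Qed.

Lemma opbX P c W m : opb P c W -> opb (P ^+ m) (c ^+ m) (m * W).
Proof.
move=> h; elim: m => [|m IH]; first exact: opb1.
by rewrite !exprS mulSn; exact: opbM.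
Qed.

Lemma opb_coef P c W i : opb P c W -> (W < i)%N -> P`_i = 0.
Proof.
move=> h Wi; apply/eqP; rewrite -normr_le0 -act_delta -[leRHS](mulr0 c).
apply: h => j jW; rewrite add0n; case: eqP => [e|_]; last by rewrite normr0.
by rewrite -e ltnNge jW in Wi.
Qed.

(* 1 - avg N vanishes at r = 1 and at r = -1: its powers localize the spectral sum to indices within O(N) of k. *)
Definition avg (N : nat) : {poly R} := N%:R^-1 *: \sum_(i < N) 'X^(2 * i).
Definition avgq (N : nat) : {poly R} := N%:R^-1 *: \sum_(i < N) \sum_(s < i) 'X^(2 * s).

Lemma avg_factor N : (0 < N)%N -> 1 - avg N = (1 - 'X) * (1 + 'X) * avgq N.
Proof.
move=> N0; have n0 : N%:R != 0 :> R by rewrite pnatr_eq0 -lt0n.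
have -> : (1 : {poly R}) - avg N = N%:R^-1 *: \sum_(i < N) (1 - 'X^(2 * i)).
  rewrite sumrB sumr_const card_ord scalerBr -/(avg N); congr (_ - _).
  by rewrite -polyC_natr -mul_polyC -polyCM mulVf.
rewrite /avgq -scalerAr; congr (_ *: _); rewrite mulr_sumr; apply: eq_bigr => i _.
have -> : (1 - 'X) * (1 + 'X) = - ('X^2 - 1) :> {poly R} by ring.
rewrite mulNr -[LHS]opprB; congr (- _).
rewrite exprM subrX1; congr (_ * _); apply: eq_bigr => s _.
by rewrite exprM.
Qed.

Lemma opb_avg N : (0 < N)%N -> opb (avg N) 1 (2 * N).
Proof.
move=> N0 u k B hu; rewrite actZ act_sum normrM ger0_norm ?invr_ge0 //.
rewrite ler_pdivrMl ?ltr0n // mul1r.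
apply: (le_trans (ler_norm_sum _ _ _)); rewrite -[N in N%:R]card_ord mulrC mulr_natr -sumr_const.
apply: ler_sum => i _; rewrite actXn; apply: hu.
by rewrite leq_mul2l ltnW //.
Qed.

Lemma opb_avgq N : (0 < N)%N -> opb (avgq N) N%:R (2 * N).
Proof.
move=> N0 u k B hu; rewrite actZ act_sum normrM ger0_norm ?invr_ge0 //.
have B0 : 0 <= B by rewrite (le_trans _ (hu 0%N _)).
rewrite ler_pdivrMl ?ltr0n // mulrA.
apply: (le_trans (ler_norm_sum _ _ _)).
apply: (@le_trans _ _ (\sum_(i < N) N%:R * B)); last first.
  by rewrite sumr_const card_ord -[leLHS]mulr_natl mulrA.
apply: ler_sum => i _; rewrite act_sum; apply: (le_trans (ler_norm_sum _ _ _)).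
apply: (@le_trans _ _ (\sum_(s < i) B)).
  apply: ler_sum => s _; rewrite actXn; apply: hu.
  by rewrite leq_mul2l /= ltnW // (ltn_trans (ltn_ord s)).
by rewrite sumr_const card_ord -[leLHS]mulr_natl ler_wpM2r // ler_nat ltnW.
Qed.

Definition mult (N b : nat) : {poly R} := (1 - avg N) ^+ b.

Lemma opb_1avg N : (0 < N)%N -> opb (1 - avg N) 2 (2 * N).
Proof.
move=> N0; have -> : (2 : R) = 1 + 1 by [].
by apply: opbD; [exact: opb1|apply: opbN; exact: opb_avg].
Qed.

(** The average over a single term is the identity, so the telescoping sum of the pieces starts from
    0. *)
Lemma mult1 b : (0 < b)%N -> mult 1 b = 0.
Proof.
move=> b0; rewrite /mult /avg big_ord_recl big_ord0 addr0 muln0 expr0 invr1 scale1r subrr.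
by rewrite expr0n eqn0Ngt b0.
Qed.

(** [mult N b - 1] is minus the average composed with an operator of norm at most $2^b$, and the
    average has coefficients at most $1/N$. *)
Lemma mult_coef N b i : (0 < N)%N -> `|(mult N b - 1)`_i| <= 2 ^+ b / N%:R.
Proof.
move=> N0; pose Q : {poly R} := \sum_(s < b) (1 - avg N) ^+ s.
have E : mult N b - 1 = - (Q * avg N).
  by rewrite /mult subrX1 mulrC -mulrN; congr (_ * _); ring.
have hQ : exists W, opb Q (2 ^+ b) W.
  exists (b * (2 * N))%N; rewrite /Q; elim: b {E Q} => [|b IH].
    by rewrite big_ord0 => u k B hu; rewrite act0 normr0 mulr_ge0 // (le_trans _ (hu 0%N _)).
  rewrite big_ord_recr /= exprS mulr_natl mulr2n; apply: opbD.
    by apply: (opb_wk IH) => //; rewrite leq_mul2r leqnSn orbT.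
  have h : opb ((1 - avg N) ^+ b) (2 ^+ b) (b * (2 * N)) by apply: opbX; exact: opb_1avg.
  by apply: (opb_wk h); rewrite ?lexx // leq_mul2r leqnSn orbT.
have [W hW] := hQ; rewrite E coefN normrN -act_delta act_mul.
apply: hW => j _; rewrite add0n actZ act_sum normrM ger0_norm ?invr_ge0 //.
rewrite -[leRHS]mulr1 ler_wpM2l ?invr_ge0 //.
under eq_bigr do rewrite actXn.
rewrite ger0_norm; last by apply: sumr_ge0.
have [[s js]|ns] := pselect (exists s : 'I_N, (j + 2 * s = i)%N); last first.
  by rewrite big1 // => s _; case: eqP => // e; case: ns; exists s.
rewrite (bigD1 s) //= js eqxx big1 ?addr0 // => t ts.
by rewrite -js eqn_add2l eqn_mul2l /= (negbTE (ts : (t : nat) != s)).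
Qed.

End Act.

Section LagShift.
Variables (R : realType) (x : R).

Lemma act_lag_down j b k : act (('X - 1) ^+ j) (fun i => lagv (j + b) i x) k = lagv b (k + j)%N x.
Proof.
elim: j k => [|j IH] k; first by rewrite expr0 act1 addn0.
rewrite exprSr act_mul addnS -addSn -IH.
rewrite (@act_shift R _ _ (fun i => lagv (j + b) i x) k 1) ?addn1 // => i.
rewrite actB act1 -['X]expr1 actXn addn1 /lagv -[in RHS]lag_pascal.
by rewrite hornerD hornerN.
Qed.

(** In this normalisation a difference in the index raises the order by one with the exact factor
    $-x$ ([lag_rec5]), without index-dependent coefficients. *)
Definition nlag (j i : nat) : R := i`!%:R / (i + j)`!%:R * lagv j i x.

Lemma act_nlag j k : act (('X - 1) ^+ j) (nlag 0) k = (- x) ^+ j * nlag j k.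
Proof.
elim: j k => [|j IH] k; first by rewrite !expr0 act1 mul1r.
rewrite exprS act_mul actB act1 -['X]expr1 actXn expr1 !IH addn1 -mulrBr exprSr -mulrA; congr (_ * _).
have := congr1 (fun P : {poly R} => P.[x]) (lag_rec5 R j k).
rewrite hornerD !hornerN !hornerZ hornerM hornerX -!/(lagv _ _ _) => E.
rewrite /nlag mulrCA mulNr -E addnS factS addSn factS !natrM.
have F (a b c d u v : R) : a != 0 -> b != 0 -> c != 0 ->
   a * c / (b * d) * u - c / d * v = c / (b * d) * (a * u - b * v).
  move=> a0 b0 c0; have [->|d0] := eqVneq d 0; first by rewrite !(mulr0, invr0, mul0r) subrr.
  by field; rewrite ?a0 ?b0 ?c0 ?d0.
by rewrite F ?fact_neq0 ?pnatr_eq0.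
Qed.

Lemma act_lag a k : act (('X - 1) ^+ (a + a)) (fun i => lagv a i x) k =
  (- x) ^+ a * ((k + a)`!%:R / (k + a + a)`!%:R * lagv a (k + a) x).
Proof.
rewrite exprD act_mul.
rewrite (@act_shift _ _ _ (nlag 0) _ a) ?act_nlag // => i.
have := act_lag_down a 0 i; rewrite addn0 => ->.
by rewrite /nlag addn0 divff ?mul1r // fact_neq0.
Qed.

Lemma act_phi a k : act (('X - 1) ^+ (a + a)) (fun i => phi a i x) k =
  (- x) ^+ a * ((k + a)`!%:R / (k + a + a)`!%:R * phi a (k + a) x).
Proof.
have E i : phi a i x = expR (- 2^-1 * x) * lagv a i x by rewrite phiE mulrC.
have -> : (fun i => phi a i x) = (fun i => expR (- 2^-1 * x) * lagv a i x) by apply/funext.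
by rewrite act_scale act_lag E; ring.
Qed.

End LagShift.

(** * Energy estimates for the Laguerre equation *)

Section Energy.
Variables (R : realType) (b : nat) (nu : R) (f g h : R -> R).
Notation br := (b%:R : R).
Hypothesis nu0 : 0 < nu.
Hypothesis df : forall x, der f x (g x).
Hypothesis dg : forall x, der g x (h x).
Hypothesis ode : forall x, x * h x = - ((br + 1) * g x) - (nu - x) / 4 * f x.

(** In the variable $y=\sqrt x$ the function $w=x^{b/2+1/4}f$ solves
    $w''+(\nu-y^2-(b^2-\frac14)/y^2)w=0$. Its energy, the square of $w'$ plus the potential times
    $w^2$, is $x^{b+1/2}$ times [FF] (compare [FF_eq]). *)
Definition FF (x : R) := 4 * x * g x ^+ 2 + (nu - x) * f x ^+ 2 + (4 * br + 2) * (f x * g x) + (br + 2^-1) * f x ^+ 2 / x.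
(** Energy in the variable x itself: it decreases on the whole line, but its second term changes
    sign at the turning point [nu]. *)
Definition HH (x : R) := x * g x ^+ 2 + (nu - x) / 4 * f x ^+ 2.

Lemma der_FF x : 0 < x -> der FF x ((f x ^+ 2 * ((br ^+ 2 - 4^-1) / x - x) - (br + 2^-1) * FF x) / x).
Proof.
move=> x0; have xn : x != 0 by rewrite gt_eqF.
have f2 := derP_M (df x) (df x); have g2 := derP_M (dg x) (dg x); have fg := derP_M (df x) (dg x).
have di := derP_inv xn (derP_id x).
have d1 := derP_M (derP_Z 4 (derP_id x)) g2.
have d2 := derP_M (derP_aff (-1) nu x) f2.
have d3 := derP_Z (4 * br + 2) fg.
have d4 := derP_M (derP_Z (br + 2^-1) f2) di.
have d := derP_D (derP_D (derP_D d1 d2) d3) d4.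
have d' := derP_ext _ d (g := FF).
apply: (derP_eq (d' _)).
  by move=> y; rewrite /FF; ring.
have hE : h x = (- ((br + 1) * g x) - (nu - x) / 4 * f x) / x by rewrite -ode mulrC mulKf.
rewrite /FF hE; field; exact: xn.
Qed.

Lemma FF_eq x : 0 < x -> FF x = (nu - x - (br ^+ 2 - 4^-1) / x) * f x ^+ 2 + 4 * x * (g x + (2 * br + 1) * f x / (4 * x)) ^+ 2.
Proof. by move=> x0; rewrite /FF; field; rewrite gt_eqF. Qed.

Let A : R := (br + 1) ^+ 2.
(** From here on the term $(b^2-\frac14)/x$ is at most $\nu/4$, so that up to $\nu/2$ [FF] dominates
    $\frac\nu4f^2$. *)
Definition x0 : R := 4 * A / nu.

Let A1 : 1 <= A. Proof. by rewrite /A -[leLHS](expr1n _ 2) ler_sqr ?nnegrE ?addr_ge0 // lerDr. Qed.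
Let bA : br ^+ 2 - 4^-1 <= A. Proof. by rewrite /A; have : 0 <= br by []; nra. Qed.
Lemma x0_gt0 : 0 < x0. Proof. by rewrite divr_gt0 // mulr_gt0 // (lt_le_trans ltr01). Qed.

Lemma FF_lower x : x0 <= x -> x <= nu / 2 ->
  nu / 4 * f x ^+ 2 + 4 * x * (g x + (2 * br + 1) * f x / (4 * x)) ^+ 2 <= FF x.
Proof.
move=> h1 h2; have xp : 0 < x by exact: lt_le_trans x0_gt0 h1.
rewrite FF_eq // lerD2r ler_wpM2r ?sqr_ge0 //.
have : (br ^+ 2 - 4^-1) / x <= nu / 4.
  rewrite ler_pdivrMr // (le_trans bA) //.
  by move: h1; rewrite /x0 ler_pdivrMr //; lra.
by lra.
Qed.

Lemma FF_ge0 x : x0 <= x -> x <= nu / 2 -> 0 <= FF x.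
Proof.
move=> h1 h2; have xp : 0 < x by exact: lt_le_trans x0_gt0 h1.
apply: le_trans (FF_lower h1 h2); rewrite addr_ge0 // mulr_ge0 ?sqr_ge0 //; last by rewrite mulr_ge0 // ltW.
by rewrite divr_ge0 // ltW.
Qed.

(** The square avoids the half-integer power $x^{b+1/2}$. The exponential absorbs the only term that
    can make the energy grow, of relative size $A/(\nu x^2)$; its exponent at [x0] equals 2, whence
    the constant in [FF_bound]. *)
Let G x := x ^+ (2 * b + 1) * FF x ^+ 2 * expR (8 * A / nu * x^-1).

Lemma G_dec x : x0 <= x -> x <= nu / 2 -> G x <= G x0.
Proof.
move=> h1 h2.
suff : - G x0 <= - G x by rewrite lerN2.
pose dG y := - (y ^+ (2 * b) * 2 * FF y * (f y ^+ 2 * ((br ^+ 2 - 4^-1) / y - y) - 4 * A / nu / y * FF y) * expR (8 * A / nu * y^-1)).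
apply: (der_le (g := fun y => - G y) (dg := dG) h1) => y /andP[y1 y2].
  have yp : 0 < y by exact: lt_le_trans x0_gt0 y1.
  have yn : y != 0 by rewrite gt_eqF.
  have dE := derP_comp (is_derive_expR _) (derP_Z (8 * A / nu) (derP_inv yn (derP_id y))).
  have d1 := derP_X (2 * b + 1) (derP_id y); have d2 := derP_X 2 (der_FF yp).
  have d := derP_Z (-1) (derP_M (derP_M d1 d2) dE).
  apply: (derP_eq (derP_ext _ d)) => [z|]; first by rewrite mulN1r.
  rewrite /dG addn1 /= expr1 exprS -[(2 * b).+1%:R]natr1 natrM.
  set E := expR _; set P := y ^+ (2 * b); set W := FF y.
  by field; rewrite yn gt_eqF.
have yp : 0 < y by exact: lt_le_trans x0_gt0 y1.
have y3 : y <= nu / 2 by exact: le_trans h2.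
have W0 := FF_ge0 y1 y3; have WL := FF_lower y1 y3.
have L : f y ^+ 2 * ((br ^+ 2 - 4^-1) / y - y) - 4 * A / nu / y * FF y <= 0.
  have fy : 0 <= f y ^+ 2 by rewrite sqr_ge0.
  have s1 : nu / 4 * f y ^+ 2 <= FF y.
    by apply: le_trans WL; rewrite lerDl mulr_ge0 ?sqr_ge0 // mulr_ge0 // ltW.
  have s2 : f y ^+ 2 <= 4 / nu * FF y.
    by rewrite mulrAC ler_pdivlMr //; lra.
  have Ay : 0 <= A / y by rewrite divr_ge0 ?(ltW yp) // (le_trans _ A1).
  rewrite subr_le0; apply: (@le_trans _ _ (f y ^+ 2 * (A / y))).
    rewrite ler_wpM2l // lerBlDr (@le_trans _ _ (A / y)) ?lerDl ?(ltW yp) // ler_wpM2r ?invr_ge0 ?(ltW yp) //.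
  have -> : 4 * A / nu / y * FF y = 4 / nu * FF y * (A / y) by field; rewrite !gt_eqF.
  by rewrite ler_wpM2r.
rewrite /dG oppr_ge0.
rewrite mulr_le0_ge0 ?expR_ge0 // mulr_ge0_le0 // !mulr_ge0 ?exprn_ge0 ?(ltW yp) //.
Qed.

Lemma FF_bound x : x0 <= x -> x <= nu / 2 ->
  x ^+ (2 * b + 1) * FF x ^+ 2 <= expR 2 * (x0 ^+ (2 * b + 1) * FF x0 ^+ 2).
Proof.
move=> h1 h2; have xp : 0 < x by exact: lt_le_trans x0_gt0 h1.
have L0 : 0 <= x ^+ (2 * b + 1) * FF x ^+ 2 by rewrite mulr_ge0 ?sqr_ge0 // exprn_ge0 // ltW.
apply: (@le_trans _ _ (G x)).
  rewrite /G ler_peMr // -expR0 ler_expR mulr_ge0 ?invr_ge0 ?(ltW xp) // divr_ge0 ?(ltW nu0) // mulr_ge0 // (le_trans _ A1) //.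
apply: (le_trans (G_dec h1 h2)); rewrite /G mulrC.
have -> : 8 * A / nu * x0^-1 = 2.
  by rewrite /x0; field; rewrite !gt_eqF // (lt_le_trans ltr01 A1).
by [].
Qed.

Lemma der_HH x : der HH x (- (2 * br + 1) * g x ^+ 2 - f x ^+ 2 / 4).
Proof.
have f2 := derP_M (df x) (df x); have g2 := derP_M (dg x) (dg x).
have d1 := derP_M (derP_id x) g2.
have d2 := derP_M (derP_Z 4^-1 (derP_aff (-1) nu x)) f2.
have d' := derP_ext _ (derP_D d1 d2) (g := HH).
apply: (derP_eq (d' _)).
  by move=> y; rewrite /HH; ring.
have -> : x * (g x * h x + g x * h x) = 2 * g x * (x * h x) by ring.
by rewrite ode; field.
Qed.

Lemma HH_dec x y : x <= y -> HH y <= HH x.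
Proof.
move=> xy; rewrite -lerN2.
apply: (der_le (g := fun z => - HH z) (dg := fun z => (2 * br + 1) * g z ^+ 2 + f z ^+ 2 / 4) xy).
  move=> z _; apply: (derP_eq (derP_ext _ (derP_Z (-1) (der_HH z)))) => [u|]; first by rewrite mulN1r.
  by ring.
move=> z _; rewrite addr_ge0 // ?divr_ge0 ?sqr_ge0 // mulr_ge0 ?sqr_ge0 //.
Qed.

Hypothesis decay : exists C, forall x, 0 <= x -> `|x ^+ (b + 1) * (f x * g x)| <= C / (1 + x).

Let S x := x ^+ (b + 1) * (f x * g x).

(** Beyond the turning point $x^{b+1}ff'$ is nondecreasing by the equation, and it tends to 0 at
    infinity, so it cannot be positive. *)
Lemma fg_le0 x : nu <= x -> f x * g x <= 0.
Proof.
move=> nx; have [C HC] := decay.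
have mono y z : nu <= y -> y <= z -> S y <= S z.
  move=> ny yz; apply: (der_le (dg := fun u => u ^+ b * (u * g u ^+ 2 + (u - nu) / 4 * f u ^+ 2)) yz) => u /andP[yu _].
    have d := derP_M (derP_X (b + 1) (derP_id u)) (derP_M (df u) (dg u)).
    apply: (derP_eq (derP_ext _ d)) => [//|].
    rewrite addn1 /= exprS -natr1.
    have -> : u * u ^+ b * (f u * h u + g u * g u) = u ^+ b * (f u * (u * h u) + u * (g u * g u)) by ring.
    by rewrite ode; field.
  have u0 : 0 <= u by rewrite (le_trans _ yu) // (le_trans (ltW nu0)).
  rewrite mulr_ge0 ?exprn_ge0 // addr_ge0 //; first by rewrite mulr_ge0 // sqr_ge0.
  by rewrite mulr_ge0 ?sqr_ge0 // divr_ge0 // subr_ge0 (le_trans ny).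
have xp : 0 < x by exact: lt_le_trans nx.
rewrite leNgt; apply/negP => fg0.
have S0 : 0 < S x by rewrite mulr_gt0 // exprn_gt0.
pose z := x + `|C| / S x.
have xz : x <= z by rewrite lerDl divr_ge0 // ltW.
have z0 : 0 <= z by rewrite (le_trans (ltW xp)).
have := le_trans (mono _ _ nx xz) (le_trans (ler_norm _) (HC z z0)).
rewrite ler_pdivlMr; last by rewrite ltr_pwDl.
have : S x * (1 + z) = S x + S x * x + `|C| by rewrite /z; field; rewrite gt_eqF.
move=> -> hh; have : 0 < S x * x by rewrite mulr_gt0.
by have := ler_norm C; lra.
Qed.

(** By the equation the derivative of $x^{2b+2}f'^2$ is a nonnegative multiple of $ff'$ past [nu],
    hence nonpositive by [fg_le0]. *)
Lemma g_tail x : nu <= x -> g x ^+ 2 <= g nu ^+ 2.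
Proof.
move=> nx; have xp : 0 < x by exact: lt_le_trans nx.
have : - (nu ^+ (2 * b + 2) * g nu ^+ 2) <= - (x ^+ (2 * b + 2) * g x ^+ 2).
  apply: (der_le (g := fun y => - (y ^+ (2 * b + 2) * g y ^+ 2)) (dg := fun u => - (u ^+ (2 * b + 1) * (u - nu) / 2 * (f u * g u))) nx) => u /andP[nu1 _].
    have d := derP_Z (-1) (derP_M (derP_X (2 * b + 2) (derP_id u)) (derP_X 2 (dg u))).
    apply: (derP_eq (derP_ext _ d)) => [y|]; first by rewrite mulN1r.
    rewrite addn2 addn1 /= expr1 !exprS.
    have -> : (2 * b).+2%:R = 2 * br + 2 :> R by rewrite -natr1 -natr1 natrM; ring.
    set P := u ^+ (2 * b).
    have -> : u * (u * P) * (2 * g u * h u) = u * P * (2 * g u * (u * h u)) by ring.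
    by rewrite ode; field.
  have u0 : 0 <= u by rewrite (le_trans _ nu1) // ltW.
  by rewrite oppr_ge0 mulr_ge0_le0 ?fg_le0 // divr_ge0 // mulr_ge0 ?exprn_ge0 // subr_ge0.
rewrite lerN2 => hh; have p0 : 0 < nu ^+ (2 * b + 2) by rewrite exprn_gt0.
rewrite -(ler_pM2l p0); apply: le_trans hh; rewrite ler_wpM2r ?sqr_ge0 //.
by rewrite ler_pXn2r ?nnegrE ?addn_gt0 ?orbT // ltW.
Qed.

Lemma g_bound c x : 0 < c -> c <= 2^-1 -> x0 <= c * nu -> c * nu <= x -> g x ^+ 2 <= HH (c * nu) / (c * nu).
Proof.
move=> c0 c2 h0; have cn0 : 0 < c * nu by rewrite mulr_gt0.
have cn : c * nu <= nu by rewrite ler_piMl ?(ltW nu0) // (le_trans c2) // invf_le1 // ler1n.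
have main y : c * nu <= y -> y <= nu -> g y ^+ 2 <= HH (c * nu) / (c * nu).
  move=> h1 h2; rewrite ler_pdivlMr // mulrC; apply: le_trans (HH_dec h1).
  apply: (@le_trans _ _ (y * g y ^+ 2)); first by rewrite ler_wpM2r ?sqr_ge0.
  by rewrite /HH lerDl mulr_ge0 ?sqr_ge0 // divr_ge0 // subr_ge0.
move=> cx; have [|/ltW nx] := leP x nu; first exact: main.
by apply: (le_trans (g_tail nx)); apply: main.
Qed.

Lemma HH_FF c : 0 < c -> c <= 2^-1 -> x0 <= c * nu ->
  HH (c * nu) <= (2 + 2 * A) * FF (c * nu).
Proof.
move=> c0 c2 h0; set x := c * nu; have xp : 0 < x by rewrite mulr_gt0.
have x2 : x <= nu / 2 by rewrite mulrC /x mulrC [leRHS]mulrC ler_wpM2r // ltW.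
have := FF_lower h0 x2; rewrite -/x; have := FF_ge0 h0 x2; rewrite -/x.
set W := FF x; set u := f x; set v := g x => W0 L.
set w := v + (2 * br + 1) * u / (4 * x) in L.
have u0 : 0 <= u ^+ 2 by rewrite sqr_ge0.
have w0 : 0 <= x * w ^+ 2 by rewrite mulr_ge0 ?sqr_ge0 // ltW.
have xA : 4 * A / x <= nu.
  by rewrite ler_pdivrMr // [nu * x]mulrC; move: h0; rewrite /x0 -/x ler_pdivrMr.
have v2 : x * v ^+ 2 <= 2 * (x * w ^+ 2) + A / x * u ^+ 2.
  have -> : v = w - (2 * br + 1) * u / (4 * x) by rewrite /w addrK.
  set z := (2 * br + 1) * u / (4 * x).
  have zE : 2 * (x * z ^+ 2) <= A / x * u ^+ 2.
    have -> : 2 * (x * z ^+ 2) = ((2 * br + 1) ^+ 2 / 8) / x * u ^+ 2 by rewrite /z; field; rewrite gt_eqF.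
    rewrite ler_wpM2r // ler_wpM2r ?invr_ge0 ?(ltW xp) // /A.
    by have : 0 <= br by []; nra.
  have := mulr_ge0 (ltW xp) (sqr_ge0 (w + z)); nra.
have Au : A / x * u ^+ 2 <= nu / 4 * u ^+ 2.
  by rewrite ler_wpM2r //; move: xA; rewrite -mulrA; lra.
rewrite /HH -/u -/v.
have t1 : (nu - x) / 4 * u ^+ 2 <= nu / 4 * u ^+ 2 by rewrite ler_wpM2r // ler_wpM2r //; lra.
have AW : 0 <= A * W by rewrite mulr_ge0 // (le_trans _ A1).
nra.
Qed.

End Energy.

Section LagBounds.
Variable R : realType.

Lemma bin_leq_expn n m : ('C(n, m) <= n ^ m)%N.
Proof.
apply: (@leq_trans (n ^_ m)); first by rewrite -bin_ffact leq_pmulr // fact_gt0.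
elim: m n => [|m IH] n; first by rewrite ffactn0 expn0.
case: n => [|n]; first by rewrite ffact0n.
by rewrite ffactnS expnS leq_mul2l (leq_trans (IH n)) ?orbT //; case: (m) => [//|m']; rewrite leq_exp2r.
Qed.

(** A crude bound, by integrating $L_{l+1}'=-L_l^{(b+1)}$ from 0. It serves only for x below
    [x00 b l], where $lx$ is bounded independently of l. *)
Lemma lag_exp_bound b l (x : R) : 0 <= x -> `|lagv b l x| <= 'C(l + b, b)%:R * expR (l%:R * x).
Proof.
elim: l b x => [|l IH] b x x0.
  by rewrite /lagv lag0 hornerC normr1 add0n binn mul0r expR0 mulr1.
set c : R := 'C(l.+1 + b, b)%:R.
have c0 : 0 <= c by [].
pose E (y : R) := c * expR (l.+1%:R * y).
have dE (y : R) : der E y (c * (expR (l.+1%:R * y) * l.+1%:R)).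
  by apply: derP_Z; apply: derP_comp; [exact: is_derive_expR|have := derP_Z (l.+1%:R) (derP_id y); rewrite mulr1].
have dL (y : R) : der (lagv b l.+1) y (- lagv b.+1 l y).
  have := is_derive_poly (lag R b l.+1) y; rewrite deriv_lag hornerN; exact: id.
have key y : 0 <= y -> `|lagv b.+1 l y| <= c * (expR (l.+1%:R * y) * l.+1%:R).
  move=> y0; apply: (le_trans (IH b.+1 y y0)).
  have h : ('C(l + b.+1, b.+1) <= 'C(l.+1 + b, b) * l.+1)%N.
    rewrite addnS -addSn; have := mul_bin_left (l.+1 + b) b; rewrite addnK => e.
    by rewrite mulnC -e leq_pmull.
  have -> : c * (expR (l.+1%:R * y) * l.+1%:R) = c * l.+1%:R * expR (l.+1%:R * y) by ring.
  apply: ler_pM => //; rewrite ?expR_ge0 //.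
    by rewrite -natrM ler_nat.
  by rewrite ler_expR ler_wpM2r // ler_nat.
have E0 : E 0 = c by rewrite /E mulr0 expR0 mulr1.
have L0 : lagv b l.+1 0 = c by rewrite /lagv lag_at0.
rewrite ler_norml; apply/andP; split.
  have := der_le (g := fun y => lagv b l.+1 y + E y) x0 (fun y _ => derP_D (dL y) (dE y)).
  rewrite E0 L0 => h; rewrite lerNl -subr_ge0 opprK addrC.
  apply: le_trans (h _); first by rewrite addr_ge0.
  move=> y /andP[y0 _]; have := key y y0; rewrite ler_norml => /andP[_ h2].
  by rewrite addrC subr_ge0.
have := der_le (g := fun y => E y + (-1) * lagv b l.+1 y) x0 (fun y _ => derP_D (dE y) (derP_Z (-1) (dL y))).
rewrite E0 L0 mulN1r subrr mulN1r subr_ge0; apply => y /andP[y0 _].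
by have := key y y0; rewrite ler_norml => /andP[h2 _]; rewrite mulN1r opprK; lra.
Qed.

Definition dphi (b l : nat) (x : R) : R := pexp 2^-1 (dpoly 2^-1 (lag R b l)) x.
Definition nul (b l : nat) : R := 4 * l%:R + 2 * b%:R + 2.

Lemma nul_gt0 b l : 0 < nul b l.
Proof. by rewrite /nul ltr_wpDl // addr_ge0 // mulr_ge0. Qed.

Lemma nul_ge2 b l : 2 <= nul b l.
Proof. by rewrite /nul lerDr addr_ge0 // mulr_ge0. Qed.

Lemma der_phi b l x : der (phi b l) x (dphi b l x).
Proof. exact: der_pexp. Qed.

Lemma dphiE b l x : dphi b l x = ((lag R b l)^`().[x] - 2^-1 * lagv b l x) * expR (- 2^-1 * x).
Proof. by rewrite /dphi /pexp /dpoly hornerD hornerN hornerZ. Qed.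

Lemma phi_ode b l x : x * pexp 2^-1 (dpoly 2^-1 (dpoly 2^-1 (lag R b l))) x =
  - ((b%:R + 1) * dphi b l x) - (nul b l - x) / 4 * phi b l x.
Proof.
rewrite dphiE phiE /pexp /lagv /dpoly derivB derivZ !(hornerD, hornerN, hornerZ).
have := congr1 (fun P : {poly R} => P.[x]) (lag_ode R b l).
rewrite !(hornerD, hornerN, hornerM, hornerX, horner0) -!polyC_natr !hornerC -natr1.
set u := (lag R b l)^`()^`().[x]; set v := (lag R b l)^`().[x]; set w := (lag R b l).[x] => E.
have Exu : x * u = - ((b%:R + 1 - x) * v) - l%:R * w by rewrite -[RHS]addr0 -E; ring.
set e := expR _; transitivity ((x * u - x * v + x * w / 4) * e); first by field.
by rewrite Exu /nul; field.
Qed.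

Lemma phi_decay b l : exists C, forall x, 0 <= x -> `|x ^+ (b + 1) * (phi b l x * dphi b l x)| <= C / (1 + x).
Proof.
have s2 : 0 < 2^-1 :> R by [].
have [C C0 hC] := pexp_bd (lag R b l) (b + 2) s2.
have [E E0 hE] := pexp_bd (dpoly 2^-1 (lag R b l)) 0 s2.
exists (C * E) => x x0; have xp : 0 < 1 + x by rewrite ltr_pwDl.
have h2 := hE x x0; rewrite expr0 divr1 in h2.
have F1 : x ^+ (b + 1) * `|phi b l x| <= C / (1 + x).
  apply: (@le_trans _ _ ((1 + x) ^+ (b + 1) * (C / (1 + x) ^+ (b + 2)))).
    apply: ler_pM; rewrite ?exprn_ge0 //; last exact: hC.
    by rewrite ler_pXn2r ?nnegrE ?addn1 ?(ltW xp) // lerDr.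
  rewrite (addnS b 1) exprS le_eqVlt; apply/orP; left; apply/eqP.
  set z := (1 + x) ^+ (b + 1); have z0 : z != 0 by rewrite gt_eqF // exprn_gt0.
  by field; rewrite z0 gt_eqF.
have -> : C * E / (1 + x) = C / (1 + x) * E by rewrite mulrAC.
rewrite mulrA (normrM (x ^+ (b + 1) * phi b l x)) (normrM (x ^+ (b + 1))) [`|x ^+ _|]ger0_norm ?exprn_ge0 //.
by apply: ler_pM => //; rewrite mulr_ge0 ?exprn_ge0.
Qed.

Let AA b : R := (b%:R + 1) ^+ 2.
Let x00 b l := x0 b (nul b l).

Lemma AA_ge1 b : 1 <= AA b.
Proof. by rewrite /AA -[leLHS](expr1n _ 2) ler_sqr ?nnegrE ?addr_ge0 // lerDr. Qed.

Lemma x00_le b l (x : R) : 0 <= x -> x <= x00 b l -> expR (l%:R * x) <= expR (AA b).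
Proof.
move=> xp hx; rewrite ler_expR.
have : x * nul b l <= 4 * AA b by rewrite -ler_pdivlMr ?nul_gt0.
rewrite /nul => h; have : 0 <= x * b%:R by rewrite mulr_ge0.
have := mulr_ge0 xp (ler0n R l); lra.
Qed.

Lemma expR_le1 (x : R) : 0 <= x -> expR (- 2^-1 * x) <= 1.
Proof. by move=> x0; rewrite -expR0 ler_expR mulNr oppr_le0 mulr_ge0. Qed.

Lemma bin_nul b l c : 'C(l + b, c)%:R <= nul b l ^+ c.
Proof.
apply: (@le_trans _ _ ((l + b)%:R ^+ c)); first by rewrite -natrX ler_nat bin_leq_expn.
case: c => [|c]; first by rewrite !expr0.
rewrite ler_pXn2r ?nnegrE ?(ltW (nul_gt0 b l)) // /nul natrD.
by have := ler0n R l; have := ler0n R b; lra.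
Qed.

Lemma phi_small b l x : 0 <= x -> x <= x00 b l -> `|phi b l x| <= nul b l ^+ b * expR (AA b).
Proof.
move=> xp hx; rewrite phiE normrM [`|expR _|]ger0_norm ?expR_ge0 //.
rewrite -[leRHS]mulr1; apply: ler_pM; rewrite ?expR_ge0 ?expR_le1 //.
apply: (le_trans (lag_exp_bound b l xp)); apply: ler_pM; rewrite ?expR_ge0 ?x00_le //.
exact: bin_nul.
Qed.

Lemma dphi_small b l x : 0 <= x -> x <= x00 b l -> `|dphi b l x| <= 2 * nul b l ^+ b.+1 * expR (AA b).
Proof.
move=> xp hx; rewrite dphiE normrM [`|expR _|]ger0_norm ?expR_ge0 //.
rewrite -[leRHS]mulr1; apply: ler_pM; rewrite ?expR_ge0 ?expR_le1 //.
have n1 : 1 <= nul b l by rewrite (le_trans _ (nul_ge2 b l)) // ler1n.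
have e1 : 0 <= expR (AA b) by exact: expR_ge0.
apply: (le_trans (ler_normB _ _)).
have -> : 2 * nul b l ^+ b.+1 * expR (AA b) = nul b l ^+ b.+1 * expR (AA b) + nul b l ^+ b.+1 * expR (AA b) by ring.
apply: lerD.
  case: l hx n1 => [|l] hx n1.
    by rewrite lag0 derivC horner0 normr0 mulr_ge0 // exprn_ge0 // (le_trans _ n1).
  rewrite deriv_lag hornerN normrN; apply: (le_trans (lag_exp_bound b.+1 l xp)).
  apply: ler_pM; rewrite ?expR_ge0 //.
    by rewrite addnS -addSn bin_nul.
  apply: le_trans (x00_le xp hx); rewrite ler_expR ler_wpM2r // ler_nat //.
rewrite normrM ger0_norm // -[leRHS]mul1r; apply: ler_pM => //; first by rewrite invf_le1 // ler1n.
apply: (le_trans (lag_exp_bound b l xp)); apply: ler_pM; rewrite ?expR_ge0 ?x00_le //.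
apply: (le_trans (bin_nul b l b)); rewrite exprS ler_peMl // exprn_ge0 //; exact: le_trans n1.
Qed.

Let FFb b l := FF b (nul b l) (phi b l) (dphi b l).

(** The starting point is of size $1/\nu$ and the crude bounds give [FF] of size $\nu^{2b+1}$ there;
    squaring and multiplying by $x^{2b+1}$ leaves $\nu^{2b+1}$. *)
Lemma FF_start b : exists2 K : R, 0 <= K & forall l, x00 b l <= nul b l / 2 ->
  x00 b l ^+ (2 * b + 1) * FFb b l (x00 b l) ^+ 2 <= K * nul b l ^+ (2 * b + 1).
Proof.
pose E := expR (AA b); pose K0 : R := E ^+ 2 * (64 * AA b + 1 + 2 * (4 * b%:R + 2) + (b%:R + 1)).
have A1 := AA_ge1 b; have A0 : 0 < AA b by exact: lt_le_trans A1.
have K00 : 0 <= K0.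
  by rewrite mulr_ge0 ?sqr_ge0 // !addr_ge0 ?mulr_ge0 ?addr_ge0 ?mulr_ge0 ?(ltW A0).
exists ((4 * AA b) ^+ (2 * b + 1) * K0 ^+ 2).
  by rewrite mulr_ge0 ?sqr_ge0 // exprn_ge0 // mulr_ge0 // ltW.
move=> l hl; have n0 := nul_gt0 b l; set nu := nul b l in n0 hl *.
have xp : 0 < x00 b l by exact: x0_gt0.
have F0 : 0 <= FFb b l (x00 b l).
  by apply: FF_ge0.
have hf := phi_small (ltW xp) (lexx _); have hg := dphi_small (ltW xp) (lexx _).
suff F1 : FFb b l (x00 b l) <= K0 * nu ^+ (2 * b + 1).
  have -> : x00 b l = 4 * AA b / nu by [].
  rewrite expr_div_n.
  apply: (@le_trans _ _ ((4 * AA b) ^+ (2 * b + 1) / nu ^+ (2 * b + 1) * (K0 * nu ^+ (2 * b + 1)) ^+ 2)).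
    rewrite ler_wpM2l ?divr_ge0 ?exprn_ge0 ?(ltW n0) ?mulr_ge0 ?(ltW A0) // ler_sqr ?nnegrE //.
    by rewrite mulr_ge0 // exprn_ge0 // ltW.
  set X := (4 * AA b) ^+ _; set Y := nu ^+ _; have Y0 : Y != 0 by rewrite gt_eqF // exprn_gt0.
  by rewrite le_eqVlt; apply/orP; left; apply/eqP; field.
move: hf hg; rewrite /FFb /FF -/nu -/E; set f := phi b l _; set g := dphi b l _ => hf hg.
set P := nu ^+ b in hf; have P0 : 0 <= P by rewrite exprn_ge0 // ltW.
have E0 : 0 <= E by exact: expR_ge0.
have f2 : f ^+ 2 <= P ^+ 2 * E ^+ 2.
  by rewrite -real_normK ?num_real // -exprMn ler_sqr ?nnegrE ?mulr_ge0.
have g2 : g ^+ 2 <= 4 * (nu ^+ 2 * P ^+ 2) * E ^+ 2.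
  rewrite exprS in hg; have -> : 4 * (nu ^+ 2 * P ^+ 2) * E ^+ 2 = (2 * (nu * P) * E) ^+ 2 by ring.
  by rewrite -real_normK ?num_real // ler_sqr ?nnegrE // !mulr_ge0 // ltW.
have fg : f * g <= 2 * (nu * P ^+ 2) * E ^+ 2.
  apply: (le_trans (ler_norm _)); rewrite (normrM f g) exprS -/P in hg *.
  have -> : 2 * (nu * P ^+ 2) * E ^+ 2 = P * E * (2 * (nu * P) * E) by ring.
  by rewrite ler_pM.
have -> : nu ^+ (2 * b + 1) = nu * P ^+ 2 by rewrite addn1 exprS mulnC exprM.
set W := P ^+ 2 in f2 g2 fg *; set V := E ^+ 2 in f2 g2 fg *.
have W0 : 0 <= W by exact: sqr_ge0. have V0 : 0 <= V by exact: sqr_ge0.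
have x0E : x00 b l = 4 * AA b / nu by [].
have t1 : 4 * x00 b l * g ^+ 2 <= 64 * AA b * (nu * W * V).
  apply: (@le_trans _ _ (4 * x00 b l * (4 * (nu ^+ 2 * W) * V))); first by rewrite ler_wpM2l // mulr_ge0 // ltW.
  by rewrite x0E le_eqVlt; apply/orP; left; apply/eqP; field; rewrite gt_eqF.
have t2 : (nu - x00 b l) * f ^+ 2 <= nu * W * V.
  rewrite -mulrA; apply: ler_pM => //; rewrite ?sqr_ge0 ?lerBlDr ?lerDl ?(ltW xp) //.
  by rewrite subr_ge0; apply: (le_trans hl); rewrite ler_pdivrMr // ler_peMr ?(ltW n0) // ler1n.
have t3 : (4 * b%:R + 2) * (f * g) <= 2 * (4 * b%:R + 2) * (nu * W * V).
  have -> : 2 * (4 * b%:R + 2) * (nu * W * V) = (4 * b%:R + 2) * (2 * (nu * W) * V) by ring.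
  by rewrite ler_wpM2l // addr_ge0 // mulr_ge0.
have t4 : (b%:R + 2^-1) * f ^+ 2 / x00 b l <= (b%:R + 1) * (nu * W * V).
  apply: (@le_trans _ _ ((b%:R + 1) * (W * V) / x00 b l)).
    rewrite ler_wpM2r ?invr_ge0 ?(ltW xp) // ler_pM ?sqr_ge0 ?addr_ge0 // lerD2l; lra.
  rewrite x0E invf_div -[leLHS]mulrA ler_wpM2l ?addr_ge0 //.
  have -> : nu * W * V = W * V * nu by ring.
  apply: ler_wpM2l; first exact: mulr_ge0.
  rewrite ler_pdivrMr ?mulr_gt0 // ler_peMr ?(ltW n0) //; lra.
have -> : K0 * (nu * W) = 64 * AA b * (nu * W * V) + nu * W * V + 2 * (4 * b%:R + 2) * (nu * W * V) + (b%:R + 1) * (nu * W * V).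
  by rewrite /K0 -/V; ring.
by rewrite !lerD.
Qed.

Lemma FF_bulk b : exists2 K : R, 0 <= K & forall l x, x00 b l <= x -> x <= nul b l / 2 ->
  x ^+ (2 * b + 1) * FFb b l x ^+ 2 <= K * nul b l ^+ (2 * b + 1).
Proof.
have [K K0 hK] := FF_start b; exists (expR 2 * K); first by rewrite mulr_ge0 // expR_ge0.
move=> l x h1 h2.
apply: (le_trans (FF_bound (nul_gt0 b l) (der_phi b l) (der_pexp _ _) (phi_ode b l) h1 h2)).
by rewrite -mulrA ler_wpM2l ?expR_ge0 // hK // (le_trans h1).
Qed.

(** In other words $|\phi_l|=O(\nu^{b/2-1/4}x^{-b/2-1/4})$; fourth powers clear the fractional
    exponents. To the right of [x00 b l] it comes from the energy, to the left from [phi_small]. *)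
Lemma phi_bulk b : exists2 K : R, 0 <= K & forall l x, 0 <= x -> x <= nul b l / 2 ->
  x ^+ (2 * b + 1) * phi b l x ^+ 4 * nul b l <= K * nul b l ^+ (2 * b).
Proof.
have [K K0 hK] := FF_bulk b.
have A1 := AA_ge1 b; have A0 : 0 < AA b by exact: lt_le_trans A1.
exists (16 * K + (4 * AA b) ^+ (2 * b + 1) * expR (AA b) ^+ 4).
  by rewrite addr_ge0 ?mulr_ge0 ?exprn_ge0 ?expR_ge0 // mulr_ge0 // ltW.
move=> l x xp h2; have n0 := nul_gt0 b l; set nu := nul b l in n0 h2 *.
have N0 : 0 <= nu ^+ (2 * b) by rewrite exprn_ge0 // ltW.
have p4 (u : R) : u ^+ 4 = (u ^+ 2) ^+ 2 by rewrite -exprM.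
rewrite mulrDl; have [h1|h1] := leP (x00 b l) x.
  apply: (@le_trans _ _ (16 * K * nu ^+ (2 * b))); last first.
    rewrite lerDl; apply: mulr_ge0 => //; apply: mulr_ge0; last by rewrite exprn_ge0 // expR_ge0.
    by rewrite exprn_ge0 // mulr_ge0 // ltW.
  have := hK l x h1 h2; rewrite -/nu => h.
  have L : nu / 4 * phi b l x ^+ 2 + 4 * x * (dphi b l x + (2 * b%:R + 1) * phi b l x / (4 * x)) ^+ 2 <= FFb b l x by apply: FF_lower.
  have xq : 0 < x by apply: lt_le_trans h1; exact: x0_gt0.
  have F : nu / 4 * phi b l x ^+ 2 <= FFb b l x.
    by apply: le_trans L; rewrite lerDl mulr_ge0 ?sqr_ge0 // mulr_ge0.
  have F2 : (nu / 4 * phi b l x ^+ 2) ^+ 2 <= FFb b l x ^+ 2.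
    have u0 : 0 <= nu / 4 * phi b l x ^+ 2 by rewrite mulr_ge0 ?sqr_ge0 // divr_ge0 // ltW.
    by rewrite ler_sqr ?nnegrE // (le_trans u0).
  rewrite -(ler_pM2r n0); apply: (@le_trans _ _ (16 * (x ^+ (2 * b + 1) * FFb b l x ^+ 2))).
    have -> : x ^+ (2 * b + 1) * phi b l x ^+ 4 * nu * nu = 16 * (x ^+ (2 * b + 1) * (nu / 4 * phi b l x ^+ 2) ^+ 2).
      by rewrite p4; set X := x ^+ _; field.
    by rewrite ler_wpM2l // ler_wpM2l // exprn_ge0.
  have -> : 16 * K * nu ^+ (2 * b) * nu = 16 * (K * nu ^+ (2 * b + 1)).
    by rewrite addn1 exprS; set X := nu ^+ (2 * b); ring.
  by rewrite ler_wpM2l.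
apply: (@le_trans _ _ ((4 * AA b) ^+ (2 * b + 1) * expR (AA b) ^+ 4 * nu ^+ (2 * b))); last first.
  by rewrite lerDr; apply: mulr_ge0 => //; apply: mulr_ge0.
have hf := phi_small xp (ltW h1); rewrite -/nu in hf; set E := expR (AA b) in hf *.
have E0 : 0 <= E by exact: expR_ge0.
set P := nu ^+ b in hf; have P0 : 0 <= P by rewrite exprn_ge0 // ltW.
have f4 : phi b l x ^+ 4 <= (P * E) ^+ 4.
  rewrite p4 -(real_normK (num_real (phi b l x))) -p4.
  by rewrite ler_pXn2r ?nnegrE // mulr_ge0.
have -> : nu ^+ (2 * b) = P ^+ 2 by rewrite mulnC exprM.
have hx : x ^+ (2 * b + 1) * (nu * P ^+ 2) <= (4 * AA b) ^+ (2 * b + 1).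
  have -> : nu * P ^+ 2 = nu ^+ (2 * b + 1) by rewrite addn1 [RHS]exprS mulnC exprM.
  rewrite -exprMn ler_pXn2r ?addn1 ?nnegrE ?mulr_ge0 ?(ltW n0) ?(ltW A0) //.
  by rewrite -ler_pdivlMr // ltW.
apply: (@le_trans _ _ (x ^+ (2 * b + 1) * (P * E) ^+ 4 * nu)).
  by rewrite ler_wpM2r ?(ltW n0) // ler_wpM2l // exprn_ge0.
have -> : x ^+ (2 * b + 1) * (P * E) ^+ 4 * nu = x ^+ (2 * b + 1) * (nu * P ^+ 2) * (E ^+ 4 * P ^+ 2).
  by set X := x ^+ _; ring.
rewrite -[leRHS]mulrA; apply: ler_wpM2r; last exact: hx.
by apply: mulr_ge0; apply: exprn_ge0.
Qed.

Lemma fin_sup (G : nat -> R -> R) : (forall l, exists2 K : R, 0 <= K & forall x, 0 <= x -> G l x <= K) ->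
  forall L, exists2 K : R, 0 <= K & forall l x, (l < L)%N -> 0 <= x -> G l x <= K.
Proof.
move=> H; elim=> [|L [K K0 IH]]; first by exists 0.
have [K' K'0 H'] := H L; exists (K + K'); first by rewrite addr_ge0.
move=> l x; rewrite ltnS leq_eqVlt => /orP[/eqP ->|lL] x0.
  by apply: (le_trans (H' x x0)); rewrite lerDr.
by apply: (le_trans (IH l x lL x0)); rewrite lerDl.
Qed.

Lemma dphi_bulk b (c : R) : 0 < c -> c <= 2^-1 -> exists2 K : R, 0 <= K & forall l x,
  c * nul b l <= x -> dphi b l x ^+ 2 * nul b l <= K.
Proof.
move=> c0 c2; have [K K0 hK] := FF_bulk b.
have A1 := AA_ge1 b; have A0 : 0 < AA b by exact: lt_le_trans A1.
pose K1 := (2 + 2 * AA b) * (1 + K / c ^+ (2 * b + 1)) / c.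
have K10 : 0 <= K1.
  apply: divr_ge0; last exact: ltW.
  apply: mulr_ge0; first by rewrite addr_ge0 // mulr_ge0 // ltW.
  by rewrite addr_ge0 // divr_ge0 // exprn_ge0 // ltW.
have fin l : exists2 K : R, 0 <= K & forall x, 0 <= x -> dphi b l x ^+ 2 * nul b l <= K.
  have s2 : 0 < 2^-1 :> R by rewrite invr_gt0.
  have [E E0 hE] := pexp_bd (dpoly 2^-1 (lag R b l)) 0 s2.
  exists (E ^+ 2 * nul b l); first by rewrite mulr_ge0 ?sqr_ge0 // ltW // nul_gt0.
  move=> x x0; rewrite ler_wpM2r ?(ltW (nul_gt0 b l)) // -real_normK ?num_real // ler_sqr ?nnegrE //.
  by have := hE x x0; rewrite expr0 divr1.
(* If $c\nu$ lies to the left of the starting point then $c\nu^2<4(b+1)^2$, which forces $l$ below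
   [L]: finitely many indices, handled by [fin_sup]. *)
pose L := (Num.truncn (4 * AA b / c)).+1.
have [K2 K20 h2] := fin_sup fin L.
exists (K1 + K2); first by rewrite addr_ge0.
move=> l x hx; have n0 := nul_gt0 b l.
have x0' : 0 <= x by apply: le_trans hx; rewrite mulr_ge0 // ltW.
have [h|h] := leP (x00 b l) (c * nul b l); last first.
  apply: (@le_trans _ _ K2); last by rewrite lerDr.
  apply: h2 => //; rewrite -(ltr_nat R); apply: (@le_lt_trans _ _ (4 * AA b / c)); last exact: truncnS_gt.
  rewrite ler_pdivlMr //; move: h; rewrite /x00 /x0 -/(AA b) ltr_pdivlMr // => h.
  apply: le_trans (ltW h); rewrite mulrC -mulrA; apply: ler_wpM2l; first exact: ltW.
  have n1 : 1 <= nul b l by rewrite (le_trans _ (nul_ge2 b l)) // ler1n.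
  apply: (@le_trans _ _ (nul b l)); last by rewrite ler_peMr // ltW.
  by rewrite /nul; have := ler0n R l; have := ler0n R b; lra.
apply: (@le_trans _ _ K1); last by rewrite lerDl.
have gb := g_bound n0 (der_phi b l) (der_pexp _ _) (phi_ode b l) (phi_decay b l) c0 c2 h hx.
rewrite -ler_pdivlMr //; apply: (le_trans gb).
have cn0 : 0 < c * nul b l by rewrite mulr_gt0.
have HF : HH (nul b l) (phi b l) (dphi b l) (c * nul b l) <= (2 + 2 * AA b) * FF b (nul b l) (phi b l) (dphi b l) (c * nul b l) by apply: HH_FF.
have x2 : c * nul b l <= nul b l / 2 by rewrite mulrC ler_wpM2l // ltW.
have := hK l _ h x2; rewrite /FFb; set W := FF _ _ _ _ _ in HF *.
rewrite exprMn => hW.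
have W2 : W ^+ 2 <= K / c ^+ (2 * b + 1).
  rewrite ler_pdivlMr ?exprn_gt0 // -(ler_pM2r (exprn_gt0 (2 * b + 1) n0)).
  by apply: le_trans hW; rewrite le_eqVlt; apply/orP; left; apply/eqP; ring.
have W1 : W <= 1 + K / c ^+ (2 * b + 1).
  by apply: (@le_trans _ _ (1 + W ^+ 2)); [have := sqr_ge0 (W - 1); have := sqr_ge0 W; nra|rewrite lerD2l].
rewrite /K1 -[leRHS]mulrA -invfM ler_wpM2r ?invr_ge0 ?(ltW cn0) //.
apply: (le_trans HF); apply: ler_wpM2l => //; apply: addr_ge0 => //; apply: mulr_ge0 => //; exact: ltW.
Qed.

(** Both Laguerre terms of the derivative of $\phi^{(b)}_{l+1}$ are expressed at order $b+1$. The
    smallness of neighbouring sums is thus the derivative bound [dphi_bulk]. *)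
Lemma phi_pair b l x : phi b.+1 l x + phi b.+1 l.+1 x = - (2 * dphi b l.+1 x).
Proof.
have E : lagv b l.+1 x = lagv b.+1 l.+1 x - lagv b.+1 l x by rewrite /lagv -[in LHS]lag_pascal hornerD hornerN.
rewrite dphiE !phiE deriv_lag hornerN -/(lagv _ _ _) E.
by field.
Qed.

Lemma fact_ratio m j : (m`! * m.+1 ^ j <= (m + j)`!)%N.
Proof.
elim: j => [|j IH]; first by rewrite expn0 muln1 addn0.
rewrite addnS factS expnS mulnCA; apply: leq_mul => //.
by rewrite ltnS leq_addr.
Qed.

Lemma lag_const_pow4 (X Y : R) : 0 <= Y -> X ^+ 4 <= Y -> `|X| <= Num.sqrt (Num.sqrt Y).
Proof.
move=> Y0 h; rewrite -sqrtr_sqr; apply: ler_wsqrtr; rewrite -[X ^+ 2]ger0_norm ?sqr_ge0 // -sqrtr_sqr.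
by apply: ler_wsqrtr; rewrite -exprM.
Qed.

(* the gain N^a sqrt(N/k): for x <~ k, use (S-1)^{2a} phi_l = x^a O(k^{-a}) phi_{l+a}; for x >~ k, use phi_l + phi_{l+1} = O(k^{-1/2}) *)
Lemma mult_bound b D : let a := b.+1 in exists2 C : R, 0 <= C & forall k N l x, (0 < N)%N -> (N <= k.+1)%N ->
  (k <= l <= k + D * k.+1)%N -> 0 <= x ->
  act (mult R N (a + a)) (fun i => phi a i x) l ^+ 4 * k.+1%:R ^+ 2 <= C * N%:R ^+ (4 * a + 2).
Proof.
move=> a; have [K K0 hK] := phi_bulk a.
(* Large enough for $\nu\le E(k+1)$ at every index that the multiplier reaches: it starts at most at
   $k+D(k+1)$ and moves by at most $3a+4aN+2$ with $N\le k+1$. *)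
pose E := (4 * (1 + D + 7 * a) + 2 * a + 12)%N; pose Er : R := E%:R.
have E2 : 2 <= Er by rewrite ler_nat /E addnC.
have E0 : 0 < Er by rewrite (lt_le_trans _ E2).
have c0 : 0 < Er^-1 by rewrite invr_gt0.
have c2 : Er^-1 <= 2^-1 by rewrite lef_pV2 ?posrE.
have [K' K'0 hK'] := dphi_bulk b c0 c2.
pose C1 := (2 ^+ (a + a)) ^+ 4 * (K * Er ^+ (2 * a)).
pose C2 := (2 ^+ (a + a) * 2) ^+ 4 * K' ^+ 2.
have C10 : 0 <= C1 by rewrite mulr_ge0 ?exprn_ge0 // mulr_ge0 // exprn_ge0 // ltW.
have C20 : 0 <= C2 by rewrite mulr_ge0 ?exprn_ge0 // mulr_ge0 ?exprn_ge0.
exists (C1 + C2); first exact: addr_ge0.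
move=> k N l x N0 Nk /andP[kl lk] xp.
set u := fun i => phi a i x; set M := mult R N (a + a).
pose kr : R := k.+1%:R; have kr0 : 0 < kr by rewrite ltr0n.
pose nr : R := N%:R; have nr1 : 1 <= nr by rewrite ler1n.
have nr0 : 0 < nr by rewrite ltr0n.
rewrite -/kr -/nr mulrDl.
have nuE i : (l <= i)%N -> (i <= l + (3 * a + 4 * a * N + 2))%N -> 4 * kr <= nul a i /\ nul a i <= Er * kr /\ nul b i <= Er * kr /\ kr <= nul b i.
  move=> li il.
  have h1 : (k <= i)%N by exact: leq_trans li.
  have h2 : (i <= (1 + D + 7 * a) * k.+1 + 2)%N by clear -il lk Nk; nia.
  have h2r : i%:R <= (1 + D%:R + 7 * a%:R) * kr + 2 :> R.
    by move: h2; rewrite -(ler_nat R) !(natrD, natrM).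
  have h1r : k%:R <= i%:R :> R by rewrite ler_nat.
  have kE : kr = k%:R + 1 by rewrite natr1.
  have k1 : 1 <= kr by rewrite ler1n.
  have EE : Er = 4 * (1 + D%:R + 7 * a%:R) + 2 * a%:R + 12.
    by rewrite /Er /E !(natrD, natrM).
  have ab : a%:R = b%:R + 1 :> R by rewrite natr1.
  have b0 : 0 <= b%:R :> R by [].
  have bk : 0 <= (kr - 1) * a%:R by rewrite mulr_ge0 // subr_ge0.
  split; first by rewrite /nul ab kE; lra.
  have up : nul a i <= Er * kr by rewrite /nul EE; lra.
  split => //; split; last by rewrite /nul kE; have := ler0n R i; lra.
  by apply: le_trans up; rewrite /nul ab; lra.
have M4 : 0 <= C2 * nr ^+ (4 * a + 2) by rewrite mulr_ge0 // exprn_ge0 // ltW.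
have M4' : 0 <= C1 * nr ^+ (4 * a + 2) by rewrite mulr_ge0 // exprn_ge0 // ltW.
have p4 (z : R) : z ^+ 4 = `|z| ^+ 4 by rewrite -normrX ger0_norm // (exprM z 2 2) sqr_ge0.
have X1 : opb (1 + 'X : {poly R}) (1 + 1) 1.
  by apply: opbD; [exact: opb1|rewrite -['X]expr1; exact: opbXn].
have X2 : opb (1 - 'X : {poly R}) (1 + 1) 1.
  by apply: opbD; [exact: opb1|apply: opbN; rewrite -['X]expr1; exact: opbXn].
have fin z Z : `|act M u l| <= z -> z ^+ 4 * kr ^+ 2 <= Z -> act M u l ^+ 4 * kr ^+ 2 <= Z.
  move=> h; apply: le_trans; rewrite ler_wpM2r ?sqr_ge0 // p4.
  by rewrite ler_pXn2r ?nnegrE // (le_trans _ h).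
have [hx|hx] := leP x (2 * kr).
  apply: ler_wpDr => //.
  pose Q : {poly R} := (1 + 'X) * avgq R N.
  (* All the zeros at 1 are kept for [act_phi]; the zeros at -1 go into [Q], each at the cost of a
     factor 2N. *)
  have ME : M = Q ^+ (a + a) * ('X - 1) ^+ (a + a).
    rewrite /M /mult (avg_factor _ N0) -mulrA mulrC exprMn; congr (_ * _).
    by rewrite -opprB exprNn addnn -signr_odd odd_double expr0 mul1r.
  have hQ : opb (Q ^+ (a + a)) (((1 + 1) * N%:R) ^+ (a + a)) ((a + a) * (1 + 2 * N)).
    by apply: opbX; apply: opbM => //; exact: opb_avgq.
  have inner B : (forall i, (l <= i)%N -> (i <= l + (3 * a + 4 * a * N + 2))%N -> `|u i| <= B) ->
      `|act M u l| <= (2 * nr) ^+ (a + a) * (x ^+ a * kr ^- a * B).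
    move=> hB; rewrite ME act_mul; apply: hQ => i iW.
    rewrite act_phi normrM normrX normrN (ger0_norm xp) -[leRHS]mulrA ler_wpM2l ?exprn_ge0 //.
    rewrite normrM; apply: ler_pM => //; last first.
      by apply: hB; [clear; lia|clear -iW; nia].
    rewrite ger0_norm ?divr_ge0 // ler_pdivrMr ?ltr0n ?fact_gt0 // mulrC -[kr ^- a]mul1r mulrA ler_pdivlMr ?exprn_gt0 // mulr1.
    rewrite -natrX -natrM ler_nat; apply: leq_trans (fact_ratio _ _).
    rewrite leq_mul2l leq_exp2r //; apply/orP; right; clear -kl; lia.
  have := xp; rewrite le_eqVlt => /orP[/eqP x0|x0].
    apply: (fin 0); last by rewrite expr0n mul0r.
    rewrite ME act_mul -(mulr0 (((1 + 1) * N%:R) ^+ (a + a))); apply: hQ => i _.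
    by rewrite act_phi -x0 oppr0 exprS !mul0r normr0.
  pose Y := K * (Er * kr) ^+ (2 * a) / (x ^+ (2 * a + 1) * kr).
  have Y0 : 0 <= Y by rewrite divr_ge0 ?mulr_ge0 ?exprn_ge0 ?mulr_ge0 ?(ltW kr0) ?(ltW E0).
  pose B := Num.sqrt (Num.sqrt Y); have B0 : 0 <= B by exact: sqrtr_ge0.
  have B4 : B ^+ 4 = Y by rewrite (exprM B 2 2) !sqr_sqrtr // sqrtr_ge0.
  have uB i : (l <= i)%N -> (i <= l + (3 * a + 4 * a * N + 2))%N -> `|u i| <= B.
    move=> li il; have [n1 [n2 [n3 n4]]] := nuE i li il.
    apply: lag_const_pow4 => //; rewrite ler_pdivlMr ?mulr_gt0 ?exprn_gt0 //.
    have x2 : x <= nul a i / 2 by apply: (le_trans hx); lra.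
    have h := hK i x xp x2.
    have u4 : 0 <= u i ^+ 4 by rewrite (exprM _ 2 2) sqr_ge0.
    apply: (@le_trans _ _ (K * nul a i ^+ (2 * a))).
      apply: le_trans h; rewrite mulrA [u i ^+ 4 * _]mulrC ler_wpM2l //.
        by rewrite mulr_ge0 // exprn_ge0.
      by have := ltW kr0; lra.
    by rewrite ler_wpM2l // ler_pXn2r ?nnegrE ?mulr_ge0 ?(ltW kr0) ?(ltW E0) // ltW // nul_gt0.
  (* The identity gains $y^a$ over the trivial bound. Since $\min(1,y^{4a})\le y^{2a+1}$, the powers
     of x in [Y] cancel. *)
  pose y := nr ^+ 2 * x / kr; have y0 : 0 <= y by rewrite divr_ge0 ?mulr_ge0 ?sqr_ge0 ?(ltW kr0).
  have z1 : `|act M u l| <= 2 ^+ (a + a) * B.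
    have h : opb M (2 ^+ (a + a)) ((a + a) * (2 * N)) by apply: opbX; exact: opb_1avg.
    by apply: h => i iW; apply: uB; [clear; lia|clear -iW; nia].
  have z2 : `|act M u l| <= 2 ^+ (a + a) * B * y ^+ a.
    apply: (le_trans (inner B uB)); rewrite le_eqVlt; apply/orP; left; apply/eqP.
    have -> : y ^+ a = (nr ^+ 2) ^+ a * x ^+ a / kr ^+ a by rewrite /y expr_div_n (exprMn a (nr ^+ 2) x).
    have -> : (nr ^+ 2) ^+ a = nr ^+ (a + a) by rewrite -exprM mul2n addnn.
    rewrite (exprMn (a + a) 2 nr).
    by set T := 2 ^+ _; set U := nr ^+ _; set V := x ^+ _; ring.
  have fE : (2 ^+ (a + a) * B) ^+ 4 * y ^+ (2 * a + 1) * kr ^+ 2 <= C1 * nr ^+ (4 * a + 2).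
    have -> : y ^+ (2 * a + 1) = nr ^+ (4 * a + 2) * x ^+ (2 * a + 1) / kr ^+ (2 * a + 1).
      rewrite /y expr_div_n (exprMn (2 * a + 1) (nr ^+ 2) x) -exprM.
      by have -> : (2 * (2 * a + 1) = 4 * a + 2)%N by clear; lia.
    rewrite (exprMn 4 _ B) B4 /Y /C1 (exprMn (2 * a) Er kr).
    set T := (2 ^+ _) ^+ 4; set U := nr ^+ _; rewrite addn1 (exprS kr) (exprS x).
    set V := x ^+ _; set W := kr ^+ (2 * a); set Z := Er ^+ _.
    have V0 : V != 0 by rewrite gt_eqF // exprn_gt0.
    have W0 : W != 0 by rewrite gt_eqF // exprn_gt0.
    by rewrite le_eqVlt; apply/orP; left; apply/eqP; field; rewrite V0 W0 !gt_eqF.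
  have TB0 : 0 <= (2 ^+ (a + a) * B) ^+ 4 by rewrite exprn_ge0 // mulr_ge0 // exprn_ge0.
  have [y1|y1] := leP y 1.
    apply: (fin _ _ z2); apply: le_trans fE; rewrite ler_wpM2r ?sqr_ge0 // exprMn ler_wpM2l // -exprM.
    by rewrite ler_wiXn2l // /a; clear; lia.
  apply: (fin _ _ z1); apply: le_trans fE; rewrite ler_wpM2r ?sqr_ge0 // ler_peMr //.
  by rewrite exprn_ege1 // ltW.
apply: ler_wpDl => //.
pose B := Num.sqrt (K' / kr).
have B2 : B ^+ 2 = K' / kr by rewrite sqr_sqrtr // divr_ge0 // ltW.
have B0 : 0 <= B by exact: sqrtr_ge0.
(* For large x one zero at -1 is enough: it produces [phi_pair], costs a single factor N, and the
   remaining factors are bounded. *)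
have ME : M = avgq R N * (1 - 'X) * (1 - avg R N) ^+ (b + a) * (1 + 'X).
  by rewrite /M /mult {1}/a addSn exprS {1}(avg_factor _ N0); ring.
have h : opb (avgq R N * (1 - 'X) * (1 - avg R N) ^+ (b + a)) (N%:R * (1 + 1) * 2 ^+ (b + a)) (2 * N + 1 + (b + a) * (2 * N)).
  apply: opbM; first by apply: opbM => //; exact: opb_avgq.
  by apply: opbX; exact: opb_1avg.
have z1 : `|act M u l| <= N%:R * (1 + 1) * 2 ^+ (b + a) * (2 * B).
  rewrite ME act_mul; apply: h => i iW.
  rewrite actD act1 -['X]expr1 actXn addn1 phi_pair normrN normrM ger0_norm // ler_wpM2l //.
  have [n1 [n2 [n3 n4]]] := nuE (l + i).+1 (leqW (leq_addr _ _)) (ltac:(rewrite /a in iW *; clear -iW; nia)).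
  rewrite -sqrtr_sqr; apply: ler_wsqrtr; rewrite ler_pdivlMr //.
  apply: (@le_trans _ _ (dphi b (l + i).+1 x ^+ 2 * nul b (l + i).+1)); first by rewrite ler_wpM2l // sqr_ge0.
  by apply: hK'; rewrite mulrC ler_pdivrMr // (le_trans n3) // mulrC ler_wpM2r ?(ltW E0) //; have := ltW kr0; lra.
apply: (fin _ _ z1).
have -> : N%:R * (1 + 1) * 2 ^+ (b + a) * (2 * B) = nr * (2 ^+ (a + a) * 2 * B).
  by rewrite {2}/a addSn exprS; ring.
have -> : (nr * (2 ^+ (a + a) * 2 * B)) ^+ 4 * kr ^+ 2 = C2 * nr ^+ 4.
  rewrite !exprMn (exprM B 2 2) B2 /C2 expr_div_n exprMn.
  by set T := (2 ^+ _) ^+ 4; field; rewrite gt_eqF.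
by rewrite ler_wpM2l // ler_weXn2l // /a; clear; lia.
Qed.

End LagBounds.

(** * The upper bound *)

Section Pieces.
Variables (R : realType) (b : nat).
Notation a := b.+1.
Notation A := (b.+1 + b.+1)%N.
Notation n := b.+2.

(** Dyadic telescoping from [mult R 1 A = 0] to the identity; the last piece collects the difference
    between the identity and the largest scale. *)
Definition piece (J j : nat) : {poly R} :=
  if (j < J)%N then mult R (2 ^ j.+1) A - mult R (2 ^ j) A else 1 - mult R (2 ^ J) A.
(** The first term covers the reach of the multiplier at scale $2^{j+1}$, the second the size of the
    coefficients of a difference of two multipliers. *)
Definition pieceD : nat := (8 * a + 2 * 2 ^ A)%N.

Lemma pieceD_gt0 : (0 < pieceD)%N.
Proof. by rewrite /pieceD addn_gt0. Qed.

Lemma piece_sum J i : \sum_(j < J.+1) (piece J j)`_i = (i == 0%N)%:R.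
Proof.
rewrite big_ord_recr /= {2}/piece ltnn.
have -> : \sum_(j < J) (piece J j)`_i = (mult R (2 ^ J) A)`_i.
  rewrite (eq_bigr (fun j : 'I_J => (mult R (2 ^ j.+1) A)`_i - (mult R (2 ^ j) A)`_i)); last first.
    by move=> j _; rewrite /piece ltn_ord coefB.
  elim: J => [|J IH]; first by rewrite big_ord0 expn0 mult1 ?coef0.
  by rewrite big_ord_recr /= IH addrC subrK.
by rewrite coefB coef1 addrC subrK.
Qed.

Lemma pow2_gt0 j : (0 < 2 ^ j)%N. Proof. by rewrite expn_gt0. Qed.

Lemma piece_bd J j i : (j <= J)%N -> `|(piece J j)`_i| <= pieceD%:R / 2 ^+ j.
Proof.
move=> jJ; have D2 : 2 * 2 ^+ A <= pieceD%:R :> R.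
  by rewrite -[2 in X in X <= _]/(2%:R) -natrX -natrM ler_nat /pieceD leq_addl.
have c j' : `|(mult R (2 ^ j') A - 1)`_i| <= 2 ^+ A / 2 ^+ j' by have := mult_coef R A i (pow2_gt0 j'); rewrite natrX.
have t0 j' : 0 < 2 ^+ j' :> R by rewrite exprn_gt0.
apply: (@le_trans _ _ (2 * 2 ^+ A / 2 ^+ j)); last by rewrite ler_wpM2r // invr_ge0 ltW.
rewrite /piece; case: ifPn => [h|h].
  have -> : mult R (2 ^ j.+1) A - mult R (2 ^ j) A = (mult R (2 ^ j.+1) A - 1) - (mult R (2 ^ j) A - 1) by ring.
  rewrite coefB (le_trans (ler_normB _ _)) // -mulrA mulr_natl mulr2n lerD //.
  apply: (le_trans (c j.+1)); rewrite ler_wpM2l ?exprn_ge0 // lef_pV2 ?posrE // ler_weXn2l //.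
  by rewrite ler1n.
have -> : j = J by apply/eqP; rewrite eqn_leq jJ leqNgt.
have -> : 1 - mult R (2 ^ J) A = - (mult R (2 ^ J) A - 1) by rewrite opprB.
rewrite coefN normrN (le_trans (c J)) // ler_wpM2r ?invr_ge0 ?(ltW (t0 _)) // ler_peMl ?exprn_ge0 //; lra.
Qed.

Lemma piece_supp J j i : (pieceD * 2 ^ j < i)%N -> (j <= J)%N -> (piece J j)`_i = 0.
Proof.
move=> hi jJ; have m j' : opb (mult R (2 ^ j') A) (2 ^+ A) (A * (2 * 2 ^ j')).
  by apply: opbX; apply: opb_1avg; exact: pow2_gt0.
have w j' : (j' <= j.+1)%N -> (A * (2 * 2 ^ j') <= pieceD * 2 ^ j)%N.
  move=> h; have : (2 ^ j' <= 2 * 2 ^ j)%N by rewrite -expnS leq_exp2l.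
  rewrite /pieceD; move: (2 ^ A)%N (2 ^ j)%N (2 ^ j')%N => X Y Z; nia.
have h1 (P : {poly R}) : (exists c, opb P c (pieceD * 2 ^ j)) -> P`_i = 0.
  by move=> [c hc]; exact: (opb_coef hc hi).
apply: h1; rewrite /piece; case: ifPn => h.
  exists (2 ^+ A + 2 ^+ A); apply: opbD; [|apply: opbN].
    by apply: (opb_wk (m j.+1)) => //; exact: w.
  by apply: (opb_wk (m j)) => //; exact: w.
have jE : J = j by apply/eqP; rewrite eqn_leq jJ andbT leqNgt.
exists (1 + 2 ^+ A); apply: opbD; [exact: opb1|apply: opbN].
by rewrite jE; apply: (opb_wk (m j)) => //; exact: w.
Qed.

Lemma le_pow4 (x y : R) : 0 <= y -> x ^+ 4 <= y ^+ 4 -> `|x| <= y.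
Proof.
move=> y0; have -> : x ^+ 4 = `|x| ^+ 4 by rewrite -normrX ger0_norm // (exprM x 2 2) sqr_ge0.
by rewrite ler_pXn2r ?nnegrE.
Qed.

Lemma mult_root : exists2 C : R, 0 <= C & forall k N l x, (0 < N)%N -> (N <= k.+1)%N ->
  (k <= l <= k + pieceD * k.+1)%N -> 0 <= x ->
  `|act (mult R N A) (fun i => phi a i x) l| <= C * N%:R `^ (cc R n) / Num.sqrt k.+1%:R.
Proof.
have [C C0 hC] := mult_bound R b pieceD; exists (Num.sqrt (Num.sqrt C)); first exact: sqrtr_ge0.
move=> k N l x N0 Nk kl x0; have := hC k N l x N0 Nk kl x0.
have k0 : 0 < k.+1%:R :> R by rewrite ltr0n.
have s0 : 0 < Num.sqrt k.+1%:R :> R by rewrite sqrtr_gt0.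
rewrite -ler_pdivlMr ?exprn_gt0 // => h; apply: le_pow4.
  by rewrite !mulr_ge0 ?sqrtr_ge0 ?powR_ge0 // invr_ge0 ltW.
apply: (le_trans h); rewrite le_eqVlt; apply/orP; left; apply/eqP.
have cE : Num.sqrt (Num.sqrt C) ^+ 4 = C by rewrite (exprM _ 2 2) !sqr_sqrtr // sqrtr_ge0.
have kE : Num.sqrt k.+1%:R ^+ 4 = k.+1%:R ^+ 2 :> R by rewrite (exprM _ 2 2) sqr_sqrtr // ltW.
have nE : (N%:R `^ cc R n) ^+ 4 = N%:R ^+ (4 * a + 2) :> R.
  rewrite -powR_mulrn ?powR_ge0 // -powRrM -powR_mulrn //; congr (_ `^ _).
  by rewrite /cc natrD natrM -natr1; field.
by rewrite expr_div_n exprMn cE kE nE.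
Qed.

Lemma piece_ker : exists2 C0 : R, 0 < C0 & forall m k J j l (w q : bpt R n), (0 < m)%N ->
  (2 ^ J <= k.+1 < 2 ^ J.+1)%N -> (j <= J)%N -> (k <= l <= k + pieceD * 2 ^ J)%N ->
  `|\sum_(i < (pieceD * 2 ^ j).+1) (piece J j)`_i * KK m (l + i) w q| <=
  C0 * cK R n m / Num.sqrt k.+1%:R * (2 ^+ j) `^ (cc R n).
Proof.
have [C C_0 hC] := mult_root.
pose E : R := (4 * (1 + pieceD) + 2 * a + 2)%:R; have E0 : 0 < E by rewrite ltr0n addn2.
pose t : R := 2 `^ (cc R n); have t0 : 0 < t by rewrite powR_gt0.
exists (C * (t + 1) + E ^+ a * t).
  by rewrite ltr_wpDl ?mulr_gt0 ?exprn_gt0 // mulr_ge0 // addr_ge0 // ltW.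
move=> m k J j l w q m0 /andP[Jk kJ] jJ /andP[kl lk].
have n0 : (0 < n)%N by [].
have c0 : 0 < cK R n m by exact: cK_gt0.
have k0 : 0 < k.+1%:R :> R by rewrite ltr0n.
have s0 : 0 < Num.sqrt k.+1%:R :> R by rewrite sqrtr_gt0.
have lk' : (k <= l <= k + pieceD * k.+1)%N.
  by rewrite kl (leq_trans lk) // leq_add2l leq_mul2l Jk orbT.
set x : R := m%:R * rho2 (ltr (- (w : pt R n)) (q : pt R n)); have x0 : 0 <= x by rewrite mulr_ge0 // rho_ge0.
set o := om m 0 (tcoord (ltr (- (w : pt R n)) (q : pt R n))); have o1 : `|o| <= 1 by exact: abs_cos_le1.
have actE (P : {poly R}) : \sum_(i < size P) P`_i * KK m (l + i) w q = cK R n m * o * act P (fun i => phi a i x) l.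
  rewrite /act mulr_sumr; apply: eq_bigr => i _; rewrite KK_phi -/x -/o /=; ring.
have widen (P : {poly R}) W : (forall i, (W < i)%N -> P`_i = 0) ->
   \sum_(i < W.+1) P`_i * KK m (l + i) w q = cK R n m * o * act P (fun i => phi a i x) l.
  move=> hP; rewrite -actE; have h : (size P <= W.+1)%N by apply/leq_sizeP => i; exact: hP.
  rewrite (big_ord_widen _ (fun i => P`_i * KK m (l + i) w q) h) [RHS]big_mkcond; apply: eq_bigr => i _.
  by case: ifPn => //; rewrite -leqNgt => hi; rewrite nth_default ?mul0r.
rewrite widen; last by move=> i hi; exact: piece_supp.
have co z : `|cK R n m * o * z| <= cK R n m * `|z|.
  rewrite (normrM (cK R n m * o) z) (normrM (cK R n m) o) (gtr0_norm c0) ler_wpM2r // ler_piMr // ltW //.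
have mb N : (0 < N)%N -> (N <= k.+1)%N -> `|act (mult R N A) (fun i => phi a i x) l| <= C * N%:R `^ (cc R n) / Num.sqrt k.+1%:R.
  by move=> N0 Nk; exact: hC.
have pw i : (2 ^ i)%:R = 2 ^+ i :> R by rewrite natrX.
have S i : (2 ^+ i.+1 : R) `^ cc R n = t * (2 ^+ i) `^ cc R n by rewrite exprS powRM // exprn_ge0.
rewrite /piece; case: ifPn => h.
  apply: (le_trans (co _)).
  have -> : (C * (t + 1) + E ^+ a * t) * cK R n m / Num.sqrt k.+1%:R * (2 ^+ j) `^ cc R n =
     cK R n m * ((C * (t + 1) + E ^+ a * t) / Num.sqrt k.+1%:R * (2 ^+ j) `^ cc R n) by ring.
  rewrite ler_wpM2l ?(ltW c0) // actB (le_trans (ler_normB _ _)) //.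
  have jk : (2 ^ j.+1 <= k.+1)%N by apply: leq_trans Jk; rewrite leq_exp2l.
  have jk' : (2 ^ j <= k.+1)%N by apply: leq_trans jk; rewrite leq_exp2l.
  apply: (le_trans (lerD (mb _ (pow2_gt0 _) jk) (mb _ (pow2_gt0 _) jk'))).
  rewrite !pw S; set X := (2 ^+ j) `^ _; have X0 : 0 <= X by exact: powR_ge0.
  have -> : C * (t * X) / Num.sqrt k.+1%:R + C * X / Num.sqrt k.+1%:R = C * (t + 1) / Num.sqrt k.+1%:R * X by ring.
  rewrite ler_wpM2r // ler_wpM2r ?invr_ge0 ?(ltW s0) // lerDl.
  by apply: mulr_ge0; [rewrite exprn_ge0 // ltW|exact: ltW].
have jE : j = J by apply/eqP; rewrite eqn_leq jJ leqNgt.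
rewrite actB mulrBr (le_trans (ler_normB _ _)) // jE.
(* The identity in the last piece has no cancellation, but its kernel is $O(k^a)$ by the diagonal,
   which is the wanted size because $2^J$ is comparable with $k$. *)
have K1 : `|cK R n m * o * act 1 (fun i => phi a i x) l| <= cK R n m * E ^+ a * k.+1%:R ^+ a.
  have -> : cK R n m * o * act 1 (fun i => phi a i x) l = KK m l w q by rewrite act1 KK_phi -/x -/o /=; ring.
  have KS l' w' : \int[haar R n]_y (KK m l' w' y ^+ 2) = KK m l' w' w'.
    by have := KK_orth m0 n0 l' l' w' w'; rewrite eqxx => <-.
  have mK' l' w' : measurable_fun setT (KK m l' w' : bpt R n -> R) by exact: (Vk_measurable (Vk_KK m0 n0 l' w')).
  have LK l' w' : L1 (haar R n) (fun y => KK m l' w' y ^+ 2) by exact: (Vk_L2 (Vk_KK m0 n0 l' w')).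
  have := cauchy_schwarz (mK' l w) (mK' l q) (LK l w) (LK l q).
  rewrite (KK_orth m0 n0) eqxx !KS !KK_diag -expr2 /= => cs.
  have b0 : 0 <= cK R n m * 'C(l + a, a)%:R by rewrite mulr_ge0 // ltW.
  have h1 : `|KK m l w q| <= cK R n m * 'C(l + a, a)%:R.
    by rewrite -(ler_pXn2r (n := 2)) ?nnegrE // real_normK // num_real.
  apply: (le_trans h1); rewrite -mulrA ler_wpM2l ?(ltW c0) //.
  apply: (@le_trans _ _ (nul R a l ^+ a)).
    exact: bin_nul.
  rewrite -exprMn ler_pXn2r ?nnegrE ?mulr_ge0 ?(ltW E0) ?(ltW k0) ?(ltW (nul_gt0 _ _ _)) //.
  have h2 : (4 * l + 2 * a + 2 <= (4 * (1 + pieceD) + 2 * a + 2) * k.+1)%N.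
    by case/andP: lk' => _; move: pieceD => P; clear; nia.
  have h2r : (4 * l + 2 * a + 2)%:R <= E * k.+1%:R by rewrite -natrM ler_nat.
  by move: h2r; rewrite /nul natrD natrD natrM natrM.
have J2 : k.+1%:R ^+ a <= t * (2 ^+ J) `^ cc R n / Num.sqrt k.+1%:R :> R.
  rewrite ler_pdivlMr // -powR12_sqrt ?(ltW k0) // -powR_mulrn ?(ltW k0) // -powRD; last by apply/implyP => _; rewrite gt_eqF.
  have -> : a%:R + 2^-1 = cc R n :> R by rewrite /cc -[n%:R]natr1; field.
  rewrite -S; apply: ler_powR_base; rewrite ?ler0n //.
    by rewrite /cc -natr1 -natr1; have := ler0n R b; lra.
  by rewrite -natrX ler_nat ltnW.
have K2 : `|cK R n m * o * act (mult R (2 ^ J) A) (fun i => phi a i x) l| <= cK R n m * (C * (2 ^+ J) `^ cc R n / Num.sqrt k.+1%:R).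
  by rewrite (le_trans (co _)) // ler_wpM2l ?(ltW c0) // -pw; apply: mb => //; exact: pow2_gt0.
apply: (le_trans (lerD K1 K2)).
have s1 : cK R n m * E ^+ a * k.+1%:R ^+ a <= cK R n m * E ^+ a * (t * (2 ^+ J) `^ cc R n / Num.sqrt k.+1%:R).
  by rewrite ler_wpM2l // mulr_ge0 ?exprn_ge0 ?(ltW E0) // ltW.
apply: (le_trans (lerD s1 (lexx _))).
set X := (2 ^+ J) `^ _; set V := (Num.sqrt _)^-1; have X0 : 0 <= X by exact: powR_ge0.
have V0 : 0 <= V by rewrite invr_ge0 ltW.
have : 0 <= C * t * cK R n m * V * X.
  by apply: mulr_ge0 => //; apply: mulr_ge0 => //; apply: mulr_ge0; [apply: mulr_ge0 => //; exact: ltW|exact: ltW].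
have -> : (C * (t + 1) + E ^+ a * t) * cK R n m * V * X = cK R n m * E ^+ a * (t * X * V) + cK R n m * (C * X * V) + C * t * cK R n m * V * X.
  by set Y := E ^+ a; ring.
by rewrite lerDl.
Qed.

End Pieces.

Definition Q2 (R : realType) (n : nat) (f : pt R n -> R) : R := \int[haar R n]_q (f q ^+ 2).

Section VFacts.
Variables (R : realType) (n : nat).
Hypothesis n1 : (1 < n)%N.

Lemma evq : ev R n * qq R n = qq R n - 2.
Proof.
have N1 : 1 < n%:R :> R by rewrite ltr1n.
have z1 : 2 * n%:R + 1 != 0 :> R by rewrite gt_eqF //; lra.
have z2 : 2 * n%:R - 1 != 0 :> R by rewrite gt_eqF //; lra.
by rewrite /ev /qq; field; rewrite z1 z2.
Qed.

Lemma sup_bound m k (f : pt R n -> R) w : (0 < m)%N -> Vk m (@eigval R n m k) f ->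
  f w ^+ 2 <= cK R n m * (2 * k%:R + n%:R) ^+ n.-1 * Q2 f.
Proof.
move=> m0 Vf; have n0 : (0 < n)%N by exact: ltnW.
have mK' l' w' : measurable_fun setT (KK m l' w' : bpt R n -> R) by exact: (Vk_measurable (Vk_KK m0 n0 l' w')).
have LK l' w' : L1 (haar R n) (fun y => KK m l' w' y ^+ 2) by exact: (Vk_L2 (Vk_KK m0 n0 l' w')).
have KS : \int[haar R n]_y (KK m k w y ^+ 2) = KK m k w w.
  by have := KK_orth m0 n0 k k w w; rewrite eqxx => <-.
have := cauchy_schwarz (Vk_measurable Vf) (mK' k w) (Vk_L2 Vf) (LK k w).
have := KK_repr m0 n0 k w Vf; rewrite eqxx => ->.
rewrite KS KK_diag mulrC => /le_trans; apply; rewrite ler_wpM2r //.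
  by apply: int_ge0 => q; exact: sqr_ge0.
apply: ler_wpM2l; first by rewrite ltW // cK_gt0.
apply: (@le_trans _ _ ((k + n.-1)%:R ^+ n.-1)); first by rewrite -natrX ler_nat bin_leq_expn.
have h : (k + n.-1 <= 2 * k + n)%N by clear -n1; lia.
have n2 : (0 < n.-1)%N by clear -n1; lia.
by rewrite ler_pXn2r ?nnegrE ?addr_ge0 ?mulr_ge0 //; move: h; rewrite -(ler_nat R) !(natrD, natrM).
Qed.

End VFacts.

Lemma strong_V (R : realType) (n : nat) (n1 : (1 < n)%N) : exists2 C : R, 0 < C & forall m k (f : pt R n -> R), (0 < m)%N -> Vk m (@eigval R n m k) f ->
  L1 (haar R n) (fun q => `|f q| `^ qq R n) /\
  \int[haar R n]_q (`|f q| `^ qq R n) <=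
    C * (m%:R ^+ n / Num.sqrt (2 * k%:R + n%:R)) `^ ((qq R n - 2) / 2) * Q2 f `^ (qq R n / 2).
Proof.
case: n n1 => [//|[//|b]] n1'; set N := b.+2 in n1' *.
have N1 : 1 < N%:R :> R by rewrite ltr1n.
have cc0 : 0 < cc R N by rewrite /cc; lra.
have [G1 G10 hG1] := geo_min_pow (ltr01 : 0 < 1 :> R) cc0.
have h2 : 0 < 2^-1 :> R by rewrite invr_gt0.
have [G2 G20 hG2] := geo_min_pow h2 cc0.
have [C0 C00 hC0] := piece_ker R b.
have q2 := qq_gt2 R n1'.
have D0 := pieceD_gt0 b.
pose B : R := G2 * ((pieceD b)%:R * (2 * (pieceD b)%:R * (G1 * ((pieceD b)%:R + 1)) + 1) + 1) * (4 / (1 - eta0 R N)).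
have /andP[et0 et1] := eta0_lt1 R n1'.
have Dr : 0 < (pieceD b)%:R :> R by rewrite ltr0n.
have B0 : 0 < B.
  apply: mulr_gt0; last by rewrite divr_gt0 // subr_gt0.
  by apply: mulr_gt0 => //; rewrite addr_gt0 // mulr_gt0 // addr_gt0 // !mulr_gt0 // addr_gt0.
(* The square root pays for replacing $k+1$ by $2k+n$, as $2k+n\le n(k+1)$. *)
pose c1 : R := C0 / pi ^+ N.+1 * Num.sqrt N%:R.
have c10 : 0 < c1 by rewrite mulr_gt0 ?sqrtr_gt0 // ?divr_gt0 // ?exprn_gt0 ?pi_gt0 // (lt_trans ltr01).
exists (2 * 2 `^ qq R N * (B `^ (qq R N / 2) * c1 `^ ((qq R N - 2) / 2))).
  by rewrite !mulr_gt0 ?powR_gt0.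
move=> m k f m0 Vf; have N0 : (0 < N)%N by [].
have mf := Vk_measurable Vf; have f2 := Vk_L2 Vf.
have Q0 : 0 <= Q2 f by apply: int_ge0 => q; exact: sqr_ge0.
pose Bf := Num.sqrt (cK R N m * (2 * k%:R + N%:R) ^+ N.-1 * Q2 f).
have fb (q : pt R N) : `|f q| <= Bf.
  have h := sup_bound n1' q m0 Vf; rewrite -sqrtr_sqr; apply: ler_wsqrtr; exact: h.
have fr x : \int[haar R N]_y (f y * KK m k x y) = f x by rewrite (KK_repr m0 N0 k x Vf) eqxx.
split; first exact: (L1_fq n1' mf f2 fb).
have k0 : 0 < k.+1%:R :> R by rewrite ltr0n.
have s0 : 0 < Num.sqrt k.+1%:R :> R by rewrite sqrtr_gt0.
pose kappa := C0 * cK R N m / Num.sqrt k.+1%:R.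
have kap0 : 0 < kappa by rewrite divr_gt0 // mulr_gt0 // cK_gt0.
(* The largest dyadic scale not exceeding [k + 1], so that the whole window stays at indices
   comparable with [k]. *)
pose J := trunc_log 2 k.+1.
have hJ : (2 ^ J <= k.+1 < 2 ^ J.+1)%N by rewrite trunc_logP // trunc_log_ltn.
pose p j i : R := if (j <= J)%N then (piece R b J j)`_i else 0.
have p_bd j i : (j <= J)%N -> `|p j i| <= (pieceD b)%:R / 2 ^+ j.
  by move=> jJ; rewrite /p jJ; exact: piece_bd.
have p_supp j i : (pieceD b * 2 ^ j < i)%N -> p j i = 0.
  by move=> h; rewrite /p; case: ifP => // jJ; exact: piece_supp.
have p_sum i : \sum_(j < J.+1) p j i = (i == 0%N)%:R.
  by rewrite -(piece_sum R b J i); apply: eq_bigr => j _; rewrite /p -ltnS ltn_ord.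
have p_ker j l (x y : bpt R N) : (j <= J)%N -> (k <= l <= k + pieceD b * 2 ^ J)%N ->
  `|\sum_(i < (pieceD b * 2 ^ j).+1) p j i * KK m (l + i) x y| <= kappa * (2 ^+ j) `^ cc R N.
  by move=> jJ hl; rewrite /p jJ; exact: hC0.
have Kb l : exists D, forall x : bpt R N, KK m l x x <= D.
  by exists (cK R N m * 'C(l + N.-1, N.-1)%:R) => x; rewrite KK_diag.
have KL2 l (x : bpt R N) : L1 (haar R N) (fun y => KK m l x y ^+ 2) by exact: (Vk_L2 (Vk_KK m0 N0 l x)).
have := strong_bound (meas_KK m0 N0) (@KK_sym R N m) KL2 (KK_orth m0 N0) Kb n1' D0 kap0 p_bd p_supp p_sum p_ker
  (conj G10 hG1) (conj G20 hG2) mf f2 fb fr.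
move=> /le_trans; apply.
set Q := Q2 f in Q0 *.
set w := m%:R ^+ N / Num.sqrt _.
have z0 : 0 < 2 * k%:R + N%:R :> R by rewrite ltr_wpDl ?mulr_ge0 // (lt_trans ltr01).
have w0 : 0 < w by rewrite divr_gt0 ?exprn_gt0 ?ltr0n // sqrtr_gt0.
have kw : kappa <= c1 * w.
  rewrite /kappa /cK /c1 /w.
  have -> : C0 * (m%:R ^+ N / pi ^+ N.+1) / Num.sqrt k.+1%:R = C0 / pi ^+ N.+1 * m%:R ^+ N * (Num.sqrt k.+1%:R)^-1 by ring.
  have -> : C0 / pi ^+ N.+1 * Num.sqrt N%:R * (m%:R ^+ N / Num.sqrt (2 * k%:R + N%:R)) = C0 / pi ^+ N.+1 * m%:R ^+ N * (Num.sqrt N%:R / Num.sqrt (2 * k%:R + N%:R)) by ring.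
  apply: ler_wpM2l; first by rewrite mulr_ge0 ?exprn_ge0 // divr_ge0 ?(ltW C00) // exprn_ge0 // pi_ge0.
  have h : (2 * k + N <= N * k.+1)%N by rewrite /N; clear; nia.
  have sq : Num.sqrt (2 * k%:R + N%:R) <= Num.sqrt N%:R * Num.sqrt k.+1%:R :> R.
    rewrite -sqrtrM ?ler0n //; apply: ler_wsqrtr.
    by move: h; rewrite -(ler_nat R) natrD natrM natrM.
  by rewrite ler_pdivlMr ?sqrtr_gt0 // mulrC ler_pdivrMr.
have evp : 0 < ev R N by rewrite /ev divr_gt0 //; lra.
have CE : Cf N (pieceD b) kappa G1 G2 = B * kappa `^ ev R N by rewrite /Cf /B; ring.
rewrite CE -/(Q2 f) -/Q -[leRHS]mulrA -[leRHS]mulrA; apply: ler_wpM2l; first by rewrite mulr_ge0 ?powR_ge0.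
apply: (@le_trans _ _ ((B * (c1 * w) `^ ev R N * Q) `^ (qq R N / 2))).
  have B1 := ltW B0.
  apply: ler_powR_base; [lra| |].
    by rewrite mulr_ge0 // mulr_ge0 // powR_ge0.
  apply: ler_wpM2r => //; apply: ler_wpM2l => //.
  by apply: ler_powR_base => //; exact: ltW.
have M3 (x y z r : R) : 0 <= x -> 0 <= y -> 0 <= z -> (x * y * z) `^ r = x `^ r * y `^ r * z `^ r.
  by move=> x0 y0 z0'; rewrite !powRM // mulr_ge0.
rewrite (M3 B _ Q _ (ltW B0) (powR_ge0 _ _) Q0) -(powRrM (c1 * w)).
have -> : ev R N * (qq R N / 2) = (qq R N - 2) / 2 by rewrite mulrA evq.
rewrite (powRM ((qq R N - 2) / 2) (ltW c10) (ltW w0)).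
by rewrite le_eqVlt; apply/orP; left; apply/eqP; ring.
Qed.

(** * Norms of complex functions and duality *)

Section Norms.
Variables (R : realType) (n : nat).
Notation pt := (pt R n).
Notation bpt := (bpt R n).
Notation haar := (haar R n).
Notation L1 := (@L1 _ bpt R haar).
Implicit Types f g : cfun R n.

Lemma cabs_ge0 f q : 0 <= cabs f q.
Proof. exact: sqrtr_ge0. Qed.

Lemma cabs_sqr f q : cabs f q ^+ 2 = f.1 q ^+ 2 + f.2 q ^+ 2.
Proof. by rewrite sqr_sqrtr // addr_ge0 // sqr_ge0. Qed.

Lemma hfun_meas f : is_hfun f -> measurable_fun setT (f.1 : bpt -> R) /\ measurable_fun setT (f.2 : bpt -> R).
Proof. by move=> [_ _ b1 b2]; split; exact: measurable_borel_fun. Qed.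

Lemma meas_cabs f : is_hfun f -> measurable_fun setT (cabs f : bpt -> R).
Proof.
move=> /hfun_meas[m1 m2].
have h : measurable_fun setT (fun q : bpt => f.1 q ^+ 2 + f.2 q ^+ 2).
  by apply: measurable_funD; exact: measurable_funX.
exact: (measurableT_comp (continuous_measurable_fun (@sqrt_continuous R)) h).
Qed.

Lemma meas_cabsX p f : is_hfun f -> measurable_fun setT (fun q : bpt => cabs f q `^ p).
Proof. by move=> /meas_cabs h; exact: (measurableT_comp (measurable_powR _) h). Qed.

Lemma normpE p f : 0 < p -> is_hfun f -> L1 (fun q => cabs f q `^ p) ->
  normp p f = ((\int[haar]_q (cabs f q `^ p)) `^ p^-1)%:E.
Proof.
move=> p0 hf If; rewrite /normp -haarE.
- by rewrite intE // poweR_EFin.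
- by apply/measurable_EFinP; exact: meas_cabsX.
by move=> q; rewrite lee_fin powR_ge0.
Qed.

Lemma inLp_int p f : 0 < p -> inLp p f -> L1 (fun q => cabs f q `^ p).
Proof.
move=> p0 [hf fin]; have m := meas_cabsX p hf.
have E : (\int[haar]_q (cabs f q `^ p)%:E)%E = hint (fun q => (cabs f q `^ p)%:E).
  by rewrite haarE //; [apply/measurable_EFinP|move=> q; rewrite lee_fin powR_ge0].
apply/L1P; split => //.
rewrite (eq_integral (fun q : bpt => (cabs f q `^ p)%:E)); last by move=> q _; rewrite ger0_norm ?powR_ge0.
rewrite E ltNge leye_eq; apply/negP => /eqP h; move: fin; rewrite /normp h poweRyr ?gt_eqF ?invr_gt0 //.
Qed.

Lemma inLp2_L2 f : inLp 2 f -> L1 (fun q => f.1 q ^+ 2) /\ L1 (fun q => f.2 q ^+ 2).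
Proof.
move=> Lf; have := inLp_int (ltr0n R 2) Lf; have [hf _] := Lf; have [m1 m2] := hfun_meas hf.
rewrite (_ : (fun q => _) = (fun q => f.1 q ^+ 2 + f.2 q ^+ 2)); last first.
  by apply/funext => q; rewrite powR_mulrn ?cabs_ge0 // cabs_sqr.
move=> I; split; apply: (L1_le _ I); try exact: measurable_funX.
  by move=> q; rewrite ger0_norm ?sqr_ge0 // lerDl sqr_ge0.
by move=> q; rewrite ger0_norm ?sqr_ge0 // lerDr sqr_ge0.
Qed.

Lemma normp2E f : inLp 2 f -> normp 2 f = (Num.sqrt (\int[haar]_q (cabs f q ^+ 2)))%:E.
Proof.
move=> Lf; rewrite normpE //; [|by case: Lf|exact: (inLp_int _ Lf)].
rewrite powR12_sqrt; last by apply: int_ge0 => q; exact: powR_ge0.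
congr (Num.sqrt _)%:E; apply: eqR => q; by rewrite powR_mulrn ?cabs_ge0.
Qed.

Lemma L2_cabs f : inLp 2 f -> L1 (fun q => cabs f q ^+ 2).
Proof.
move=> /inLp2_L2[i1 i2]; rewrite (_ : (fun q => _) = (fun q => f.1 q ^+ 2 + f.2 q ^+ 2)).
  exact: L1D.
by apply/funext => q; rewrite cabs_sqr.
Qed.

Lemma dot_le_cabs f g q : f.1 q * g.1 q + f.2 q * g.2 q <= cabs f q * cabs g q.
Proof.
rewrite -sqrtrM; last by rewrite addr_ge0 // sqr_ge0.
apply: (le_trans (ler_norm _)); rewrite -sqrtr_sqr; apply: ler_wsqrtr.
have := sqr_ge0 (f.1 q * g.2 q - f.2 q * g.1 q).
by set a := f.1 q; set b := f.2 q; set c := g.1 q; set d := g.2 q; nra.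
Qed.

Lemma intr_absz (m : int) : (`|m|%:~R : R) = (`|m|%N)%:R.
Proof. by rewrite -abszE. Qed.

Lemma eig_Vk m k g : eigsp m k g -> Vk `|m|%N (eigval R n `|m|%N k) g.1 /\ Vk `|m|%N (eigval R n `|m|%N k) g.2.
Proof.
move=> [Lg [s1 [s2 [l1 [l2 [d1 d2]]]]]].
have [[p1 p2 _ _] _] := Lg; have [i1 i2] := inLp2_L2 Lg.
have M2 : (`|m|%N%:R : R) ^+ 2 = m%:~R ^+ 2.
  by rewrite -intr_absz -[LHS]rmorphXn -[RHS]rmorphXn /= real_normK ?num_real.
have ez : 2 * `|m|%:~R * (2 * k%:R + n%:R) = eigval R n `|m|%N k by rewrite intr_absz.
have DZ (c : R) (f : pt -> R) : smooth f -> Dt (fun q => c * f q) = (fun q => c * Dt f q).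
  move=> sf; apply/funext => q; rewrite /Dt; apply: derive_val.
  have [_ df] := sf [::]; have h := df (eb R (ct n)) q.
  exact: (@is_deriveZ _ _ _ _ _ _ _ _ (DeriveDef h erefl)).
split; split => //.
- rewrite d1 (_ : (fun q => _) = (fun q => (- m%:~R) * g.2 q)); last by apply/funext => q; rewrite mulNr.
  by rewrite DZ // d2 M2; apply/funext => q; ring.
rewrite d2 DZ // d1 M2; apply/funext => q; ring.
Qed.

(** The orthogonality of $f-g$ is tested with $g$ itself, which belongs to the eigenspace. *)
Lemma eig_pair m k f g : inLp 2 f -> Pmk m k f g ->
  \int[haar]_q (f.1 q * g.1 q + f.2 q * g.2 q) = \int[haar]_q (cabs g q ^+ 2).
Proof.
move=> Lf [Eg H]; have [+ _] := H g Eg; have Lg : inLp 2 g by case: Eg.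
have [f1 f2] := inLp2_L2 Lf; have [g1 g2] := inLp2_L2 Lg.
have [mf1 mf2] := hfun_meas (let: conj h _ := Lf in h); have [mg1 mg2] := hfun_meas (let: conj h _ := Lg in h).
have I1 : L1 (fun q => f.1 q * g.1 q + f.2 q * g.2 q) by apply: L1D; exact: L1_mul.
have I2 := L2_cabs Lg.
have I : L1 (fun q => f.1 q * g.1 q + f.2 q * g.2 q - cabs g q ^+ 2) by exact: L1B.
rewrite /inner_re /= (_ : (fun q => _) = EFin \o (fun q => f.1 q * g.1 q + f.2 q * g.2 q - cabs g q ^+ 2)); last first.
  by apply/funext => q /=; congr EFin; rewrite cabs_sqr; ring.
rewrite hint_integrable // intE // intB // => /eqP; rewrite eqe subr_eq0 => /eqP; exact.
Qed.

Lemma young (a b p : R) : 1 < p -> 0 <= a -> 0 <= b -> a * b <= a `^ p + b `^ (p / (p - 1)).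
Proof.
move=> p1 a0 b0; have p10 : 0 < p - 1 by rewrite subr_gt0.
have p0 : 0 < p by exact: lt_trans p1.
have [->|an] := eqVneq a 0; first by rewrite mul0r addr_ge0 // powR_ge0.
have ap : 0 < a by rewrite lt_neqAle eq_sym an.
have [h|h] := leP b (a `^ (p - 1)).
  apply: (@le_trans _ _ (a `^ p)); last by rewrite lerDl powR_ge0.
  have -> : a `^ p = a * a `^ (p - 1).
    by rewrite -{2}[a]powRr1 // -powRD ?an ?implybT //; congr (_ `^ _); ring.
  by rewrite ler_wpM2l.
apply: (@le_trans _ _ (b `^ (p / (p - 1)))); last by rewrite lerDr powR_ge0.
have bp : 0 < b by apply: le_lt_trans h; exact: powR_ge0.
have -> : b `^ (p / (p - 1)) = b `^ (p - 1)^-1 * b.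
  have -> : p / (p - 1) = (p - 1)^-1 + 1 by field; rewrite gt_eqF.
  by rewrite powRD ?powRr1 //; apply/implyP => _; rewrite gt_eqF.
rewrite ler_wpM2r //.
have -> : a = (a `^ (p - 1)) `^ (p - 1)^-1 by rewrite -powRrM mulfV ?gt_eqF // powRr1.
by apply: ler_powR_base; rewrite ?powR_ge0 ?invr_ge0 // ltW.
Qed.

(** Comes from the non-sharp [young], hence the factor 2; [NF] and [Y] may be upper bounds of the
    norms. *)
Lemma holder_weak (F G : bpt -> R) (p NF Y : R) : 1 < p -> (forall q, 0 <= F q) -> (forall q, 0 <= G q) ->
  measurable_fun setT F -> measurable_fun setT G ->
  L1 (fun q => F q `^ p) -> L1 (fun q => G q `^ (p / (p - 1))) -> 0 < NF -> 0 < Y ->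
  \int[haar]_q (F q `^ p) <= NF `^ p -> \int[haar]_q (G q `^ (p / (p - 1))) <= Y `^ (p / (p - 1)) ->
  L1 (fun q => F q * G q) /\ \int[haar]_q (F q * G q) <= 2 * (NF * Y).
Proof.
set r := p / (p - 1) => p1 F0 G0 mF mG IF IG N0 Y0 hF hG.
have pw q : F q * G q <= NF * Y * (NF `^ (- p) * F q `^ p + Y `^ (- r) * G q `^ r).
  have := @young (NF^-1 * F q) (Y^-1 * G q) p p1; rewrite !mulr_ge0 ?invr_ge0 ?(ltW N0) ?(ltW Y0) // => /(_ isT isT).
  have iv (x s : R) : 0 < x -> (x^-1) `^ s = x `^ (- s).
    by move=> x0; rewrite -powR_inv1 ?ltW // -powRrM mulN1r.
  rewrite powRM ?invr_ge0 ?(ltW N0) // powRM ?invr_ge0 ?(ltW Y0) // !iv // -/r => h.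
  have : NF * Y * (NF^-1 * F q * (Y^-1 * G q)) <= NF * Y * (NF `^ (- p) * F q `^ p + Y `^ (- r) * G q `^ r).
    by rewrite ler_wpM2l ?mulr_ge0 ?(ltW N0) ?(ltW Y0).
  by congr (_ <= _); field; rewrite !gt_eqF.
have IH : L1 (fun q => NF * Y * (NF `^ (- p) * F q `^ p + Y `^ (- r) * G q `^ r)).
  by apply: L1Z; apply: L1D; exact: L1Z.
have IFG : L1 (fun q => F q * G q).
  by apply: (L1_le _ IH); [exact: measM|move=> q; rewrite ger0_norm ?mulr_ge0].
split => //; apply: (le_trans (int_le IFG IH pw)).
rewrite intZ; last by apply: L1D; exact: L1Z.
rewrite intD; [|exact: L1Z|exact: L1Z]; rewrite !intZ // mulrC ler_wpM2r ?mulr_ge0 ?(ltW N0) ?(ltW Y0) //.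
have -> : (2 : R) = 1 + 1 by [].
have z (x s : R) : 0 < x -> x `^ (- s) * x `^ s = 1.
  by move=> x0; rewrite powRN mulVf // gt_eqF // powR_gt0.
apply: lerD; [rewrite -(z NF p N0)|rewrite -(z Y r Y0)]; by rewrite ler_wpM2l ?powR_ge0.
Qed.

End Norms.

Section Upper.
Variables (R : realType) (n : nat).
Hypothesis n1 : (1 < n)%N.
Notation q := (qq R n).

Lemma p_crit_lt p : 1 < p -> p < p_crit R n -> q < p / (p - 1).
Proof.
move=> p1; have p10 : 0 < p - 1 by rewrite subr_gt0.
have N1 : 1 < n%:R :> R by rewrite ltr1n.
rewrite /p_crit ltr_pdivlMr; last by lra.
by rewrite ltr_pdivlMr // /qq mulrAC ltr_pdivrMr; [nra|lra].
Qed.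

Lemma p_crit_ge p : 1 < p -> p_crit R n <= p -> p / (p - 1) <= q.
Proof.
move=> p1; have p10 : 0 < p - 1 by rewrite subr_gt0.
have N1 : 1 < n%:R :> R by rewrite ltr1n.
rewrite /p_crit ler_pdivrMr; last by lra.
by rewrite ler_pdivrMr // /qq mulrAC ler_pdivlMr; [nra|lra].
Qed.

Lemma p_crit_gt1 : 1 < p_crit R n.
Proof.
have N1 : 1 < n%:R :> R by rewrite ltr1n.
by rewrite /p_crit ltr_pdivlMr; lra.
Qed.

(* |g| <= s sqrt Q, int |g|^q <= C w^((q-2)/2) Q^(q/2) *)
Lemma eig_sup_q : exists2 C : R, 0 < C & forall m k g, m != 0 -> eigsp m k g ->
  let M : R := `|m|%N%:R in let z : R := 2 * k%:R + n%:R in let Q := \int[haar R n]_x (cabs g x ^+ 2) in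
  (forall x, cabs g x <= C * (M `^ (n%:R / 2) * z `^ ((n%:R - 1) / 2)) * Num.sqrt Q) /\
  L1 (haar R n) (fun x => cabs g x `^ q) /\
  \int[haar R n]_x (cabs g x `^ q) <= C * (M ^+ n / Num.sqrt z) `^ ((q - 2) / 2) * Q `^ (q / 2).
Proof.
have [C C0 hC] := strong_V R n1.
have q2 := qq_gt2 R n1; have N0 : (0 < n)%N by exact: ltnW.
pose c : R := Num.sqrt (pi ^+ n.+1)^-1.
have c0 : 0 < c by rewrite sqrtr_gt0 invr_gt0 exprn_gt0 // pi_gt0.
exists (c + 2 `^ q * (2 * C)); first by rewrite addr_gt0 // !mulr_gt0 // powR_gt0.
move=> m k g m0 Eg M z Q.
have [V1 V2] := eig_Vk Eg; have Lg : inLp 2 g by case: Eg.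
have m1 : (0 < `|m|%N)%N by rewrite absz_gt0.
have Mp : 0 < M by rewrite ltr0n.
have z0 : 0 < z by rewrite ltr_wpDl ?mulr_ge0 // ltr0n.
have [i1 i2] := inLp2_L2 Lg; have [hg _] := Lg.
have QE : Q = Q2 g.1 + Q2 g.2.
  by rewrite /Q /Q2 -intD //; apply: eqR => x; rewrite cabs_sqr.
have Qa : 0 <= Q2 g.1 by apply: int_ge0 => x; exact: sqr_ge0.
have Qb : 0 <= Q2 g.2 by apply: int_ge0 => x; exact: sqr_ge0.
have Q0 : 0 <= Q by rewrite QE addr_ge0.
have q0 : 0 <= q by apply: ltW; exact: lt_trans (qq_gt2 R n1).
have CC : 0 <= 2 `^ q * (2 * C) by rewrite mulr_ge0 ?powR_ge0 // mulr_ge0 // ltW.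
split.
  move=> x; apply: (@le_trans _ _ (c * (M `^ (n%:R / 2) * z `^ ((n%:R - 1) / 2)) * Num.sqrt Q)); last first.
    by rewrite ler_wpM2r ?sqrtr_ge0 // ler_wpM2r ?mulr_ge0 ?powR_ge0 // lerDl.
  have hs : cabs g x ^+ 2 <= (pi ^+ n.+1)^-1 * (M ^+ n * z ^+ n.-1) * Q.
    rewrite cabs_sqr QE mulrDr.
    have E : cK R n `|m|%N * z ^+ n.-1 = (pi ^+ n.+1)^-1 * (M ^+ n * z ^+ n.-1) by rewrite /cK -/M; ring.
    by rewrite -E; apply: lerD; [exact: (sup_bound n1 x m1 V1)|exact: (sup_bound n1 x m1 V2)].
  have -> : M `^ (n%:R / 2) = Num.sqrt (M ^+ n).
    by rewrite -powR12_sqrt ?exprn_ge0 ?(ltW Mp) // -powR_mulrn ?(ltW Mp) // -powRrM.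
  have -> : z `^ ((n%:R - 1) / 2) = Num.sqrt (z ^+ n.-1).
    rewrite -powR12_sqrt ?exprn_ge0 ?(ltW z0) // -powR_mulrn ?(ltW z0) // -powRrM; congr (_ `^ (_ / 2)).
    by rewrite -{1}(prednK N0) -natr1 addrK.
  rewrite /c -!sqrtrM ?mulr_ge0 ?invr_ge0 ?exprn_ge0 ?(ltW Mp) ?(ltW z0) ?pi_ge0 //.
  rewrite -[leLHS]ger0_norm ?cabs_ge0 // -sqrtr_sqr; exact: ler_wsqrtr.
have [I1 h1] := hC _ k _ m1 V1; have [I2 h2] := hC _ k _ m1 V2.
have pt x : cabs g x `^ q <= 2 `^ q * (`|g.1 x| `^ q + `|g.2 x| `^ q).
  set u := `|g.1 x|; set v := `|g.2 x|.
  have u0 : 0 <= u by exact: normr_ge0. have v0 : 0 <= v by exact: normr_ge0.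
  have le2 : cabs g x <= 2 * Num.max u v.
    apply: (@le_trans _ _ (u + v)).
      have -> : u + v = Num.sqrt ((u + v) ^+ 2) by rewrite sqrtr_sqr ger0_norm // addr_ge0.
      apply: ler_wsqrtr.
      rewrite -(real_normK (num_real (g.1 x))) -(real_normK (num_real (g.2 x))) -/u -/v sqrrD.
      by rewrite lerD2r lerDl mulrn_wge0 // mulr_ge0.
    by rewrite mulr_natl mulr2n lerD // le_max lexx ?orbT.
  apply: (@le_trans _ _ ((2 * Num.max u v) `^ q)).
    by apply: (ler_powR_base q0 _ le2); exact: cabs_ge0.
  have mx0 : 0 <= Num.max u v by rewrite le_max u0.
  rewrite powRM // ler_wpM2l ?powR_ge0 //.
  by case: (leP u v) => _; rewrite ?lerDl ?lerDr powR_ge0.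
have IB : L1 (haar R n) (fun x => 2 `^ q * (`|g.1 x| `^ q + `|g.2 x| `^ q)) by apply: L1Z; exact: L1D.
have Iq : L1 (haar R n) (fun x => cabs g x `^ q).
  by apply: (L1_le (meas_cabsX q hg) IB) => x; rewrite ger0_norm ?powR_ge0.
split; [exact: Iq|apply: (le_trans (int_le Iq IB pt))].
rewrite intZ; last exact: L1D.
rewrite intD; [|exact: I1|exact: I2]; rewrite -/M -/z in h1 h2.
set W := (_ / Num.sqrt z) `^ _ in h1 h2 *; have W0 : 0 <= W by exact: powR_ge0.
have mono u : 0 <= u -> u <= Q -> C * W * u `^ (q / 2) <= C * W * Q `^ (q / 2).
  move=> u0 uQ; apply: ler_wpM2l; first by apply: mulr_ge0 => //; exact: ltW.
  exact: (ler_powR_base (divr_ge0 q0 (ler0n _ 2)) u0 uQ).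
have s1 := le_trans h1 (mono _ Qa (ltac:(by rewrite QE lerDl))).
have s2 := le_trans h2 (mono _ Qb (ltac:(by rewrite QE lerDr))).
apply: (@le_trans _ _ (2 `^ q * (C * W * Q `^ (q / 2) + C * W * Q `^ (q / 2)))).
  by apply: ler_wpM2l; [exact: powR_ge0|exact: (lerD s1 s2)].
have -> : (c + 2 `^ q * (2 * C)) * W * Q `^ (q / 2) = 2 `^ q * (C * W * Q `^ (q / 2) + C * W * Q `^ (q / 2)) + c * W * Q `^ (q / 2) by ring.
by rewrite lerDl !mulr_ge0 ?powR_ge0 // ltW.
Qed.

Lemma div_le_of_sqr (B N s : R) : 0 < N -> 0 < s -> s ^+ 2 <= B * N * s -> s / N <= B.
Proof. by move=> N0 s0; rewrite ler_pdivrMr // expr2 ler_pM2r. Qed.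

Lemma sqrtM_powR (a b x : R) : 0 <= a -> 0 <= b ->
  Num.sqrt (a * b) `^ x = a `^ (x / 2) * b `^ (x / 2).
Proof.
by move=> a0 b0; rewrite -powR12_sqrt ?mulr_ge0 // -powRrM (mulrC 2^-1) powRM.
Qed.

Lemma ler_double (y : R) : 0 <= y -> y <= 2 * y.
Proof. by move=> y0; rewrite mulr_natl mulr2n lerDl. Qed.

Lemma bound33_ge0 m k p : 0 <= bound33 n m k p :> R.
Proof. by rewrite /bound33; case: ifP => _; rewrite mulr_ge0 ?powR_ge0. Qed.

(** Exponent bookkeeping: the left side is what interpolating $L^r$ between $L^q$ and $L^\infty$
    produces, with r dual to p. *)
Lemma bound_supercritical (M z p : R) : 0 < M -> 0 < z -> 1 < p ->
  let r := p / (p - 1) in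
  (M `^ (n%:R / 2) * z `^ ((n%:R - 1) / 2)) `^ (r - q) * (M ^+ n / Num.sqrt z) `^ ((q - 2) / 2) =
  (z `^ (n%:R * (p^-1 - 2^-1) - 2^-1) * M `^ (n%:R * (p^-1 - 2^-1))) `^ r.
Proof.
move=> M0 z0 p1 r; rewrite -(powR_mulrn _ (ltW M0)) -(powR12_sqrt (ltW z0)).
have N1 : 1 < n%:R :> R by rewrite ltr1n.
move: M0 z0 => /lnK <- /lnK <-; set a := ln M; set b := ln z.
rewrite !powR_expR -!expRN -!expRD !powR_expR -expRD; congr expR.
rewrite /r /qq; field.
by rewrite !gt_eqF //; lra.
Qed.

Lemma bound_subcritical (M z p : R) : 0 < M -> 0 < z -> 1 < p ->
  let r := p / (p - 1) in
  (M ^+ n / Num.sqrt z) `^ ((r - 2) / 2) =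
  (z `^ (4^-1 - (2 * p)^-1) * M `^ (n%:R * (p^-1 - 2^-1))) `^ r.
Proof.
move=> M0 z0 p1 r; rewrite -(powR_mulrn _ (ltW M0)) -(powR12_sqrt (ltW z0)).
move: M0 z0 => /lnK <- /lnK <-; set a := ln M; set b := ln z.
rewrite !powR_expR -!expRN -!expRD !powR_expR; congr expR.
rewrite /r; field.
by rewrite !gt_eqF //; lra.
Qed.

Lemma upper_bound p : 1 <= p <= 2 -> exists2 C : R, 0 < C &
  forall (m : int) k, m != 0 -> (opnorm_p2 n m k p <= (C * bound33 n m k p)%:E)%E.
Proof.
(* Taking a constant at least 1 lets all its powers of exponent at most r be absorbed in the r-th
   power. *)
move=> /andP[p1 p2]; have [C C0 hC] := eig_sup_q; pose C' := 1 + C.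
have C'0 : 0 < C' by rewrite addr_gt0.
have C'1 : 1 <= C' by rewrite lerDl ltW.
have q2 := qq_gt2 R n1; have N0 : (0 < n)%N by exact: ltnW.
have p0 : 0 < p by exact: lt_le_trans p1.
exists (2 * C'); first exact: mulr_gt0.
move=> m k m0; apply: ub_ereal_sup => _ [f [g [Lp L2' np P ->]]]; rewrite lee_fin.
have Eg : eigsp m k g by case: P. have Lg : inLp 2 g by case: Eg.
have [hsup [Iq hq]] := hC m k g m0 Eg.
set M : R := _%:R in hsup hq; set z : R := 2 * k%:R + n%:R in hsup hq; set Q := Rintegral _ _ _ in hsup hq.
have m1 : (0 < `|m|%N)%N by rewrite absz_gt0.
have Mp : 0 < M by rewrite ltr0n.
have z0 : 0 < z by rewrite ltr_wpDl ?mulr_ge0 // ltr0n.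
have Q0 : 0 <= Q by apply: int_ge0 => x; exact: sqr_ge0.
rewrite (normp2E Lg) /= -/Q.
have IF := inLp_int p0 Lp; have [hf _] := Lp; have [hg _] := Lg.
move: np; rewrite (normpE p0 hf IF) /= eqe; set NF := _ `^ p^-1 => NFn.
have NF0 : 0 < NF by rewrite lt_neqAle eq_sym NFn powR_ge0.
set Bd := bound33 n m k p; have Bd0 : 0 <= Bd by exact: bound33_ge0.
move: Q0; rewrite le_eqVlt => /orP[/eqP Qz|Q0].
  by rewrite -Qz sqrtr0 mul0r !mulr_ge0 // ltW.
have sQ0 : 0 < Num.sqrt Q by rewrite sqrtr_gt0.
have sQQ : Num.sqrt Q ^+ 2 = Q by rewrite sqr_sqrtr // ltW.
suff main : Q <= 2 * C' * Bd * NF * Num.sqrt Q.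
  by apply: (div_le_of_sqr NF0 sQ0); rewrite sQQ.
have E := eig_pair L2' P; rewrite -/Q in E; rewrite -{1}E.
have [mf1 mf2] := hfun_meas hf; have [mg1 mg2] := hfun_meas hg.
have [f1 f2] := inLp2_L2 L2'; have [g1 g2] := inLp2_L2 Lg.
have Ifg : L1 (haar R n) (fun x => f.1 x * g.1 x + f.2 x * g.2 x) by apply: L1D; exact: L1_mul.
have Icc : L1 (haar R n) (fun x => cabs f x * cabs g x).
  by apply: L1_mul; [exact: meas_cabs|exact: meas_cabs|exact: L2_cabs|exact: L2_cabs].
apply: (le_trans (int_le Ifg Icc (dot_le_cabs f g))).
have absm : `|m|%:~R = M by rewrite intr_absz.
pose s := M `^ (n%:R / 2) * z `^ ((n%:R - 1) / 2); have s0 : 0 < s by rewrite mulr_gt0 // powR_gt0.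
have hsup' x : cabs g x <= C' * s * Num.sqrt Q.
  apply: (le_trans (hsup x)); rewrite ler_wpM2r ?sqrtr_ge0 // ler_wpM2r ?(ltW s0) // lerDr //.
(* At $p=1$ the dual exponent is infinite, so the supremum bound is used directly. *)
move: p1; rewrite le_eqVlt => /orP[/eqP pE|p1].
  have NE : NF = \int[haar R n]_x cabs f x.
    rewrite /NF -pE invr1 powRr1; last by apply: int_ge0 => x; exact: powR_ge0.
    by apply: eqR => x; rewrite powRr1 ?cabs_ge0.
  have I1 : L1 (haar R n) (cabs f).
    by move: IF; rewrite -pE; rewrite (_ : (fun x => _) = cabs f) //; apply/funext => x; rewrite powRr1 ?cabs_ge0.
  have BE : Bd = s.
    rewrite /Bd /bound33 -pE p_crit_gt1 absm invr1 mulrC /s -/z; congr (M `^ _ * z `^ _); clear; lra.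
  apply: (@le_trans _ _ (\int[haar R n]_x (C' * s * Num.sqrt Q * cabs f x))).
    apply: int_le => //; first exact: L1Z.
    by move=> x; rewrite mulrC ler_wpM2r ?cabs_ge0.
  rewrite intZ // -NE BE.
  have -> : 2 * C' * s * NF * Num.sqrt Q = 2 * (C' * s * Num.sqrt Q * NF) by ring.
  apply: ler_double; apply: mulr_ge0; [|exact: ltW].
  apply: mulr_ge0; [|exact: ltW]; apply: mulr_ge0; exact: ltW.
pose r := p / (p - 1); have p10 : 0 < p - 1 by rewrite subr_gt0.
have r2 : 2 <= r by rewrite ler_pdivlMr //; clear -p2; lra.
have r0 : 0 < r by exact: lt_le_trans r2.
pose w := M ^+ n / Num.sqrt z; have w0 : 0 < w by rewrite divr_gt0 ?exprn_gt0 // sqrtr_gt0.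
pose Y := C' * Bd * Num.sqrt Q.
have mG := meas_cabs hg.
have Qr : Num.sqrt Q `^ r = Q `^ (r / 2) by rewrite -powR12_sqrt ?(ltW Q0) // -powRrM mulrC.
have YE : Y `^ r = C' `^ r * Bd `^ r * Q `^ (r / 2).
  by rewrite /Y powRM ?mulr_ge0 ?(ltW C'0) ?sqrtr_ge0 // powRM ?(ltW C'0) // Qr.
have Bdp : 0 < Bd.
  by rewrite /Bd /bound33 absm -/z; case: ifP => _; rewrite mulr_gt0 ?powR_gt0.
have Y0 : 0 < Y by rewrite !mulr_gt0.
have [IG hG] : L1 (haar R n) (fun x => cabs g x `^ r) /\ \int[haar R n]_x (cabs g x `^ r) <= Y `^ r.
  have mGr := meas_cabsX r hg.
  have [hp|hp] := ltP p (p_crit R n).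
    have qr := p_crit_lt p1 hp; rewrite -/r in qr.
    pose S := C' * s * Num.sqrt Q; have S0 : 0 < S by apply: mulr_gt0 => //; exact: mulr_gt0.
    have pt x : cabs g x `^ r <= S `^ (r - q) * cabs g x `^ q.
      have [->|gn] := eqVneq (cabs g x) 0; first by rewrite powR0 ?gt_eqF // mulr_ge0 ?powR_ge0.
      have -> : cabs g x `^ r = cabs g x `^ (r - q) * cabs g x `^ q.
        by rewrite -powRD ?subrK //; apply/implyP => _.
      rewrite ler_wpM2r ?powR_ge0 //; apply: (ler_powR_base _ _ (hsup' x)); [by rewrite subr_ge0 ltW|exact: cabs_ge0].
    have IB := L1Z (S `^ (r - q)) Iq.
    have IG : L1 (haar R n) (fun x => cabs g x `^ r).
      by apply: (L1_le mGr IB) => x; rewrite ger0_norm ?powR_ge0.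
    split; [exact: IG|apply: (le_trans (int_le IG IB pt))]; rewrite intZ; last exact: Iq.
    apply: (@le_trans _ _ (S `^ (r - q) * (C' * w `^ ((q - 2) / 2) * Q `^ (q / 2)))).
      rewrite ler_wpM2l ?powR_ge0 //; apply: (le_trans hq).
      by rewrite ler_wpM2r ?powR_ge0 // ler_wpM2r ?powR_ge0 // lerDr.
    have BE : Bd `^ r = s `^ (r - q) * w `^ ((q - 2) / 2).
      by rewrite /Bd /bound33 hp absm -/z -(bound_supercritical Mp z0 p1).
    have SE : S `^ (r - q) = C' `^ (r - q) * s `^ (r - q) * Q `^ ((r - q) / 2).
      have -> : Q `^ ((r - q) / 2) = Num.sqrt Q `^ (r - q) by rewrite -powR12_sqrt ?(ltW Q0) // -powRrM mulrC.
      have Cs : 0 <= C' * s by apply: mulr_ge0; exact: ltW.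
      rewrite -(powRM _ (ltW C'0) (ltW s0)); exact: (powRM _ Cs (ltW sQ0)).
    rewrite YE BE SE.
    have QE : Q `^ (r / 2) = Q `^ ((r - q) / 2) * Q `^ (q / 2).
      by rewrite -powRD; [congr (_ `^ _); clear; lra|apply/implyP => _; rewrite gt_eqF].
    rewrite QE.
    have -> : C' `^ (r - q) * s `^ (r - q) * Q `^ ((r - q) / 2) * (C' * w `^ ((q - 2) / 2) * Q `^ (q / 2)) =
      C' `^ (r - q) * C' * (s `^ (r - q) * w `^ ((q - 2) / 2) * (Q `^ ((r - q) / 2) * Q `^ (q / 2))) by ring.
    rewrite -[leRHS]mulrA ler_wpM2r ?mulr_ge0 ?powR_ge0 //.
    rewrite -{2}[C']powRr1 ?(ltW C'0) // -powRD; last by apply/implyP => _; rewrite gt_eqF.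
    by rewrite ler_powR //; clear -q2; lra.
  have rq := p_crit_ge p1 hp; rewrite -/r in rq.
  (* The height at which the $L^2$ and the $L^q$ bound of [g] contribute equally to $\int|g|^r$ for
     $2\le r\le q$. *)
  pose T := Num.sqrt (w * Q); have T0 : 0 < T by rewrite sqrtr_gt0 mulr_gt0.
  have TE x : T `^ x = w `^ (x / 2) * Q `^ (x / 2).
    exact: (sqrtM_powR x (ltW w0) (ltW Q0)).
  have pt x : cabs g x `^ r <= T `^ (r - 2) * cabs g x ^+ 2 + T `^ (r - q) * cabs g x `^ q.
    have t1 : 0 <= T `^ (r - 2) * cabs g x ^+ 2 by rewrite mulr_ge0 ?powR_ge0 // sqr_ge0.
    have t2 : 0 <= T `^ (r - q) * cabs g x `^ q by rewrite mulr_ge0 ?powR_ge0.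
    have [e|gn] := eqVneq (cabs g x) 0; first by rewrite {1}e powR0 ?gt_eqF // addr_ge0.
    have gp : 0 < cabs g x by rewrite lt_neqAle eq_sym gn cabs_ge0.
    have [h|h] := leP (cabs g x) T.
      apply: (le_trans _ (_ : T `^ (r - 2) * cabs g x ^+ 2 <= _)); last by rewrite lerDl.
      have -> : cabs g x `^ r = cabs g x `^ (r - 2) * cabs g x ^+ 2.
        by rewrite -powR_mulrn ?cabs_ge0 // -powRD ?subrK //; apply/implyP => _.
      rewrite ler_wpM2r ?sqr_ge0 //; apply: (ler_powR_base _ _ h); [by rewrite subr_ge0|exact: cabs_ge0].
    apply: (le_trans _ (_ : T `^ (r - q) * cabs g x `^ q <= _)); last by rewrite lerDr.
    have -> : cabs g x `^ r = cabs g x `^ (r - q) * cabs g x `^ q.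
      by rewrite -powRD ?subrK //; apply/implyP => _.
    rewrite ler_wpM2r ?powR_ge0 //.
    have nv y : y `^ (r - q) = (y `^ (q - r))^-1 by rewrite -powRN opprB.
    rewrite !nv lef_pV2 ?posrE ?powR_gt0 //; apply: (ler_powR_base _ _ (ltW h)); [by rewrite subr_ge0|exact: ltW].
  have I2 := L2_cabs Lg.
  have IB : L1 (haar R n) (fun x => T `^ (r - 2) * cabs g x ^+ 2 + T `^ (r - q) * cabs g x `^ q).
    by apply: L1D; exact: L1Z.
  have IG : L1 (haar R n) (fun x => cabs g x `^ r).
    by apply: (L1_le mGr IB) => x; rewrite ger0_norm ?powR_ge0.
  split; [exact: IG|apply: (le_trans (int_le IG IB pt))]; rewrite intD; [|exact: L1Z|exact: L1Z].
  rewrite (intZ _ I2) (intZ _ Iq) -/Q.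
  apply: (@le_trans _ _ (T `^ (r - 2) * Q + T `^ (r - q) * (C * w `^ ((q - 2) / 2) * Q `^ (q / 2)))).
    by rewrite lerD2l ler_wpM2l ?powR_ge0.
  have BE : Bd `^ r = w `^ ((r - 2) / 2).
    by rewrite /Bd /bound33 ltNge hp /= absm -/z -(bound_subcritical Mp z0 p1).
  rewrite YE BE !TE.
  have D (x y y' : R) : 0 < x -> x `^ y * x `^ y' = x `^ (y + y').
    by move=> x0; rewrite -powRD //; apply/implyP => _; rewrite gt_eqF.
  have e1 : w `^ ((r - 2) / 2) * Q `^ ((r - 2) / 2) * Q = w `^ ((r - 2) / 2) * Q `^ (r / 2).
    by rewrite -mulrA -{2}[Q]powRr1 ?(ltW Q0) // D //; congr (_ * _ `^ _); clear; lra.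
  have e2 : w `^ ((r - q) / 2) * Q `^ ((r - q) / 2) * (C * w `^ ((q - 2) / 2) * Q `^ (q / 2)) = C * (w `^ ((r - 2) / 2) * Q `^ (r / 2)).
    transitivity (C * ((w `^ ((r - q) / 2) * w `^ ((q - 2) / 2)) * (Q `^ ((r - q) / 2) * Q `^ (q / 2)))); first by ring.
    by rewrite !D //; congr (_ * (_ `^ _ * _ `^ _)); clear; lra.
  rewrite e1 e2 -{1}[_ * Q `^ _]mul1r -mulrDl -/C' -[leRHS]mulrA ler_wpM2r ?mulr_ge0 ?powR_ge0 //.
  by rewrite -{1}[C']powRr1 ?(ltW C'0) // ler_powR //; clear -r2; lra.
have hF : \int[haar R n]_x (cabs f x `^ p) <= NF `^ p.
  rewrite /NF -powRrM mulVf ?gt_eqF // powRr1 //; by apply: int_ge0 => x; exact: powR_ge0.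
have [_ H] := holder_weak p1 (cabs_ge0 f) (cabs_ge0 g) (meas_cabs hf) mG IF IG NF0 Y0 hF hG.
by apply: (le_trans H); rewrite /Y le_eqVlt; apply/orP; left; apply/eqP; ring.
Qed.

End Upper.

(** * Lower bounds *)

Section Phases.
Variables (R : realType) (n : nat).
Notation pt := (pt R n).
Notation bpt := (bpt R n).
Notation haar := (haar R n).
Notation ct := (@ct n).
Notation rho := (@rho2 R n).
Notation tc := (@tcoord R n).
Notation L1 := (@L1 _ bpt R haar).

Lemma inLp_of_L1 p (f : cfun R n) : 0 < p -> is_hfun f -> L1 (fun q => cabs f q `^ p) -> inLp p f.
Proof. by move=> p0 hf If; split => //; rewrite normpE // ltry. Qed.

(** The phase for which $\cos(|m|t+\beta)=\sin(mt)$, whatever the sign of m. *)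
Definition beta (m : int) : R := if 0 < m then - (pi / 2) else pi / 2.

(** The hypotheses say that [u al] behaves like the real part of $e^{i\,al}$ times a complex
    function on which $\partial_t$ acts as $i|m|$; phases 0 and [beta m] then give real and
    imaginary part. *)
Lemma eigsp_phase (m : int) k (u : R -> pt -> R) : m != 0 ->
  (forall al, Vk `|m|%N (eigval R n `|m|%N k) (u al)) ->
  (forall al q, Dt (u al) q = `|m|%N%:R * u (al + pi / 2) q) ->
  (forall al q, u (al + pi) q = - u al q) -> eigsp m k (u 0, u (beta m)).
Proof.
move=> m0 Vu Du pu.
have Eh : is_hfun (u 0, u (beta m)).
  have [s1 p1 _ _ _] := Vu 0; have [s2 p2 _ _ _] := Vu (beta m).
  by split => //=; apply: continuous_borel; exact: smooth_cont.
have L a b : L1 (fun q => cabs (u a, u b) q ^+ 2).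
  rewrite (_ : (fun q => _) = (fun q => u a q ^+ 2 + u b q ^+ 2)); last by apply/funext => q; rewrite cabs_sqr.
  by apply: L1D; apply: Vk_L2; exact: Vu.
have Lu : inLp 2 (u 0, u (beta m)).
  apply: inLp_of_L1 => //; rewrite (_ : (fun q => _) = (fun q => cabs (u 0, u (beta m)) q ^+ 2)); first exact: L.
  by apply/funext => q; rewrite powR_mulrn ?cabs_ge0.
have ez : 2 * `|m|%:~R * (2 * k%:R + n%:R) = eigval R n `|m|%N k by rewrite intr_absz.
have [s1 _ _ l1 _] := Vu 0; have [s2 _ _ l2 _] := Vu (beta m).
have hp q al : u (al + pi / 2) q = - u (al - pi / 2) q.
  by rewrite -pu; congr (u _ q); lra.
split; [exact: Lu|split; [exact: s1|split; [exact: s2|split; [|split]]]]; rewrite /= ?ez //.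
have [hm|hm] := ltP 0 m.
  have bE : beta m = - (pi / 2) by rewrite /beta hm.
  have mE : `|m|%N%:R = m%:~R :> R by rewrite -intr_absz gtr0_norm.
  split; apply/funext => q; rewrite Du mE bE; first by rewrite hp !add0r mulrN.
  by rewrite addNr.
have bE : beta m = pi / 2 by rewrite /beta ltNge hm.
have mE : `|m|%N%:R = - m%:~R :> R by rewrite -intr_absz ler0_norm // mulrNz.
split; apply/funext => q; rewrite Du mE bE; first by rewrite add0r mulNr.
by rewrite -splitr -[pi]add0r pu mulrNN.
Qed.

Lemma cabs_phase (m : int) (u : R -> pt -> R) q : (forall al q, u (al + pi) q = - u al q) ->
  cabs (u 0, u (beta m)) q ^+ 2 = u 0 q ^+ 2 + u (pi / 2) q ^+ 2.
Proof.
move=> pu; rewrite cabs_sqr /= /beta; case: ifP => // _; congr (_ + _).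
by rewrite -[LHS]sqrrN -pu; congr (u _ q ^+ 2); lra.
Qed.

Section Gaussian.
Variables (m : nat).
Hypotheses (m0 : (0 < m)%N) (n0 : (0 < n)%N).
Notation M := (m%:R : R).
Let M0 : 0 < M. Proof. by rewrite ltr0n. Qed.

Lemma omDpi al x : om m (al + pi) x = - om m al x :> R.
Proof. by rewrite /om addrA cosDpi. Qed.

Lemma om_sqr x : om m 0 x ^+ 2 + om m (pi / 2) x ^+ 2 = 1 :> R.
Proof. by rewrite /om addr0 cosDpihalf sqrrN cos2Dsin2. Qed.

Lemma ef_pi l al q : @ef R n m l (al + pi) q = - @ef R n m l al q.
Proof. by rewrite /ef omDpi mulrN. Qed.

Lemma Dt_ef1 l al q : Dt (@ef R n m l al) q = M * @ef R n m l (al + pi / 2) q.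
Proof.
have -> : @ef R n m l al = radt (pexp (M / 2) (lagM R n m l)) (om m al) by [].
rewrite (@Dt_radt R n _ _ _ _ _ _ (der_pexp _ _) (der_pexp _ _) (@cont_pexp _ _ _) (der_om m al) (der_om1 m al) (@cont_om2 _ m al)).
by rewrite /ef /= /om1 /om addrA cosDpihalf; ring.
Qed.

Lemma eigsp_ef (mz : int) k : `|mz|%N = m -> eigsp mz k (@ef R n m k 0, @ef R n m k (beta mz)).
Proof.
move=> mE; apply: (@eigsp_phase mz k (fun al => @ef R n m k al)).
- by rewrite -absz_eq0 mE -lt0n.
- by move=> al; rewrite mE; exact: Vk_ef.
- by move=> al q; rewrite mE; exact: Dt_ef1.
- by move=> al q; exact: ef_pi.
Qed.

Let shift (al : R) : pt := (- (al / M)) *: eb R ct.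

Lemma int_phase (f : pt -> R) k s P al : 0 < s -> Vk m (eigval R n m k) f ->
  \int[haar]_q (f q * (pexp s P (rho q) * om m al (tc q))) = moment m (f \o ltr (shift al)) s P.
Proof.
move=> s0 Vf; pose g (q : pt) := f q * (pexp s P (rho q) * om m al (tc q)).
have pg : tperiodic g.
  move=> q; rewrite /g tperiodic_rho -[om m al (tc (q + _))]/((om m al \o tc) (q + _)) tperiodic_om.
  by have [_ -> _ _ _] := Vf.
rewrite -(int_addv (shift al) pg (L1_fpexp Vf P al s0)); apply: eqR => q.
have rE : rho ((q : pt) + shift al) = rho q.
  by apply: eq_bigr => j _; rewrite !mxE !cE /= !mulr0 !addr0.
have lE : ltr (shift al) q = q + shift al by rewrite /ltr sgC sgZ sg_ct mulr0 oppr0 scale0r addr0.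
rewrite /g rE /= lE /tc /om !mxE !eqxx /= mulr1; congr (_ * (_ * cos _)).
by field; rewrite gt_eqF.
Qed.

(** The coefficient of the projection of $e^{-s|z|^2}e^{imt}$ on the radial eigenfunction of index
    k: the constant of [mom_all] multiplied by [cK]. *)
Definition gam (k : nat) (s : R) : R := M ^+ n * 2 ^+ n * ((2 * s - M) ^+ k / (2 * s + M) ^+ (n + k)).

Lemma gauss_ef k f s al : M / 2 < s -> Vk m (eigval R n m k) f ->
  \int[haar]_q (f q * (pexp s 1 (rho q) * om m al (tc q))) =
  gam k s * \int[haar]_q (f q * @ef R n m k al q).
Proof.
move=> sM Vf; have s0 : 0 < s by apply: lt_trans sM; rewrite divr_gt0.
have Vf' := Vk_ltr (shift al) Vf; have h2 : 0 < M / 2 by rewrite divr_gt0.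
rewrite (int_phase 1 al s0 Vf) (mom_all m0 Vf' sM) (int_phase (lagM R n m k) al h2 Vf).
have := ef_repr m0 Vf'; rewrite -[LHS]/(moment _ _ _ _) => ->.
rewrite /gam /cK; set X := (2 * s - M) ^+ k / _; field.
by rewrite !gt_eqF ?exprn_gt0 ?pi_gt0.
Qed.

Definition gs (s al : R) (q : pt) : R := pexp s 1 (rho q) * om m al (tc q).

Lemma gsE s al q : gs s al q = expR (- s * rho q) * om m al (tc q).
Proof. by rewrite /gs /pexp hornerC mul1r. Qed.

Lemma gam_gt0 k s : M / 2 < s -> 0 < gam k s.
Proof.
move=> sM; have h1 : 0 < 2 * s - M by lra.
have h2 : 0 < 2 * s + M by apply: addr_gt0 => //; apply: mulr_gt0 => //; apply: lt_trans sM; exact: divr_gt0.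
by apply: mulr_gt0; [apply: mulr_gt0; exact: exprn_gt0|apply: divr_gt0; exact: exprn_gt0].
Qed.

Lemma gauss_orth k h s al : M / 2 < s -> Vk m (eigval R n m k) h ->
  let u q := ((gam k s)^-1 * gs s al q - @ef R n m k al q) * h q in
  L1 u /\ \int[haar]_q u q = 0.
Proof.
move=> sM Vh u; have s0 : 0 < s by apply: lt_trans sM; rewrite divr_gt0.
have I1 := L1Z (gam k s)^-1 (L1_fpexp Vh 1 al s0).
have I2 : L1 (fun q => h q * @ef R n m k al q).
  by apply: L1_mul; [exact: Vk_measurable Vh|exact: meas_ef|exact: Vk_L2 Vh|exact: L2_ef].
have uE : u = (fun q => (gam k s)^-1 * (h q * (pexp s 1 (rho q) * om m al (tc q))) - h q * @ef R n m k al q).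
  by apply/funext => q; rewrite /u /gs; ring.
rewrite uE; split; first exact: L1B.
rewrite intB // (intZ _ (L1_fpexp Vh 1 al s0)).
by rewrite (gauss_ef al sM Vh) mulKf ?subrr // gt_eqF // gam_gt0.
Qed.

Lemma Pmk_gauss (mz : int) k s : `|mz|%N = m -> M / 2 < s ->
  Pmk mz k ((fun q => (gam k s)^-1 * gs s 0 q), (fun q => (gam k s)^-1 * gs s (beta mz) q))
    (@ef R n m k 0, @ef R n m k (beta mz)).
Proof.
move=> mE sM; split; first exact: eigsp_ef.
move=> h Eh; have [V1 V2] := eig_Vk Eh; rewrite mE in V1 V2.
have [a1 b1] := gauss_orth 0 sM V1; have [a2 b2] := gauss_orth (beta mz) sM V2.
have [a3 b3] := gauss_orth (beta mz) sM V1; have [a4 b4] := gauss_orth 0 sM V2.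
have Z (w : pt -> R) : L1 w -> \int[haar]_q w q = 0 -> hint (fun q => (w q)%:E) = 0%E.
  by move=> Iw w0; rewrite -[LHS]/(hint (EFin \o w)) hint_integrable // intE // w0.
split.
  by apply: Z; [exact: (L1D a1 a2)|rewrite intD // b1 b2 addr0].
by apply: Z; [exact: (L1B a3 a4)|rewrite intB // b3 b4 subr0].
Qed.

Lemma int_ef_sqr k al : \int[haar]_q (@ef R n m k al q ^+ 2) = 'C(k + n.-1, n.-1)%:R / cK R n m.
Proof.
have h2 : 0 < M / 2 by rewrite divr_gt0.
have Ve := Vk_ef m0 n0 k al.
transitivity (\int[haar]_q (@ef R n m k al q * (pexp (M / 2) (lagM R n m k) (rho q) * om m al (tc q)))).
  by apply: eqR => q; rewrite expr2.
rewrite (int_phase _ al h2 Ve); have := ef_repr m0 (Vk_ltr (shift al) Ve); rewrite -[LHS]/(moment _ _ _ _) => ->.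
congr (_ / _); rewrite /= /ef pexp_phi.
have rE : rho (ltr (shift al) 0) = 0.
  by rewrite /rho2 big1 // => j _; rewrite /ltr /sg !mxE !cE /=; ring.
rewrite rE mulr0 phiE /lagv lag_at0 mulr0 expR0 mulr1.
have -> : tc (ltr (shift al) 0) = - (al / M).
  rewrite /tc ltr_ct sgC /shift sgZ sg_ct !mxE !eqxx /=; ring.
by rewrite /om (_ : _ + al = 0) ?cos0 ?mulr1 //; field; rewrite gt_eqF.
Qed.

End Gaussian.
End Phases.

Section LowerGauss.
Variables (R : realType) (n : nat).
Notation pt := (pt R n).
Notation bpt := (bpt R n).
Notation haar := (haar R n).
Notation rho := (@rho2 R n).
Notation tc := (@tcoord R n).
Notation L1 := (@L1 _ bpt R haar).

Lemma opnorm_ge (m : int) k p (f g : cfun R n) (A : R) : 0 < p -> inLp p f -> inLp 2 f -> Pmk m k f g ->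
  \int[haar]_q (cabs f q `^ p) = A -> 0 < A ->
  ((Num.sqrt (\int[haar]_q (cabs g q ^+ 2)) / A `^ p^-1)%:E <= opnorm_p2 n m k p)%E.
Proof.
move=> p0 Lp L2 P IA A0; have Lg : inLp 2 g by case: P => [[]].
have [hf _] := Lp; have npE := normpE p0 hf (inLp_int p0 Lp); rewrite IA in npE.
apply: ereal_sup_ubound; exists f, g; split => //.
  by rewrite npE eqe gt_eqF // powR_gt0.
by rewrite npE (normp2E Lg).
Qed.

Lemma expn_leq_bin k a : (k.+1 ^ a <= 'C(k + a, a) * a`!)%N.
Proof.
rewrite bin_ffact; elim: a => [|a IH]; first by rewrite ffactn0.
by rewrite addnS ffactSS expnS leq_mul // ltnS leq_addr.
Qed.

Lemma expn_leq_bin2 k : (1 < n)%N -> ((2 * k + n) ^ n.-1 <= n ^ n.-1 * n.-1`! * 'C(k + n.-1, n.-1))%N.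
Proof.
move=> n1; apply: (@leq_trans ((n * k.+1) ^ n.-1)); last first.
  by rewrite expnMn -mulnA leq_mul2l mulnC expn_leq_bin orbT.
rewrite leq_exp2r ?mulnS 1?addnC ?leq_add2l ?leq_mul2r ?n1 ?orbT //.
by case: n n1 => [|[]].
Qed.

(** At this width the inverse coefficient is $(\frac{z+1}{z-1})^k(\frac{z+1}2)^n$, and the first
    factor stays bounded because $k$ is at most a multiple of $z-1$. *)
Lemma gam_lower (m k : nat) : (0 < m)%N -> (1 < n)%N ->
  forall z : R, z = 2 * k%:R + n%:R -> (gam n m k (z * m%:R / 2))^-1 <= expR 2 * z ^+ n.
Proof.
move=> m0 n1 z zE; have M0 : 0 < m%:R :> R by rewrite ltr0n.
have N1 : 2 <= n%:R :> R by rewrite ler_nat.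
have K0 : 0 <= k%:R :> R by exact: ler0n.
have z1 : 0 < z - 1 by rewrite zE; lra.
have zp : 0 < z + 1 by lra.
have gE : (gam n m k (z * m%:R / 2))^-1 = ((z + 1) / (z - 1)) ^+ k * ((z + 1) / 2) ^+ n.
  rewrite /gam (_ : 2 * (z * m%:R / 2) - m%:R = (z - 1) * m%:R); last by field.
  rewrite (_ : 2 * (z * m%:R / 2) + m%:R = (z + 1) * m%:R); last by field.
  rewrite exprD !expr_div_n (exprMn k (z - 1)) (exprMn n (z + 1)) (exprMn k (z + 1)).
  have := exprn_gt0 n M0; have := exprn_gt0 k M0; set a := _ ^+ k; set b := _ ^+ n => a0 b0.
  have := exprn_gt0 n zp; have := exprn_gt0 k zp; set c := _ ^+ k; set d := _ ^+ n => c0 d0.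
  have := exprn_gt0 k z1; set e := _ ^+ k => e0.
  have := exprn_gt0 n (ltr0n R 2); set h := _ ^+ n => h0.
  by field; rewrite !gt_eqF.
rewrite gE; apply: ler_pM; rewrite ?exprn_ge0 ?divr_ge0 ?(ltW zp) ?(ltW z1) //; last first.
  by apply: lerXn2r; rewrite ?nnegrE; lra.
apply: (@le_trans _ _ (expR (2 / (z - 1)) ^+ k)).
  apply: lerXn2r; rewrite ?nnegrE ?expR_ge0 ?divr_ge0 ?(ltW zp) ?(ltW z1) //.
  by apply: le_trans (expR_ge1Dx _); rewrite le_eqVlt; apply/orP; left; apply/eqP; field; rewrite gt_eqF.
by rewrite -expRM_natl ler_expR mulrA ler_pdivrMr // mulrC ler_pM2l // zE; lra.
Qed.

Lemma cabs_gauss (m : nat) (mz : int) (c s p : R) q : 0 <= c ->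
  cabs ((fun q => c * gs m s 0 q), (fun q => c * gs m s (beta R mz) q)) (q : pt) `^ p =
  c `^ p * expR (- (p * s) * rho q).
Proof.
move=> c0; have cs : cabs ((fun q => c * gs m s 0 q), (fun q => c * gs m s (beta R mz) q)) q = c * expR (- s * rho q).
  have cE : 0 <= c * expR (- s * rho q) by rewrite mulr_ge0 ?expR_ge0.
  rewrite -(ger0_norm cE) -(ger0_norm (cabs_ge0 _ _)) -!sqrtr_sqr; congr Num.sqrt.
  rewrite (@cabs_phase _ _ mz (fun al q => c * gs m s al q)); last first.
    by move=> al x; rewrite /gs omDpi; ring.
  rewrite !gsE; set E := expR _; transitivity ((c * E) ^+ 2 * (om m 0 (tc q) ^+ 2 + om m (pi / 2) (tc q) ^+ 2)); first by ring.
  by rewrite om_sqr mulr1.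
rewrite cs powRM ?expR_ge0 //; congr (_ * _); rewrite powR_expR; congr expR; ring.
Qed.

Lemma lower_gauss p : (1 < n)%N -> 1 <= p -> exists2 c : R, 0 < c & forall (m : int) k, m != 0 ->
  ((c * ((2 * k%:R + n%:R) `^ (n%:R * (p^-1 - 2^-1) - 2^-1) * (`|m|%:~R) `^ (n%:R * (p^-1 - 2^-1))))%:E
    <= opnorm_p2 n m k p)%E.
Proof.
move=> n1 p1; have p0 : 0 < p by exact: lt_le_trans p1.
have n0 : (0 < n)%N by exact: ltnW.
pose D : R := (n ^ n.-1 * n.-1`!)%:R.
have D0 : 0 < D by rewrite ltr0n muln_gt0 expn_gt0 n0 fact_gt0.
have pi0 := pi_gt0 R.
pose S := Num.sqrt (2 * pi ^+ n.+1 / D).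
have S0 : 0 < S by rewrite sqrtr_gt0 divr_gt0 // mulr_gt0 // exprn_gt0.
pose T : R := 2 * pi * (2 * pi) ^+ n; have T0 : 0 < T by rewrite mulr_gt0 ?exprn_gt0 ?mulr_gt0.
pose K0 := T `^ p^-1; have K00 : 0 < K0 by exact: powR_gt0.
exists (S / (expR 2 * K0)); first by rewrite divr_gt0 // mulr_gt0 ?expR_gt0.
move=> mz k mz0; rewrite intr_absz; set m := `|mz|%N.
have m0 : (0 < m)%N by rewrite absz_gt0.
have M0 : 0 < m%:R :> R by rewrite ltr0n.
set M : R := m%:R; set z : R := 2 * k%:R + n%:R.
have N1 : 2 <= n%:R :> R by rewrite ler_nat.
have k0 : 0 <= k%:R :> R by exact: ler0n.
have z2 : 2 <= z by rewrite /z; lra.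
have z0 : 0 < z by lra.
(* The Gaussian gets the width of the central peak of the radial eigenfunction, where $m|z|^2$ is of
   order $1/(2k+n)$. *)
pose s := z * M / 2; have sM : M / 2 < s by rewrite /s ltr_pdivrMr // divfK // ltr_pMl //; lra.
have s0 : 0 < s by rewrite /s divr_gt0 // mulr_gt0.
have P := Pmk_gauss m0 n0 k (erefl : `|mz|%N = m) sM.
set c := (gam n m k s)^-1 in P; have c0 : 0 < c by rewrite invr_gt0; exact: gam_gt0.
have c0' := ltW c0.
set f := (_, _) in P; set g := (_, _) in P.
have hf : is_hfun f.
  have H al : smooth (fun q : pt => c * gs m s al q) /\ tperiodic (fun q : pt => c * gs m s al q).
    have h : smooth (gs m s al : pt -> R) by apply: (@smoothM R n (fun q => pexp s 1 (rho q)) (om m al \o tc)); [exact: smooth_pexp|exact: smooth_om].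
    split; first exact: smoothZ.
    by move=> q; rewrite /gs tperiodic_rho -[om m al (tc (q + _))]/((om m al \o tc) (q + _)) tperiodic_om.
  by split; rewrite /=; try (by case: (H 0)); try (by case: (H (beta R mz))); apply: continuous_borel; apply: smooth_cont; [case: (H 0)|case: (H (beta R mz))].
have Ip r : 0 < r -> L1 (fun q => cabs f q `^ r).
  move=> r0; rewrite (_ : (fun q => _) = (fun q : pt => c `^ r * expR (- (r * s) * rho q))); last first.
    by apply/funext => q; exact: cabs_gauss.
  by apply: L1Z; apply: L1_gauss; rewrite mulr_gt0.
have IA : \int[haar]_q (cabs f q `^ p) = c `^ p * (2 * pi * (pi / (p * s)) ^+ n).
  rewrite -int_gauss ?mulr_gt0 // -intZ; last by apply: L1_gauss; rewrite mulr_gt0.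
  by apply: eqR => q; exact: cabs_gauss.
have G0 : 0 < 2 * pi * (pi / (p * s)) ^+ n by rewrite mulr_gt0 ?mulr_gt0 ?exprn_gt0 ?divr_gt0 ?mulr_gt0.
have A0 : 0 < c `^ p * (2 * pi * (pi / (p * s)) ^+ n) by rewrite mulr_gt0 ?powR_gt0.
have := opnorm_ge p0 (inLp_of_L1 p0 hf (Ip _ p0)) (inLp_of_L1 _ hf (Ip 2 (ltr0n R 2))) P IA A0.
rewrite ltr0n => /(_ isT); apply: le_trans; rewrite lee_fin.
have IB : \int[haar]_q (cabs g q ^+ 2) = 2 * 'C(k + n.-1, n.-1)%:R / cK R n m.
  transitivity (\int[haar]_q (@ef R n m k 0 q ^+ 2 + @ef R n m k (pi / 2) q ^+ 2)).
    apply: eqR => q; apply: (@cabs_phase _ _ mz (fun al q => @ef R n m k al q)) => al x; exact: ef_pi.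
  rewrite intD ?int_ef_sqr //; [ring|exact: L2_ef|exact: L2_ef].
have Bl : S * (z `^ ((n%:R - 1) / 2) * M `^ (- (n%:R / 2))) <= Num.sqrt (\int[haar]_q (cabs g q ^+ 2)).
  have zE : z `^ ((n%:R - 1) / 2) = Num.sqrt (z ^+ n.-1).
    rewrite -powR12_sqrt ?exprn_ge0 ?(ltW z0) // -powR_mulrn ?(ltW z0) // -powRrM; congr (_ `^ (_ / 2)).
    by rewrite -{1}(prednK n0) -natr1 addrK.
  have mE : M `^ (- (n%:R / 2)) = Num.sqrt (M ^- n).
    by rewrite -powR12_sqrt ?invr_ge0 ?exprn_ge0 ?(ltW M0) // -powR_mulrn ?(ltW M0) // -powRN -powRrM mulNr.
  rewrite zE mE /S -!sqrtrM ?exprn_ge0 ?(ltW z0) ?divr_ge0 ?mulr_ge0 ?exprn_ge0 ?(ltW pi0) ?(ltW D0) //.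
  apply: ler_wsqrtr; rewrite IB /cK invf_div -/M.
  have hC : z ^+ n.-1 <= D * 'C(k + n.-1, n.-1)%:R.
    have h : (((2 * k + n) ^ n.-1) <= n ^ n.-1 * n.-1`! * 'C(k + n.-1, n.-1))%N by exact: expn_leq_bin2.
    by move: h; rewrite -(ler_nat R) natrX natrD natrM natrM -/z.
  have -> : 2 * pi ^+ n.+1 / D * (z ^+ n.-1 / M ^+ n) = (2 * pi ^+ n.+1 / M ^+ n) * (z ^+ n.-1 / D).
    by ring.
  have -> : 2 * 'C(k + n.-1, n.-1)%:R * (pi ^+ n.+1 / M ^+ n) = (2 * pi ^+ n.+1 / M ^+ n) * 'C(k + n.-1, n.-1)%:R.
    by ring.
  apply: ler_wpM2l; first by rewrite divr_ge0 ?mulr_ge0 ?exprn_ge0 ?(ltW M0) ?(ltW pi0).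
  by rewrite ler_pdivrMr // mulrC.
apply: (le_trans _ (_ : S * (z `^ ((n%:R - 1) / 2) * M `^ (- (n%:R / 2))) / (c `^ p * (2 * pi * (pi / (p * s)) ^+ n)) `^ p^-1 <= _)); last first.
  by rewrite ler_pM2r // invr_gt0 powR_gt0.
rewrite ler_pdivlMr ?powR_gt0 //.
have Au : (c `^ p * (2 * pi * (pi / (p * s)) ^+ n)) `^ p^-1 <= expR 2 * z ^+ n * (K0 * (z * M) `^ (- (n%:R / p))).
  rewrite powRM ?powR_ge0 ?(ltW G0) // -powRrM mulfV ?gt_eqF // powRr1 //.
  apply: ler_pM; rewrite ?powR_ge0 //; first exact: (gam_lower m0 n1 (erefl z)).
  have -> : K0 * (z * M) `^ (- (n%:R / p)) = (2 * pi * (2 * pi / (z * M)) ^+ n) `^ p^-1.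
    have zM0 : 0 <= z * M by rewrite mulr_ge0 ?(ltW z0) ?(ltW M0).
    have wE : (z * M) `^ (- (n%:R / p)) = ((z * M) ^- n) `^ p^-1.
      by rewrite -powR_mulrn // -powRN -powRrM mulNr.
    have w0 : 0 <= (z * M) ^- n by rewrite invr_ge0 exprn_ge0.
    by rewrite wE expr_div_n mulrA -/T (powRM _ (ltW T0) w0).
  apply: ler_powR_base; [by rewrite invr_ge0 ltW|exact: ltW|].
  apply: ler_wpM2l; first by rewrite mulr_ge0 // ltW.
  apply: lerXn2r; rewrite ?nnegrE ?divr_ge0 ?mulr_ge0 ?(ltW pi0) ?(ltW p0) ?(ltW s0) ?(ltW z0) ?(ltW M0) //.
  have -> : pi / (p * s) = 2 * pi / (z * M) / p by rewrite /s; field; rewrite !gt_eqF.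
  by rewrite ler_pdivrMr // ler_peMr // divr_ge0 ?mulr_ge0 ?(ltW pi0) ?(ltW z0) ?(ltW M0).
set e := n%:R * _ - _; set e' := n%:R * _.
have W0 : 0 <= S / (expR 2 * K0) * (z `^ e * M `^ e').
  apply: mulr_ge0; last by apply: mulr_ge0; exact: powR_ge0.
  apply: divr_ge0; first exact: ltW.
  by apply: mulr_ge0; [exact: expR_ge0|exact: ltW].
apply: (le_trans (ler_wpM2l W0 Au)); rewrite le_eqVlt; apply/orP; left; apply/eqP.
transitivity (S * (z `^ e * M `^ e' * (z ^+ n * (z * M) `^ (- (n%:R / p))))).
  by field; rewrite !gt_eqF ?expR_gt0.
congr (S * _); rewrite -(powR_mulrn _ (ltW z0)) powRM ?(ltW z0) ?(ltW M0) // /e /e'.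
rewrite -/M in M0; clear -z0 M0 p0; clearbody M z.
move: z0 M0 => /lnK <- /lnK <-.
rewrite !powR_expR -!expRD; congr expR; field.
by rewrite gt_eqF.
Qed.

End LowerGauss.

(** * The eigenfunctions $z_1^ke^{-|m||z|^2/2}e^{imt}$ *)

Section HighestWeight.
Variables (R : realType) (n : nat) (m : nat) (j0 : 'I_n).
Hypothesis m0 : (0 < m)%N.
Notation pt := (pt R n).
Notation ct := (@ct n).
Notation rho := (@rho2 R n).
Notation tc := (@tcoord R n).
Notation M := (m%:R : R).
Notation e0 := (@ef R n m 0).
Let M0 : 0 < M. Proof. by rewrite ltr0n. Qed.
Let n0 : (0 < n)%N. Proof. exact: leq_trans (ltn_ord j0). Qed.

Definition xc (j : 'I_n) (q : pt) : R := q 0 (cx j).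
Definition yc (j : 'I_n) (q : pt) : R := q 0 (cy j).
Definition cst (c : R) (q : pt) : R := c.

Fixpoint cpow (k : nat) : (pt -> R) * (pt -> R) :=
  if k is k'.+1 then
    ((xc j0 \* (cpow k').1) \+ (cst (-1) \* (yc j0 \* (cpow k').2)), (xc j0 \* (cpow k').2) \+ (yc j0 \* (cpow k').1))
  else (cst 1, cst 0).

(** [cpow] holds the real and imaginary part of $z_{j_0}^k$, and the phase shift by $\pi/2$ turns
    the cosine into minus the sine: this is the real part of $z_{j_0}^ke^{i(mt+al)}$ times the
    Gaussian. *)
Definition hw (k : nat) (al : R) : pt -> R := ((cpow k).1 \* e0 al) \+ ((cpow k).2 \* e0 (al + pi / 2)).

Let sN0 (f : pt -> R) : smooth f -> smoothN 1 f. Proof. by move=> /smoothP; exact. Qed.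
Let sx j : smooth (xc j). Proof. exact: smooth_coord. Qed.
Let sy j : smooth (yc j). Proof. exact: smooth_coord. Qed.
Let sc c : smooth (cst c). Proof. exact: smooth_cst. Qed.

Lemma smooth_cpow k : smooth (cpow k).1 /\ smooth (cpow k).2.
Proof.
elim: k => [|k [s1 s2]]; first by split; exact: sc.
split; apply: smooth_add.
- exact: (smoothM (sx _) s1).
- exact: (smoothM (sc _) (smoothM (sy _) s2)).
- exact: (smoothM (sx _) s2).
- exact: (smoothM (sy _) s1).
Qed.

Let se al : smooth (e0 al : pt -> R). Proof. by apply: smooth_ef. Qed.

Lemma smooth_hw k al : smooth (hw k al).
Proof.
have [s1 s2] := smooth_cpow k.
exact: (smooth_add (smoothM s1 (se _)) (smoothM s2 (se _))).
Qed.

Lemma tperiodic_hw k al : tperiodic (hw k al).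
Proof.
have [p1 p2] : tperiodic (cpow k).1 /\ tperiodic (cpow k).2.
  elim: k => [|k [p1 p2]]; first by split => q.
  have px : tperiodic (xc j0) by exact: tperiodic_cx.
  have py : tperiodic (yc j0) by exact: tperiodic_cy.
  by split => q /=; rewrite p1 p2 px py.
by move=> q; rewrite /hw /= p1 p2 !tperiodic_ef.
Qed.

Let dl (j : 'I_n) (k : nat) : R := (j == j0)%:R * k%:R.

Let D0 (v q : pt) c : 'D_v (cst c) q = 0. Proof. exact: derive_cst. Qed.

Let Dx v i q : 'D_v (xc i) q = v 0 (cx i). Proof. exact: D_coord. Qed.
Let Dy v i q : 'D_v (yc i) q = v 0 (cy i). Proof. exact: D_coord. Qed.

Lemma Xx i j q : Xop j (xc i) q = (j == i)%:R.
Proof. by rewrite /Xop !(Dx, Dy) !mxE !cE eqxx /= mulr0 subr0 eq_sym. Qed.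
Lemma Xy i j q : Xop j (yc i) q = 0.
Proof. by rewrite /Xop !(Dx, Dy) !mxE !cE eqxx /= mulr0 subr0. Qed.
Lemma Yx i j q : Yop j (xc i) q = 0.
Proof. by rewrite /Yop !(Dx, Dy) !mxE !cE eqxx /= mulr0 addr0. Qed.
Lemma Yy i j q : Yop j (yc i) q = (j == i)%:R.
Proof. by rewrite /Yop !(Dx, Dy) !mxE !cE eqxx /= mulr0 addr0 eq_sym. Qed.
Lemma Xc c j q : Xop j (cst c) q = 0. Proof. exact: X_cst. Qed.
Lemma Yc c j q : Yop j (cst c) q = 0. Proof. exact: Y_cst. Qed.

Lemma X_cpow k j q : Xop j (cpow k).1 q = dl j k * (cpow k.-1).1 q /\ Xop j (cpow k).2 q = dl j k * (cpow k.-1).2 q.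
Proof.
elim: k => [|k [IH1 IH2]]; first by rewrite /= !Xc /dl mulr0 !mul0r.
have [/sN0 s1 /sN0 s2] := smooth_cpow k; have x1 := sN0 (sx j0); have y1 := sN0 (sy j0); have c1 := sN0 (sc (-1)).
have y2 := smoothN_M y1 s2; have x2 := smoothN_M x1 s1; have z2 := smoothN_M c1 y2.
have x3 := smoothN_M x1 s2; have y3 := smoothN_M y1 s1.
rewrite /= (XopD j q x2 z2) (XopD j q x3 y3) (XopM j q c1 y2) !(XopM j q x1) // !(XopM j q y1) // IH1 IH2 Xc Xx Xy.
rewrite /dl -natr1; case: eqP => [_|_] /=; last by split; ring.
by case: k {IH1 IH2 s1 s2 y2 x2 z2 x3 y3} => [|k] /=; rewrite /cst; split; ring.
Qed.

Lemma Y_cpow k j q : Yop j (cpow k).1 q = - (dl j k * (cpow k.-1).2 q) /\ Yop j (cpow k).2 q = dl j k * (cpow k.-1).1 q.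
Proof.
elim: k => [|k [IH1 IH2]]; first by rewrite /= !Yc /dl /cst; split; ring.
have [/sN0 s1 /sN0 s2] := smooth_cpow k; have x1 := sN0 (sx j0); have y1 := sN0 (sy j0); have c1 := sN0 (sc (-1)).
have y2 := smoothN_M y1 s2; have x2 := smoothN_M x1 s1; have z2 := smoothN_M c1 y2.
have x3 := smoothN_M x1 s2; have y3 := smoothN_M y1 s1.
rewrite /= (YopD j q x2 z2) (YopD j q x3 y3) (YopM j q c1 y2) !(YopM j q x1) // !(YopM j q y1) // IH1 IH2 Yc Yx Yy.
rewrite /dl -natr1; case: eqP => [_|_] /=; last by split; ring.
by case: k {IH1 IH2 s1 s2 y2 x2 z2 x3 y3} => [|k] /=; rewrite /cst; split; ring.
Qed.

Let P0 : lagM R n m 0 = 1.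
Proof. by rewrite /lagM lag0 comp_polyC. Qed.

Let dpE : dpoly (M / 2) (lagM R n m 0) = - (M / 2) *: 1.
Proof. by rewrite /dpoly P0 derivC sub0r scaleNr. Qed.

Lemma e0DD al q : e0 (al + pi / 2 + pi / 2) q = - e0 al q.
Proof. by rewrite -addrA -splitr ef_pi. Qed.

Lemma X_e0 al j q : Xop j (e0 al) q = - M * (xc j q * e0 al q + yc j q * e0 (al + pi / 2) q).
Proof.
rewrite {1}(_ : e0 al = radt (pexp (M / 2) (lagM R n m 0)) (om m al)); last by [].
rewrite (@X_radt R n _ _ _ _ _ _ (der_pexp _ _) (der_pexp _ _) (@cont_pexp _ _ _) (der_om m al) (der_om1 m al) (@cont_om2 _ m al)) /=.
rewrite /ef dpE P0 /om1 /om addrA cosDpihalf /pexp hornerZ !hornerC /xc /yc; by field.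
Qed.

Lemma Y_e0 al j q : Yop j (e0 al) q = M * (xc j q * e0 (al + pi / 2) q - yc j q * e0 al q).
Proof.
rewrite {1}(_ : e0 al = radt (pexp (M / 2) (lagM R n m 0)) (om m al)); last by [].
rewrite (@Y_radt R n _ _ _ _ _ _ (der_pexp _ _) (der_pexp _ _) (@cont_pexp _ _ _) (der_om m al) (der_om1 m al) (@cont_om2 _ m al)) /=.
rewrite /ef dpE P0 /om1 /om addrA cosDpihalf /pexp hornerZ !hornerC /xc /yc; by field.
Qed.

Lemma X_hw k al j : Xop j (hw k al) =
  (cst (dl j k) \* hw k.-1 al) \+ (cst (- M) \* ((xc j \* hw k al) \+ (yc j \* hw k (al + pi / 2)))).
Proof.
apply/funext => q; have [/sN0 s1 /sN0 s2] := smooth_cpow k; have [X1 X2] := X_cpow k j q.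
have e1 a := sN0 (se a).
rewrite {1}/hw (XopD j q (smoothN_M s1 (e1 _)) (smoothN_M s2 (e1 _))) (XopM j q s1 (e1 _)) (XopM j q s2 (e1 _)).
rewrite X1 X2 !X_e0 /hw /= !e0DD /cst; ring.
Qed.

Lemma Y_hw k al j : Yop j (hw k al) =
  (cst (dl j k) \* hw k.-1 (al + pi / 2)) \+ (cst M \* ((xc j \* hw k (al + pi / 2)) \+ (cst (-1) \* (yc j \* hw k al)))).
Proof.
apply/funext => q; have [/sN0 s1 /sN0 s2] := smooth_cpow k; have [Y1 Y2] := Y_cpow k j q.
have e1 a := sN0 (se a).
rewrite {1}/hw (YopD j q (smoothN_M s1 (e1 _)) (smoothN_M s2 (e1 _))) (YopM j q s1 (e1 _)) (YopM j q s2 (e1 _)).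
rewrite Y1 Y2 !Y_e0 /hw /= !e0DD /cst; ring.
Qed.

Lemma hw_pi k al q : hw k (al + pi) q = - hw k al q.
Proof. by rewrite /hw /= addrAC !ef_pi; ring. Qed.

Lemma hwDD k al q : hw k (al + pi / 2 + pi / 2) q = - hw k al q.
Proof. by rewrite -addrA -splitr hw_pi. Qed.

(** The relation $z\cdot z^{k-1}=z^k$ in real form; it closes the computation of $X_j^2+Y_j^2$,
    whose first-order terms raise the degree back to k. *)
Lemma hw_succ k j al q :
  dl j k * (xc j q * hw k.-1 al q + yc j q * hw k.-1 (al + pi / 2) q) = dl j k * hw k al q.
Proof.
rewrite /dl; case: eqP => [->|_]; last by rewrite !mul0r.
case: k => [|k]; first by rewrite !mulr0 !mul0r.
by congr (_ * _); rewrite /hw /= !e0DD /cst; ring.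
Qed.

Lemma XXYY_hw k al j q : Xop j (Xop j (hw k al)) q + Yop j (Yop j (hw k al)) q = - (4 * M * dl j k + 2 * M) * hw k al q.
Proof.
have h i a := sN0 (smooth_hw i a); have cc c := sN0 (sc c); have x1 := sN0 (sx j); have y1 := sN0 (sy j).
rewrite X_hw Y_hw.
have A1 := smoothN_M (cc (dl j k)) (h k.-1 al); have A1' := smoothN_M (cc (dl j k)) (h k.-1 (al + pi / 2)).
have A2 := smoothN_M x1 (h k al); have A3 := smoothN_M y1 (h k (al + pi / 2)); have A4 := smoothN_add A2 A3.
have B2 := smoothN_M x1 (h k (al + pi / 2)); have B3 := smoothN_M y1 (h k al).
have B4 := smoothN_M (cc (-1)) B3; have B5 := smoothN_add B2 B4.
rewrite (XopD j q A1 (smoothN_M (cc (- M)) A4)) (XopM j q (cc _) (h _ _)) (XopM j q (cc _) A4) (XopD j q A2 A3).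
rewrite (XopM j q x1 (h _ _)) (XopM j q y1 (h _ _)).
rewrite (YopD j q A1' (smoothN_M (cc M) B5)) (YopM j q (cc _) (h _ _)) (YopM j q (cc _) B5) (YopD j q B2 B4).
rewrite (YopM j q (cc _) B3) (YopM j q x1 (h _ _)) (YopM j q y1 (h _ _)).
rewrite !Xc !Yc Xx Yx Xy Yy eqxx !X_hw !Y_hw /= !hwDD.
have := hw_succ k j al q; have := hw_succ k j (al + pi / 2) q; rewrite hwDD.
rewrite /cst; set d := dl j k; set d1 := dl j k.-1; set x := xc j q; set y := yc j q.
set a := hw k al q; set b := hw k (al + _) q; set a1 := hw k.-1 al q; set b1 := hw k.-1 (al + _) q.
set a2 := hw k.-2 al q => E2 E1.
transitivity (- (2 * M * (d * (x * a1 + y * b1)) + 2 * M * (d * a) + 2 * M * a) + 0 * (d * (x * b1 + y * - a1) - d * b)); last first.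
  by rewrite E1; ring.
rewrite -E1; ring.
Qed.

Lemma subLap_hw k al : subLap (hw k al) = (fun q => eigval R n m k * hw k al q).
Proof.
apply/funext => q; rewrite /subLap (eq_bigr (fun j => - (4 * M * dl j k + 2 * M) * hw k al q)); last first.
  by move=> j _; exact: XXYY_hw.
rewrite -mulr_suml -mulNr; congr (_ * _); rewrite sumrN opprK big_split /= -mulr_sumr sumr_const card_ord.
rewrite (bigD1 j0) //= big1 ?addr0; last by move=> j /negbTE; rewrite /dl => ->; rewrite mul0r.
by rewrite /dl eqxx mul1r /eigval -mulr_natr; ring.
Qed.

Lemma Dt_hw k al q : Dt (hw k al) q = M * hw k (al + pi / 2) q.
Proof.
have [/sN0 s1 /sN0 s2] := smooth_cpow k.
have e1 a := sN0 (se a).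
have [Dc1 Dc2] : 'D_(eb R ct) (cpow k).1 q = 0 /\ 'D_(eb R ct) (cpow k).2 q = 0.
  elim: k {s1 s2} => [|k [IH1 IH2]]; first by rewrite /= !D0.
  have [/sN0 s1 /sN0 s2] := smooth_cpow k; have x1 := sN0 (sx j0); have y1 := sN0 (sy j0); have c1 := sN0 (sc (-1)).
  have y2 := smoothN_M y1 s2; have x2 := smoothN_M x1 s1; have z2 := smoothN_M c1 y2.
  have x3 := smoothN_M x1 s2; have y3 := smoothN_M y1 s1.
  rewrite /= (derD q _ x2 z2) (derD q _ x3 y3) (derM q _ c1 y2) !(derM q _ x1) // !(derM q _ y1) // IH1 IH2 D0 !Dx !Dy.
  by rewrite !mxE !cE /=; split; ring.
have De a : 'D_(eb R ct) (e0 a) q = M * e0 (a + pi / 2) q by exact: (Dt_ef1 _ _ _ q).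
rewrite {1}/hw /Dt (derD q _ (smoothN_M s1 (e1 _)) (smoothN_M s2 (e1 _))) (derM q _ s1 (e1 _)) (derM q _ s2 (e1 _)).
by rewrite Dc1 Dc2 !De /hw /= !e0DD; ring.
Qed.

Definition radsq (q : pt) : R := xc j0 q ^+ 2 + yc j0 q ^+ 2.
Definition gpow (b : R) (j : nat) (q : pt) : R := radsq q ^+ j * expR (- b * rho q).

Lemma om_sqrD al x : om m al x ^+ 2 + om m (al + pi / 2) x ^+ 2 = 1 :> R.
Proof. by rewrite /om addrA cosDpihalf sqrrN cos2Dsin2. Qed.

Lemma hw_sqr k al q : hw k al q ^+ 2 + hw k (al + pi / 2) q ^+ 2 = gpow M k q.
Proof.
have E : (cpow k).1 q ^+ 2 + (cpow k).2 q ^+ 2 = radsq q ^+ k.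
  elim: k => [|k IH] /=; first by rewrite /cst expr1n expr0n addr0.
  by rewrite [RHS]exprS -IH /radsq /cst /=; ring.
rewrite /gpow -E /hw /= e0DD.
rewrite /ef P0 /pexp !hornerC !mul1r.
have := om_sqrD al (tc q); set a := om m al _; set b := om m (al + pi / 2) _ => ab.
have -> : expR (- M * rho q) = expR (- (M / 2) * rho q) ^+ 2.
  by rewrite -expRM_natl; congr expR; field.
set E' := expR _; set u := (cpow k).1 q; set v := (cpow k).2 q.
transitivity ((u ^+ 2 + v ^+ 2) * E' ^+ 2 * (a ^+ 2 + b ^+ 2)); first by ring.
by rewrite ab mulr1.
Qed.

End HighestWeight.

(** The central binomial bound $4^i\le\sqrt{4i+1}\binom{2i}{i}$, squared to stay in the natural
    numbers. *)
Lemma fact_double i : ((i`! ^ 2 * 4 ^ i) ^ 2 <= (4 * i + 1) * (2 * i)`! ^ 2)%N.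
Proof.
elim: i => [//|i IH]; have -> : (2 * i.+1 = (2 * i).+2)%N by lia.
rewrite !factS (expnS 4 i).
move: IH; set a := i`!; set b := (2 * i)`!; set c := (4 ^ i)%N => IH.
apply: (@leq_trans ((4 * i + 1) * b ^ 2 * (16 * i.+1 ^ 4))).
  have -> : (((i.+1 * a) ^ 2 * (4 * c)) ^ 2 = (a ^ 2 * c) ^ 2 * (16 * i.+1 ^ 4))%N by clear; ring.
  by rewrite leq_mul2r IH orbT.
have -> : ((4 * i + 1) * b ^ 2 * (16 * i.+1 ^ 4) = (4 * i.+1 ^ 2 * b ^ 2) * ((4 * i + 1) * (4 * i.+1 ^ 2)))%N by clear; ring.
have -> : ((4 * i.+1 + 1) * ((2 * i).+2 * ((2 * i).+1 * b)) ^ 2 = (4 * i.+1 ^ 2 * b ^ 2) * ((4 * i + 5) * (2 * i).+1 ^ 2))%N by clear; ring.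
by rewrite leq_mul2l; apply/orP; right; clear; nia.
Qed.

Lemma fact_pair k : ((k./2`! * (uphalf k)`! * 2 ^ k) ^ 2 <= (2 * k + 3) * k`! ^ 2)%N.
Proof.
have [i [kE|kE]] : exists i, k = (2 * i)%N \/ k = (2 * i).+1.
  by exists k./2; case: (boolP (odd k)) => h; [right|left]; move: (odd_double_half k); rewrite ?h ?(negbTE h) -mul2n /=; lia.
  have e1 : k./2 = i by lia.
  have e2 : uphalf k = i by lia.
  have h := fact_double i; rewrite e1 e2 kE (expnM 2 2 i) (_ : 2 ^ 2 = 4)%N // mulnn.
  apply: (leq_trans h).
  by rewrite leq_mul2r; apply/orP; right; lia.
have e1 : k./2 = i by lia.
have e2 : uphalf k = i.+1 by lia.
have := fact_double i; rewrite e1 e2 kE !factS (expnS 2 (2 * i)) (expnM 2 2 i) (_ : 2 ^ 2 = 4)%N //.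
set a := i`!; set b := (2 * i)`!; set c := (4 ^ i)%N => h.
apply: (@leq_trans ((4 * i + 1) * b ^ 2 * (4 * i.+1 ^ 2))).
  have -> : ((a * (i.+1 * a) * (2 * c)) ^ 2 = (a ^ 2 * c) ^ 2 * (4 * i.+1 ^ 2))%N by clear; ring.
  by rewrite leq_mul2r h orbT.
have -> : ((4 * i + 1) * b ^ 2 * (4 * i.+1 ^ 2) = b ^ 2 * ((4 * i + 1) * (4 * i.+1 ^ 2)))%N by clear; ring.
have -> : ((2 * (2 * i).+1 + 3) * ((2 * i).+1 * b) ^ 2 = b ^ 2 * ((4 * i + 5) * (2 * i).+1 ^ 2))%N by clear; ring.
by rewrite leq_mul2l; apply/orP; right; clear; nia.
Qed.

Section Moments.
Variables (R : realType) (n : nat) (j0 : 'I_n).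
Notation pt := (pt R n).
Notation bpt := (bpt R n).
Notation haar := (haar R n).
Notation rho := (@rho2 R n).
Notation L1 := (@L1 _ bpt R haar).
Notation xc := (@xc R n j0).
Notation yc := (@yc R n j0).
Notation rr := (@radsq R n j0).
Notation GG := (@gpow R n j0).

Lemma rr_ge0 q : 0 <= rr q. Proof. by rewrite addr_ge0 ?sqr_ge0. Qed.

Lemma rr_le_rho q : rr q <= rho q.
Proof.
rewrite /rho2 (bigD1 j0) //= lerDl; apply: sumr_ge0 => i _.
by rewrite addr_ge0 ?sqr_ge0.
Qed.

Lemma GG_ge0 b j q : 0 <= GG b j q.
Proof. by rewrite mulr_ge0 ?expR_ge0 ?exprn_ge0 ?rr_ge0. Qed.

Let sxc : smooth xc. Proof. exact: smooth_coord. Qed.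
Let syc : smooth yc. Proof. exact: smooth_coord. Qed.

Lemma smooth_rr : smooth rr.
Proof.
have -> : rr = (xc \* xc) \+ (yc \* yc) by apply/funext => q; rewrite /radsq /= !expr2.
exact: (smooth_add (smoothM sxc sxc) (smoothM syc syc)).
Qed.

Lemma smooth_rrX j : smooth (fun q => rr q ^+ j).
Proof.
elim: j => [|j IH]; first exact: smooth_cst.
rewrite (_ : (fun q => _) = rr \* (fun q => rr q ^+ j)); last by apply/funext => q; rewrite exprS.
exact: (smoothM smooth_rr IH).
Qed.

Lemma GGE b j : GG b j = (fun q => rr q ^+ j) \* (fun q => pexp b 1 (rho q)).
Proof. by apply/funext => q; rewrite /gpow /= /pexp hornerC mul1r. Qed.

Let sp b : smooth (fun q : pt => pexp b 1 (rho q)). Proof. by apply: smooth_pexp. Qed.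

Lemma smooth_GG b j : smooth (GG b j).
Proof. by rewrite GGE; exact: (smoothM (smooth_rrX j) (sp b)). Qed.

Lemma decay_of (g : pt -> R) b P : 0 < b -> (forall q, `|g q| <= pexp b P (rho q)) -> decay g.
Proof.
move=> b0 H; have [C HC] := @decay_pexp R n b P b0; exists C => q.
by apply: (le_trans (H q)); apply: le_trans (HC q); exact: ler_norm.
Qed.

Lemma GG_le b j q : GG b j q <= pexp b 'X^j (rho q).
Proof.
rewrite /gpow /pexp hornerXn ler_wpM2r ?expR_ge0 //; apply: lerXn2r; rewrite ?nnegrE ?rr_ge0 ?rho_ge0 //.
exact: rr_le_rho.
Qed.

Lemma decay_GG b j : 0 < b -> decay (GG b j).
Proof. by move=> b0; apply: (decay_of b0 (P := 'X^j)) => q; rewrite ger0_norm ?GG_ge0 ?GG_le. Qed.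

Lemma L1_smooth_decay (g : pt -> R) : smooth g -> decay g -> L1 g.
Proof. by move=> /smooth_cont sg; apply: L1_decay; exact: continuous_measurable_bpt. Qed.

Lemma L1_GG b j : 0 < b -> L1 (GG b j).
Proof. by move=> b0; apply: L1_smooth_decay; [exact: smooth_GG|exact: decay_GG]. Qed.

Lemma GGS b j q : GG b j.+1 q = rr q * GG b j q.
Proof. by rewrite /gpow exprS mulrA. Qed.

Lemma tperiodic_GG b j : tperiodic (GG b j).
Proof.
have px : tperiodic xc by exact: tperiodic_cx.
have py : tperiodic yc by exact: tperiodic_cy.
by move=> q; rewrite /gpow /radsq px py tperiodic_rho.
Qed.

Let sN0 (f : pt -> R) : smooth f -> smoothN 1 f. Proof. by move=> /smoothP; exact. Qed.

(** [h] is the derivative along [v] of [c] times [GG b j], written out; [c] will be the coordinate x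
    or y of index [j0]. *)
Lemma mom_dir b j (c : pt -> R) (v : pt) : 0 < b -> smooth c -> tperiodic c ->
  (forall q, 'D_v c q = 1) -> (forall q, 'D_v rr q = 2 * c q) -> (forall q, 'D_v rho q = 2 * c q) ->
  (forall q, c q ^+ 2 <= rr q) ->
  let h q := GG b j q + 2 * c q ^+ 2 * (j%:R * GG b j.-1 q - b * GG b j q) in L1 h /\ \int[haar]_q h q = 0.
Proof.
move=> b0 sc pc Dc Dr Dh cr h; pose G := c \* GG b j.
have sG : smooth G by exact: (smoothM sc (smooth_GG b j)).
have hE : h = 'D_v G.
  apply/funext => q; rewrite /G (derM q v (sN0 sc) (sN0 (smooth_GG b j))) Dc mul1r.
  rewrite {2}GGE (derM q v (sN0 (smooth_rrX j)) (sN0 (sp b))).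
  have -> : 'D_v (fun q => rr q ^+ j) q = j%:R * rr q ^+ j.-1 * (2 * c q).
    have d := derP_X j (derP_id (rr q)).
    by rewrite mulr1 in d; rewrite -Dr -(D_comp v d (sN0 smooth_rr)).
  have -> : 'D_v (fun q => pexp b 1 (rho q)) q = pexp b (dpoly b 1) (rho q) * (2 * c q).
    by rewrite -Dh -(D_comp v (der_pexp b 1 (rho q)) (sN_rho R n 1)).
  by rewrite /h /gpow /dpoly derivC sub0r /pexp hornerN hornerZ !hornerC; ring.
have c1 q : `|c q| <= 1 + rho q.
  have := cr q; have := rr_le_rho q; have := sqr_ge0 (`|c q| - 1); rewrite -(real_normK (num_real (c q))).
  by have := normr_ge0 (c q); set u := `|c q|; nra.
have dG : decay G.
  apply: (decay_of b0 (P := (1 + 'X) * 'X^j)) => q; rewrite /G /= normrM (ger0_norm (GG_ge0 _ _ _)).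
  have -> : pexp b ((1 + 'X) * 'X^j) (rho q) = (1 + rho q) * pexp b 'X^j (rho q).
    by rewrite /pexp hornerM hornerD hornerC hornerX [RHS]mulrA.
  exact: (ler_pM (normr_ge0 _) (GG_ge0 b j q) (c1 q) (GG_le b j q)).
have dh : decay h.
  apply: (decay_of b0 (P := (1 + 2 * j%:R) *: 'X^j + (2 * b) *: 'X^(j.+1))) => q.
  have H1 : c q ^+ 2 * (j%:R * GG b j.-1 q) <= j%:R * pexp b 'X^j (rho q).
    case: j {G sG h hE dG} => [|j]; first by rewrite !mul0r mulr0.
    rewrite mulrCA; apply: ler_wpM2l => //; apply: le_trans (GG_le b j.+1 q).
    by rewrite GGS; apply: ler_wpM2r; [exact: GG_ge0|exact: cr].
  have H2 : c q ^+ 2 * (b * GG b j q) <= b * pexp b 'X^(j.+1) (rho q).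
    rewrite mulrCA; apply: ler_wpM2l; first exact: ltW.
    apply: le_trans (GG_le b j.+1 q).
    by rewrite GGS; apply: ler_wpM2r; [exact: GG_ge0|exact: cr].
  have H3 := GG_le b j q; have H0 := GG_ge0 b j q.
  have H4 : 0 <= c q ^+ 2 * (j%:R * GG b j.-1 q) by rewrite mulr_ge0 ?sqr_ge0 // mulr_ge0 ?GG_ge0.
  have H5 : 0 <= c q ^+ 2 * (b * GG b j q) by rewrite mulr_ge0 ?sqr_ge0 // mulr_ge0 ?GG_ge0 // ltW.
  have -> : pexp b ((1 + 2 * j%:R) *: 'X^j + (2 * b) *: 'X^(j.+1)) (rho q) =
    pexp b 'X^j (rho q) + 2 * (j%:R * pexp b 'X^j (rho q)) + 2 * (b * pexp b 'X^(j.+1) (rho q)).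
    by rewrite /pexp hornerD !hornerZ; ring.
  have -> : h q = GG b j q + 2 * (c q ^+ 2 * (j%:R * GG b j.-1 q)) - 2 * (c q ^+ 2 * (b * GG b j q)).
    by rewrite /h; ring.
  move: H1 H2 H3 H0 H4 H5; clear.
  move: (c q ^+ 2 * (j%:R * _)) (c q ^+ 2 * (b * _)) => u2 u3.
  move: (j%:R * _) (b * _) => v2 v3; move: (GG b j q) (pexp b 'X^j _) => u1 v1.
  by rewrite ler_norml => *; apply/andP; split; lra.
have sh : smooth h by rewrite hE; exact: smoothD.
split; first exact: L1_smooth_decay.
apply: (int_D0 (smooth_cont sG) (smooth_cont sh) _ _ dG dh (v := v)).
  by move=> q; rewrite /G /= pc tperiodic_GG.
by move=> q; rewrite hE; apply: derivableP; exact: smooth_der.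
Qed.

(** The divergence theorem in the plane of $z_{j_0}$: the two directions are added, and the squares
    of the coordinates combine to $|z_{j_0}|^2$. *)
Lemma mom_gpow_rec b j : 0 < b -> b * \int[haar]_q GG b j.+1 q = j.+1%:R * \int[haar]_q GG b j q.
Proof.
move=> b0.
have Dxx (v q : pt) : 'D_v xc q = v 0 (cx j0) by exact: D_coord.
have Dyy (v q : pt) : 'D_v yc q = v 0 (cy j0) by exact: D_coord.
have x1 := sN0 sxc; have y1 := sN0 syc.
have Drr (v q : pt) : 'D_v rr q = 2 * (xc q * v 0 (cx j0) + yc q * v 0 (cy j0)).
  have -> : rr = (xc \* xc) \+ (yc \* yc) by apply/funext => r; rewrite /radsq /= !expr2.
  by rewrite (derD q v (smoothN_M x1 x1) (smoothN_M y1 y1)) (derM q v x1 x1) (derM q v y1 y1) Dxx Dyy; ring.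
have [|||||I1 E1] := @mom_dir b j xc (eb R (cx j0)) b0 sxc; rewrite /=.
- exact: tperiodic_cx.
- by move=> q; rewrite Dxx !mxE !eqxx.
- by move=> q; rewrite Drr !mxE !cE !eqxx /=; ring.
- by move=> q; rewrite Drho_cx.
- by move=> q; rewrite /radsq lerDl sqr_ge0.
have [|||||I2 E2] := @mom_dir b j yc (eb R (cy j0)) b0 syc; rewrite /=.
- exact: tperiodic_cy.
- by move=> q; rewrite Dyy !mxE !eqxx.
- by move=> q; rewrite Drr !mxE !cE !eqxx /=; ring.
- by move=> q; rewrite Drho_cy.
- by move=> q; rewrite /radsq lerDr sqr_ge0.
have := intD I1 I2; rewrite E1 E2 addr0 (_ : (fun q => _) = (fun q => (2 * j.+1%:R) * GG b j q - (2 * b) * GG b j.+1 q)).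
  rewrite intB; [|by apply: L1Z; exact: L1_GG|by apply: L1Z; exact: L1_GG].
  rewrite !intZ; [|exact: L1_GG|exact: L1_GG] => /eqP; rewrite subr_eq0 -!mulrA => /eqP h.
  by apply: (@mulfI _ 2) => //; rewrite -h.
apply/funext => q; rewrite -natr1 /gpow.
have -> : rr q ^+ j.+1 = (xc q ^+ 2 + yc q ^+ 2) * rr q ^+ j by rewrite exprS.
case: j {I1 E1 I2 E2} => [|j] /=; first by ring.
have -> : rr q ^+ j.+1 = (xc q ^+ 2 + yc q ^+ 2) * rr q ^+ j by rewrite exprS.
ring.
Qed.

Lemma mom_GG b j : 0 < b -> \int[haar]_q GG b j q = j`!%:R / b ^+ j * (2 * pi * (pi / b) ^+ n).
Proof.
move=> b0; elim: j => [|j IH].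
  rewrite fact0 expr0 divr1 mul1r -int_gauss //; apply: eqR => q; by rewrite /gpow expr0 mul1r.
apply: (@mulfI _ b); first by rewrite gt_eqF.
rewrite (mom_gpow_rec j b0) IH factS natrM (exprS b); have := exprn_gt0 j b0; set B := b ^+ j => B0.
by field; rewrite !gt_eqF.
Qed.

End Moments.

Section LowerHW.
Variables (R : realType) (n : nat).
Notation pt := (pt R n).
Notation bpt := (bpt R n).
Notation haar := (haar R n).
Notation L1 := (@L1 _ bpt R haar).

Lemma eigsp_hw (mz : int) k (j0 : 'I_n) : mz != 0 ->
  eigsp mz k (@hw R n `|mz|%N j0 k 0, @hw R n `|mz|%N j0 k (beta R mz)).
Proof.
move=> mz0; have m0 : (0 < `|mz|%N)%N by rewrite absz_gt0.
have M0 : 0 < `|mz|%N%:R :> R by rewrite ltr0n.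
apply: (@eigsp_phase R n mz k (fun al => @hw R n `|mz|%N j0 k al)) => //.
- move=> al; have sh : smooth (@hw R n `|mz|%N j0 k al) by apply: smooth_hw.
  have cc (c : R) : smoothN 1 ((fun=> c) : pt -> R) by apply: smoothN_cst.
  have sh1 a : smoothN 1 (@hw R n `|mz|%N j0 k a : pt -> R).
    by move: 1%N; apply/smoothP; apply: smooth_hw.
  split => //.
  + by apply: tperiodic_hw.
  + apply: (L1_le _ (@L1_GG R n j0 _ k M0)).
      by apply: measurable_funX; apply: continuous_measurable_bpt; exact: smooth_cont.
    by move=> q; rewrite ger0_norm ?sqr_ge0 // -(hw_sqr _ _ k al) lerDl sqr_ge0.
  + by apply: subLap_hw.
  apply/funext => q; have -> : Dt (hw `|mz|%N j0 k al) = (fun=> `|mz|%N%:R) \* hw `|mz|%N j0 k (al + pi / 2).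
    by apply/funext => r; apply: Dt_hw.
  rewrite /Dt (derM q _ (cc _) (sh1 _)) derive_cst mul0r add0r -[X in _ * X]/(Dt _ q) Dt_hw // hwDD //; ring.
- by move=> al q; apply: Dt_hw.
- by move=> al q; apply: hw_pi.
Qed.

Lemma powR_threshold (c T p : R) : 1 <= p <= 2 -> 0 < T -> 0 <= c ->
  c `^ p <= T `^ (p - 1) * c + T `^ (p - 2) * c ^+ 2.
Proof.
move=> /andP[p1 p2] T0; rewrite le_eqVlt => /orP[/eqP <-|c0].
  by rewrite powR0 ?gt_eqF ?(lt_le_trans _ p1) // mulr0 expr0n mulr0 addr0.
have c0' := ltW c0.
have i (y y' : R) : c `^ y * c `^ y' = c `^ (y + y').
  by rewrite -powRD //; apply/implyP => _; rewrite gt_eqF.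
have [h|h] := leP c T.
  apply: (@le_trans _ _ (T `^ (p - 1) * c)); last by rewrite lerDl mulr_ge0 ?powR_ge0 ?sqr_ge0.
  have -> : c `^ p = c `^ (p - 1) * c by rewrite -{3}(powRr1 c0') i subrK.
  by rewrite ler_wpM2r //; apply: (ler_powR_base _ c0' h); rewrite subr_ge0.
apply: (@le_trans _ _ (T `^ (p - 2) * c ^+ 2)); last by rewrite lerDr mulr_ge0 ?powR_ge0.
have -> : c `^ p = c `^ (p - 2) * c ^+ 2 by rewrite -(powR_mulrn 2 c0') i subrK.
rewrite ler_wpM2r ?sqr_ge0 // -(opprB 2 p) !powRN lef_pV2 ?posrE ?powR_gt0 //.
by apply: (ler_powR_base _ (ltW T0) (ltW h)); rewrite subr_ge0.
Qed.

(** The modulus is $|z|^k$ times a Gaussian, and its integral for odd k involves half-integer Gamma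
    values. Splitting k into its halves rounded down and up, Cauchy-Schwarz reduces it to even
    moments, which are factorials compared by [fact_pair]. *)
Lemma cabs_hw_bound (mz : int) k (j0 : 'I_n) : mz != 0 ->
  let m := `|mz|%N in let M : R := m%:R in let f := (@hw R n m j0 k 0, @hw R n m j0 k (beta R mz)) in
  let Z := 2 * pi * (pi / M) ^+ n in
  [/\ \int[haar]_q (cabs f q ^+ 2) = k`!%:R / M ^+ k * Z, L1 (cabs f),
    \int[haar]_q cabs f q <= Num.sqrt (Num.sqrt (2 * k%:R + 3) * (4 ^+ n * Z) * (k`!%:R / M ^+ k * Z)) &
    exists2 K : R, 0 < K & forall q, cabs f q <= K].
Proof.
move=> mz0 m M f Z; have m0 : (0 < m)%N by rewrite absz_gt0.
have M0 : 0 < M by rewrite ltr0n.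
have Z0 : 0 < Z by rewrite mulr_gt0 ?mulr_gt0 ?pi_gt0 // exprn_gt0 // divr_gt0 ?pi_gt0.
have cE q : cabs f q ^+ 2 = @gpow R n j0 M k q.
  rewrite (@cabs_phase R n mz (fun al => @hw R n m j0 k al)); last by move=> al r; apply: hw_pi.
  by rewrite -(hw_sqr _ _ k 0) add0r.
pose i := k./2; pose j := uphalf k.
have ij : (i + j = k)%N by rewrite /i /j; lia.
have h2 : 0 < M / 2 by rewrite divr_gt0.
pose A (l : nat) (q : pt) := Num.sqrt (@gpow R n j0 (M / 2) l q).
have A2 l q : A l q ^+ 2 = @gpow R n j0 (M / 2) l q by rewrite /A sqr_sqrtr // GG_ge0.
have mA l : measurable_fun setT (A l : bpt -> R).
  have h : measurable_fun setT (@gpow R n j0 (M / 2) l : bpt -> R).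
    by apply: continuous_measurable_bpt; apply: smooth_cont; apply: smooth_GG.
  exact: (measurableT_comp (continuous_measurable_fun (@sqrt_continuous R)) h).
have LA l : L1 (fun q => A l q ^+ 2).
  by rewrite (_ : (fun q => _) = @gpow R n j0 (M / 2) l); [exact: L1_GG|apply/funext => q; exact: A2].
have cA q : cabs f q = A i q * A j q.
  rewrite -[LHS]ger0_norm ?cabs_ge0 // -sqrtr_sqr cE /A -sqrtrM ?GG_ge0 //; congr Num.sqrt.
  rewrite /gpow -[X in _ ^+ X]ij exprD; set u := _ ^+ i; set v := _ ^+ j.
  have -> : expR (- M * rho2 q) = expR (- (M / 2) * rho2 q) * expR (- (M / 2) * rho2 q).
    by rewrite -expRD; congr expR; field.
  by ring.
have cAf : cabs f = (fun q => A i q * A j q) by apply/funext.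
split.
- by rewrite -(mom_GG j0 k M0); apply: eqR.
- by rewrite cAf; exact: L1_mul.
- have := cauchy_schwarz (mA i) (mA j) (LA i) (LA j); rewrite -cAf.
  have IA l : \int[haar]_q (A l q ^+ 2) = l`!%:R / (M / 2) ^+ l * (2 * pi * (pi / (M / 2)) ^+ n).
    by rewrite -(mom_GG j0 l h2); apply: eqR => q; exact: A2.
  rewrite !IA => CS.
  have G0 : 0 <= \int[haar]_q cabs f q by apply: int_ge0 => q; exact: cabs_ge0.
  rewrite -[leLHS]ger0_norm // -sqrtr_sqr; apply: ler_wsqrtr; apply: (le_trans CS).
  have -> : 2 * pi * (pi / (M / 2)) ^+ n = 2 ^+ n * Z.
    rewrite /Z (_ : pi / (M / 2) = 2 * (pi / M)); last by field; rewrite gt_eqF.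
    by rewrite exprMn; set u := _ ^+ n; set v := _ ^+ n; ring.
  have -> : (4 : R) ^+ n = 2 ^+ n * 2 ^+ n by rewrite -exprMn; congr (_ ^+ _); ring.
  rewrite !expr_div_n; have MM : M ^+ k = M ^+ i * M ^+ j by rewrite -exprD ij.
  have TT : (2 : R) ^+ k = 2 ^+ i * 2 ^+ j by rewrite -exprD ij.
  have key : i`!%:R * j`!%:R * 2 ^+ k <= Num.sqrt (2 * k%:R + 3) * k`!%:R :> R.
    have h := fact_pair k; rewrite -/i -/j -(ler_nat R) natrX !natrM !natrX natrD natrM in h.
    have k3 : 0 <= 2 * k%:R + 3 :> R by rewrite addr_ge0 ?mulr_ge0.
    have -> : Num.sqrt (2 * k%:R + 3) * k`!%:R = Num.sqrt ((2 * k%:R + 3) * (k`!%:R * k`!%:R)) :> R.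
      by rewrite sqrtrM // -expr2 sqrtr_sqr ger0_norm.
    rewrite -[leLHS]ger0_norm ?mulr_ge0 ?exprn_ge0 // -sqrtr_sqr.
    exact: ler_wsqrtr.
  move: key; rewrite MM TT; have := exprn_gt0 i M0; have := exprn_gt0 j M0.
  have := exprn_gt0 i (ltr0n R 2); have := exprn_gt0 j (ltr0n R 2); have := exprn_gt0 n (ltr0n R 2).
  set N := 2 ^+ n; set a := 2 ^+ i; set b := 2 ^+ j; set c := M ^+ i; set d := M ^+ j; set s := Num.sqrt _.
  set u := i`!%:R; set v := j`!%:R; set w := k`!%:R => N0 b0 a0 d0 c0 key.
  have -> : u / (c / a) * (N * Z) * (v / (d / b) * (N * Z)) = u * v * (a * b) * (N ^+ 2 * Z ^+ 2 / (c * d)).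
    by field; rewrite !gt_eqF.
  have -> : s * (N * N * Z) * (w / (c * d) * Z) = s * w * (N ^+ 2 * Z ^+ 2 / (c * d)).
    by field; rewrite !gt_eqF.
  apply: ler_wpM2r; last exact: key.
  by apply: ltW; apply: divr_gt0; [apply: mulr_gt0; exact: exprn_gt0|exact: mulr_gt0].
- have [C HC] := decay_bd (@decay_GG R n j0 M k M0).
  have C0 : 0 <= C by apply: le_trans (HC 0).
  exists (C + 1); first by rewrite ltr_wpDl.
  move=> q; have h : cabs f q ^+ 2 <= C by rewrite cE; apply: le_trans (HC q); exact: ler_norm.
  have := cabs_ge0 f q; move: h; set c := cabs f q; nra.
Qed.

Lemma lower_hw p : (2 < n)%N -> 1 <= p <= 2 -> exists2 c : R, 0 < c & forall (mz : int) k, mz != 0 ->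
  ((c * ((2 * k%:R + n%:R) `^ (4^-1 - (2 * p)^-1) * (`|mz|%:~R) `^ (n%:R * (p^-1 - 2^-1))))%:E
    <= opnorm_p2 n mz k p)%E.
Proof.
move=> n2 p12; have /andP[p1 p2] := p12; have p0 : 0 < p by exact: lt_le_trans p1.
have pi0 := pi_gt0 R; pose A0 : R := 4 ^+ n * (2 * pi * pi ^+ n).
have A00 : 0 < A0 by rewrite mulr_gt0 ?exprn_gt0 // mulr_gt0 ?mulr_gt0 ?exprn_gt0.
pose e := p^-1 - 2^-1.
exists (2 `^ (- p^-1) * A0 `^ (- e)); first by rewrite mulr_gt0 ?powR_gt0.
move=> mz k mz0; rewrite intr_absz; pose j0 : 'I_n := Ordinal (ltn_trans (ltn0Sn 1) n2).
have [] := cabs_hw_bound k j0 mz0.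
set m := `|mz|%N; set f := (_, _) => N2E LF G2 [K K0 HK].
have Ef : eigsp mz k f by apply: eigsp_hw.
have m0 : (0 < m)%N by rewrite absz_gt0.
have M0 : 0 < m%:R :> R by rewrite ltr0n.
set M : R := m%:R in M0 N2E G2 *; set z : R := 2 * k%:R + n%:R.
have z0 : 0 < z by rewrite ltr_wpDl ?mulr_ge0 // ltr0n; lia.
(* Here $n\ge3$ enters: the constant 3 coming from [fact_pair] is absorbed into $2k+n$. *)
have zk : 2 * k%:R + 3 <= z by rewrite lerD2l ler_nat.
set Z := 2 * pi * _ in N2E G2; set N2 := k`!%:R / M ^+ k * Z in N2E G2.
have Z0 : 0 < Z by rewrite mulr_gt0 ?mulr_gt0 // exprn_gt0 // divr_gt0.
have N20 : 0 < N2 by rewrite mulr_gt0 // divr_gt0 ?exprn_gt0 // ltr0n fact_gt0.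
pose A := Num.sqrt z * (4 ^+ n * Z).
have A1 : 0 < A by rewrite mulr_gt0 ?sqrtr_gt0 // mulr_gt0 // exprn_gt0.
have Lf : inLp 2 f by case: Ef.
have hf : is_hfun f by case: Lf.
have L2f := L2_cabs Lf.
have G3 : \int[haar]_q cabs f q <= Num.sqrt (A * N2).
  apply: (le_trans G2); apply: ler_wsqrtr; apply: ler_wpM2r; first exact: ltW.
  by apply: ler_wpM2r; [apply: mulr_ge0; [exact: exprn_ge0|exact: ltW]|exact: ler_wsqrtr].
(* The height at which the two terms of [powR_threshold] have equal bounds, given $\|f\|_1^2\le
   A\|f\|_2^2$. *)
pose T := Num.sqrt (N2 / A); have T0 : 0 < T by rewrite sqrtr_gt0 divr_gt0.
have IB : L1 (fun q => T `^ (p - 1) * cabs f q + T `^ (p - 2) * cabs f q ^+ 2) by apply: L1D; exact: L1Z.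
have pw q := powR_threshold p12 T0 (cabs_ge0 f q).
have Ip : L1 (fun q => cabs f q `^ p).
  by apply: (L1_le (meas_cabsX p hf) IB) => q; rewrite ger0_norm ?powR_ge0.
have up : \int[haar]_q (cabs f q `^ p) <= 2 * (T `^ (p - 2) * N2).
  apply: (le_trans (int_le Ip IB pw)); rewrite intD; [|exact: L1Z|exact: L1Z].
  rewrite (intZ _ LF) (intZ _ L2f) N2E mulr_natl mulr2n lerD2r.
  have -> : T `^ (p - 2) * N2 = T `^ (p - 1) * Num.sqrt (A * N2).
    have -> : T `^ (p - 1) = T `^ (p - 2) * T.
      rewrite -{3}(powRr1 (ltW T0)) -powRD; first by congr (_ `^ _); lra.
      by apply/implyP => _; rewrite gt_eqF.
    rewrite -mulrA; congr (_ * _); rewrite /T -sqrtrM ?divr_ge0 ?(ltW N20) ?(ltW A1) //.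
    rewrite (_ : N2 / A * (A * N2) = N2 ^+ 2); last by field; rewrite gt_eqF.
    by rewrite sqrtr_sqr ger0_norm // ltW.
  by rewrite ler_wpM2l ?powR_ge0.
(* Positivity allows the division by the norm; it follows from $\|f\|_2^2\le K^{2-p}\int|f|^p$ for a
   bounded [f]. *)
have lo : 0 < \int[haar]_q (cabs f q `^ p).
  have : N2 <= K `^ (2 - p) * \int[haar]_q (cabs f q `^ p).
    rewrite -N2E -intZ //; apply: int_le => //; first exact: L1Z.
    move=> q; have := cabs_ge0 f q; rewrite le_eqVlt => /orP[/eqP <-|c0].
      by rewrite expr0n mulr_ge0 ?powR_ge0.
    have -> : cabs f q ^+ 2 = cabs f q `^ (2 - p) * cabs f q `^ p.
      rewrite -powRD ?subrK ?powR_mulrn ?cabs_ge0 //.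
      by apply/implyP => _; rewrite gt_eqF.
    rewrite ler_wpM2r ?powR_ge0 //; apply: (ler_powR_base _ (cabs_ge0 _ _) (HK q)).
    by rewrite subr_ge0.
  move=> /(lt_le_trans N20); rewrite pmulr_rgt0 // powR_gt0 //.
have P : Pmk mz k f f.
  split => // h _; have zE : csub f f = (fun=> 0, fun=> 0).
    by rewrite /csub; congr pair; apply/funext => q; rewrite /= subrr.
  have h0 : hint ((fun=> 0%:E) : pt -> \bar R) = 0%E.
    by rewrite -haarE // integral0.
  by rewrite /inner_re /inner_im zE /=; split; rewrite -[RHS]h0; congr hint; apply/funext => q; rewrite !mul0r ?addr0 ?subr0.
have := opnorm_ge p0 (inLp_of_L1 p0 hf Ip) Lf P erefl lo.
apply: le_trans; rewrite lee_fin N2E.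
rewrite ler_pdivlMr ?powR_gt0 //.
have Iu : (\int[haar]_q (cabs f q `^ p)) `^ p^-1 <= (2 * (T `^ (p - 2) * N2)) `^ p^-1.
  by apply: (ler_powR_base _ (ltW lo) up); rewrite invr_ge0 ltW.
have W0 : 0 <= 2 `^ (- p^-1) * A0 `^ (- e) * (z `^ (4^-1 - (2 * p)^-1) * M `^ (n%:R * (p^-1 - 2^-1))).
  by apply: mulr_ge0; apply: mulr_ge0; exact: powR_ge0.
apply: (le_trans (ler_wpM2l W0 Iu)); rewrite le_eqVlt; apply/orP; left; apply/eqP.
have AE : A = A0 * (z `^ 2^-1 * M `^ (- n%:R)).
  rewrite /A /Z expr_div_n powRN powR_mulrn ?(ltW M0) // powR12_sqrt ?(ltW z0) // /A0.
  set u := Num.sqrt z; set v := pi ^+ n; set w := M ^+ n; set y := 4 ^+ n; ring.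
have TE : T = (N2 / A) `^ 2^-1 by rewrite powR12_sqrt // divr_ge0 ?ltW.
have SE : Num.sqrt N2 = N2 `^ 2^-1 by rewrite powR12_sqrt // ltW.
rewrite TE SE AE /e; clearbody A0 z M N2.
clear -z0 M0 A00 N20 p0; move: z0 M0 A00 N20 (ltr0n R 2) => /lnK <- /lnK <- /lnK <- /lnK <- /lnK h2.
have D2 x : 2 `^ x = expR (x * ln 2) :> R by rewrite -{1}h2 powR_expR.
rewrite powRM ?(ler0n R 2) ?mulr_ge0 ?powR_ge0 ?expR_ge0 // !D2.
do 4! rewrite ?powR_expR -?expRN -?expRD.
congr expR; field.
by rewrite gt_eqF.
Qed.

End LowerHW.

Theorem theorem3p3 (R : realType) (n : nat) (p : R) :
  (2 < n)%N -> 1 <= p <= 2 ->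
  exists C : R, exists c : R, 0 < C /\ 0 < c /\
    forall (m : int) (k : nat), m != 0 ->
      ((c * bound33 n m k p)%:E <= opnorm_p2 n m k p)%E /\
      (opnorm_p2 n m k p <= (C * bound33 n m k p)%:E)%E.
Proof.
move=> n2 p12; have n1 : (1 < n)%N by exact: ltnW.
have [C C0 hC] := upper_bound n1 p12.
have [c c0 hc] : exists2 c : R, 0 < c & forall (m : int) k, m != 0 -> ((c * bound33 n m k p)%:E <= opnorm_p2 n m k p)%E.
  have [hp|hp] := ltP p (p_crit R n).
    have [c c0 hc] := lower_gauss n1 (proj1 (andP p12)).
    by exists c => // m k m0; rewrite /bound33 hp; exact: hc.
  have [c c0 hc] := lower_hw n2 p12.
  by exists c => // m k m0; rewrite /bound33 ltNge hp; exact: hc.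
by exists C, c; split => //; split => // m k m0; split; [exact: hc|exact: hC].
Qed.
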